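(* Let $G$ be a compact connected Lie group with semi-simple part $G'$ (its commutator subgroup), let $\mathcal{Z}_0(G)$ be the identity component of the center of $G$, and put $r=\dim \mathcal{Z}_0(G)$. Then $G$ is diffeomorphic to the product manifold $$G\cong G'\times T^{r},$$ where $T^{r}$ is the $r$-dimensional torus group.
   Context: All Lie groups are compact and connected. The commutator subgroup $G'$ of $G$ is called the semi-simple part of $G$. *)

(* Defs.v *)
(* Smooth manifolds and Lie groups on top of Mathematical Components and
   MathComp-Analysis.

   A chartedType R is a topological space with a dimension and a set of charts;
   smooth_manifold is the property that it is a smooth (C^oo) manifold.  The
   data and the property are kept apart, so that every subset of a manifold
   carries a candidate manifold structure, the one given by its slice charts. *)
From HB Require Import structures.
From mathcomp Require Import all_boot all_order all_algebra.
From mathcomp Require Import all_classical all_reals all_analysis.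

Set Implicit Arguments.
Unset Strict Implicit.
Unset Printing Implicit Defensive.

Import Order.TTheory GRing.Theory Num.Theory numFieldNormedType.Exports.

Local Open Scope classical_set_scope.
Local Open Scope ring_scope.

(* k-times continuous differentiability; U is meant to be open. *)
Fixpoint Ck_on (R : realType) (V W : normedModType R) (k : nat)
    (U : set V) (f : V -> W) : Prop :=
  if k is k'.+1 then
    (forall x, U x -> differentiable f x) /\ (forall v, Ck_on k' U ('D_v f))
  else forall x, U x -> {for x, continuous f}.

Definition smooth_on (R : realType) (V W : normedModType R)
    (U : set V) (f : V -> W) : Prop :=
  forall k, Ck_on k U f.

(* Only the values of chart_to on chart_dom, and those of chart_from on the
   image of chart_dom, are meaningful. *)
Record chart (R : realType) (M : Type) (n : nat) := Chart {
  chart_dom : set M ;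
  chart_to : M -> 'rV[R]_n ;
  chart_from : 'rV[R]_n -> M }.

Definition chart_img (R : realType) (M : Type) (n : nat) (c : chart R M n)
    : set 'rV[R]_n :=
  chart_to c @` chart_dom c.

Definition is_chart (R : realType) (M : topologicalType) (n : nat)
    (c : chart R M n) : Prop :=
  [/\ open (chart_dom c), open (chart_img c),
      forall x, chart_dom c x -> chart_from c (chart_to c x) = x,
      forall x, chart_dom c x -> {for x, continuous (chart_to c)} &
      forall u, chart_img c u -> {for u, continuous (chart_from c)}].

Definition smooth_transition (R : realType) (M : Type) (n : nat)
    (c d : chart R M n) : Prop :=
  smooth_on (chart_to c @` (chart_dom c `&` chart_dom d))
            (chart_to d \o chart_from c).

Definition compatible (R : realType) (M : Type) (n : nat)
    (c d : chart R M n) : Prop :=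
  smooth_transition c d /\ smooth_transition d c.

HB.mixin Record isCharted (R : realType) (M : Type) := {
  mdim : nat ;
  atlas : set (chart R M mdim) }.

#[short(type="chartedType")]
HB.structure Definition Charted (R : realType) :=
  {M of Topological M & isCharted R M}.

Arguments mdim {R} s.
Arguments atlas {R} s.

Definition smooth_manifold (R : realType) (M : chartedType R) : Prop :=
  [/\ hausdorff_space M,
      @second_countable M,
      forall c, atlas M c -> is_chart c,
      forall x : M, exists2 c, atlas M c & chart_dom c x &
      forall c d, atlas M c -> atlas M d -> compatible c d].

Definition maximal_atlas (R : realType) (M : chartedType R)
    : set (chart R M (mdim M)) :=
  [set c | is_chart c /\ forall d, atlas M d -> compatible c d].
Arguments maximal_atlas {R} M.

Definition smooth (R : realType) (M N : chartedType R) (f : M -> N) : Prop :=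
  continuous f /\
  forall x : M, exists c d,
    [/\ atlas M c, atlas N d, chart_dom c x, chart_dom d (f x) &
        smooth_on (chart_to c @` (chart_dom c `&` f @^-1` chart_dom d))
                  (chart_to d \o f \o chart_from c)].

Definition diffeomorphic (R : realType) (M N : chartedType R) : Prop :=
  [/\ smooth_manifold M, smooth_manifold N &
      exists (f : M -> N) (g : N -> M),
        [/\ cancel f g, cancel g f, smooth f & smooth g]].

Section Euclidean.
Variables (R : realType) (n : nat).

Definition euclidean_atlas : set (chart R 'rV[R]_n n) := [set Chart setT id id].

HB.instance Definition _ := isCharted.Build R 'rV[R]_n euclidean_atlas.

End Euclidean.

Section Product.
Variables (R : realType) (M N : chartedType R).

Definition prod_chart (c : chart R M (mdim M)) (d : chart R N (mdim N))
    : chart R (M * N)%type (mdim M + mdim N) :=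
  Chart (chart_dom c `*` chart_dom d)
        (fun p => row_mx (chart_to c p.1) (chart_to d p.2))
        (fun u => (chart_from c (lsubmx u), chart_from d (rsubmx u))).

Definition prod_atlas : set (chart R (M * N)%type (mdim M + mdim N)) :=
  [set prod_chart c d | c in atlas M & d in atlas N].

HB.instance Definition _ := isCharted.Build R (M * N)%type prod_atlas.

End Product.

Section Submanifold.
Variables (R : realType) (M : chartedType R) (S : set M).

(* For k <= n, right multiplication by pid_mx k is the inclusion of R^k in R^n
   as the first k coordinates, and the projection of R^n on these. *)
Definition slice_chart (k : nat) (c : chart R M (mdim M)) : Prop :=
  maximal_atlas M c /\
  chart_to c @` (chart_dom c `&` S) =
  chart_img c `&` range (fun v : 'rV[R]_k => v *m pid_mx k).

Definition embedded_submanifold (k : nat) : Prop :=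
  (k <= mdim M)%N /\
  forall x, S x -> exists2 c, slice_chart k c & chart_dom c x.

(* The dimension of S as an embedded submanifold; it is determined by S when S
   is a nonempty embedded submanifold, and meaningless otherwise. *)
Definition submanifold_dim : nat := xget 0%N [set k | embedded_submanifold k].

(* The charts of S are the restrictions to S of the slice charts of M. *)
Definition submanifold_atlas : set (chart R (set_type S) submanifold_dim) :=
  [set c | is_chart c /\ exists2 d, slice_chart submanifold_dim d &
    chart_dom c = set_val @^-1` chart_dom d /\
    forall x, chart_dom c x ->
      chart_to c x = chart_to d (set_val x) *m pid_mx submanifold_dim].

HB.instance Definition _ := isCharted.Build R (set_type S) submanifold_atlas.

End Submanifold.

Definition circle (R : realType) : set 'rV[R]_2 :=
  [set u | u 0 0 ^+ 2 + u 0 1 ^+ 2 = 1].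
Arguments circle : clear implicits.

(* T^r as the product manifold of r circles. *)
Fixpoint torus (R : realType) (r : nat) : chartedType R :=
  if r is r'.+1 then (set_type (circle R) * torus R r')%type : chartedType R
  else 'rV[R]_0 : chartedType R.

HB.mixin Record isLieGroup (R : realType) (G : Type)
    of Group G & Charted R G := {
  lie_manifold : smooth_manifold G ;
  smooth_mulg : smooth (fun p : G * G => (p.1 * p.2)%g) ;
  smooth_invg : smooth (fun x : G => (x^-1)%g) }.

#[short(type="lieGroupType")]
HB.structure Definition LieGroup (R : realType) :=
  {G of Group G & Charted R G & isLieGroup R G}.

Section Subgroups.
Variable G : groupType.

Definition subgroup (H : set G) : Prop :=
  H 1%g /\ forall x y, H x -> H y -> H (x / y)%g.

Definition commutator_subgroup : set G :=
  smallest subgroup [set z | exists x y, z = [~ x, y]%g].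

Definition center_subgroup : set G := [set z | forall x : G, commute z x].

End Subgroups.

Arguments commutator_subgroup : clear implicits.
Arguments center_subgroup : clear implicits.

(* The identity component of the center, in the subspace topology. *)
Definition center_component (R : realType) (G : lieGroupType R) : set G :=
  connected_component (center_subgroup G) 1%g.
Arguments center_component {R} G.

(* Main.v *)
(* Averaging the adjoint representation over G gives a projection P onto the Lie
   algebra of the center.  An implicit function argument parametrizes the center
   near 1 by the range of P, and logarithms of central elements yield a smooth
   homomorphism E from R^r onto a neighbourhood of 1 in the center.  The identity
   1 - P = sum N_i (Ad x_i - 1) shows that products of commutators cover the
   complementary directions, so that near 1 every element is a product of
   commutators times E(tau x), for a local homomorphism tau : G -> R^r.

   In general tau does not extend to G.  By Dirichlet's theorem some multiple N tau
   has almost integral transition constants on a finite cover of G by translates, so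
   a small correction turns it into a map G -> R^r/Z^r.  Averaging its increments
   over G gives a local homomorphism p, close to N tau, whose sum along a closed word
   is integral.  Hence E(v) in G' forces v L in Z^r for an invertible matrix L:
   the vectors v with E(v) in G' form a lattice, which after a linear change of
   variables is Z^r.  Thus G' is the zero set of tau near 1, hence embedded, and
   G is the quotient of G' x R^r by a central action of Z^r.  The generators of this
   action are translations by elements joined to 1 by smooth paths in G', and
   untwisting along these paths gives G' x T^r. *)
Require Import Defs.
From HB Require Import structures.
From mathcomp Require Import all_boot all_order all_algebra.
From mathcomp Require Import all_classical all_reals all_analysis.
From mathcomp Require Import ring lra.
Import Order.TTheory GRing.Theory Num.Theory numFieldNormedType.Exports.
Local Open Scope classical_set_scope.
Local Open Scope ring_scope.

Set Implicit Arguments.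
Unset Strict Implicit.
Unset Printing Implicit Defensive.

(** * Smooth maps between normed spaces *)

(** The subgroup G' is given only algebraically: nothing says beforehand that it is closed, or that
    it meets the torus E(R^r) in a discrete set. If E(v) lies in G' for some v <> 0, a homomorphism
    G -> R^r extending tau would vanish on G' and yet send E(v) to v, so at best a map to R^r/Z^r
    can be hoped for. The recurring device is that an integer of modulus less than 1 is 0.
    Dirichlet's theorem makes the rounding errors smaller than 1/4, so that relations known modulo Z
    between at most four of them hold exactly; the same device shows that an element of G' close to
    1 has tau = 0. Invertibility of L comes from the multiplier N >= 1 dominating these errors; that
    the lattice has full rank comes from compactness of G. Derivatives of maps into G are taken
    through the left logarithmic derivative. Multiplied by P it turns products into sums and kills
    commutators, which is how tau becomes additive near 1. Local constancy then follows from a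
    vanishing derivative, first for commutators with candidate central elements, later for the
    central factor of a product of commutators. *)

Section CkGeneral.
Context {R : realType}.
Implicit Types (V W : normedModType R) (k : nat).

Lemma Ck_on_sub V W k (U U' : set V) (f : V -> W) :
  U `<=` U' -> Ck_on k U' f -> Ck_on k U f.
Proof.
move=> UU'; elim: k f => [|k IH] f /=; first by move=> fc x /UU'; exact: fc.
by case=> df Df; split=> [x /UU'|v]; [exact: df|exact: IH].
Qed.

Lemma Ck_on_cont V W k (U : set V) (f : V -> W) :
  Ck_on k U f -> forall x, U x -> {for x, continuous f}.
Proof. by case: k => [|k] //= [df _] x Ux; apply/differentiable_continuous/df. Qed.

Lemma Ck_onSW V W k (U : set V) (f : V -> W) : Ck_on k.+1 U f -> Ck_on k U f.
Proof.
elim: k f => [|k IH] f; first exact: Ck_on_cont.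
by move=> [df Df]; split=> // v; apply: IH; exact: Df.
Qed.

Lemma open_near_eq (T : topologicalType) (T' : Type) (U : set T) (f g : T -> T') x :
  open U -> U x -> (forall y, U y -> f y = g y) -> \near x, f x = g x.
Proof. by move=> oU Ux fg; near do apply: fg; exact: open_nbhs_nbhs. Unshelve. all: by end_near. Qed.

(** [g - f] vanishes near [x], so its differential there is 0 by uniqueness, and [g] is the sum of
    [f] and this difference. *)
Lemma near_eq_differentiable V W (f g : V -> W) x :
  (\near x, f x = g x) -> differentiable f x -> differentiable g x.
Proof.
move=> fg df.
have fgx : f x = g x by exact: nbhs_singleton fg.
have h0 : differentiable (g - f) x.
  have H : (g - f) \o shift x = cst ((g - f) x) + (0 : V -> W) +o_ 0 id.
    apply/eqaddoP => _/posnumP[e].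
    have : \forall y \near x, (g - f) y = 0.
      by apply: filterS fg => y fgy; rewrite -[LHS]/(g y - f y) fgy subrr.
    rewrite (near_shift 0) subr0; apply: filterS => y /= E.
    rewrite -[X in `|X|]/((g - f) (y + x) - ((g - f) x + 0)) E.
    by rewrite -[(g - f) x]/(g x - f x) fgx subrr addr0 subrr normr0 mulr_ge0.
  have c0 : continuous (0 : V -> W) by move=> ?; exact: cst_continuous.
  have E : 'd (g - f) x = (\0 : {linear V -> W}) :> (V -> W) by apply: diff_unique.
  by apply/diff_locallyP; rewrite E.
have -> : g = f + (g - f) by rewrite addrC subrK.
exact: differentiableD.
Qed.

Lemma eq_Ck_on V W k (U : set V) (f g : V -> W) : open U ->
  (forall x, U x -> f x = g x) -> Ck_on k U f -> Ck_on k U g.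
Proof.
move=> oU; elim: k f g => [|k IH] f g fg /=.
  move=> fc x Ux; have := fc x Ux; rewrite /prop_for/continuous_at -(fg _ Ux).
  move=> h; apply: cvg_trans h; apply: near_eq_cvg.
  exact: open_near_eq Ux fg.
move=> [df Df]; split=> [x Ux|v].
  by apply: near_eq_differentiable (df x Ux); exact: open_near_eq Ux fg.
apply: IH (Df v) => x Ux; apply: near_eq_derive.
exact: open_near_eq Ux fg.
Qed.

(** [Ck_on] speaks of ['D_v f] as a function on all of [V]. Openness of [U] lets a formula for the
    derivative valid on [U] alone feed the inductions on [k] below. *)
Lemma Ck_onS V W k (U : set V) (f : V -> W) (D : V -> V -> W) : open U ->
  (forall x, U x -> differentiable f x) ->
  (forall v x, U x -> 'D_v f x = D v x) -> (forall v, Ck_on k U (D v)) ->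
  Ck_on k.+1 U f.
Proof.
move=> oU df Df CD; split=> // v.
by apply: eq_Ck_on (CD v) => // x Ux; rewrite Df.
Qed.

Lemma Ck_on_cst V W k (U : set V) (a : W) : Ck_on k U (cst a).
Proof.
elim: k a => [|k IH] a /=; first by move=> x _; exact: cst_continuous.
split=> [x _|v]; first exact: differentiable_cst.
have -> : 'D_v (cst a : V -> W) = cst 0 by apply/funext => x; rewrite derive_cst.
exact: IH.
Qed.

Lemma Ck_on_lin V W k (U : set V) (f : {linear V -> W}) :
  continuous f -> Ck_on k U f.
Proof.
move=> fc; case: k => [|k] /=; first by move=> x _; exact: fc.
split=> [x _|v]; first exact: linear_differentiable.
have -> : 'D_v f = cst (f v).
  apply/funext => x; rewrite deriveE; last exact: linear_differentiable.
  by rewrite diff_lin.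
exact: Ck_on_cst.
Qed.

Lemma Ck_onD V W k (U : set V) (f g : V -> W) : open U ->
  Ck_on k U f -> Ck_on k U g -> Ck_on k U (fun x => f x + g x).
Proof.
move=> oU; elim: k f g => [|k IH] f g.
  by move=> cf cg x Ux; apply: continuousD; [exact: cf|exact: cg].
move=> [df Df] [dg Dg].
apply: (@Ck_onS _ _ _ _ _ (fun v x => 'D_v f x + 'D_v g x)) => //.
- by move=> x Ux; apply: differentiableD; [exact: df|exact: dg].
- by move=> v x Ux; rewrite -deriveD //; apply: diff_derivable; [exact: df|exact: dg].
- by move=> v; apply: IH; [exact: Df|exact: Dg].
Qed.

Lemma Ck_on_sum V W k (U : set V) (I : Type) (s : seq I) (P : pred I) (f : I -> V -> W) :
  open U -> (forall i, P i -> Ck_on k U (f i)) ->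
  Ck_on k U (fun x => \sum_(i <- s | P i) f i x).
Proof.
move=> oU Cf; elim: s => [|i s IH].
  rewrite (_ : (fun x => _) = cst 0); first exact: Ck_on_cst.
  by apply/funext => x; rewrite big_nil.
case: (boolP (P i)) => Pi; last by apply: eq_Ck_on IH => // x _; rewrite big_cons (negPf Pi).
apply: (@eq_Ck_on _ _ _ _ (fun x => f i x + \sum_(j <- s | P j) f j x)) => //.
  by move=> x _; rewrite big_cons Pi.
by apply: Ck_onD => //; exact: Cf.
Qed.

Lemma Ck_onM V k (U : set V) (f g : V -> R) : open U ->
  Ck_on k U f -> Ck_on k U g -> Ck_on k U (fun x => f x * g x).
Proof.
move=> oU; elim: k f g => [|k IH] f g.
  by move=> cf cg x Ux; apply: continuousM; [exact: cf|exact: cg].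
move=> Cf Cg; have [df Df] := Cf; have [dg Dg] := Cg.
apply: (@Ck_onS _ _ _ _ _ (fun v x => f x * 'D_v g x + g x * 'D_v f x)) => //.
- by move=> x Ux; apply: differentiableM; [exact: df|exact: dg].
- move=> v x Ux; apply: (@deriveM _ _ f g); apply: diff_derivable; [exact: df|exact: dg].
- by move=> v; apply: Ck_onD => //; apply: IH; rewrite //; by [exact: Ck_onSW|exact: Df|exact: Dg].
Qed.

Lemma Ck_on_prod V k (U : set V) (I : Type) (s : seq I) (P : pred I) (f : I -> V -> R) :
  open U -> (forall i, P i -> Ck_on k U (f i)) ->
  Ck_on k U (fun x => \prod_(i <- s | P i) f i x).
Proof.
move=> oU Cf; elim: s => [|i s IH].
  rewrite (_ : (fun x => _) = cst 1); first exact: Ck_on_cst.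
  by apply/funext => x; rewrite big_nil.
case: (boolP (P i)) => Pi; last by apply: eq_Ck_on IH => // x _; rewrite big_cons (negPf Pi).
apply: (@eq_Ck_on _ _ _ _ (fun x => f i x * \prod_(j <- s | P j) f j x)) => //.
  by move=> x _; rewrite big_cons Pi.
by apply: Ck_onM => //; exact: Cf.
Qed.

Lemma Ck_onV V k (U : set V) (f : V -> R) : open U ->
  (forall x, U x -> f x != 0) -> Ck_on k U f -> Ck_on k U (fun x => (f x)^-1).
Proof.
move=> oU f0; elim: k => [|k IH].
  by move=> cf x Ux; apply: continuousV; [exact: f0|exact: cf].
move=> Cf; have [df Df] := Cf.
apply: (@Ck_onS _ _ _ _ _ (fun v x => (-1) * ((f x)^-1 * (f x)^-1) * 'D_v f x)) => //.
- by move=> x Ux; apply: differentiableV; [exact: df|exact: f0].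
- move=> v x Ux; rewrite (@deriveV _ _ f); [|exact: f0|exact/diff_derivable/df].
  by rewrite /GRing.scale/= mulN1r -exprVn expr2.
- move=> v; apply: Ck_onM; rewrite //; last exact: Df.
  apply: Ck_onM; rewrite //; first exact: Ck_on_cst.
  by apply: Ck_onM => //; apply: IH; exact: Ck_onSW.
Qed.

Lemma derive_coord V m n (f : V -> 'M[R]_(m, n)) x v i j :
  derivable f x v -> 'D_v (fun y => f y i j) x = 'D_v f x i j.
Proof. by move=> df; rewrite derive_mx // mxE. Qed.

Lemma differentiable_coordP V m n (f : V -> 'M[R]_(m, n)) x :
  differentiable f x <-> forall i j, differentiable (fun y => f y i j) x.
Proof.
split=> [df i j|df].
  by apply: (differentiable_comp (g := fun A : 'M[R]_(m, n) => A i j)) => //; exact: differentiable_coord.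
have -> : f = \sum_i \sum_j (fun y => f y i j *: delta_mx i j).
  apply/funext => y; rewrite fct_sumE {1}(matrix_sum_delta (f y)).
  by apply: eq_bigr => i _; rewrite fct_sumE.
apply: differentiable_sum => i; apply: differentiable_sum => j.
exact: differentiableZl.
Qed.

Lemma continuous_coordP (T : topologicalType) m n (f : T -> 'M[R]_(m, n)) x :
  {for x, continuous f} <-> forall i j, {for x, continuous (fun y => f y i j)}.
Proof.
split=> [cf i j|cf].
  apply: (continuous_comp (g := fun A : 'M[R]_(m, n) => A i j)) => //; exact: coord_continuous.
have -> : f = \sum_i \sum_j (fun y => f y i j *: delta_mx i j).
  apply/funext => y; rewrite fct_sumE {1}(matrix_sum_delta (f y)).
  by apply: eq_bigr => i _; rewrite fct_sumE.
rewrite /prop_for /continuous_at.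
elim/big_ind : _ => [|g h cg ch|i _]; first exact: cst_continuous.
  exact: continuousD.
elim/big_ind : _ => [|g h cg ch|j _]; first exact: cst_continuous.
  exact: continuousD.
exact: continuousZr_tmp.
Qed.

Lemma Ck_on_mxP V m n k (U : set V) (f : V -> 'M[R]_(m, n)) : open U ->
  Ck_on k U f <-> forall i j, Ck_on k U (fun x => f x i j).
Proof.
move=> oU; elim: k f => [|k IH] f; split.
- by move=> cf i j x Ux; have /continuous_coordP := cf x Ux; apply.
- by move=> cf x Ux; apply/continuous_coordP => i j; exact: cf.
- move=> [df Df] i j; apply: (@Ck_onS _ _ _ _ _ (fun v x => 'D_v f x i j)) => //.
  + by move=> x Ux; have /differentiable_coordP := df x Ux; apply.
  + by move=> v x Ux; rewrite derive_coord//; exact/diff_derivable/df.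
  + by move=> v; have /IH := Df v; apply.
- move=> Cf.
  have df x : U x -> differentiable f x.
    by move=> Ux; apply/differentiable_coordP => i j; have [+ _] := Cf i j; apply.
  split=> // v; apply/IH => i j; have [_ Df] := Cf i j.
  by apply: eq_Ck_on (Df v) => // x Ux; rewrite derive_coord//; exact/diff_derivable/df.
Qed.

End CkGeneral.

Section CkComp.
Context {R : realType}.
Implicit Types (V W : normedModType R) (k : nat).

Lemma diff_sum_derive V m (g : 'rV[R]_m -> V) y w : differentiable g y ->
  'd g y w = \sum_i w 0 i *: 'D_(delta_mx 0 i) g y.
Proof.
move=> dg; rewrite {1}(row_sum_delta w) linear_sum; apply: eq_bigr => i _.
by rewrite linearZ deriveE.
Qed.

Lemma diff_R (g : R -> R) y v : differentiable g y -> 'd g y v = v * 'D_1 g y.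
Proof. by move=> dg; rewrite (diff1E dg) derive1E. Qed.

Lemma derive_R (g : R -> R) y v : differentiable g y -> 'D_v g y = v * 'D_1 g y.
Proof. by move=> dg; rewrite deriveE// diff_R. Qed.

(** The chain rule writes the derivative as a finite sum of products whose factors
    ['D_(delta_mx 0 i) g \o f] are again composites, to which the induction on [k] applies. This is
    why the intermediate space is a coordinate space. *)
Lemma Ck_on_comp_scalar V m k (U : set V) (U' : set 'rV[R]_m) (f : V -> 'rV[R]_m)
    (g : 'rV[R]_m -> R) : open U -> open U' -> (forall x, U x -> U' (f x)) ->
  Ck_on k U f -> Ck_on k U' g -> Ck_on k U (g \o f).
Proof.
move=> oU oU' UU'; elim: k g => [|k IH] g.
  by move=> cf cg x Ux; apply: continuous_comp; [exact: cf|apply/cg/UU'].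
move=> Cf Cg; have [df Df] := Cf; have [dg Dg] := Cg.
apply: (@Ck_onS _ _ _ _ _ _
   (fun v x => \sum_i 'D_v f x 0 i * ('D_(delta_mx 0 i) g \o f) x)) => //.
- by move=> x Ux; apply: differentiable_comp; [exact: df|apply/dg/UU'].
- move=> v x Ux; rewrite deriveE; last by apply: differentiable_comp; [exact: df|apply/dg/UU'].
  rewrite diff_comp; [|exact: df|apply/dg/UU' => //].
  rewrite /= diff_sum_derive; last exact/dg/UU'.
  by apply: eq_bigr => i _; rewrite (deriveE v (df x Ux)).
- move=> v; apply: Ck_on_sum => // i _; apply: Ck_onM => //.
    by move: (Df v) => /(Ck_on_mxP _ _ oU); apply.
  by apply: IH; [exact: Ck_onSW|exact: Dg].
Qed.

Lemma Ck_on_comp V m p q k (U : set V) (U' : set 'rV[R]_m) (f : V -> 'rV[R]_m)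
    (g : 'rV[R]_m -> 'M[R]_(p, q)) : open U -> open U' -> (forall x, U x -> U' (f x)) ->
  Ck_on k U f -> Ck_on k U' g -> Ck_on k U (g \o f).
Proof.
move=> oU oU' UU' Cf /(Ck_on_mxP _ _ oU') Cg; apply/Ck_on_mxP => // i j.
exact: (@Ck_on_comp_scalar _ _ _ _ _ _ (fun x => g x i j)) UU' Cf (Cg i j).
Qed.

Lemma Ck_on_compR V k (U : set V) (U' : set R) (f : V -> R)
    (g : R -> R) : open U -> open U' -> (forall x, U x -> U' (f x)) ->
  Ck_on k U f -> Ck_on k U' g -> Ck_on k U (g \o f).
Proof.
move=> oU oU' UU'; elim: k g => [|k IH] g.
  by move=> cf cg x Ux; apply: continuous_comp; [exact: cf|apply/cg/UU'].
move=> Cf Cg; have [df Df] := Cf; have [dg Dg] := Cg.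
apply: (@Ck_onS _ _ _ _ _ _
   (fun v x => 'D_v f x * ('D_1 g \o f) x)) => //.
- by move=> x Ux; apply: differentiable_comp; [exact: df|apply/dg/UU'].
- move=> v x Ux; rewrite deriveE; last by apply: differentiable_comp; [exact: df|apply/dg/UU'].
  rewrite diff_comp; [|exact: df|apply/dg/UU' => //].
  by rewrite /= diff_R -?(deriveE v (df x Ux))//; exact/dg/UU'.
- move=> v; apply: Ck_onM => //; first exact: Df.
  by apply: IH; [exact: Ck_onSW|exact: Dg].
Qed.

Lemma Ck_on_sin_cos k (U : set R) : open U ->
  Ck_on k U (@sin R) /\ Ck_on k U (@cos R).
Proof.
move=> oU; elim: k => [|k [IHs IHc]].
  by split=> x _; [exact: continuous_sin|exact: continuous_cos].
have ds (x : R) : differentiable (@sin R) x by apply/derivable1_diffP; exact: ex_derive.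
have dc (x : R) : differentiable (@cos R) x by apply/derivable1_diffP; exact: ex_derive.
split.
- apply: (@Ck_onS _ _ _ _ _ _ (fun v x : R => v * cos x)) => //.
  + move=> v x Ux; by rewrite derive_R// derive_val.
  + by move=> v; apply: Ck_onM => //; exact: Ck_on_cst.
- apply: (@Ck_onS _ _ _ _ _ _ (fun v x : R => - v * sin x)) => //.
  + move=> v x Ux; by rewrite derive_R// derive_val mulrN mulNr.
  + by move=> v; apply: Ck_onM => //; exact: Ck_on_cst.
Qed.

Lemma Ck_on_mulmx V k m n p (U : set V) (f : V -> 'M[R]_(m, n)) (g : V -> 'M[R]_(n, p)) :
  open U -> Ck_on k U f -> Ck_on k U g -> Ck_on k U (fun x => f x *m g x).
Proof.
move=> oU /(Ck_on_mxP _ _ oU) Cf /(Ck_on_mxP _ _ oU) Cg; apply/Ck_on_mxP => // i j.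
apply: (@eq_Ck_on _ _ _ _ _ (fun x => \sum_l f x i l * g x l j)) => //.
  by move=> x _; rewrite mxE.
by apply: Ck_on_sum => // l _; apply: Ck_onM.
Qed.

Lemma Ck_on_det V k n (U : set V) (f : V -> 'M[R]_n) : open U ->
  Ck_on k U f -> Ck_on k U (fun x => \det (f x)).
Proof.
move=> oU /(Ck_on_mxP _ _ oU) Cf; rewrite /determinant.
apply: Ck_on_sum => // s _; apply: Ck_onM => //; first exact: Ck_on_cst.
by apply: Ck_on_prod => // i _; exact: Cf.
Qed.

Lemma Ck_on_invmx V k n (U : set V) (f : V -> 'M[R]_n) : open U ->
  (forall x, U x -> f x \in unitmx) ->
  Ck_on k U f -> Ck_on k U (fun x => invmx (f x)).
Proof.
move=> oU uf Cf; apply/Ck_on_mxP => // i j.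
apply: (@eq_Ck_on _ _ _ _ _ (fun x => (\det (f x))^-1 * cofactor (f x) j i)) => //.
  by move=> x Ux; rewrite /invmx uf// mxE mxE.
apply: Ck_onM => //.
  apply: Ck_onV => //; last exact: Ck_on_det.
  by move=> x Ux; rewrite -unitfE -unitmxE; exact: uf.
rewrite /cofactor; apply: Ck_onM => //; first exact: Ck_on_cst.
apply: Ck_on_det => //; apply/Ck_on_mxP => // a b.
apply: (@eq_Ck_on _ _ _ _ _ (fun x => f x (lift j a) (lift i b))) => //.
  by move=> x _; rewrite !mxE.
by move/(Ck_on_mxP _ _ oU) : Cf; apply.
Qed.

End CkComp.

(** * Germs of smooth maps and their Jacobians *)

Section Germ.
Context {R : realType}.
Implicit Types (V W : normedModType R).

(** Smoothness as a property of a point: one neighbourhood serves all orders [k], and composition no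
    longer requires keeping track of domains. *)
Definition sm V W (f : V -> W) (x : V) := exists2 U, open_nbhs x U & smooth_on U f.

Lemma smooth_on_sm V W (f : V -> W) (U : set V) :
  (forall x, U x -> sm f x) -> smooth_on U f.
Proof.
move=> H k; elim: k f H => [|k IH] f H /=.
  by move=> x /H[U' [oU' U'x] S]; exact: (S 0%N).
split=> [x /H[U' [oU' U'x] S]|v]; first by have [+ _] := S 1%N; apply.
apply: IH => x /H[U' [oU' U'x] S]; exists U' => // k'.
by have [_] := S k'.+1; apply.
Qed.

Lemma sm_open V W (f : V -> W) (U : set V) :
  open U -> (forall x, U x -> sm f x) <-> smooth_on U f.
Proof. by move=> oU; split=> [|H x Ux]; [exact: smooth_on_sm|exists U]. Qed.

Lemma sm_nbhs V W (f : V -> W) (S : set V) x : nbhs x S -> smooth_on S f -> sm f x.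
Proof.
move=> Sx Sf; exists S°.
  by split; [exact: open_interior|].
by move=> k; apply: Ck_on_sub (Sf k); exact: interior_subset.
Qed.

Lemma sm_near V W (f : V -> W) x : sm f x -> \forall y \near x, sm f y.
Proof.
move=> [U [oU Ux] S]; near=> y; exists U => //; split => //.
by near: y; exact: open_nbhs_nbhs.
Unshelve. all: by end_near. Qed.

Lemma sm_diff V W (f : V -> W) x : sm f x -> differentiable f x.
Proof. by move=> [U [oU Ux] /(_ 1%N)[+ _]]; apply. Qed.

Lemma sm_cont V W (f : V -> W) x : sm f x -> {for x, continuous f}.
Proof. by move/sm_diff/differentiable_continuous. Qed.

Lemma sm_derive V W (f : V -> W) v x : sm f x -> sm ('D_v f) x.
Proof. by move=> [U oU S]; exists U => // k; have [_] := S k.+1; apply. Qed.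

Lemma near_open (T : topologicalType) (x : T) (P : T -> Prop) :
  (\forall y \near x, P y) -> exists2 U, open_nbhs x U & forall y, U y -> P y.
Proof. by move=> H; have : nbhs x P by []; rewrite nbhsE => -[U oU UP]; exists U. Qed.

Lemma open_nbhsI' (T : topologicalType) (x : T) (U U' : set T) :
  open_nbhs x U -> open_nbhs x U' -> open_nbhs x (U `&` U').
Proof. by move=> [oU Ux] [oU' U'x]; split; [exact: openI|]. Qed.

Lemma sm_eq V W (f g : V -> W) x : (\near x, f x = g x) -> sm f x -> sm g x.
Proof.
move=> /near_open[U' oU' fg] [U oU S]; exists (U `&` U'); first exact: open_nbhsI'.
move=> k; apply: (@eq_Ck_on _ _ _ _ _ f).
- by apply: openI; [exact: (oU.1)|exact: oU'.1].
- by move=> y [_]; exact: fg.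
- by apply: Ck_on_sub (S k) => y [].
Qed.

Lemma sm_cst V W (a : W) (x : V) : sm (fun=> a) x.
Proof. by exists setT => [|k]; [exact: open_nbhsT|exact: Ck_on_cst]. Qed.

Lemma sm_id V (x : V) : sm id x.
Proof.
exists setT => [|k]; first exact: open_nbhsT.
by apply: (@Ck_on_lin _ V V k setT (idfun : {linear V -> V})) => y; exact: cvg_id.
Qed.

Lemma sm_D V W (f g : V -> W) x : sm f x -> sm g x -> sm (fun y => f y + g y) x.
Proof.
move=> [U oU S] [U' oU' S']; exists (U `&` U'); first exact: open_nbhsI'.
move=> k; apply: Ck_onD; first by apply: openI; [exact: oU.1|exact: oU'.1].
  by apply: Ck_on_sub (S k) => y [].
by apply: Ck_on_sub (S' k) => y [].
Qed.

Lemma sm_M V (f g : V -> R) x : sm f x -> sm g x -> sm (fun y => f y * g y) x.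
Proof.
move=> [U oU S] [U' oU' S']; exists (U `&` U'); first exact: open_nbhsI'.
move=> k; apply: Ck_onM; first by apply: openI; [exact: oU.1|exact: oU'.1].
  by apply: Ck_on_sub (S k) => y [].
by apply: Ck_on_sub (S' k) => y [].
Qed.

Lemma sm_mulmx V m n p (f : V -> 'M[R]_(m, n)) (g : V -> 'M[R]_(n, p)) x :
  sm f x -> sm g x -> sm (fun y => f y *m g y) x.
Proof.
move=> [U oU S] [U' oU' S']; exists (U `&` U'); first exact: open_nbhsI'.
move=> k; apply: Ck_on_mulmx; first by apply: openI; [exact: oU.1|exact: oU'.1].
  by apply: Ck_on_sub (S k) => y [].
by apply: Ck_on_sub (S' k) => y [].
Qed.

Lemma sm_mxP V m n (f : V -> 'M[R]_(m, n)) x :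
  sm f x <-> forall i j, sm (fun y => f y i j) x.
Proof.
split=> [[U oU S] i j|H].
  by exists U => // k; move: (S k) => /(Ck_on_mxP _ _ oU.1); apply.
have : \forall y \near x, forall ij : 'I_m * 'I_n, sm (fun y => f y ij.1 ij.2) y.
  by apply: filter_forall => -[i j]; exact: sm_near.
move=> /near_open[U oU HU]; exists U => // k; apply/Ck_on_mxP => [|i j]; first exact: oU.1.
by apply: (sm_open _ oU.1).1 => y Uy; exact: (HU y Uy (i, j)).
Qed.

Lemma sm_comp V m p q (f : V -> 'rV[R]_m) (g : 'rV[R]_m -> 'M[R]_(p, q)) x :
  sm f x -> sm g (f x) -> sm (g \o f) x.
Proof.
move=> Sf; have cf := sm_cont Sf; move: Sf => [U oU S] [U' [oU' U'x] S'].
have /near_open[U2 oU2 fU2] : \forall y \near x, U' (f y).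
  by apply: cf; exact: open_nbhs_nbhs.
exists (U `&` U2); first exact: open_nbhsI'.
move=> k; apply: (@Ck_on_comp _ _ _ _ _ _ _ U') => //.
- by apply: openI; [exact: oU.1|exact: oU2.1].
- by move=> y [_]; exact: fU2.
- by apply: Ck_on_sub (S k) => y [].
Qed.

Lemma sm_compR V (f : V -> R) (g : R -> R) x :
  sm f x -> sm g (f x) -> sm (g \o f) x.
Proof.
move=> Sf; have cf := sm_cont Sf; move: Sf => [U oU S] [U' [oU' U'x] S'].
have /near_open[U2 oU2 fU2] : \forall y \near x, U' (f y).
  by apply: cf; exact: open_nbhs_nbhs.
exists (U `&` U2); first exact: open_nbhsI'.
move=> k; apply: (@Ck_on_compR _ _ _ _ U') => //.
- by apply: openI; [exact: oU.1|exact: oU2.1].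
- by move=> y [_]; exact: fU2.
- by apply: Ck_on_sub (S k) => y [].
Qed.

Lemma sm_invmx V n (f : V -> 'M[R]_n) x :
  f x \in unitmx -> sm f x -> sm (fun y => invmx (f y)) x.
Proof.
move=> ux [U oU S].
have dc : {for x, continuous (fun y => \det (f y))}.
  exact: (Ck_on_cont (Ck_on_det oU.1 (S 0%N)) oU.2).
have /near_open[U' oU' fU'] : \forall y \near x, f y \in unitmx.
  have : nbhs (\det (f x)) [set y | y != 0].
    apply: open_nbhs_nbhs; split; first exact: open_neq.
    by rewrite /= -unitfE -unitmxE.
  by move=> /dc H; near=> y; rewrite unitmxE unitfE; near: y; exact: H.
exists (U `&` U'); first exact: open_nbhsI'.
move=> k; apply: Ck_on_invmx.
- by apply: openI; [exact: oU.1|exact: oU'.1].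
- by move=> y [_]; exact: fU'.
- by apply: Ck_on_sub (S k) => y [].
Unshelve. all: by end_near. Qed.

Lemma sm_sin (x : R) : sm (@sin R) x.
Proof. by exists setT => [|k]; [exact: open_nbhsT|exact: (Ck_on_sin_cos _ openT).1]. Qed.

Lemma sm_cos (x : R) : sm (@cos R) x.
Proof. by exists setT => [|k]; [exact: open_nbhsT|exact: (Ck_on_sin_cos _ openT).2]. Qed.

Lemma jacobianP m n (f : 'rV[R]_m -> 'rV[R]_n) x B : differentiable f x ->
  (forall v, 'D_v f x = v *m B) -> jacobian f x = B.
Proof.
move=> df DB; apply/row_matrixP => i.
by rewrite [LHS]rowE [RHS]rowE -deriveEjacobian.
Qed.

Lemma jacobian_entry m n (f : 'rV[R]_m -> 'rV[R]_n) x i j : differentiable f x ->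
  jacobian f x i j = 'D_(delta_mx 0 i) f x 0 j.
Proof. by move=> df; rewrite deriveEjacobian// -rowE [RHS]mxE. Qed.

Lemma sm_jacobian m n (f : 'rV[R]_m -> 'rV[R]_n) x : sm f x -> sm (jacobian f) x.
Proof.
move=> Sf; apply/sm_mxP => i j.
apply: (@sm_eq _ _ (fun y => 'D_(delta_mx 0 i) f y 0 j)).
  by apply: filterS (sm_near Sf) => y /sm_diff df; rewrite jacobian_entry.
by move: (sm_derive (delta_mx 0 i) Sf) => /sm_mxP; apply.
Qed.

(** Vectors are rows, so Jacobians multiply in the order in which the maps are applied. *)
Lemma jacobian_comp m n p (f : 'rV[R]_m -> 'rV[R]_n) (g : 'rV[R]_n -> 'rV[R]_p) x :
  differentiable f x -> differentiable g (f x) ->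
  jacobian (g \o f) x = jacobian f x *m jacobian g (f x).
Proof.
move=> df dg; have dgf : differentiable (g \o f) x by exact: differentiable_comp.
apply: jacobianP => // v; rewrite (deriveE v dgf) (diff_comp df dg) mulmxA /=.
by rewrite -(deriveE v df) (deriveEjacobian v df) -(deriveE _ dg) (deriveEjacobian _ dg).
Qed.

Lemma near_eq_jacobian m n (f g : 'rV[R]_m -> 'rV[R]_n) x :
  (\near x, f x = g x) -> differentiable f x -> jacobian f x = jacobian g x.
Proof.
move=> fg df; apply: jacobianP => // v; rewrite -deriveEjacobian.
  exact: near_eq_derive.
exact: near_eq_differentiable fg df.
Qed.

Lemma jacobian_id m (x : 'rV[R]_m) : jacobian id x = 1%:M.
Proof. by apply: jacobianP => // v; rewrite derive_id mulmx1. Qed.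

Lemma jacobianD m n (f g : 'rV[R]_m -> 'rV[R]_n) x :
  differentiable f x -> differentiable g x ->
  jacobian (fun y => f y + g y) x = jacobian f x + jacobian g x.
Proof.
move=> df dg; apply: jacobianP => [|v]; first exact: (differentiableD df dg).
transitivity ('D_v f x + 'D_v g x); first by apply: deriveD; exact: diff_derivable.
by rewrite (deriveEjacobian v df) (deriveEjacobian v dg) -mulmxDr.
Qed.

Lemma differentiable_mulmxr V m n p (B : 'M[R]_(n, p)) (f : V -> 'M[R]_(m, n)) x :
  differentiable f x -> differentiable (fun y => f y *m B) x.
Proof.
move=> df; apply: (differentiable_comp (g := mulmxr B)) => //.
apply: linear_differentiable => y; apply: (sm_cont (f := mulmxr B)).
by apply: sm_mulmx; [exact: sm_id|exact: sm_cst].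
Qed.

Lemma jacobian_lin m n (B : 'M[R]_(m, n)) (x : 'rV[R]_m) :
  jacobian (mulmxr B) x = B.
Proof.
have c : continuous (mulmxr B : 'rV[R]_m -> 'rV[R]_n).
  move=> y; apply: (sm_cont (f := mulmxr B)).
  by apply: sm_mulmx; [exact: sm_id|exact: sm_cst].
apply: jacobianP => [|v]; first exact: linear_differentiable.
by rewrite deriveE ?diff_lin//; exact: linear_differentiable.
Qed.

Lemma jacobian_mulmxr m n p (B : 'M[R]_(n, p)) (f : 'rV[R]_m -> 'rV[R]_n) x :
  differentiable f x -> jacobian (fun y => f y *m B) x = jacobian f x *m B.
Proof.
move=> df; rewrite -[LHS]/(jacobian (mulmxr B \o f) x) jacobian_comp ?jacobian_lin//.
exact: (differentiable_mulmxr B (f := id)).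
Qed.

Lemma jacobian_cst m n (a : 'rV[R]_n) (x : 'rV[R]_m) : jacobian (fun=> a) x = 0.
Proof. by apply: jacobianP => [|v]; [exact: differentiable_cst|rewrite mulmx0 derive_cst]. Qed.

End Germ.

(** * The inverse function theorem *)

Section InverseFunction.
Context {R : realType}.

Lemma rv_coord_le m n (v : 'M[R]_(m, n)) i j : `|v i j| <= `|v|.
Proof. by rewrite [leRHS]/Num.Def.normr/= mx_normrE; exact: (le_bigmax _ (fun ij => `|v ij.1 ij.2|) (i, j)). Qed.

Lemma rv_norm_le m n (v : 'M[R]_(m, n)) c :
  0 <= c -> (forall i j, `|v i j| <= c) -> `|v| <= c.
Proof. by move=> c0 H; rewrite [leLHS]/Num.Def.normr/= mx_normrE; apply: bigmax_le => // -[i j] _; exact: H. Qed.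

Lemma mulmx_norm_le m n p (A : 'M[R]_(m, n)) (B : 'M[R]_(n, p)) :
  `|A *m B| <= n%:R * `|B| * `|A|.
Proof.
apply: rv_norm_le => [|i j]; first by rewrite !mulr_ge0.
rewrite mxE; apply: (le_trans (ler_norm_sum _ _ _)).
apply: (@le_trans _ _ (\sum_(l < n) `|B| * `|A|)).
  apply: ler_sum => l _; rewrite normrM mulrC.
  by apply: ler_pM => //; exact: rv_coord_le.
by rewrite sumr_const card_ord -mulrA mulr_natl.
Qed.

Lemma diff_epsP m n (f : 'rV[R]_m -> 'rV[R]_n) (B : 'M[R]_(m, n)) (x : 'rV[R]_m) :
  (forall e : R, 0 < e -> \forall k \near (0 : 'rV[R]_m), `|f (k + x) - f x - k *m B| <= e * `|k|) <->
  differentiable f x /\ jacobian f x = B.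
Proof.
have cB : continuous (mulmxr B : 'rV[R]_m -> 'rV[R]_n).
  move=> y; apply: (sm_cont (f := mulmxr B)).
  by apply: sm_mulmx; [exact: sm_id|exact: sm_cst].
split=> [H|[df <-] e e0].
  have E : f \o shift x = cst (f x) + (mulmxr B : 'rV[R]_m -> 'rV[R]_n) +o_ (0 : 'rV[R]_m) id.
    apply/eqaddoP => e e0; apply: filterS (H e e0) => k.
    by rewrite -[X in _ -> `|X| <= _]/(f (k + x) - (f x + k *m B)) opprD addrA.
  have dE : 'd f x = mulmxr B :> ('rV[R]_m -> 'rV[R]_n) by exact: diff_unique.
  split; first by apply/diff_locallyP; rewrite dE.
  apply: jacobianP => [|v]; first by apply/diff_locallyP; rewrite dE.
  by rewrite deriveE ?dE//; apply/diff_locallyP; rewrite dE.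
have /diff_locally/eqaddoP/(_ e e0) := df; apply: filterS => k.
rewrite -[X in `|X| <= _ -> _]/(f (k + x) - (f x + 'd f x k)).
by rewrite /jacobian mul_rV_lin1 opprD addrA.
Qed.

(** The one-variable mean value theorem is applied to each coordinate along the segment from [x] to
    [y], which stays in the ball; as the norm is the sup norm, a bound for each coordinate
    suffices. *)
Lemma lipschitz_of_diff m n (f : 'rV[R]_m -> 'rV[R]_n)
    (x0 : 'rV[R]_m) (r K : R) : 0 <= K ->
  (forall x, ball x0 r x -> differentiable f x) ->
  (forall x (v : 'rV[R]_m), ball x0 r x -> `|v *m jacobian f x| <= K * `|v|) ->
  forall x y : 'rV[R]_m, ball x0 r x -> ball x0 r y -> `|f y - f x| <= K * `|y - x|.
Proof.
move=> K0 df dK x y Bx By.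
apply: rv_norm_le => [|i j]; first by rewrite mulr_ge0.
rewrite ord1 {i}.
pose c (t : R) := x + t *: (y - x).
have Bc (t : R) : 0 <= t <= 1 -> ball x0 r (c t).
  move=> /andP[t0 t1]; move: Bx By; rewrite -!ball_normE /ball_/= => Bx By.
  have -> : x0 - c t = (1 - t) *: (x0 - x) + t *: (x0 - y).
    by rewrite /c; apply/rowP => i; rewrite !mxE; ring.
  apply: (le_lt_trans (ler_normD _ _)); rewrite !normrZ.
  rewrite (ger0_norm t0) ger0_norm ?subr_ge0//.
  have [->|tn0] := eqVneq t 0; first by rewrite mul0r addr0 subr0 mul1r.
  have tp : 0 < t by rewrite lt_neqAle eq_sym tn0.
  have := ltr_pM2l tp `|x0 - y| r; rewrite By => H.
  have : (1 - t) * `|x0 - x| <= (1 - t) * r by apply: ler_wpM2l; [rewrite subr_ge0|exact: ltW].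
  by move: H; lra.
have did (t : R) : differentiable (fun t : R => t) t by exact: ex_diff.
have dZ (t : R) : differentiable (fun t : R => t *: (y - x)) t.
  exact: (differentiableZl (y - x) (did t)).
have dct (t : R) : differentiable c t.
  exact: (differentiableD (differentiable_cst x t) (dZ t)).
have Dc (t : R) : 'D_1 c t = y - x.
  transitivity ('D_1 (cst x) t + 'D_1 (fun t : R => t *: (y - x)) t).
    by apply: deriveD; apply: diff_derivable => //; exact: differentiable_cst.
  rewrite derive_cst add0r (deriveE _ (dZ t)) (diffZl (y - x) (did t)).
  by rewrite -(deriveE _ (did t)) derive_id scale1r.
have dfc (t : R) : 0 <= t <= 1 ->
    is_derive t 1 (fun t => f (c t) 0 j) (((y - x) *m jacobian f (c t)) 0 j).
  move=> /Bc /df dfc.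
  have dd : differentiable (f \o c) t by exact: (differentiable_comp (dct t) dfc).
  have ddj : differentiable (fun t => f (c t) 0 j) t.
    by move: dd => /differentiable_coordP; apply.
  apply: DeriveDef; first exact: diff_derivable.
  rewrite (@derive_coord _ _ _ _ (f \o c)); last exact: diff_derivable.
  rewrite (deriveE _ dd) (diff_comp (dct t) dfc) /= -(deriveE _ (dct t)) Dc.
  by rewrite -(deriveE _ dfc) (deriveEjacobian _ dfc).
have [|||t t01] := @MVT R (fun t => f (c t) 0 j) (fun t => ((y - x) *m jacobian f (c t)) 0 j) 0 1.
- exact: ltr01.
- by move=> t; rewrite in_itv/= => /andP[/ltW t0 /ltW t1]; apply: dfc; rewrite t0.
- apply: derivable_within_continuous => t; rewrite in_itv/= => t01.
  by case: (dfc t t01).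
- have -> : c 1 = y by rewrite /c scale1r addrC subrK.
  have -> : c 0 = x by rewrite /c scale0r addr0.
  rewrite subr0 mulr1 => E.
  have -> : (f y - f x) 0 j = f y 0 j - f x 0 j by rewrite !mxE.
  rewrite E; apply: le_trans (dK (c t) (y - x) _).
    exact: rv_coord_le.
  by apply: Bc; move: t01; rewrite in_itv/= => /andP[/ltW-> /ltW->].
Qed.

Lemma near_norm_lt n (x0 : 'rV[R]_n) (P : 'rV[R]_n -> Prop) :
  (\forall x \near x0, P x) -> exists2 r, 0 < r & forall x, `|x0 - x| < r -> P x.
Proof.
by move=> /nbhs_ballP[r /= r0 H]; exists r => // x Hx; apply: H; rewrite -ball_normE.
Qed.

Lemma sm_near_diff m n (f : 'rV[R]_m -> 'rV[R]_n) (x0 : 'rV[R]_m) :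
  sm f x0 -> forall e : R, 0 < e ->
  \forall x \near x0, forall v : 'rV[R]_m, `|v *m (jacobian f x - jacobian f x0)| <= e * `|v|.
Proof.
move=> Sf e e0.
(* The added 1 keeps the denominator positive when [m] is 0. *)
pose d := e / (m%:R + 1).
have m0 : 0 < m%:R + 1 :> R by rewrite ltr_wpDl.
have d0 : 0 < d by rewrite divr_gt0.
have /cvgrPdist_lt/(_ d d0) := sm_cont (sm_jacobian Sf).
apply: filterS => x; rewrite distrC => /ltW Hd v; apply: (le_trans (mulmx_norm_le _ _)).
apply: ler_wpM2r => //.
apply: (@le_trans _ _ ((m%:R + 1) * d)); last by rewrite /d mulrCA divff ?mulr1// gt_eqF.
by apply: ler_pM => //; rewrite lerDl.
Qed.

Lemma continuous_normf (T : topologicalType) n (u : T -> 'rV[R]_n) z :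
  {for z, continuous u} -> continuous_at z (fun y => `|u y|).
Proof. by move=> cu; exact: cvg_norm. Qed.

Lemma cvg_addr0 (V : normedModType R) (y : V) : (fun k : V => k + y) @ (0 : V) --> y.
Proof.
apply/cvgrPdist_lt => e e0; near=> k.
rewrite opprD addrCA subrr addr0 normrN; near: k.
exact: nbhs0_lt.
Unshelve. all: by end_near. Qed.

Section Local.
Variables (n : nat) (f : 'rV[R]_n -> 'rV[R]_n) (x0 : 'rV[R]_n).
Hypothesis (Sf : sm f x0) (Uf : jacobian f x0 \in unitmx).
Let A := invmx (jacobian f x0).

(** The last clause is exactly what makes the Newton map [x - f x *m A] a contraction of ratio
    1/2. *)
Let near_good : \forall x \near x0, [/\ sm f x, jacobian f x \in unitmx &
   forall v : 'rV[R]_n, `|v *m (jacobian f x - jacobian f x0) *m A| <= 2^-1 * `|v|].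
Proof.
have n0 : 0 < n%:R * `|A| + 1 :> R by rewrite ltr_wpDl// mulr_ge0.
have e0 : 0 < 2^-1 / (n%:R * `|A| + 1) :> R by rewrite divr_gt0.
have dc : {for x0, continuous (fun y => \det (jacobian f y))}.
  have [U oU S] := sm_jacobian Sf.
  exact: (Ck_on_cont (Ck_on_det oU.1 (S 0%N)) oU.2).
have uN : \forall y \near x0, \det (jacobian f y) != 0.
  have : nbhs (\det (jacobian f x0)) [set y | y != 0].
    apply: open_nbhs_nbhs; split; first exact: open_neq.
    by rewrite /= -unitfE -unitmxE.
  by move/dc.
near=> x; split.
- by near: x; exact: (sm_near Sf).
- by rewrite unitmxE unitfE; near: x.
- move=> v.
  have H : `|v *m (jacobian f x - jacobian f x0)| <= 2^-1 / (n%:R * `|A| + 1) * `|v|.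
    by move: v; near: x; exact: (sm_near_diff Sf).
  apply: (le_trans (mulmx_norm_le _ _)).
  apply: (@le_trans _ _ ((n%:R * `|A| + 1) * (2^-1 / (n%:R * `|A| + 1) * `|v|))).
    by apply: ler_pM => //; rewrite ?mulr_ge0// lerDl.
  by rewrite mulrA mulrCA divff ?mulr1// gt_eqF.
Unshelve. all: by end_near. Qed.

Lemma inverse_function : exists g : 'rV[R]_n -> 'rV[R]_n,
  [/\ sm g (f x0), g (f x0) = x0, \forall y \near f x0, f (g y) = y &
      \forall x \near x0, g (f x) = x].
Proof.
have [r r0 Hr] := near_norm_lt near_good.
have HrS x : ball x0 r x -> sm f x by rewrite -ball_normE => /Hr[].
have HrU x : ball x0 r x -> jacobian f x \in unitmx by rewrite -ball_normE => /Hr[].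
(* The Newton map: the fixed points of [h] shifted by [y *m A] are the solutions of [f x = y]. *)
pose h x := x + (- f x) *m A.
have dh x : ball x0 r x -> differentiable h x.
  move=> /HrS/sm_diff df; apply: differentiableD => //.
  by apply: differentiable_mulmxr; exact: differentiableN.
have HJ (J J0 : 'M[R]_n) : J0 \in unitmx ->
    1%:M + - J *m invmx J0 = - ((J - J0) *m invmx J0).
  by move=> U; rewrite mulmxBl mulmxV// opprB mulNmx.
have Jh x : ball x0 r x -> jacobian h x = - ((jacobian f x - jacobian f x0) *m A).
  move=> /[dup] Bx /HrS/sm_diff df.
  have dNf : differentiable (fun y => - f y) x by exact: differentiableN.
  rewrite /h jacobianD//; last exact: differentiable_mulmxr.
  rewrite jacobian_id jacobian_mulmxr//.
  have -> : jacobian (fun y => - f y) x = - jacobian f x.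
    apply: jacobianP => // v; transitivity (- 'D_v f x); first by apply: deriveN; exact: diff_derivable.
    by rewrite (deriveEjacobian v df) mulmxN.
  exact: HJ.
have Lh x y : ball x0 r x -> ball x0 r y -> `|h y - h x| <= 2^-1 * `|y - x|.
  apply: lipschitz_of_diff => // {}x v Bx.
  rewrite Jh// mulmxN normrN mulmxA.
  by move: Bx; rewrite -ball_normE => /Hr[].
(* [(f y - f x) *m A] differs from [y - x] by at most half of its length. This gives injectivity of
   [f] and the Lipschitz bound for the inverse. *)
have Lf x y : ball x0 r x -> ball x0 r y -> `|y - x| <= 2 * `|(f y - f x) *m A|.
  move=> Bx By; have := Lh _ _ Bx By.
  have -> : (f y - f x) *m A = (y - x) - (h y - h x).
    by rewrite /h mulmxBl !mulNmx; apply/rowP => i; rewrite !mxE; ring.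
  by have := lerB_normD (y - x) (- (h y - h x)); rewrite normrN; lra.
pose r' := r / 2.
have r'0 : 0 < r' by rewrite divr_gt0.
have r'r : r' < r by rewrite /r' ltr_pdivrMr// ltr_pMr// ltr1n.
have subB x : `|x - x0| <= r' -> ball x0 r x.
  by rewrite -ball_normE /ball_/= distrC => H; exact: le_lt_trans r'r.
(* The bound [r' / 2] leaves the other half of [r'] to the displacement [h x - h x0], so that [T]
   maps the closed ball into the open one. *)
pose W := [set y | `|(y - f x0) *m A| < r' / 2].
have oW : open W.
  have -> : W = (fun y => `|(y - f x0) *m A|) @^-1` [set t | t < r' / 2] by [].
  apply: open_comp; last exact: open_lt.
  move=> y _; apply: (continuous_normf (u := fun y : 'rV[R]_n => (y - f x0) *m A)).
  apply: sm_cont; apply: sm_mulmx; last exact: sm_cst.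
  by apply: sm_D; [exact: sm_id|exact: sm_cst].
have Wf : W (f x0) by rewrite /W/= subrr mul0mx normr0 divr_gt0.
have solve y : W y -> exists x, `|x - x0| < r' /\ f x = y.
  move=> Wy.
  pose T x := h x + y *m A.
  have TB x : `|x - x0| <= r' -> `|T x - x0| < r'.
    move=> Bx; have -> : T x - x0 = (h x - h x0) + (y - f x0) *m A.
      by rewrite /T /h mulmxBl !mulNmx; apply/rowP => i; rewrite !mxE; ring.
    apply: (le_lt_trans (ler_normD _ _)).
    have := Lh x0 x (ballxx _ r0) (subB _ Bx).
    move: Wy; rewrite /W/=; move: Bx; lra.
  have cpt : compact [set x | `|x - x0| <= r'].
    apply: bounded_closed_compact.
      exists (`|x0| + r'); split; first exact: num_real.
      move=> M HM x /= Hx; apply: le_trans (ltW HM).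
      by rewrite -(subrK x0 x) addrC (le_trans (ler_normD _ _))// lerD2l.
    have -> : [set x | `|x - x0| <= r'] = (fun x => `|x - x0|) @^-1` [set t | t <= r'] by [].
    apply: closed_comp; last exact: closed_le.
    move=> x _; apply: (continuous_normf (u := fun y : 'rV[R]_n => y - x0)).
    by apply: sm_cont; apply: sm_D; [exact: sm_id|exact: sm_cst].
  (* The fixed point is a minimizer of the displacement [T x - x] on the compact ball: applying [T]
     at least halves the displacement, so the minimum is 0. *)
  have [||c] := @EVT_min_rV R n (fun x => `|T x - x|) [set x | `|x - x0| <= r'] _ cpt.
  - by exists x0; rewrite /= subrr normr0 ltW.
  - apply: continuous_in_subspaceT => x; rewrite inE/= => Bx.
    apply: (continuous_normf (u := fun y : 'rV[R]_n => T y - y)).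
    have ch : {for x, continuous h} by apply/differentiable_continuous/dh/subB.
    have cT : {for x, continuous T} by exact: (cvgD ch (cvg_cst (y *m A))).
    by apply: (@cvgB _ _ _ (nbhs x) _ T idfun) => //; exact: cvg_id.
  - rewrite inE/= => Bc Hmin; exists (T c).
    have BT := TB _ Bc.
    have E : T c = c.
      apply/eqP; rewrite -subr_eq0 -normr_le0.
      have := Hmin (T c); rewrite inE/= (ltW BT) => /(_ isT).
      have -> : T (T c) - T c = h (T c) - h c by rewrite /T opprD addrACA subrr addr0.
      by have := Lh _ _ (subB _ Bc) (subB _ (ltW BT)); lra.
    split=> //; rewrite E.
    have : (y - f c) *m A = 0.
      by move/eqP: E; rewrite /T /h -addrA eq_sym -subr_eq0 opprD addNKr oppr_eq0 mulNmx addrC -mulmxBl => /eqP.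
    move/(congr1 (mulmx^~ (jacobian f x0))); rewrite mul0mx mulmxKV//.
    by move/eqP; rewrite subr_eq0 => /eqP.
pose g y := xget x0 [set x | `|x - x0| < r' /\ f x = y].
have gP y : W y -> `|g y - x0| < r' /\ f (g y) = y.
  by move=> /solve[x Hx]; rewrite /g; case: xgetP => [z _ //|/(_ x)]; case.
have Bg y : W y -> ball x0 r (g y) by move=> /gP[/ltW/subB].
have Lg y y' : W y -> W y' -> `|g y' - g y| <= (2 * (n%:R * `|A|)) * `|y' - y|.
  move=> Wy Wy'; have := Lf _ _ (Bg _ Wy) (Bg _ Wy').
  rewrite (gP _ Wy).2 (gP _ Wy').2 => /le_trans; apply.
  by rewrite -mulrA ler_pM2l// mulmx_norm_le.
pose C := 2 * (n%:R * `|A|) + 1.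
have C0 : 0 < C by rewrite ltr_wpDl// !mulr_ge0.
have Lg' y y' : W y -> W y' -> `|g y' - g y| <= C * `|y' - y|.
  by move=> Wy Wy'; apply: (le_trans (Lg _ _ Wy Wy')); rewrite ler_wpM2r// lerDl.
have cg (y : 'rV[R]_n) : W y -> {for y, continuous g}.
  move=> Wy; apply/(@cvgrPdist_lt _ _ _ (nbhs y)) => e e0; near=> z.
  have Wz : W z by near: z; exact: open_nbhs_nbhs.
  rewrite distrC; apply: (le_lt_trans (Lg' _ _ Wy Wz)).
  rewrite mulrC -ltr_pdivlMr// distrC; near: z.
  by apply: cvgr_dist_lt; [exact: cvg_id|exact: divr_gt0].
have dg (y : 'rV[R]_n) : W y -> differentiable g y /\ jacobian g y = invmx (jacobian f (g y)).
  move=> Wy; apply/diff_epsP => e e0.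
  set x := g y; set J := jacobian f x.
  have UJ : J \in unitmx by apply/HrU/Bg.
  have df : differentiable f x by apply/sm_diff/HrS/Bg.
  pose D := n%:R * `|invmx J| + 1.
  have D0 : 0 < D by rewrite ltr_wpDl// mulr_ge0.
  have e1 : 0 < e / (D * C) by rewrite divr_gt0// mulr_gt0.
  have /(_ _ e1) Hf := (diff_epsP f J x).2 (conj df erefl).
  have Hc : (fun k : 'rV[R]_n => g (k + y) - x) @ (0 : 'rV[R]_n) --> (0 : 'rV[R]_n).
    have c1 : (fun k : 'rV[R]_n => k + y) @ (0 : 'rV[R]_n) --> y.
      exact: cvg_addr0.
    have c2 := cvgB (cvg_comp _ _ c1 (cg _ Wy)) (cvg_cst x).
    by rewrite -[X in _ --> X](subrr x); exact: c2.
  have HW : nbhs y W by exact: open_nbhs_nbhs.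
  have HWk : \forall k \near (0 : 'rV[R]_n), W (k + y) by exact: cvg_addr0 HW.
  have Hfk : \forall k \near (0 : 'rV[R]_n),
      `|f (g (k + y) - x + x) - f x - (g (k + y) - x) *m J| <=
      e / (D * C) * `|g (k + y) - x| by exact: Hc Hf.
  near=> k.
  have Wk : W (k + y) by near: k.
  have Hk : `|f (g (k + y) - x + x) - f x - (g (k + y) - x) *m J| <=
      e / (D * C) * `|g (k + y) - x|.
    by near: k.
  move: Hk; rewrite subrK (gP _ Wk).2 (gP _ Wy).2 addrK => Hk.
  have -> : g (k + y) - x - k *m invmx J = - ((k - (g (k + y) - x) *m J) *m invmx J).
    by rewrite mulmxBl mulmxK// opprB.
  rewrite normrN; apply: (le_trans (mulmx_norm_le _ _)).
  have := Lg' _ _ Wy Wk; rewrite addrK -/x => HL.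
  apply: (@le_trans _ _ (D * (e / (D * C) * (C * `|k|)))).
    apply: ler_pM.
    - by rewrite mulr_ge0.
    - exact: normr_ge0.
    - by rewrite lerDl.
    - by apply: (le_trans Hk); rewrite ler_pM2l.
  suff -> : D * (e / (D * C) * (C * `|k|)) = e * `|k| by [].
  by field; rewrite !gt_eqF.
(* Bootstrap: the derivative of [g] is [invmx (jacobian f (g y))], a smooth function of [g y], so
   each order of differentiability of [g] yields the next. *)
have Sg : smooth_on W g.
  move=> k; elim: k => [|k IH]; first by move=> y; exact: cg.
  apply: (@Ck_onS _ _ _ _ _ _ (fun v y => ((fun x => v *m invmx (jacobian f x)) \o g) y)) => //.
  - by move=> y /dg[].
  - by move=> v y /dg[dgy Jg]; rewrite deriveEjacobian// Jg.
  - move=> v; apply: (@Ck_on_comp _ _ _ _ _ _ W (ball x0 r) g (fun x => v *m invmx (jacobian f x))) => //.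
      exact: ball_open.
    have oB : open (ball x0 r) by exact: ball_open.
    have S : smooth_on (ball x0 r) (fun x => v *m invmx (jacobian f x)).
      apply/(sm_open _ oB) => x Bx; apply: sm_mulmx; first exact: sm_cst.
      by apply: sm_invmx; [exact: HrU|apply/sm_jacobian/HrS].
    exact: S.
have inj x : `|x - x0| < r' -> W (f x) -> g (f x) = x.
  move=> Bx Wx; apply/eqP; rewrite -subr_eq0 -normr_le0.
  have := Lf _ _ (subB _ (ltW Bx)) (Bg _ Wx).
  by rewrite (gP _ Wx).2 subrr mul0mx normr0 mulr0.
exists g; split.
- by exists W.
- by apply: inj => //; rewrite subrr normr0.
- by near=> y; apply: (gP _ _).2; near: y; exact: open_nbhs_nbhs.
- near=> x; apply: inj.
    rewrite distrC; near: x; apply: cvgr_dist_lt => //; exact: cvg_id.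
  near: x; apply: (sm_cont Sf); exact: open_nbhs_nbhs.
Unshelve. all: by end_near. Qed.

End Local.
End InverseFunction.

(** * Smooth maps between manifolds *)

Section Charts.
Context {R : realType} {M : topologicalType} {n : nat}.
Implicit Types (c d : chart R M n) (x : M).

Lemma chart_toK c x : is_chart c -> chart_dom c x -> chart_from c (chart_to c x) = x.
Proof. by case=> _ _ + _ _; apply. Qed.

Lemma chart_nbhs c x : is_chart c -> chart_dom c x -> nbhs x (chart_dom c).
Proof. by move=> [oc _ _ _ _] cx; exact: open_nbhs_nbhs. Qed.

Lemma chart_img_to c x : chart_dom c x -> chart_img c (chart_to c x).
Proof. by move=> cx; exists x. Qed.

Lemma chart_img_nbhs c x : is_chart c -> chart_dom c x -> nbhs (chart_to c x) (chart_img c).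
Proof. by move=> [_ oi _ _ _] cx; apply: open_nbhs_nbhs; split => //; exact: chart_img_to. Qed.

Lemma chart_imgK c u : is_chart c -> chart_img c u ->
  chart_dom c (chart_from c u) /\ chart_to c (chart_from c u) = u.
Proof. by move=> hc [x cx <-]; rewrite chart_toK. Qed.

Lemma chart_to_cvg c x : is_chart c -> chart_dom c x -> chart_to c @ x --> chart_to c x.
Proof. by move=> [_ _ _ + _] cx; apply. Qed.

Lemma chart_from_cvg c x : is_chart c -> chart_dom c x ->
  chart_from c @ chart_to c x --> x.
Proof.
move=> hc cx; rewrite -[X in _ --> X](chart_toK hc cx).
by case: hc => _ _ _ _; apply; exact: chart_img_to.
Qed.

Lemma chart_to_nbhs c x (S : set M) : is_chart c -> chart_dom c x -> nbhs x S ->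
  nbhs (chart_to c x) (chart_to c @` (chart_dom c `&` S)).
Proof.
move=> hc cx Sx; near=> u.
have /(chart_imgK hc)[du <-] : chart_img c u by near: u; exact: chart_img_nbhs.
exists (chart_from c u) => //; split => //; near: u.
exact: chart_from_cvg Sx.
Unshelve. all: by end_near. Qed.

Lemma compatible_sm c d x : is_chart c -> is_chart d -> smooth_transition c d ->
  chart_dom c x -> chart_dom d x -> sm (chart_to d \o chart_from c) (chart_to c x).
Proof.
move=> hc hd cd cx dx; apply: sm_nbhs cd.
exact/chart_to_nbhs/chart_nbhs.
Qed.

End Charts.

Section SmoothAt.
Context {R : realType}.
Implicit Types M N P : chartedType R.

Lemma manifold_chart M x : smooth_manifold M -> exists2 c, maximal_atlas M c & chart_dom c x /\ atlas M c.
Proof.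
move=> [_ _ ch cov comp]; have [c Mc cx] := cov x; exists c; last by [].
by split=> [|d]; [exact: ch|exact: comp].
Qed.

Lemma atlas_maximal M c : smooth_manifold M -> atlas M c -> maximal_atlas M c.
Proof. by move=> [_ _ ch _ comp] Mc; split=> [|d]; [exact: ch|exact: comp]. Qed.

(** Each of the two charts is compatible with a chart of the atlas around [x], and near [x] the
    transition factors through that chart. *)
Lemma maximal_sm M c d x : smooth_manifold M -> maximal_atlas M c -> maximal_atlas M d ->
  chart_dom c x -> chart_dom d x -> sm (chart_to d \o chart_from c) (chart_to c x).
Proof.
move=> mM [hc cc] [hd cd] cx dx.
have [e [he _] [ex Me]] := manifold_chart x mM.
have s1 := compatible_sm hc he (cc e Me).1 cx ex.
have s2 := compatible_sm he hd (cd e Me).2 ex dx.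
have E : (chart_to e \o chart_from c) (chart_to c x) = chart_to e x by rewrite /= chart_toK.
rewrite -E in s2; apply: sm_eq (sm_comp s1 s2); near=> u => /=.
rewrite chart_toK//; near: u.
by apply: (chart_from_cvg hc cx); exact: chart_nbhs.
Unshelve. all: by end_near. Qed.

(** Continuity is asked at the point only, and the expression in charts is asked to be smooth as a
    germ; [smooth_at_near] recovers both at nearby points. *)
Definition smooth_at M N (f : M -> N) (x : M) := {for x, continuous f} /\
  exists c d, [/\ atlas M c, atlas N d, chart_dom c x, chart_dom d (f x) &
    sm (chart_to d \o f \o chart_from c) (chart_to c x)].

Lemma smooth_at_max M N (f : M -> N) x c d : smooth_manifold M -> smooth_manifold N ->
  maximal_atlas M c -> maximal_atlas N d -> chart_dom c x -> chart_dom d (f x) ->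
  smooth_at f x -> sm (chart_to d \o f \o chart_from c) (chart_to c x).
Proof.
move=> mM mN Mc Nd cx dx [cf [c' [d' [Mc' Nd' c'x d'x S]]]].
have {}Mc' := atlas_maximal mM Mc'; have {}Nd' := atlas_maximal mN Nd'.
have [hc _] := Mc; have [hc' _] := Mc'; have [hd _] := Nd; have [hd' _] := Nd'.
have s1 := maximal_sm mM Mc Mc' cx c'x.
have s3 := maximal_sm mN Nd' Nd d'x dx.
have E1 : (chart_to c' \o chart_from c) (chart_to c x) = chart_to c' x by rewrite /= chart_toK.
have E2 : (chart_to d' \o f \o chart_from c') (chart_to c' x) = chart_to d' (f x) by rewrite /= chart_toK.
rewrite -E2 in s3; have s4 := sm_comp S s3; rewrite -E1 in s4.
have cu : chart_from c u @[u --> chart_to c x] --> x by exact: chart_from_cvg.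
have H1 := cu _ (chart_nbhs hc' c'x).
have H2 := cu _ (cf _ (chart_nbhs hd' d'x)).
apply: sm_eq (sm_comp s1 s4); near=> u => /=.
have E : chart_from c' (chart_to c' (chart_from c u)) = chart_from c u.
  by rewrite chart_toK//; near: u; exact: H1.
by rewrite !E chart_toK//; near: u; exact: H2.
Unshelve. all: by end_near. Qed.

Lemma smooth_at_of M N (f : M -> N) x c d : smooth_manifold M -> smooth_manifold N ->
  maximal_atlas M c -> maximal_atlas N d -> chart_dom c x -> chart_dom d (f x) ->
  {for x, continuous f} -> sm (chart_to d \o f \o chart_from c) (chart_to c x) ->
  smooth_at f x.
Proof.
move=> mM mN Mc Nd cx dx cf S; split=> //.
have [c' Mc' [c'x ac']] := manifold_chart x mM.
have [d' Nd' [d'x ad']] := manifold_chart (f x) mN.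
exists c', d'; split=> //.
have [hc _] := Mc; have [hc' _] := Mc'; have [hd _] := Nd; have [hd' _] := Nd'.
have s1 := maximal_sm mM Mc' Mc c'x cx.
have s3 := maximal_sm mN Nd Nd' dx d'x.
have E1 : (chart_to c \o chart_from c') (chart_to c' x) = chart_to c x by rewrite /= chart_toK.
have E2 : (chart_to d \o f \o chart_from c) (chart_to c x) = chart_to d (f x) by rewrite /= chart_toK.
rewrite -E2 in s3; have s4 := sm_comp S s3; rewrite -E1 in s4.
have cu : chart_from c' u @[u --> chart_to c' x] --> x by exact: chart_from_cvg.
have H1 := cu _ (chart_nbhs hc cx).
have H2 := cu _ (cf _ (chart_nbhs hd dx)).
apply: sm_eq (sm_comp s1 s4); near=> u => /=.
have E : chart_from c (chart_to c (chart_from c' u)) = chart_from c' u.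
  by rewrite chart_toK//; near: u; exact: H1.
by rewrite !E chart_toK//; near: u; exact: H2.
Unshelve. all: by end_near. Qed.

Lemma smoothP M N (f : M -> N) : smooth_manifold M -> smooth_manifold N ->
  smooth f <-> forall x, smooth_at f x.
Proof.
move=> mM mN; split=> [[cf H] x|H].
  split; first exact: cf.
  have [c [d [Mc Nd cx dx S]]] := H x; exists c, d; split=> //.
  have [hc _] := atlas_maximal mM Mc; have [hd _] := atlas_maximal mN Nd.
  apply: sm_nbhs S; apply: chart_to_nbhs => //.
  by apply: cf; exact: chart_nbhs.
split=> x; first by have [] := H x.
have [_ [c [d [Mc Nd cx dx _]]]] := H x; exists c, d; split=> //.
apply: smooth_on_sm => _ [y [cy dy] <-].
exact: (smooth_at_max mM mN (atlas_maximal mM Mc) (atlas_maximal mN Nd) cy dy (H y)).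
Qed.

Lemma smooth_at_comp M N P (f : M -> N) (g : N -> P) x :
  smooth_manifold M -> smooth_manifold N -> smooth_manifold P ->
  smooth_at f x -> smooth_at g (f x) -> smooth_at (g \o f) x.
Proof.
move=> mM mN mP Sf Sg.
have [c Mc [cx _]] := manifold_chart x mM.
have [d Nd [dx _]] := manifold_chart (f x) mN.
have [e Pe [ex _]] := manifold_chart (g (f x)) mP.
have [hc _] := Mc; have [hd _] := Nd; have [he _] := Pe.
apply: (smooth_at_of mM mP Mc Pe) => //.
  by apply: continuous_comp; [exact: Sf.1|exact: Sg.1].
have s1 := smooth_at_max mM mN Mc Nd cx dx Sf.
have s2 := smooth_at_max mN mP Nd Pe dx ex Sg.
have E : (chart_to d \o f \o chart_from c) (chart_to c x) = chart_to d (f x) by rewrite /= chart_toK.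
have cu : chart_from c u @[u --> chart_to c x] --> x by exact: chart_from_cvg.
have H := cu _ (Sf.1 _ (chart_nbhs hd dx)).
rewrite -E in s2; apply: sm_eq (sm_comp s1 s2); near=> u => /=.
by rewrite chart_toK//; near: u; exact: H.
Unshelve. all: by end_near. Qed.

Lemma smooth_at_eq M N (f g : M -> N) x : smooth_manifold M -> smooth_manifold N ->
  (\near x, f x = g x) -> smooth_at f x -> smooth_at g x.
Proof.
move=> mM mN fg Sf.
have fgx : f x = g x by exact: nbhs_singleton fg.
have [c Mc [cx _]] := manifold_chart x mM.
have [d Nd [dx _]] := manifold_chart (f x) mN.
have [hc _] := Mc.
apply: (smooth_at_of mM mN Mc Nd) => //; first by rewrite -fgx.
  have := Sf.1; rewrite /prop_for/continuous_at -fgx; apply: cvg_trans.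
  exact: near_eq_cvg fg.
apply: sm_eq (smooth_at_max mM mN Mc Nd cx dx Sf).
have H : \forall u \near chart_to c x, f (chart_from c u) = g (chart_from c u).
  exact: (chart_from_cvg hc cx) fg.
by apply: filterS H => u /= ->.
Qed.

(** Continuity at the nearby points is not part of the hypothesis. It is read off from
    [chart_from d \o g \o chart_to c], which agrees with [f] near [x] and is continuous there
    because [g] is smooth. *)
Lemma smooth_at_near M N (f : M -> N) x : smooth_manifold M -> smooth_manifold N ->
  smooth_at f x -> \forall y \near x, smooth_at f y.
Proof.
move=> mM mN Sf.
have [c Mc [cx _]] := manifold_chart x mM.
have [d Nd [dx _]] := manifold_chart (f x) mN.
have [hc _] := Mc; have [hd _] := Nd.
pose g := chart_to d \o f \o chart_from c.
have /sm_near H : sm g (chart_to c x) by exact: smooth_at_max mM mN Mc Nd cx dx Sf.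
have H1 : \forall y \near x, sm g (chart_to c y) := chart_to_cvg hc cx H.
have Hd : \forall y \near x, chart_dom d (f y) := Sf.1 _ (chart_nbhs hd dx).
have HD : \forall y \near x, chart_dom c y := chart_nbhs hc cx.
have HE : \forall y \near x, (chart_from d \o g \o chart_to c) y = f y.
  near=> y; have cy : chart_dom c y by near: y; exact: HD.
  by rewrite /g /= (chart_toK hc cy) (chart_toK hd)//; near: y; exact: Hd.
have /near_open[U [oU Ux] HU] : \forall y \near x, [/\ sm g (chart_to c y),
    chart_dom d (f y), chart_dom c y & (chart_from d \o g \o chart_to c) y = f y].
  by near=> y; split; near: y.
near=> y.
have Uy : U y by near: y; exact: open_nbhs_nbhs.
have [sy dy cy Ey] := HU y Uy.
apply: (smooth_at_of mM mN Mc Nd) => //.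
have gE : g (chart_to c y) = chart_to d (f y) by rewrite /g/= chart_toK.
have c2 : g @ chart_to c y --> chart_to d (f y) by rewrite -gE; exact: (sm_cont sy).
have cv := cvg_comp _ _ (cvg_comp _ _ (chart_to_cvg hc cy) c2) (chart_from_cvg hd dy).
apply: cvg_trans cv; apply: near_eq_cvg; near=> z.
by have [] // := HU z; near: z; exact: open_nbhs_nbhs.
Unshelve. all: by end_near. Qed.

Lemma smooth_at_cst M N (a : N) (x : M) : smooth_manifold M -> smooth_manifold N ->
  smooth_at (fun=> a) x.
Proof.
move=> mM mN.
have [c Mc [cx _]] := manifold_chart x mM.
have [d Nd [dx _]] := manifold_chart a mN.
apply: (smooth_at_of mM mN Mc Nd) => //; first exact: cvg_cst.
exact: sm_cst.
Qed.

Lemma smooth_at_id M (x : M) : smooth_manifold M -> smooth_at id x.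
Proof.
move=> mM; have [c Mc [cx _]] := manifold_chart x mM.
apply: (smooth_at_of mM mM Mc Mc) => //.
exact: (maximal_sm mM Mc Mc).
Qed.

End SmoothAt.

(** * Countable bases and the Hausdorff property *)

Section SecondCountable.

Lemma second_countableP (T : topologicalType) (B : set (set T)) : countable B ->
  B `<=` open -> (forall x A, nbhs x A -> exists U, [/\ B U, U x & U `<=` A]) ->
  @second_countable T.
Proof.
move=> cB oB H; exists B => //; split=> // x A Ax.
by have [U [BU Ux UA]] := H x A Ax; exists U.
Qed.

Lemma basis_nbhs (T : topologicalType) (B : set (set T)) x A : basis B -> nbhs x A ->
  exists U, [/\ B U, U x & U `<=` A].
Proof. by move=> [_ /(_ x)] H /H[U [BU Ux] UA]; exists U. Qed.

Lemma countable_image_of (T U : Type) (A : set T) (f : T -> U) : countable A -> countable (f @` A).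
Proof. by move=> cA; apply: sub_countable cA; exact: card_image_le. Qed.

Lemma second_countable_prod (S T : topologicalType) :
  @second_countable S -> @second_countable T -> @second_countable (S * T)%type.
Proof.
move=> [B cB bB] [C cC bC].
apply: (@second_countableP _ ((fun p => p.1 `*` p.2) @` (B `*` C))).
- by apply: countable_image_of; exact: countableX.
- move=> _ [[U V] [/= /bB.1 oU /bC.1 oV] <-].
  rewrite openE => -[x y] [/= Ux Vy]; exists (U, V) => //=.
  by split; exact: open_nbhs_nbhs.
- move=> [x y] A [[U V] [/= Ux Vy] UVA].
  have [U' [BU' U'x U'U]] := basis_nbhs bB Ux.
  have [V' [CV' V'y V'V]] := basis_nbhs bC Vy.
  exists (U' `*` V'); split => //; first by exists (U', V').
  by move=> [a b] [/= /U'U Ua /V'V Vb]; exact: UVA.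
Qed.

Lemma second_countable_sub (T : topologicalType) (A : set T) :
  @second_countable T -> @second_countable (set_type A).
Proof.
move=> [B cB bB].
apply: (@second_countableP _ ((fun U : set T => (set_val : A -> T) @^-1` U) @` B)).
- exact: countable_image_of.
- by move=> _ [U /bB.1 oU <-]; exists U.
- move=> x V [_ [[U oU <-] Ux] UV].
  have [U' [BU' U'x U'U]] := basis_nbhs bB (open_nbhs_nbhs (conj oU Ux)).
  exists (set_val @^-1` U'); split=> //; first by exists U'.
  by move=> y /U'U Uy; exact: UV.
Qed.

Lemma second_countable_rV (R : realType) n : @second_countable 'rV[R]_n.
Proof.
pose b (p : 'rV[rat]_n * rat) : set 'rV[R]_n := ball (map_mx (@ratr R) p.1 : 'rV[R]_n) (ratr p.2 : R).
apply: (@second_countableP _ (b @` setT)).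
- by apply: countable_image_of; exact: countableP.
- by move=> _ [p _ <-]; exact: ball_open.
- move=> x A /near_norm_lt[e e0 eA].
  have /rat_in_itvoo[r] : 0 < e / 2 by rewrite divr_gt0.
  rewrite in_itv/= => /andP[r0 re].
  have H i : exists q : rat, x 0 i - ratr r < ratr q < x 0 i.
    have /rat_in_itvoo[q] : x 0 i - ratr r < x 0 i by rewrite ltrBlDr ltrDl.
    by rewrite in_itv; exists q.
  have /choice[q Hq] := H.
  have hq : `|map_mx (@ratr R) (\row_i q i) - x| <= ratr r.
    apply: rv_norm_le => [|i j]; first exact: ltW.
    rewrite ord1 !mxE ler_norml; have /andP[q1 q2] := Hq j.
    by apply/andP; split; move: q1 q2 r0; lra.
  have hq' : ball (map_mx (@ratr R) (\row_i q i) : 'rV[R]_n) (ratr r : R) x.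
    (* Strict bounds on the entries give a strict bound on the norm because the norm is attained at
       some entry. The zero vector is treated apart, which also covers dimension 0. *)
    rewrite -ball_normE /ball_/=; have [n0|n0] := eqVneq (map_mx (@ratr R) (\row_i q i) - x) 0.
      by rewrite n0 normr0.
    have [[i j] E] : exists ij : 'I_1 * 'I_n, `|map_mx (@ratr R) (\row_i q i) - x| = `|(map_mx (@ratr R) (\row_i q i) - x) ij.1 ij.2|.
      apply: mx_norm_neq0; apply/eqP => H0; move/eqP: n0; apply; exact: mx_norm_eq0.
    rewrite E ord1 !mxE; have /andP[q1 q2] := Hq j.
    by rewrite ltr_norml; apply/andP; split; move: q1 q2 r0; lra.
  exists (b (\row_i q i, r)); split; [by exists (\row_i q i, r)|exact: hq'|].
  move=> y; rewrite /b/= -ball_normE /ball_/= => Hy; apply: eA.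
  rewrite -(subrK (map_mx (@ratr R) (\row_i q i)) x) -addrA.
  apply: (le_lt_trans (ler_normD _ _)); rewrite distrC.
  by move: hq Hy re; lra.
Qed.

Lemma hausdorff_prod (S T : topologicalType) :
  hausdorff_space S -> hausdorff_space T -> hausdorff_space (S * T)%type.
Proof.
move=> hS hT [a b] [c d] H; congr pair.
- apply: hS => A C Aa Cc.
  have [] := H (A `*` setT) (C `*` setT).
  + by exists (A, setT) => //; split=> //; exact: filterT.
  + by exists (C, setT) => //; split=> //; exact: filterT.
  + by move=> [x y] [[/= Ax _] [Cx _]]; exists x.
- apply: hT => A C Ab Cd.
  have [] := H (setT `*` A) (setT `*` C).
  + by exists (setT, A) => //; split=> //; exact: filterT.
  + by exists (setT, C) => //; split=> //; exact: filterT.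
  + by move=> [x y] [[/= _ Ay] [_ Cy]]; exists y.
Qed.

Lemma hausdorff_sub (T : topologicalType) (A : set T) :
  hausdorff_space T -> hausdorff_space (set_type A).
Proof.
move=> hT p q H; apply/val_inj/hT => U V Up Vq.
have c := @initial_continuous A T set_val.
have [x [Ux Vx]] := H _ _ (c p U Up) (c q V Vq).
by exists (set_val x).
Qed.

End SecondCountable.

Lemma cont_comp_at (S T U : topologicalType) (f : S -> T) (g : T -> U) x :
  f @ x --> f x -> g @ f x --> g (f x) -> (g \o f) @ x --> g (f x).
Proof. by move=> cf cg; exact: (cvg_comp _ _ cf cg). Qed.

(** * Euclidean spaces and product manifolds *)

Section Products.
Context {R : realType}.

Lemma euclidean_manifold n : smooth_manifold ('rV[R]_n : chartedType R).
Proof.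
have hc : is_chart (Chart setT id id : chart R 'rV[R]_n n).
  split; first exact: openT.
  - by rewrite /chart_img image_id; exact: openT.
  - by [].
  - by move=> x _; exact: (@cvg_id _ (nbhs x)).
  - by move=> x _; exact: (@cvg_id _ (nbhs x)).
have co : compatible (Chart setT id id : chart R 'rV[R]_n n) (Chart setT id id).
  by split; apply: smooth_on_sm => x _; exact: sm_id.
split.
- exact: norm_hausdorff.
- exact: second_countable_rV.
- by move=> c ->.
- by move=> x; exists (Chart setT id id).
- by move=> c d -> ->.
Qed.

Lemma smooth_at_rV m n (f : 'rV[R]_m -> 'rV[R]_n) x : smooth_at f x <-> sm f x.
Proof.
split=> [[_ [c [d [-> -> _ _]]]] //|S].
split; first exact: sm_cont.
by exists (Chart setT id id), (Chart setT id id).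
Qed.

Lemma sm_row_mx (V : normedModType R) m n (f : V -> 'rV[R]_m) (g : V -> 'rV[R]_n) x :
  sm f x -> sm g x -> sm (fun y => row_mx (f y) (g y)) x.
Proof.
move=> /sm_mxP Sf /sm_mxP Sg; apply/sm_mxP => i j.
case: (split_ordP j) => l ->.
  by apply: sm_eq (Sf i l); near=> y; rewrite row_mxEl.
by apply: sm_eq (Sg i l); near=> y; rewrite row_mxEr.
Unshelve. all: by end_near. Qed.

Lemma sm_lsubmx m n (x : 'rV[R]_(m + n)) : sm (@lsubmx R 1 m n) x.
Proof.
apply/sm_mxP => i j; apply: (@sm_eq _ _ _ (fun y : 'rV[R]_(m + n) => y i (lshift n j))).
  by near=> y; rewrite mxE.
by have /sm_mxP := @sm_id _ _ x; apply.
Unshelve. all: by end_near. Qed.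

Lemma sm_rsubmx m n (x : 'rV[R]_(m + n)) : sm (@rsubmx R 1 m n) x.
Proof.
apply/sm_mxP => i j; apply: (@sm_eq _ _ _ (fun y : 'rV[R]_(m + n) => y i (rshift m j))).
  by near=> y; rewrite mxE.
by have /sm_mxP := @sm_id _ _ x; apply.
Unshelve. all: by end_near. Qed.

Section Pair.
Variables (M N : chartedType R) (mM : smooth_manifold M) (mN : smooth_manifold N).

Lemma prod_chart_img c d : chart_img (@prod_chart R M N c d) =
  [set u | chart_img c (lsubmx u) /\ chart_img d (rsubmx u)].
Proof.
apply/seteqP; split=> [_ [[x y] [/= cx dy] <-]|u [[x cx xu] [y dy yu]]].
  by rewrite /= row_mxKl row_mxKr; split; exact: chart_img_to.
by exists (x, y) => //; rewrite /= xu yu hsubmxK.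
Qed.

Lemma prod_is_chart c d : is_chart c -> is_chart d -> is_chart (@prod_chart R M N c d).
Proof.
move=> hc hd; have [oc oci _ cc cc'] := hc; have [od odi _ cd cd'] := hd; split.
- rewrite openE => -[x y] [/= cx dy]; exists (chart_dom c, chart_dom d) => //=.
  by split; exact: chart_nbhs.
- rewrite prod_chart_img (_ : mkset _ = lsubmx @^-1` chart_img c `&` rsubmx @^-1` chart_img d)//.
  apply: openI.
    by apply: open_comp => // u _; exact: (sm_cont (sm_lsubmx u)).
  by apply: open_comp => // u _; exact: (sm_cont (sm_rsubmx u)).
- by move=> [x y] [/= cx dy]; rewrite row_mxKl row_mxKr !chart_toK.
- move=> [x y] [/= cx dy]; apply/continuous_coordP => i j.
  have H1 : {for (x, y), continuous (fun p : M * N => chart_to c p.1)}.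
    by apply: (@continuous_comp _ _ _ fst) => //; [exact: cvg_fst|exact: cc].
  have H2 : {for (x, y), continuous (fun p : M * N => chart_to d p.2)}.
    by apply: (@continuous_comp _ _ _ snd) => //; [exact: cvg_snd|exact: cd].
  rewrite /prop_for/continuous_at/=; case: (split_ordP j) => l ->.
    have -> : (fun p : M * N => row_mx (chart_to c p.1) (chart_to d p.2) i (lshift _ l)) =
        (fun p => chart_to c p.1 i l) by apply/funext => p; rewrite row_mxEl.
    by rewrite row_mxEl; move/continuous_coordP: H1; apply.
  have -> : (fun p : M * N => row_mx (chart_to c p.1) (chart_to d p.2) i (rshift _ l)) =
      (fun p => chart_to d p.2 i l) by apply/funext => p; rewrite row_mxEr.
  by rewrite row_mxEr; move/continuous_coordP: H2; apply.
- move=> u; rewrite prod_chart_img => -[cu du].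
  have A : (chart_from c \o lsubmx) @ u --> chart_from c (lsubmx u).
    by apply: cont_comp_at (cc' _ cu); exact: (sm_cont (sm_lsubmx u)).
  have B : (chart_from d \o rsubmx) @ u --> chart_from d (rsubmx u).
    by apply: cont_comp_at (cd' _ du); exact: (sm_cont (sm_rsubmx u)).
  exact: (cvg_pair A B).
Qed.

Lemma prod_transition c d c' d' : atlas M c -> atlas M c' -> atlas N d -> atlas N d' ->
  smooth_transition (@prod_chart R M N c d) (@prod_chart R M N c' d').
Proof.
move=> Mc Mc' Nd Nd'; apply: smooth_on_sm => _ [[x y] [[/= cx dy] [/= c'x d'y]] <-].
apply: sm_row_mx.
  have S := maximal_sm mM (atlas_maximal mM Mc) (atlas_maximal mM Mc') cx c'x.
  rewrite -[chart_to c x](row_mxKl _ (chart_to d y)) in S.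
  exact: sm_comp (sm_lsubmx _) S.
have S := maximal_sm mN (atlas_maximal mN Nd) (atlas_maximal mN Nd') dy d'y.
rewrite -[chart_to d y](row_mxKr (chart_to c x)) in S.
exact: sm_comp (sm_rsubmx _) S.
Qed.

Lemma prod_manifold : smooth_manifold (M * N)%type.
Proof.
split.
- by apply: hausdorff_prod; [have [] := mM|have [] := mN].
- by apply: second_countable_prod; [have [] := mM|have [] := mN].
- move=> _ [c Mc [d Nd <-]].
  by apply: prod_is_chart; [have [] := atlas_maximal mM Mc|have [] := atlas_maximal mN Nd].
- move=> [x y]; have [c _ [cx Mc]] := manifold_chart x mM.
  have [d _ [dy Nd]] := manifold_chart y mN.
  by exists (prod_chart c d) => //; exists c => //; exists d.
- move=> _ _ [c Mc [d Nd <-]] [c' Mc' [d' Nd' <-]].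
  by split; exact: prod_transition.
Qed.

Lemma smooth_at_fst (p : M * N) : smooth_at (@fst M N) p.
Proof.
split; first exact: cvg_fst.
have [c Mc' [cx Mc]] := manifold_chart p.1 mM.
have [d _ [dy Nd]] := manifold_chart p.2 mN.
exists (prod_chart c d), c; split=> //; first by exists c => //; exists d.
have S := maximal_sm mM Mc' Mc' cx cx.
rewrite -[chart_to c _](row_mxKl _ (chart_to d p.2)) in S.
exact: sm_comp (sm_lsubmx _) S.
Qed.

Lemma smooth_at_snd (p : M * N) : smooth_at (@snd M N) p.
Proof.
split; first exact: cvg_snd.
have [c _ [cx Mc]] := manifold_chart p.1 mM.
have [d Nd' [dy Nd]] := manifold_chart p.2 mN.
exists (prod_chart c d), d; split=> //; first by exists c => //; exists d.
have S := maximal_sm mN Nd' Nd' dy dy.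
rewrite -[chart_to d _](row_mxKr (chart_to c p.1)) in S.
exact: sm_comp (sm_rsubmx _) S.
Qed.

Lemma smooth_at_pair (L : chartedType R) (f : L -> M) (g : L -> N) x : smooth_manifold L ->
  smooth_at f x -> smooth_at g x -> smooth_at (fun y => (f y, g y) : M * N) x.
Proof.
move=> mL Sf Sg; split; first by apply: cvg_pair; [exact: Sf.1|exact: Sg.1].
have [e Le' [ex Le]] := manifold_chart x mL.
have [c Mc' [cx Mc]] := manifold_chart (f x) mM.
have [d Nd' [dy Nd]] := manifold_chart (g x) mN.
exists e, (prod_chart c d); split=> //; first by exists c => //; exists d.
apply: sm_row_mx.
  exact: smooth_at_max mL mM Le' Mc' ex cx Sf.
exact: smooth_at_max mL mN Le' Nd' ex dy Sg.
Qed.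

End Pair.
End Products.

(** * Embedded submanifolds *)

Section LocalParam.
Context {R : realType}.
Variables (M : chartedType R) (mM : smooth_manifold M).
Local Notation n := (mdim M).

Lemma euclidean_maximal k : maximal_atlas ('rV[R]_k : chartedType R) (Chart setT id id).
Proof. exact: (atlas_maximal (euclidean_manifold k)). Qed.

Lemma smooth_at_from_rv k (phi : 'rV[R]_k -> M) u c : maximal_atlas M c ->
  chart_dom c (phi u) -> smooth_at phi u -> sm (chart_to c \o phi) u.
Proof.
move=> Mc cu S.
exact: (smooth_at_max (euclidean_manifold k) mM (euclidean_maximal k) Mc _ cu S).
Qed.

Lemma smooth_at_of_from_rv k (phi : 'rV[R]_k -> M) u c : maximal_atlas M c ->
  chart_dom c (phi u) -> phi @ u --> phi u -> sm (chart_to c \o phi) u -> smooth_at phi u.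
Proof.
move=> Mc cu cphi S.
exact: (smooth_at_of (euclidean_manifold k) mM (euclidean_maximal k) Mc _ cu cphi S).
Qed.

Lemma smooth_at_to_rv k (psi : M -> 'rV[R]_k) x c : maximal_atlas M c ->
  chart_dom c x -> smooth_at psi x -> sm (psi \o chart_from c) (chart_to c x).
Proof.
move=> Mc cx S.
exact: (smooth_at_max mM (euclidean_manifold k) Mc (euclidean_maximal k) cx _ S).
Qed.

Lemma smooth_at_of_to_rv k (psi : M -> 'rV[R]_k) x c : maximal_atlas M c ->
  chart_dom c x -> psi @ x --> psi x ->
  sm (psi \o chart_from c) (chart_to c x) -> smooth_at psi x.
Proof.
move=> Mc cx cpsi S.
exact: (smooth_at_of mM (euclidean_manifold k) Mc (euclidean_maximal k) cx _ cpsi S).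
Qed.

Lemma smooth_at_chart_from c u : maximal_atlas M c -> chart_img c u ->
  smooth_at (chart_from c) u.
Proof.
move=> Mc; have [hc _] := Mc; move=> /[dup] cu /(chart_imgK hc)[du Eu].
apply: (smooth_at_of_from_rv Mc du).
  by have [_ _ _ _] := hc; apply.
apply: sm_eq (sm_id u); rewrite -{1}Eu.
by apply: filterS (chart_img_nbhs hc du) => w /(chart_imgK hc)[_ /=].
Qed.

Lemma smooth_at_chart_to c x : maximal_atlas M c -> chart_dom c x ->
  smooth_at (chart_to c) x.
Proof.
move=> Mc cx; have [hc _] := Mc.
apply: (smooth_at_of_to_rv Mc cx); first exact: chart_to_cvg.
apply: sm_eq (sm_id _).
by apply: filterS (chart_img_nbhs hc cx) => w /(chart_imgK hc)[_ /=].
Qed.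

(** The domain is shrunk to points of [W] where both composites are the identity and both maps are
    smooth; smoothness of the two maps is then compatibility with every chart of the atlas. *)
Lemma chart_of_local (phi : 'rV[R]_n -> M) (psi : M -> 'rV[R]_n) (u0 : 'rV[R]_n) (W : set M) :
  smooth_at phi u0 -> smooth_at psi (phi u0) -> psi (phi u0) = u0 ->
  (\forall y \near phi u0, phi (psi y) = y) -> (\forall u \near u0, psi (phi u) = u) ->
  nbhs (phi u0) W ->
  exists D : set M, [/\ maximal_atlas M (Chart D psi phi), D (phi u0), D `<=` W &
    forall u, chart_img (Chart D psi phi) u -> smooth_at phi u].
Proof.
move=> Sphi Spsi E0 Kphi Kpsi Wx.
have [Q [oQ Q0] HQ] : exists2 Q, open_nbhs u0 Q & forall u, Q u -> psi (phi u) = u /\ smooth_at phi u.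
  apply: near_open; near=> u; split; first by near: u.
  by near: u; exact: smooth_at_near (euclidean_manifold n) mM Sphi.
have [D0 [oD0 D00] HD0] : exists2 D0, open_nbhs (phi u0) D0 &
    forall y, D0 y -> [/\ phi (psi y) = y, smooth_at psi y & W y].
  apply: near_open; near=> y; split; first by near: y.
    by near: y; exact: smooth_at_near mM (euclidean_manifold n) Spsi.
  by near: y.
pose D := [set y | D0 y /\ Q (psi y)].
have hD : is_chart (Chart D psi phi).
  have img : chart_img (Chart D psi phi) = [set u | Q u /\ D0 (phi u)].
    apply/seteqP; split=> [_ [y [/= Dy Qy] <-]|u [/= Qu Du]].
      by split=> //=; have [-> _ _] := HD0 _ Dy.
    exists (phi u); last by have [] := HQ _ Qu.
    by split=> //=; have [-> _] := HQ _ Qu.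
  split.
  - rewrite openE => y [/= Dy Qy]; have [_ [cy _] _] := HD0 _ Dy.
    apply: filterI; first exact: open_nbhs_nbhs.
    by apply: cy; exact: open_nbhs_nbhs.
  - rewrite img openE => u [/= Qu Du]; have [_ [cu _]] := HQ _ Qu.
    apply: filterI; first exact: open_nbhs_nbhs.
    by apply: cu; exact: open_nbhs_nbhs.
  - by move=> y [/= /HD0[]].
  - by move=> y [/= /HD0[_ [cy _] _] _].
  - by rewrite img => u [/= /HQ[_ [cu _]] _].
exists D; split.
- split=> // d Md; have Md' := atlas_maximal mM Md; have [hd _] := Md'.
  split; apply: smooth_on_sm => _ [y [/= Dy dy] <-] /=.
    have [Ey _ _] := HD0 _ Dy.1; have [_ Su] := HQ _ Dy.2.
    by apply: smooth_at_from_rv => //; rewrite Ey.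
  have [_ Sy _] := HD0 _ dy.1.
  exact: smooth_at_to_rv.
- by split; rewrite //= E0.
- by move=> y [/= /HD0[]].
- by move=> _ [y [/= Dy Qy] <-]; have [] := HQ _ Qy.
Unshelve. all: by end_near. Qed.

End LocalParam.

Section Submanifold.
Context {R : realType}.
Variables (M : chartedType R) (mM : smooth_manifold M) (S : set M).
Local Notation n := (mdim M).

(** After multiplication by [B] the difference quotients along [w] are eventually 0. *)
Lemma derive_in_kernel (V : normedModType R) p q (f : V -> 'rV[R]_p) (B : 'M[R]_(p, q)) u w :
  differentiable f u -> (\forall t \near (0 : R), f (t *: w + u) *m B = 0) ->
  'D_w f u *m B = 0.
Proof.
move=> df H.
have dfB : differentiable (fun y => f y *m B) u by exact: differentiable_mulmxr.
have c : continuous (mulmxr B : 'rV[R]_p -> 'rV[R]_q).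
  by move=> y; apply: differentiable_continuous; apply: (differentiable_mulmxr B (f := id)).
have -> : 'D_w f u *m B = 'D_w (fun y => f y *m B) u.
  have dl : differentiable (mulmxr B : 'rV[R]_p -> 'rV[R]_q) (f u) by exact: linear_differentiable.
  rewrite (deriveE _ dfB) (deriveE _ df).
  by rewrite -[in RHS]/(mulmxr B \o f) (diff_comp df dl) /= diff_lin.
rewrite /derive; apply/lim_near_cst => //=.
have H0 : f u *m B = 0 by have := nbhs_singleton H; rewrite scale0r add0r.
apply: cvg_within; apply: filterS H => t Ht; rewrite /= Ht H0 subrr scaler0 //.
Qed.

Lemma slice_dom_img k c : slice_chart S k c -> forall x, chart_dom c x -> S x ->
  exists v : 'rV[R]_k, chart_to c x = v *m pid_mx k.
Proof.
move=> [_ E] x cx Sx; have : (chart_to c @` (chart_dom c `&` S)) (chart_to c x) by exists x.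
by rewrite E => -[_ [v _ <-]]; exists v.
Qed.

Lemma slice_img_dom k c : slice_chart S k c -> forall v : 'rV[R]_k, chart_img c (v *m pid_mx k) ->
  S (chart_from c (v *m pid_mx k)).
Proof.
move=> [[hc _] E] v cv; have : (chart_to c @` (chart_dom c `&` S)) (v *m pid_mx k).
  by rewrite E; split=> //; exists v.
by move=> [y [cy Sy] <-]; rewrite chart_toK.
Qed.

(** The transition carries the part of [S] seen in one slice chart into the other. Its Jacobian [J]
    therefore maps the first [k] coordinate directions into the first [k'] ones, and it is
    invertible. *)
Lemma slice_dim_le k k' c d x : (k <= n)%N -> (k' <= n)%N -> slice_chart S k c -> slice_chart S k' d ->
  S x -> chart_dom c x -> chart_dom d x -> (k <= k')%N.
Proof.
move=> kn kn' sc sd Sx cx dx.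
have [Mc _] := sc; have [Md _] := sd; have [hc _] := Mc; have [hd _] := Md.
pose h := chart_to d \o chart_from c; pose g := chart_to c \o chart_from d.
have Sh : sm h (chart_to c x) by exact: maximal_sm.
have Sg : sm g (chart_to d x) by exact: maximal_sm.
have hx : h (chart_to c x) = chart_to d x by rewrite /h /= chart_toK.
pose J := jacobian h (chart_to c x); pose J' := jacobian g (chart_to d x).
have JJ' : J *m J' = 1%:M.
  rewrite /J /J' -hx -jacobian_comp; last 2 first.
  - exact: sm_diff.
  - by rewrite hx; exact: sm_diff.
  rewrite -[RHS](jacobian_id (chart_to c x)); apply: near_eq_jacobian; last first.
    by apply: differentiable_comp; [exact: sm_diff|rewrite hx; exact: sm_diff].
  have H1 := chart_from_cvg hc cx (chart_nbhs hd dx).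
  have H2 := chart_img_nbhs hc cx.
  near=> u; rewrite /g /h /= chart_toK//; last by near: u; exact: H1.
  by have [|] := @chart_imgK _ _ _ c u hc; first by near: u.
have [v0 Ev0] := slice_dom_img sc cx Sx.
have key (v : 'rV[R]_k) : (v *m (pid_mx k : 'M[R]_(k, n))) *m J *m copid_mx k' = 0.
  rewrite /J -(deriveEjacobian _ (sm_diff Sh)).
  apply: derive_in_kernel; first exact: sm_diff.
  have ct : (fun t : R => t *: (v *m (pid_mx k : 'M[R]_(k, n))) + chart_to c x) @ (0 : R)
      --> chart_to c x.
    rewrite -[X in _ --> X]add0r -[X in X + _](scale0r (v *m (pid_mx k : 'M[R]_(k, n)))).
    by apply: cvgD; [apply: cvgZr_tmp; exact: cvg_id|exact: cvg_cst].
  have H1 := ct _ (chart_img_nbhs hc cx).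
  have H2 := ct _ (chart_from_cvg hc cx (chart_nbhs hd dx)).
  near=> t.
  have i1 : chart_img c (t *: (v *m (pid_mx k : 'M[R]_(k, n))) + chart_to c x) by near: t; exact: H1.
  have i2 : chart_dom d (chart_from c (t *: (v *m (pid_mx k : 'M[R]_(k, n))) + chart_to c x)).
    by near: t; exact: H2.
  move: i1 i2; rewrite Ev0 scalemxAl -mulmxDl => i1 i2.
  have Sy := slice_img_dom sc i1.
  have [w Ew] := slice_dom_img sd i2 Sy.
  by rewrite /h /= Ew -mulmxA mul_pid_mx_copid ?mulmx0.
clearbody J J'.
have key2 : (pid_mx k : 'M[R]_(k, n)) *m J *m copid_mx k' = 0.
  apply/row_matrixP => i; rewrite row0 -(key (delta_mx 0 i)).
  by rewrite [LHS]rowE !mulmxA.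
have key3 : (pid_mx k : 'M[R]_(k, n)) *m J = (pid_mx k : 'M[R]_(k, n)) *m J *m pid_mx k'.
  by apply/eqP; rewrite -subr_eq0 -[X in X - _]mulmx1 -mulmxBr; apply/eqP.
have UJ : J \in unitmx := (mulmx1_unit JJ').1.
have : \rank ((pid_mx k : 'M[R]_(k, n)) *m J) = k.
  rewrite mxrankMfree ?row_free_unit//.
  by rewrite rank_pid_mx.
rewrite key3 => <-; apply: leq_trans (mxrankM_maxr _ _) _.
rewrite -pid_mx_minv rank_pid_mx ?geq_minr ?geq_minl//.
Unshelve. all: by end_near. Qed.

Lemma embedded_dim_uniq k k' : S !=set0 -> embedded_submanifold S k ->
  embedded_submanifold S k' -> k = k'.
Proof.
move=> [x Sx] [kn Hk] [kn' Hk'].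
have [c sc cx] := Hk x Sx; have [d sd dx] := Hk' x Sx.
by apply/eqP; rewrite eqn_leq (slice_dim_le kn kn' sc sd Sx cx dx) (slice_dim_le kn' kn sd sc Sx dx cx).
Qed.

Lemma submanifold_dimE k : S !=set0 -> embedded_submanifold S k -> submanifold_dim S = k.
Proof.
move=> S0 ek; rewrite /submanifold_dim; case: xgetP => [k' -> ek'|/(_ k)//].
exact: embedded_dim_uniq.
Qed.

Hypothesis eS : embedded_submanifold S (submanifold_dim S).
Local Notation k := (submanifold_dim S).
Local Notation sub := (set_type S).

Let kn : (k <= n)%N. Proof. by case: eS. Qed.

Lemma pid_mx_inc_proj : (pid_mx k : 'M[R]_(k, n)) *m (pid_mx k : 'M[R]_(n, k)) = 1%:M.
Proof. by rewrite pid_mx_id// pid_mx_1. Qed.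

Definition slice_of (c : chart R sub k) (d : chart R M n) :=
  [/\ slice_chart S k d, chart_dom c = set_val @^-1` chart_dom d &
    forall x, chart_dom c x -> chart_to c x = chart_to d (set_val x) *m pid_mx k].

Lemma slice_ofK c d x : slice_of c d -> chart_dom c x ->
  chart_to c x *m pid_mx k = chart_to d (set_val x).
Proof.
move=> [sd Ec Hc] cx; rewrite Hc//.
have dx : chart_dom d (set_val x) by move: cx; rewrite Ec.
have [v ->] := slice_dom_img sd dx (set_valP x).
by rewrite -(mulmxA v) pid_mx_inc_proj mulmx1.
Qed.

Lemma slice_of_from c d x : slice_of c d -> is_chart c -> chart_dom c x ->
  \forall u \near chart_to c x, set_val (chart_from c u) = chart_from d (u *m pid_mx k).
Proof.
move=> scd hc cx; apply: filterS (chart_img_nbhs hc cx) => _ [y cy <-].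
rewrite chart_toK// (slice_ofK scd cy) chart_toK//.
  by case: scd => [[[]]].
by move: cy; case: scd => _ -> _.
Qed.

(** [insubd] falls back on [x0] outside [S]. This happens only off the image of the chart, where the
    values of [chart_from] carry no meaning. *)
Definition sub_chart (d : chart R M n) (x0 : sub) : chart R sub k :=
  Chart (set_val @^-1` chart_dom d) (fun x => chart_to d (set_val x) *m pid_mx k)
    (fun u => insubd x0 (chart_from d (u *m pid_mx k))).

Lemma sub_slice_of d x0 : slice_chart S k d -> slice_of (sub_chart d x0) d.
Proof. by move=> sd; split. Qed.

Lemma sub_is_chart d x0 : slice_chart S k d -> is_chart (sub_chart d x0).
Proof.
move=> sd; have [Md _] := sd; have [hd _] := Md.
have cp : continuous (fun u : 'rV[R]_k => u *m (pid_mx k : 'M[R]_(k, n))).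
  by move=> u; apply: (sm_cont (f := fun u : 'rV[R]_k => u *m _)); apply: sm_mulmx; [exact: sm_id|exact: sm_cst].
have img : chart_img (sub_chart d x0) = (fun u : 'rV[R]_k => u *m pid_mx k) @^-1` chart_img d.
  apply/seteqP; split=> [_ [x /= dx <-]|u /= du].
    by rewrite (slice_ofK (sub_slice_of x0 sd))//; exact: chart_img_to.
  have Sy := slice_img_dom sd du; have [dy Ey] := chart_imgK hd du.
  have E : set_val (insubd x0 (chart_from d (u *m pid_mx k))) = chart_from d (u *m pid_mx k).
    by apply: insubdK; exact: mem_set.
  exists (insubd x0 (chart_from d (u *m pid_mx k))); rewrite /= E// Ey.
  by rewrite -mulmxA pid_mx_inc_proj mulmx1.
split.
- by exists (chart_dom d) => //; have [] := hd.
- by rewrite img; apply: open_comp; [move=> u _; exact: cp|have [] := hd].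
- move=> x /= dx; apply: val_inj.
  rewrite (slice_ofK (sub_slice_of x0 sd) dx) chart_toK//.
  by rewrite insubdK//; exact: valP.
- move=> x /= dx.
  have c1 : (chart_to d \o set_val) @ x --> chart_to d (set_val x).
    apply: cont_comp_at; first exact: initial_continuous.
    exact: chart_to_cvg.
  by apply/continuous_coordP => i j; have := @sm_mulmx R _ _ _ _ id (cst (pid_mx k : 'M[R]_(n, k))) (chart_to d (set_val x)) (sm_id _) (sm_cst _ _) => /sm_cont H; move: (cont_comp_at c1 H) => /continuous_coordP; apply.
- move=> u ; rewrite img /= => du.
  have Eval : \forall w \near u, set_val (insubd x0 (chart_from d (w *m pid_mx k))) = chart_from d (w *m pid_mx k).
    have : nbhs (u *m (pid_mx k : 'M[R]_(k, n))) (chart_img d).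
      by apply: open_nbhs_nbhs; split=> //; have [] := hd.
    move=> /(cp u) Hn; near=> w.
    have dw : chart_img d (w *m pid_mx k) by near: w; exact: Hn.
    by apply: insubdK; apply: mem_set; exact: slice_img_dom.
  have cv : (fun w : 'rV[R]_k => chart_from d (w *m pid_mx k)) @ u --> chart_from d (u *m pid_mx k).
    apply: (@cont_comp_at _ _ _ (fun w : 'rV[R]_k => w *m pid_mx k)); first exact: cp.
    by have [_ _ _ _] := hd; apply.
  have E0 := nbhs_singleton Eval.
  move=> A [V [[U oU <-] /= Ux] UV].
  have : nbhs (chart_from d (u *m pid_mx k)) U by apply: open_nbhs_nbhs; split=> //; rewrite -E0.
  move=> /cv H.
  have H2 : \forall w \near u, U (set_val (insubd x0 (chart_from d (w *m pid_mx k)))).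
    by near=> w; rewrite (near Eval w)//; near: w; exact: H.
  by apply: filterS H2 => w Uw; exact: UV.
Unshelve. all: by end_near. Qed.

Lemma sub_manifold : smooth_manifold (set_type S).
Proof.
split.
- by apply: hausdorff_sub; have [] := mM.
- by apply: second_countable_sub; have [] := mM.
- by move=> c [].
- move=> x; have [_ H] := eS; have [d sd dx] := H _ (set_valP x).
  exists (sub_chart d x); last by [].
  by split; [exact: sub_is_chart|exists d].
- suff H : forall c c' : chart R (set_type S) k, submanifold_atlas c -> submanifold_atlas c' ->
      smooth_transition c c'.
    by move=> c c' Sc Sc'; split; exact: H.
  move=> c c' [hc [d sd [E1 E2]]] [hc' [d' sd' [E1' E2']]].
  have scd : slice_of c d by [].
  apply: smooth_on_sm => _ [x [cx c'x] <-].
  have [Md _] := sd; have [Md' _] := sd'; have [hd _] := Md; have [hd' _] := Md'.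
  have dx : chart_dom d (set_val x) by move: cx; rewrite E1.
  have d'x : chart_dom d' (set_val x) by move: c'x; rewrite E1'.
  have Sdd := maximal_sm mM Md Md' dx d'x.
  apply: (@sm_eq _ _ _ (fun u => (chart_to d' \o chart_from d) (u *m pid_mx k) *m pid_mx k)).
    have H1 := slice_of_from scd hc cx.
    have H2 := chart_from_cvg hc cx (chart_nbhs hc' c'x).
    near=> u.
    have e1 : set_val (chart_from c u) = chart_from d (u *m pid_mx k) by near: u; exact: H1.
    have e2 : chart_dom c' (chart_from c u) by near: u; exact: H2.
    by rewrite /= E2'// e1.
  apply: sm_mulmx; last exact: sm_cst.
  apply: (@sm_comp _ _ _ _ _ (fun u : 'rV[R]_k => u *m pid_mx k)).
    by apply: sm_mulmx; [exact: sm_id|exact: sm_cst].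
  by rewrite (slice_ofK scd cx).
Unshelve. all: by end_near. Qed.

Lemma smooth_at_set_val (x : sub) : smooth_at (set_val : sub -> M) x.
Proof.
have [_ H] := eS; have [d sd dx] := H _ (set_valP x).
have [Md _] := sd; have [hd _] := Md.
have Ac : atlas (set_type S : chartedType R) (sub_chart d x) by split; [exact: sub_is_chart|exists d].
have hc := sub_is_chart x sd.
apply: (smooth_at_of sub_manifold mM (atlas_maximal sub_manifold Ac) Md) => //.
  exact: initial_continuous.
apply: (@sm_eq _ _ _ (fun u : 'rV[R]_k => u *m (pid_mx k : 'M[R]_(k, n)))).
  have H1 := @slice_of_from _ d x (sub_slice_of x sd) hc dx.
  have H2 : \forall u \near chart_to (sub_chart d x) x, chart_img (sub_chart d x) u.
    exact: (@chart_img_nbhs _ _ _ (sub_chart d x)).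
  near=> u.
  have e1 : set_val (chart_from (sub_chart d x) u) = chart_from d (u *m pid_mx k).
    by near: u; exact: H1.
  have [y cy Ey] : chart_img (sub_chart d x) u by near: u; exact: H2.
  rewrite -[RHS]/(chart_to d (set_val (chart_from (sub_chart d x) u))) -Ey.
  by rewrite (@slice_ofK (sub_chart d x) d)// chart_toK.
by apply: sm_mulmx; [exact: sm_id|exact: sm_cst].
Unshelve. all: by end_near. Qed.

(** Continuity into the submanifold is that of the composite with the inclusion, by the subspace
    topology; in a slice chart the map is the ambient expression followed by a linear projection. *)
Lemma smooth_at_sub (N : chartedType R) (mN : smooth_manifold N) (f : N -> sub) x :
  smooth_at (set_val \o f : N -> M) x -> smooth_at f x.
Proof.
move=> Sf; have [_ H] := eS; have [d sd dx] := H _ (set_valP (f x)).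
have [Md _] := sd; have [hd _] := Md.
have Ac : atlas (set_type S : chartedType R) (sub_chart d (f x)) by split; [exact: sub_is_chart|exists d].
have [e Ne [ex _]] := manifold_chart x mN.
apply: (smooth_at_of mN sub_manifold Ne (atlas_maximal sub_manifold Ac)) => //.
  move=> A [V [[U oU <-] /= Ux] UV].
  have : nbhs (set_val (f x)) U by exact: open_nbhs_nbhs.
  move=> /Sf.1 Hn; have {}Hn : \forall w \near x, U (set_val (f w)) by exact: Hn.
  by apply: filterS Hn => w Uw; exact: UV.
have := smooth_at_max mN mM Ne Md ex dx Sf => Srep.
exact: (sm_mulmx Srep (sm_cst (pid_mx k : 'M[R]_(n, k)) _)).
Qed.

End Submanifold.

Section EmbeddedLocal.
Context {R : realType}.
Variables (M : chartedType R) (mM : smooth_manifold M) (S : set M).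
Local Notation n := (mdim M).

(** A local diffeomorphism that flattens [S] is enough: [chart_of_local] turns it into a chart, on a
    domain where the description of [S] is valid. *)
Lemma embedded_local k : (k <= n)%N ->
  (forall x, S x -> exists (phi : 'rV[R]_n -> M) (psi : M -> 'rV[R]_n) (u0 : 'rV[R]_n),
    [/\ phi u0 = x, smooth_at phi u0, smooth_at psi x, psi x = u0 &
    [/\ \forall y \near x, phi (psi y) = y, \forall u \near u0, psi (phi u) = u &
    \forall y \near x, S y <-> exists v : 'rV[R]_k, psi y = v *m pid_mx k]]) ->
  embedded_submanifold S k.
Proof.
move=> kn H; split=> // x Sx.
have [phi [psi [u0 [E0 Sphi Spsi Epsi [K1 K2 HS]]]]] := H x Sx.
move: Spsi Epsi K1 HS; rewrite -E0 => Spsi Epsi K1 HS.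
have [D [MD Dx DW _]] := chart_of_local mM Sphi Spsi Epsi K1 K2 HS.
exists (Chart D psi phi) => //; split=> //.
apply/seteqP; split=> [_ [y [/= Dy Sy] <-]|u [[y /= Dy <-] [v _ Ev]]].
  split; first by exists y.
  by have [v ->] := (DW _ Dy).1 Sy; exists v.
by exists y => //; split=> //; apply: (DW _ Dy).2; exists v.
Qed.

End EmbeddedLocal.

(** * The torus *)

Section Circle.
Context {R : realType}.
Local Notation pi := (@pi R).

Lemma ord2P (j : 'I_2) : j = 0 \/ j = 1.
Proof.
case: (split_ordP (j : 'I_(1 + 1))) => l ->; rewrite ord1.
  by left; apply: val_inj.
by right; apply: val_inj.
Qed.

Lemma sm_coord m n (i : 'I_m) (j : 'I_n) (u : 'M[R]_(m, n)) : sm (fun u : 'M[R]_(m, n) => u i j) u.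
Proof. by have /sm_mxP := @sm_id _ _ u; apply. Qed.

(** Polar coordinates with the radius shifted by 1, so that the unit circle is the slice [u 0 1 = 0]
    and [embedded_local] applies. *)
Definition polar (u : 'rV[R]_2) : 'rV[R]_2 :=
  \row_(j < 2) ((1 + u 0 1) * (if j == 0 then cos (u 0 0) else sin (u 0 0))).

Lemma sm_polar u : sm polar u.
Proof.
apply/sm_mxP => i j.
apply: (@sm_eq _ _ _ (fun u : 'rV[R]_2 => (1 + u 0 1) * (if j == 0 then cos (u 0 0) else sin (u 0 0)))).
  by near=> w; rewrite mxE.
apply: sm_M; first by apply: sm_D; [exact: sm_cst|exact: sm_coord].
case: (j == 0).
  exact: (sm_compR (sm_coord 0 0 u) (sm_cos _)).
exact: (sm_compR (sm_coord 0 0 u) (sm_sin _)).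
Unshelve. all: by end_near. Qed.

Lemma circle_polar (u : 'rV[R]_2) : circle R (polar u) <-> (1 + u 0 1) ^+ 2 = 1.
Proof.
rewrite /circle/= !mxE /= !exprMn -mulrDr cos2Dsin2 mulr1.
by split.
Qed.

(** The Jacobian of [polar] along the circle. It is a reflection matrix, hence its own inverse. *)
Definition polar_jac (t : R) : 'M[R]_2 :=
  \matrix_(i, j) (if i == 0 then (if j == 0 then - sin t else cos t)
                  else (if j == 0 then cos t else sin t)).

Lemma polar_jacK t : polar_jac t *m polar_jac t = 1%:M.
Proof.
apply/matrixP => i j; rewrite mxE big_ord_recl big_ord1 !mxE /=.
have := cos2Dsin2 t.
by case: (ord2P i) => ->; case: (ord2P j) => ->; rewrite /= ?mulr1n ?mulr0n; nra.
Qed.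

Lemma jacobian_polar (u : 'rV[R]_2) : u 0 1 = 0 -> jacobian polar u = polar_jac (u 0 0).
Proof.
move=> u1; apply: jacobianP => [|v]; first exact/sm_diff/sm_polar.
have dp := sm_diff (sm_polar u).
apply/rowP => j.
rewrite -derive_coord; last exact: diff_derivable.
have -> : (fun y => polar y 0 j) =
    (fun u : 'rV[R]_2 => 1 + u 0 1) * (fun u : 'rV[R]_2 => (if j == 0 then @cos R else @sin R) (u 0 0)).
  by apply/funext => w; rewrite mxE; case: (j == 0).
have d0 i : differentiable (fun u : 'rV[R]_2 => u 0 i) u by exact/sm_diff/sm_coord.
have D0 i : 'D_v (fun u : 'rV[R]_2 => u 0 i) u = v 0 i.
  by rewrite (@derive_coord _ _ _ _ id) ?derive_id//; exact: derivable_id.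
have d1 : differentiable (fun u : 'rV[R]_2 => 1 + u 0 1) u.
  by apply/sm_diff; apply: sm_D; [exact: sm_cst|exact: sm_coord].
have D1 : 'D_v (fun u : 'rV[R]_2 => 1 + u 0 1) u = v 0 1.
  transitivity ('D_v (cst (1 : R)) u + 'D_v (fun u : 'rV[R]_2 => u 0 1) u).
    by apply: deriveD; apply: diff_derivable => //; exact: differentiable_cst.
  by rewrite derive_cst add0r D0.
pose g := if j == 0 then @cos R else @sin R.
pose g' := if j == 0 then - sin (u 0 0) else cos (u 0 0).
have dg : differentiable g (u 0 0) by rewrite /g; case: (j == 0); apply/derivable1_diffP; exact: ex_derive.
have Dg : 'D_1 g (u 0 0) = g'.
  rewrite /g /g'; case: (j == 0); by rewrite derive_val.
have d2 : differentiable (fun u : 'rV[R]_2 => g (u 0 0)) u.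
  by exact: (differentiable_comp (d0 0) dg).
have D2 : 'D_v (fun u : 'rV[R]_2 => g (u 0 0)) u = v 0 0 * g'.
  rewrite (deriveE _ d2) (diff_comp (d0 0) dg) /= diff_R// Dg.
  by rewrite -(deriveE _ (d0 0)) D0.
rewrite deriveM; [|exact: diff_derivable|exact: diff_derivable].
rewrite D1 D2 u1 /GRing.scale/= addr0 mul1r.
rewrite mxE big_ord_recl big_ord1 !mxE /=.
have -> : lift ord0 ord0 = 1 :> 'I_2 by apply: val_inj.
rewrite /g /g'; case: (j == 0); lra.
Qed.

Lemma circle_angle (y : 'rV[R]_2) : circle R y -> exists t, y = polar (t *: delta_mx 0 0).
Proof.
rewrite /circle/= => Hy.
have Hp t : polar (t *: delta_mx 0 0) = \row_(j < 2) (if j == 0 then cos t else sin t).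
  by apply/rowP => j; rewrite !mxE /= mulr0 addr0 mul1r mulr1.
have y0 : -1 <= y 0 0 <= 1 by apply/andP; split; nra.
have y00 : y 0 0 \in `[(-1), 1]%R by rewrite in_itv.
have s1 : sin (acos (y 0 0)) = `|y 0 1|.
  by rewrite sin_acos// -sqrtr_sqr; congr Num.sqrt; rewrite -Hy; ring.
have two (z : 'rV[R]_2) : z 0 0 = y 0 0 -> z 0 1 = y 0 1 -> y = z.
  by move=> E0 E1; apply/rowP => j; case: (ord2P j) => ->.
have [p1|n1] := leP 0 (y 0 1).
  by exists (acos (y 0 0)); apply: two; rewrite Hp mxE/= ?acosK// s1 ger0_norm.
exists (- acos (y 0 0)); apply: two; rewrite Hp mxE/= ?cosN ?sinN ?acosK// s1.
by rewrite ltr0_norm// opprK.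
Qed.

Lemma pid_mx1P (u : 'rV[R]_2) : u 0 1 = 0 <-> exists v : 'rV[R]_1, u = v *m pid_mx 1.
Proof.
split=> [u1|[v ->]].
  exists (u 0 0)%:M; apply/rowP => j; rewrite mxE big_ord1 !mxE /=.
  by case: (ord2P j) => ->; rewrite /= ?u1 ?mulr1n ?mulr0n ?mulr1 ?mulr0.
by rewrite mxE big_ord1 !mxE /= mulr0n mulr0.
Qed.

Lemma polar_local (t : R) : exists psi : 'rV[R]_2 -> 'rV[R]_2,
  [/\ smooth_at psi (polar (t *: delta_mx 0 0)), psi (polar (t *: delta_mx 0 0)) = t *: delta_mx 0 0,
  \forall y \near polar (t *: delta_mx 0 0), polar (psi y) = y,
  \forall u \near (t *: delta_mx 0 0 : 'rV[R]_2), psi (polar u) = u &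
  \forall y \near polar (t *: delta_mx 0 0), circle R y <-> psi y 0 1 = 0].
Proof.
set u0 := t *: delta_mx 0 0.
have u01 : u0 0 1 = 0 by rewrite !mxE /= mulr0.
have Uj : jacobian polar u0 \in unitmx.
  by rewrite jacobian_polar//; exact: (mulmx1_unit (polar_jacK _)).1.
have [psi [Spsi E K1 K2]] := inverse_function (sm_polar u0) Uj.
exists psi; split=> //; first exact/smooth_at_rV.
have c : (fun y => psi y 0 1) @ polar u0 --> (0 : R).
  have E01 : psi (polar u0) 0 1 = 0 by rewrite E.
  by rewrite -E01; have /continuous_coordP := sm_cont Spsi; apply.
(* The equation [(1 + s) ^+ 2 = 1] also has the root -2, which this bound excludes. *)
have c1 : \forall y \near polar u0, `|psi y 0 1| < 1.
  have /cvgrPdist_lt/(_ 1 ltr01) := c; apply: filterS => y.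
  by rewrite sub0r normrN.
near=> y.
have <- : polar (psi y) = y by near: y.
have H1 : psi (polar (psi y)) = psi y by congr psi; near: y.
have H2 : `|psi y 0 1| < 1 by near: y.
rewrite H1 circle_polar; split=> [/eqP|->]; last by rewrite addr0 expr1n.
rewrite -subr_eq0 (_ : _ - 1 = psi y 0 1 * (2 + psi y 0 1)); last by ring.
rewrite mulf_eq0 => /orP[/eqP//|/eqP H].
by move: H2; rewrite ltr_norml => /andP[]; lra.
Unshelve. all: by end_near. Qed.

Lemma circle_embedded : embedded_submanifold (circle R : set ('rV[R]_2 : chartedType R)) 1.
Proof.
apply: (embedded_local (euclidean_manifold 2)) => // x /circle_angle[t ->].
have [psi [Spsi E K1 K2 HS]] := polar_local t.
exists polar, psi, (t *: delta_mx 0 0); split=> //; first exact/smooth_at_rV/sm_polar.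
by split=> //; near=> y; rewrite -pid_mx1P; near: y.
Unshelve. all: by end_near. Qed.

Lemma polar_circle (t : R) : circle R (polar (t *: delta_mx 0 0)).
Proof. by rewrite circle_polar !mxE /= mulr0 addr0 expr1n. Qed.

Lemma circle_emb : embedded_submanifold (circle R : set ('rV[R]_2 : chartedType R))
  (submanifold_dim (circle R : set ('rV[R]_2 : chartedType R))).
Proof.
have ne : (circle R : set ('rV[R]_2 : chartedType R)) !=set0.
  by exists (polar (0 *: delta_mx 0 0)); exact: polar_circle.
by rewrite (submanifold_dimE (euclidean_manifold 2) ne circle_embedded); exact: circle_embedded.
Qed.

Definition circ (t : 'rV[R]_1) : set_type (circle R) :=
  SigSub (mem_set (polar_circle (2 * pi * t 0 0))).

Lemma circle_manifold : smooth_manifold (set_type (circle R : set ('rV[R]_2 : chartedType R))).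
Proof. exact: (sub_manifold (euclidean_manifold 2) circle_emb). Qed.

Lemma smooth_at_circ t : smooth_at (circ : 'rV[R]_1 -> set_type (circle R : set ('rV[R]_2 : chartedType R))) t.
Proof.
apply: (smooth_at_sub (euclidean_manifold 2) circle_emb (euclidean_manifold 1)).
apply/smooth_at_rV.
apply: (@sm_comp _ _ _ _ _ (fun t : 'rV[R]_1 => (2 * pi * t 0 0) *: delta_mx 0 0 : 'rV[R]_2)); last exact: sm_polar.
apply/sm_mxP => i j; apply: (@sm_eq _ _ _ (fun t : 'rV[R]_1 => (2 * pi * t 0 0) * (delta_mx 0 0 : 'rV[R]_2) i j)).
  by near=> w; rewrite [RHS]mxE.
by apply: sm_M; last exact: sm_cst; apply: sm_M; [exact: sm_cst|exact: sm_coord].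
Unshelve. all: by end_near. Qed.

Lemma circ_surj (y : set_type (circle R)) : exists t, y = circ t.
Proof.
have [t Ht] := circle_angle (set_valP y).
exists (t / (2 * pi))%:M; apply: val_inj => /=; rewrite Ht mxE mulr1n mulrC divfK//.
by rewrite mulf_neq0// gt_eqF// pi_gt0.
Qed.

(** The floor of [x / (2 pi)] reduces [x] to some [y] in [0, 2 pi). There
    [cos y = 1 - 2 sin (y / 2) ^ 2], and the sine is positive unless [y] is 0. *)
Lemma cos_eq1 (x : R) : cos x = 1 -> exists z : int, x = 2 * pi * z%:~R.
Proof.
move=> cx; have p0 := pi_gt0 R.
have p2 : 0 < 2 * pi by rewrite mulr_gt0.
pose z := Num.floor (x / (2 * pi)); exists z.
have [h1 h2] : z%:~R <= x / (2 * pi) /\ x / (2 * pi) < z%:~R + 1.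
  by have /andP[-> ] := floor_itv (x / (2 * pi)); rewrite intrD.
have perN (w : int) (y : R) : cos (y + 2 * pi * w%:~R) = cos y.
  have P n (y' : R) : cos (y' + 2 * pi * n%:R) = cos y'.
    by rewrite -(periodicn (@cosD2pi R) n y') !mulr_natr mulr_natl.
  case: w => n; first exact: P.
  by rewrite NegzE mulrNz -pmulrn mulrN -[LHS](P n.+1) subrK.
pose y := x - 2 * pi * z%:~R.
have y0 : 0 <= y by rewrite subr_ge0 mulrC -ler_pdivlMr.
have y2 : y < 2 * pi by move: h2; rewrite /y ltr_pdivrMr// mulrDl mul1r; lra.
have cy : cos y = 1 by rewrite -cx -[in RHS](subrK (2 * pi * z%:~R) x) perN.
suff : y = 0 by move/eqP; rewrite subr_eq0 => /eqP.
apply/eqP; rewrite eq_le y0 andbT leNgt; apply/negP => yp.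
have s0 : 0 < sin (y / 2) by apply: sin_gt0_pi; apply/andP; split; lra.
have : cos (y / 2 *+ 2) = 1 by rewrite -[y / 2 *+ 2]mulr_natr divfK.
by rewrite cos_mulr2n cos2sin2 mulrnBl; nra.
Qed.

Lemma circ_eq (s t : 'rV[R]_1) : circ s = circ t <-> exists z : int, s 0 0 - t 0 0 = z%:~R.
Proof.
have p2 : 2 * pi != 0 by rewrite mulf_neq0// gt_eqF// pi_gt0.
split.
  move=> /(congr1 val)/= E.
  have E0 := congr1 (fun w : 'rV[R]_2 => w 0 0) E; have E1 := congr1 (fun w : 'rV[R]_2 => w 0 1) E.
  move: E0 E1; rewrite !mxE /= !mulr0 !addr0 !mul1r !mulr1 => E0 E1.
  have : cos (2 * pi * s 0 0 - 2 * pi * t 0 0) = 1.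
    by rewrite cosB E0 E1 -!expr2 cos2Dsin2.
  move=> /cos_eq1[z Hz]; exists z; apply: (mulfI p2).
  by rewrite mulrBr.
move=> [z Hz]; apply: val_inj => /=; apply/rowP => j; rewrite !mxE /= !mulr0 !addr0 !mul1r !mulr1.
have -> : s 0 0 = t 0 0 + z%:~R by rewrite -Hz addrC subrK.
rewrite mulrDr.
have P n (y' : R) : cos (y' + 2 * pi * n%:R) = cos y'.
  by rewrite -(periodicn (@cosD2pi R) n y') !mulr_natr mulr_natl.
have P' n (y' : R) : sin (y' + 2 * pi * n%:R) = sin y'.
  by rewrite -(periodicn (@sinD2pi R) n y') !mulr_natr mulr_natl.
case: z {Hz} => n; first by rewrite P P'.
rewrite NegzE mulrNz -pmulrn mulrN.
by rewrite -(P n.+1 (_ - _)) -(P' n.+1 (_ - _)) !subrK.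
Qed.

(** The section is the angular coordinate of a local inverse of [polar], divided by 2 pi; on the
    circle the other coordinate of that inverse vanishes. *)
Lemma circ_section (t : 'rV[R]_1) : exists sigma : set_type (circle R : set ('rV[R]_2 : chartedType R)) -> 'rV[R]_1,
  [/\ smooth_at sigma (circ t), sigma (circ t) = t & \forall y \near circ t, circ (sigma y) = y].
Proof.
have [psi [Spsi E K1 K2 HS]] := polar_local (2 * pi * t 0 0).
have p2 : 2 * pi != 0 by rewrite mulf_neq0// gt_eqF// pi_gt0.
exists (fun y => (2 * pi)^-1 *: (psi (set_val y) *m delta_mx 0 0)); split.
- have S1 := smooth_at_set_val (euclidean_manifold 2) circle_emb (circ t).
  have S2 := smooth_at_comp circle_manifold (euclidean_manifold 2) (euclidean_manifold 2) S1 Spsi.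
  apply: (smooth_at_comp (g := fun u : 'rV[R]_2 => (2 * pi)^-1 *: (u *m delta_mx 0 0) : 'rV[R]_1)
    circle_manifold (euclidean_manifold 2) (euclidean_manifold 1) S2).
  apply/smooth_at_rV.
  apply: (@sm_eq _ _ _ (fun u : 'rV[R]_2 => u *m ((2 * pi)^-1 *: delta_mx 0 0))).
    by near=> u; rewrite scalemxAr.
  by apply: sm_mulmx; [exact: sm_id|exact: sm_cst].
- rewrite set_valE /= E; apply/rowP => j; rewrite !mxE big_ord_recl big_ord1 !mxE ord1 /=.
  by rewrite !mulr1 !mulr0 addr0 mulKf.
- have cv : set_val @ circ t --> polar ((2 * pi * t 0 0) *: delta_mx 0 0) by exact: (@initial_continuous (set_type (circle R)) 'rV[R]_2 set_val (circ t)).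
  have H1 := cv _ HS; have H2 := cv _ K1.
  near=> y; apply: val_inj => /=.
  have [+ _] : circle R (set_val y) <-> psi (set_val y) 0 1 = 0 by near: y; exact: H1.
  move=> /(_ (set_valP y)) z1.
  transitivity (polar (psi (set_val y))); last by near: y; exact: H2.
  congr polar; apply/rowP => j; rewrite !mxE /= big_ord_recl big_ord1 !mxE /=.
  rewrite !mulr1 !mulr0 addr0 mulVKf//.
  by case: (ord2P j) => ->; rewrite /= ?z1 ?mulr1 ?mulr0.
Unshelve. all: by end_near. Qed.

End Circle.

Section Torus.
Context {R : realType}.

(** The quotient map of R^r by Z^r: [torus_map_eq] describes its fibres and [torus_section] gives
    its smooth local sections. *)
Fixpoint torus_map (r : nat) : 'rV[R]_r -> torus R r :=
  match r with
  | 0 => id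
  | r'.+1 => fun u : 'rV[R]_(1 + r') => (circ (lsubmx u), torus_map (rsubmx u))
  end.

Lemma torus_manifold r : smooth_manifold (torus R r).
Proof.
elim: r => [|r IH]; first exact: euclidean_manifold.
exact: (prod_manifold circle_manifold IH).
Qed.

Lemma smooth_at_torus_map r (u : 'rV[R]_r) : smooth_at (@torus_map r) u.
Proof.
elim: r u => [|r IH] u; first by apply: smooth_at_id; exact: euclidean_manifold.
have E1 := euclidean_manifold (R := R) 1.
have Er := euclidean_manifold (R := R) r.
have Er1 := euclidean_manifold (R := R) (1 + r).
apply: (smooth_at_pair circle_manifold (torus_manifold r) Er1).
  apply: (smooth_at_comp Er1 E1 circle_manifold (f := @lsubmx R 1 1 r)); last exact: smooth_at_circ.
  by apply/smooth_at_rV; exact: sm_lsubmx.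
apply: (smooth_at_comp Er1 Er (torus_manifold r) (f := @rsubmx R 1 1 r)); last exact: IH.
by apply/smooth_at_rV; exact: sm_rsubmx.
Qed.

Lemma torus_map_surj r (y : torus R r) : exists u, y = torus_map u.
Proof.
elim: r y => [|r IH] y; first by exists y.
case: y => a b; have [s ->] := circ_surj a; have [u ->] := IH b.
by exists (row_mx s u : 'rV[R]_(1 + r)); rewrite /= row_mxKl row_mxKr.
Qed.

Lemma torus_map_eq r (u w : 'rV[R]_r) :
  torus_map u = torus_map w <-> forall i, exists z : int, u 0 i - w 0 i = z%:~R.
Proof.
elim: r u w => [|r IH] u w.
  by split=> [_ []//|_]; apply/rowP => -[].
split=> [E i|H].
  have H1 : exists z : int, lsubmx (u : 'rV[R]_(1 + r)) 0 0 - lsubmx (w : 'rV[R]_(1 + r)) 0 0 = z%:~R.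
    by apply/circ_eq; exact: (congr1 fst E).
  have H2 := (IH _ _).1 (congr1 snd E).
  case: (split_ordP (i : 'I_(1 + r))) => l ->.
    by rewrite ord1; move: H1; rewrite !mxE.
  by have := H2 l; rewrite !mxE.
congr pair.
  by apply/circ_eq; have := H (lshift r 0 : 'I_(1 + r)); rewrite !mxE.
by apply/IH => i; have := H (rshift 1 i : 'I_(1 + r)); rewrite !mxE.
Qed.

Lemma torus_section r (u : 'rV[R]_r) : exists sigma : torus R r -> 'rV[R]_r,
  [/\ smooth_at sigma (torus_map u), sigma (torus_map u) = u &
      \forall y \near torus_map u, torus_map (sigma y) = y].
Proof.
elim: r u => [|r IH] u.
  exists id; split=> //; first by apply: smooth_at_id; exact: euclidean_manifold.
  by near=> y.
have [s1 [S1 E1 K1]] := circ_section (lsubmx (u : 'rV[R]_(1 + r))).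
have [s2 [S2 E2 K2]] := IH (rsubmx (u : 'rV[R]_(1 + r))).
pose x0 := torus_map u.
have P := prod_manifold circle_manifold (torus_manifold r).
have e1 := euclidean_manifold (R := R) 1.
have er := euclidean_manifold (R := R) r.
have er1 := euclidean_manifold (R := R) (1 + r).
have F1 : smooth_at (s1 \o fst : torus R r.+1 -> 'rV[R]_1) x0.
  apply: (smooth_at_comp P circle_manifold e1); last exact: S1.
  exact: (smooth_at_fst circle_manifold (torus_manifold r)).
have F2 : smooth_at (s2 \o snd : torus R r.+1 -> 'rV[R]_r) x0.
  apply: (smooth_at_comp P (torus_manifold r) er); last exact: S2.
  exact: (smooth_at_snd circle_manifold (torus_manifold r)).
exists (fun y : torus R r.+1 => row_mx (s1 y.1) (s2 y.2) : 'rV[R]_(1 + r)); split.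
- have [c Mc [cx _]] := manifold_chart x0 P.
  apply: (smooth_at_of_to_rv P Mc cx).
    apply: (continuous_coordP (fun y : torus R r.+1 => row_mx (s1 y.1) (s2 y.2) : 'rV[R]_(1 + r)) x0).2 => i j.
    have /continuous_coordP C1 := F1.1; have /continuous_coordP C2 := F2.1.
    rewrite /prop_for/continuous_at; case: (split_ordP (j : 'I_(1 + r))) => l ->.
      have -> : (fun y : torus R r.+1 => row_mx (s1 y.1) (s2 y.2) i (lshift r l)) =
        (fun y => (s1 \o fst) y i l) by apply/funext => y; rewrite row_mxEl.
      by rewrite row_mxEl; exact: C1.
    have -> : (fun y : torus R r.+1 => row_mx (s1 y.1) (s2 y.2) i (rshift 1 l)) =
      (fun y => (s2 \o snd) y i l) by apply/funext => y; rewrite row_mxEr.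
    by rewrite row_mxEr; exact: C2.
  apply: (@sm_row_mx _ _ _ _ ((s1 \o fst) \o chart_from c) ((s2 \o snd) \o chart_from c)).
    exact: (smooth_at_to_rv P Mc cx F1).
  exact: (smooth_at_to_rv P Mc cx F2).
- by rewrite /= E1 E2 hsubmxK.
- have H1 : \forall y \near x0, circ (s1 y.1) = y.1 by exact: (@cvg_fst _ _ (nbhs _) (nbhs _) _ _ K1).
  have H2 : \forall y \near x0, torus_map (s2 y.2) = y.2 by exact: (@cvg_snd _ _ (nbhs _) (nbhs _) _ _ K2).
  near=> y; rewrite /= row_mxKl row_mxKr.
  have -> : circ (s1 y.1) = y.1 by near: y.
  have -> : torus_map (s2 y.2) = y.2 by near: y.
  by rewrite -surjective_pairing.
Unshelve. all: by end_near. Qed.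

End Torus.

(** * A smooth step function *)

Section Bump.
Context {R : realType}.

(** The power of [t^-1] closes the family under differentiation: the derivative of [flat m] is [- m]
    times [flat m.+1] plus [flat m.+2], so smoothness is an induction over all [m] at once. *)
Definition flat (m : nat) (t : R) : R := if 0 < t then t^-1 ^+ m * expR (- t^-1) else 0.

Lemma flat_ge0 m t : 0 <= flat m t.
Proof. by rewrite /flat; case: ltP => // t0; rewrite mulr_ge0 ?expR_ge0// exprn_ge0// invr_ge0 ltW. Qed.

(** The term of degree m + 2 of the exponential series bounds the exponential of 1/t from below. The
    square that remains gives the derivative 0 at the origin. *)
Lemma flat_le m t : `|flat m t| <= (m.+2)`!%:R * t ^+ 2.
Proof.
rewrite ger0_norm ?flat_ge0// /flat; case: ltP => [t0|_]; last by rewrite mulr_ge0// sqr_ge0.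
have i0 : 0 < t^-1 by rewrite invr_gt0.
have := expR_ge1Dxn m.+1 (ltW i0) => H.
have {}H : t^-1 ^+ m.+2 / (m.+2)`!%:R <= expR t^-1 by apply: le_trans H; rewrite lerDr.
have f0 : 0 < (m.+2)`!%:R :> R by rewrite ltr0n fact_gt0.
rewrite expRN ler_pdivrMr ?expR_gt0//.
apply: (@le_trans _ _ ((m.+2)`!%:R * t ^+ 2 * (t^-1 ^+ m.+2 / (m.+2)`!%:R))).
  rewrite le_eqVlt; apply/orP; left; apply/eqP.
  rewrite -[m.+2]addn2 exprD; field.
  by rewrite !gt_eqF.
by apply: ler_wpM2l => //; rewrite mulr_ge0// ?sqr_ge0.
Qed.

Lemma flat_derive_pos m (t : R) : 0 < t ->
  is_derive t 1 (flat m) (- m%:R * flat m.+1 t + flat m.+2 t).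
Proof.
move=> t0; have tn0 : t != 0 by rewrite gt_eqF.
have dV : is_derive t 1 (fun y : R => y^-1) (- t ^- 2).
  apply: is_derive_eq; first by apply: (@is_deriveV R id t 1 1 tn0); exact: is_derive_id.
  by rewrite /GRing.scale/= mulr1.
have dX := is_deriveX m dV.
have dN := is_deriveN dV.
have dE : is_derive t 1 (expR \o (- (fun y : R => y^-1))) (expR (- t^-1) * - (- t ^- 2)).
  exact: (is_derive1_comp (is_derive_expR _) dN).
have dM := is_deriveM dX dE.
apply: (@near_eq_is_derive _ _ _ (((fun y : R => y^-1) ^+ m) * (expR \o (- (fun y : R => y^-1))))).
  have : nbhs t [set y | 0 < y] by apply: open_nbhs_nbhs; split => //; exact: open_gt.
  by apply: filterS => y /= y0; rewrite /flat y0 exprfctE.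
apply: is_derive_eq dM _.
rewrite /flat t0 /GRing.scale/= opprK exprfctE -!exprVn.
case: m {dX} => [|m]; first by rewrite /= !expr0 !mul0r !mulr0 oppr0 !mul0r addr0 add0r; ring.
by rewrite /= !exprS; ring.
Qed.

Lemma flat_derive m (t : R) : differentiable (flat m) t /\
  'D_1 (flat m) t = - m%:R * flat m.+1 t + flat m.+2 t.
Proof.
suff H : is_derive t 1 (flat m) (- m%:R * flat m.+1 t + flat m.+2 t).
  by split; [apply/derivable1_diffP; case: H|rewrite derive_val].
have [t0|t0|->] := ltgtP t 0; last 1 first.
- have E k : flat k 0 = 0 by rewrite /flat ltxx.
  rewrite !E mulr0 addr0.
  have cv : (fun h : R => h^-1 *: (flat m (h *: 1 + 0) - flat m 0)) @ 0^' --> (0 : R).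
    apply/cvgrPdist_le => e e0.
    have c0 : 0 < (m.+2)`!%:R :> R by rewrite ltr0n fact_gt0.
    near=> h.
    have hn0 : h != 0 by near: h; exact: nbhs_dnbhs_neq.
    rewrite sub0r normrN E subr0 addr0 /GRing.scale/= mulr1 normrM normfV.
    rewrite mulrC ler_pdivrMr ?normr_gt0//.
    apply: (le_trans (flat_le m h)); rewrite -real_normK ?num_real// expr2 mulrA ler_wpM2r//.
    rewrite mulrC -ler_pdivlMr//; near: h.
    by apply: dnbhs0_le; exact: divr_gt0.
  split; first by apply/cvg_ex; exists 0.
  exact: cvg_lim cv.
- have F k : flat k t = 0 by rewrite /flat ltNge ltW.
  rewrite !F mulr0 addr0.
  apply: (@near_eq_is_derive _ _ _ (cst (0 : R))).
  have : nbhs t [set y | y < 0] by apply: open_nbhs_nbhs; split => //; exact: open_lt.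
  by apply: filterS => y /= y0; rewrite /flat ltNge ltW.
- exact: flat_derive_pos.
Unshelve. all: by end_near. Qed.

Lemma Ck_on_flat k m : Ck_on k setT (flat m).
Proof.
elim: k m => [|k IH] m; first by move=> t _; apply/differentiable_continuous; case: (flat_derive m t).
apply: (@Ck_onS _ _ _ _ _ _ (fun v t : R => v * (- m%:R * flat m.+1 t + flat m.+2 t))).
- exact: openT.
- by move=> t _; case: (flat_derive m t).
- by move=> v t _; have [dt Dt] := flat_derive m t; rewrite derive_R// Dt.
- move=> v; apply: Ck_onM; [exact: openT|exact: Ck_on_cst|].
  apply: Ck_onD; [exact: openT| |exact: IH].
  by apply: Ck_onM; [exact: openT|exact: Ck_on_cst|exact: IH].
Qed.

Definition smooth_step (t : R) : R := flat 0 t * (flat 0 t + flat 0 (1 - t))^-1.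

Lemma flat0_gt0 t : 0 < t -> 0 < flat 0 t.
Proof. by move=> t0; rewrite /flat t0 expr0 mul1r expR_gt0. Qed.

Lemma smooth_step_le0 t : t <= 0 -> smooth_step t = 0.
Proof. by move=> t0; rewrite /smooth_step {1}/flat ltNge t0 mul0r. Qed.

Lemma smooth_step_ge1 t : 1 <= t -> smooth_step t = 1.
Proof.
move=> t1; have t0 : 0 < t by apply: lt_le_trans t1.
rewrite /smooth_step [flat 0 (1 - t)]/flat ltNge subr_le0 t1/= addr0 mulfV//.
by rewrite gt_eqF// flat0_gt0.
Qed.

Lemma sm_smooth_step t : sm smooth_step t.
Proof.
exists setT => [|k]; first exact: open_nbhsT.
have oT := @openT R.
have c2 : Ck_on k setT (fun t : R => flat 0 (1 - t)).
  apply: (@Ck_on_compR R _ k setT setT (fun t : R => 1 - t) (flat 0)) => //; last exact: Ck_on_flat.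
  apply: Ck_onD => //; first exact: Ck_on_cst.
  apply: (@eq_Ck_on _ _ _ _ _ (fun t : R => -1 * t)) => //; first by move=> x _; rewrite mulN1r.
  apply: Ck_onM => //; first exact: Ck_on_cst.
  by apply: (smooth_on_sm (f := id) (U := setT)) => x _; exact: sm_id.
apply: Ck_onM => //; first exact: Ck_on_flat.
apply: Ck_onV => //; last by apply: Ck_onD => //; exact: Ck_on_flat.
move=> x _; rewrite gt_eqF//.
have [x0|x0] := ltP 0 x; first by rewrite ltr_pwDl ?flat0_gt0 ?flat_ge0.
by rewrite ltr_wpDl ?flat_ge0// flat0_gt0// subr_gt0 (le_lt_trans x0).
Qed.

End Bump.

(** * The invariant mean of a compact Lie group *)

Section Dominance.
Context {R : realType}.

Lemma seq_max (s : seq R) : s != [::] -> exists2 m, m \in s & forall x, x \in s -> x <= m.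
Proof.
elim: s => // a s IH _; case: (eqVneq s [::]) => [->|/IH[m ms mP]].
  by exists a; rewrite ?inE// => x; rewrite inE => /eqP->.
have [am|ma] := leP a m.
  by exists m; rewrite ?inE ?ms ?orbT// => x; rewrite inE => /orP[/eqP->|/mP].
exists a; first by rewrite inE eqxx.
by move=> x; rewrite inE => /orP[/eqP->//|/mP/le_trans]; apply; exact: ltW.
Qed.

(** With the maximum of [b] as threshold, the counts force the maximum of [a] to be at most that of
    [b]. Removing one maximum from each list keeps the domination of the counts. *)
Lemma sum_dominated (a b : seq R) : size a = size b ->
  (forall t : R, (count (fun x => (t < x)%R) a <= count (fun x => (t < x)%R) b)%N) ->
  \sum_(x <- a) x <= \sum_(x <- b) x.
Proof.
elim: {a}(size a) {-2}a b (erefl (size a)) => [|n IH] a b sa sb H.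
  by move: sa sb => /size0nil-> /esym/size0nil->.
have an : a != [::] by rewrite -size_eq0 sa.
have bn : b != [::] by rewrite -size_eq0 -sb sa.
have [m ma mP] := seq_max an; have [y yb yP] := seq_max bn.
have my : m <= y.
  rewrite leNgt; apply/negP => ym; have := H y.
  have -> : count (fun x => y < x) b = 0%N.
    by apply/eqP; rewrite -leqn0 leqNgt -has_count; apply/hasPn => z /yP; rewrite leNgt.
  by rewrite leqn0 -leqn0 leqNgt -has_count => /hasPn/(_ m ma)/negP; apply.
rewrite (perm_big _ (perm_to_rem ma)) (perm_big _ (perm_to_rem yb)) /= !big_cons.
apply: lerD => //; apply: IH.
- by rewrite size_rem// sa.
- by rewrite !size_rem// sb.
- move=> t; have := H t.
  have /permP-> := perm_to_rem ma; have /permP-> := perm_to_rem yb; rewrite /=.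
  have [tm|mt] := ltP t m; first by rewrite (lt_le_trans tm my) leq_add2l.
  move=> _; suff -> : count (fun x => t < x) (rem m a) = 0%N by [].
  apply/eqP; rewrite -leqn0 leqNgt -has_count; apply/hasPn => z /mem_rem/mP zm.
  by rewrite -leNgt (le_trans zm).
Qed.

End Dominance.

Section LieTopology.
Context {R : realType} {G : lieGroupType R}.

Lemma lie_mfd : smooth_manifold G. Proof. exact: lie_manifold. Qed.
Lemma lie_mfd2 : smooth_manifold (G * G)%type. Proof. exact: prod_manifold lie_mfd lie_mfd. Qed.

Lemma smooth_at_mulg2 (p : G * G) : smooth_at (fun p : G * G => (p.1 * p.2)%g) p.
Proof. by move: p; apply/(smoothP _ lie_mfd2 lie_mfd); exact: smooth_mulg. Qed.

Lemma smooth_at_invg1 (x : G) : smooth_at (fun x : G => (x^-1)%g) x.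
Proof. by move: x; apply/(smoothP _ lie_mfd lie_mfd); exact: smooth_invg. Qed.

Lemma smooth_at_mulg (M : chartedType R) (f g : M -> G) x : smooth_manifold M ->
  smooth_at f x -> smooth_at g x -> smooth_at (fun y => (f y * g y)%g) x.
Proof.
move=> mM Sf Sg.
have S := smooth_at_pair lie_mfd lie_mfd mM Sf Sg.
exact: (smooth_at_comp mM lie_mfd2 lie_mfd S (smooth_at_mulg2 _)).
Qed.

Lemma smooth_at_invg (M : chartedType R) (f : M -> G) x : smooth_manifold M ->
  smooth_at f x -> smooth_at (fun y => ((f y)^-1)%g) x.
Proof. by move=> mM Sf; exact: (smooth_at_comp mM lie_mfd lie_mfd Sf (smooth_at_invg1 _)). Qed.

Lemma cvg_mulg (T : Type) (F : set_system T) (FF : Filter F) (f g : T -> G) a b :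
  f @ F --> a -> g @ F --> b -> (fun y => (f y * g y)%g) @ F --> (a * b)%g.
Proof.
move=> ca cb; have c := (smooth_at_mulg2 (a, b)).1.
exact: (cvg_comp _ _ (cvg_pair ca cb) c).
Qed.

Lemma cvg_invg (T : Type) (F : set_system T) (FF : Filter F) (f : T -> G) a :
  f @ F --> a -> (fun y => ((f y)^-1)%g) @ F --> (a^-1)%g.
Proof. by move=> ca; exact: (cvg_comp _ _ ca (smooth_at_invg1 a).1). Qed.

Lemma nbhs1_shift (x : G) (W : set G) : nbhs x W <-> nbhs 1%g [set g | W (g * x)%g].
Proof.
split=> H.
  have c : (fun g => g * x)%g @ (1%g : G) --> x.
    by rewrite -[X in _ --> X]mul1g; apply: cvg_mulg; [exact: cvg_id|exact: cvg_cst].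
  exact: c H.
have c : (fun g => g * x^-1)%g @ x --> (1%g : G).
  by rewrite -[X in _ --> X](mulgV x); apply: cvg_mulg; [exact: cvg_id|exact: cvg_cst].
have H2 : nbhs x ((fun g => g * x^-1)%g @^-1` [set g | W (g * x)%g]) := c _ H.
by apply: filterS H2 => g /=; rewrite mulgVK.
Qed.

End LieTopology.

Lemma ultra_fmap (T U : Type) (f : T -> U) (F : set_system T) :
  UltraFilter F -> UltraFilter (f @ F).
Proof.
move=> UF; have PF : ProperFilter F by exact: ultra_proper.
split; first exact: fmap_proper_filter.
move=> H PH FH; rewrite predeqE => A; split=> [HA|]; last exact: FH.
have [//|FC] := in_ultra_setVsetC (f @^-1` A) UF.
have HC : H (~` A) by apply: FH.
have : H (A `&` ~` A) by exact: filterI.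
by rewrite setICr => /filter_not_empty.
Qed.

(** The properties of Haar integration that the proof relies on, for continuous functions; the sup
    norm bound stands in for positivity. *)
Definition right_mean (R : realType) (G : lieGroupType R) (M : (G -> R) -> R) :=
  [/\ forall f g : G -> R, continuous f -> continuous g -> M (fun x => f x + g x) = M f + M g,
      forall (c : R) (f : G -> R), continuous f -> M (fun x => c * f x) = c * M f,
      forall c : R, M (fun=> c) = c,
      forall (f : G -> R) (B : R), continuous f -> (forall x, `|f x| <= B) -> `|M f| <= B &
      forall (f : G -> R) h, continuous f -> M (fun x => f (x * h)%g) = M f].

Section Mean.
Context {R : realType} {G : lieGroupType R}.
Hypothesis G_compact : compact [set: G].

Definition covers (W : set G) (s : seq G) := forall g, exists2 x, x \in s & W (g * x^-1)%g.

(** Compactness is used in its near-covering form, along the filter of finite lists of centers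
    ordered by inclusion. *)
Lemma covers_exists W : nbhs (1%g : G) W -> exists s, covers W s.
Proof.
move=> W1.
pose F : set_system (seq G) := [set A : set (seq G) | exists s0 : seq G, forall s : seq G, {subset s0 <= s} -> A s].
have FF : Filter F.
  split; first by exists [::].
  - move=> A B [s As] [s' Bs']; exists (s ++ s') => t st.
    by split; [apply: As|apply: Bs'] => x xs; apply: st; rewrite mem_cat xs ?orbT.
  - by move=> A B AB [s As]; exists s => t /As/AB.
have [x _|s0 /(_ s0)] := (compact_near_coveringP [set: G]).1 G_compact (seq G) F
    (fun (s : seq G) g => exists2 x, x \in s & W (g * x^-1)%g) FF.
  exists ([set g | W (g * x^-1)%g], [set s : seq G | x \in s]).
    split=> /=; last by exists [:: x] => s; apply; rewrite inE eqxx.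
    by apply/nbhs1_shift; apply: filterS W1 => g; rewrite /= mulgK.
  by move=> [g s] [/= Wg xs]; exists x.
by move=> H; exists s0 => g; exact: H.
Qed.

Let is_cover_size W n := `[< exists2 s, size s = n & covers W s >].

Let exW W : nbhs (1%g : G) W -> exists n, is_cover_size W n.
Proof. by move=> /covers_exists[s cs]; exists (size s); apply/asboolP; exists s. Qed.

Lemma min_cover W : nbhs (1%g : G) W -> exists s, covers W s /\
  forall s', covers W s' -> (size s <= size s')%N.
Proof.
move=> /exW e; case: (ex_minnP e) => n /asboolP[s sn cs] H; exists s; split=> // s' cs'.
by rewrite sn; apply: H; apply/asboolP; exists s'.
Qed.

Definition net (W : set G) : seq G :=
  xget [::] [set s | covers W s /\ forall s', covers W s' -> (size s <= size s')%N].

Lemma netP W : nbhs (1%g : G) W -> covers W (net W) /\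
  forall s', covers W s' -> (size (net W) <= size s')%N.
Proof. by move=> /min_cover[s Hs]; rewrite /net; case: xgetP => [x _ //|/(_ s)]. Qed.

Definition avg (s : seq G) (f : G -> R) : R := (\sum_(x <- s) f x) / (size s)%:R.

Definition osc_le (W : set G) (f : G -> R) (d : R) :=
  forall g x y, W (g * x^-1)%g -> W (g * y^-1)%g -> `|f x - f y| <= d.

(** An exchange argument. In [s], replace the points where [f] exceeds [t] by the points of [s']
    where [f + d] exceeds [t]. The result still covers, since two centers whose translates share a
    point have values within [d]. Minimality of [s] then bounds the number of replaced points, for
    every [t], and [sum_dominated] applies. *)
Lemma avg_le W s s' f (d : R) : covers W s -> covers W s' -> size s = size s' ->
  (forall s'', covers W s'' -> (size s <= size s'')%N) -> osc_le W f d ->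
  (0 < size s)%N -> avg s f <= avg s' f + d.
Proof.
move=> cs cs' ss' Hmin osc s0.
have n0 : (0 : R) < (size s)%:R by rewrite ltr0n.
rewrite /avg -ss' -[X in _ + X](mulfK (x := (size s)%:R)) ?gt_eqF// -mulrDl ler_pM2r ?invr_gt0//.
have -> : \sum_(x <- s') f x + d * (size s)%:R = \sum_(x <- [seq f x + d | x <- s']) x.
  by rewrite big_map big_split /= big_const_seq iter_addr_0 count_predT ss' mulr_natr.
rewrite -(big_map f xpredT id); apply: sum_dominated; first by rewrite !size_map.
move=> t; rewrite !count_map.
pose P := preim f (fun x => t < x); pose Q := preim (fun x => f x + d) (fun x => t < x).
rewrite -/P -/Q.
have : covers W (seq.filter (predC P) s ++ seq.filter Q s').
  move=> g; have [x xs Wx] := cs g; have [y ys Wy] := cs' g.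
  have [Px|nPx] := boolP (P x); last by exists x => //; rewrite mem_cat mem_filter /= nPx xs.
  exists y => //; rewrite mem_cat !mem_filter ys andbT; apply/orP; right.
  rewrite /Q /=; move: Px; rewrite /P /= => Px.
  by have := osc g x y Wx Wy; rewrite ler_norml => /andP[_]; lra.
move=> /Hmin; rewrite size_cat !size_filter -[size s](count_predC P) => H.
by move: H; rewrite addnC leq_add2l.
Qed.

(** Limits along this filter are limits as the neighbourhood [W] shrinks to 1. *)
Let F0 : set_system (set G) := [set A | exists2 V, nbhs (1%g : G) V &
  forall W, nbhs (1%g : G) W -> W `<=` V -> A W].

Let F0_proper : ProperFilter F0.
Proof.
split.
  by move=> [V V1 /(_ V V1)]; apply.
split; first by exists setT; [exact: filterT|].
- move=> A B [V V1 HV] [V' V'1 HV']; exists (V `&` V'); first exact: filterI.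
  by move=> W W1 WV; split; [apply: HV|apply: HV'] => // x /WV[].
- by move=> A B AB [V V1 HV]; exists V => // W W1 /HV; move=> /(_ W1)/AB.
Qed.

(** If [v = g * x^-1] lies in the neighbourhood, then [x = v^-1 * g]. Compactness makes
    [f (v^-1 * g)] close to [f g] uniformly in [g]; the halves of [d] serve the two points
    compared. *)
Lemma uniform_cont (f : G -> R) : continuous f -> forall d : R, 0 < d -> exists2 V, nbhs (1%g : G) V & osc_le V f d.
Proof.
move=> cf d d0.
have H := (compact_near_coveringP [set: G]).1 G_compact G (nbhs (1%g : G))
  (fun v g => `|f (v^-1 * g)%g - f g| <= d / 2) (nbhs_filter _).
have {}H : \forall v \near (1%g : G), [set: G] `<=` (fun g => `|f (v^-1 * g)%g - f g| <= d / 2).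
  apply: H => x _.
  have c1 : (fun p : G * G => (p.2^-1 * p.1)%g) @ (x, 1%g : G) --> x.
    rewrite -[X in _ --> X]mul1g -[X in (X * _)%g]invg1.
    by apply: cvg_mulg; [apply: cvg_invg; exact: cvg_snd|exact: cvg_fst].
  have c2 : (fun p : G * G => f (p.2^-1 * p.1)%g - f p.1) @ (x, 1%g : G) --> f x - f x.
    apply: cvgB; first exact: (cvg_comp _ _ c1 (cf x)).
    by apply: (@cvg_comp _ _ _ fst f); [exact: cvg_fst|exact: cf].
  have d2 : 0 < d / 2 by rewrite divr_gt0.
  have /cvgrPdist_le/(_ _ d2) := c2.
  by rewrite subrr; apply: filterS => p; rewrite sub0r normrN.
exists [set v | forall g, `|f (v^-1 * g)%g - f g| <= d / 2].
  by apply: filterS H => v Hv g; exact: Hv.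
move=> g x y /(_ g) + /(_ g).
rewrite !invgF !mulgVK => H1 H2.
rewrite -(subrK (f g) (f x)) -addrA; apply: (le_trans (ler_normD _ _)).
by rewrite [X in _ + X]distrC; move: H1 H2; lra.
Qed.

Lemma osc_leW W W' f d : W' `<=` W -> osc_le W f d -> osc_le W' f d.
Proof. by move=> WW' H g x y /WW' + /WW'; exact: H. Qed.

Lemma net_gt0 W : nbhs (1%g : G) W -> (0 < size (net W))%N.
Proof.
by move=> /netP[/(_ 1%g)[x xs _] _]; rewrite lt0n size_eq0; apply: contraTneq xs => ->.
Qed.

Lemma covers_shift W s h : covers W s -> covers W [seq (x * h)%g | x <- s].
Proof.
move=> cs g; have [x xs Wx] := cs (g / h)%g.
exists (x * h)%g; first exact: map_f.
have -> : (g * (x * h)^-1 = g / h * x^-1)%g by apply: (mulIg (x * h)%g); rewrite mulgVK mulgA !mulgVK.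
exact: Wx.
Qed.

Lemma avg_shift W f d h : nbhs (1%g : G) W -> osc_le W f d ->
  `|avg (net W) (fun x => f (x * h)%g) - avg (net W) f| <= d.
Proof.
move=> W1 osc; have [cs Hmin] := netP W1; have s0 := net_gt0 W1.
have -> : avg (net W) (fun x => f (x * h)%g) = avg [seq (x * h)%g | x <- net W] f.
  by rewrite /avg size_map big_map.
have cs' := covers_shift h cs.
have ss : size (net W) = size [seq (x * h)%g | x <- net W] by rewrite size_map.
have H1 := avg_le cs cs' ss Hmin osc s0.
have H2 : avg [seq (x * h)%g | x <- net W] f <= avg (net W) f + d.
  by apply: avg_le osc _ => //; rewrite size_map.
by rewrite ler_norml; apply/andP; split; move: H1 H2; lra.
Qed.

Lemma avg_bound s f B : (0 < size s)%N -> (forall x, `|f x| <= B) -> `|avg s f| <= B.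
Proof.
move=> s0 fB; rewrite /avg normrM normfV [`|(size s)%:R|]ger0_norm// ler_pdivrMr ?ltr0n//.
apply: (le_trans (ler_norm_sum _ _ _)).
apply: (@le_trans _ _ (\sum_(x <- s) B)); first by apply: ler_sum.
by rewrite big_const_seq iter_addr_0 count_predT mulr_natr.
Qed.

Lemma cont_bound (f : G -> R) : continuous f -> exists B, forall x, `|f x| <= B.
Proof.
move=> cf; have cn : continuous (fun x => `|f x|) by move=> x; apply: cvg_norm; exact: cf.
have [|||x _ Hx] := @compact_EVT_max G R (fun x => `|f x|) setT.
- by exists 1%g.
- exact: G_compact.
- exact: continuous_subspaceT.
- by exists `|f x| => y; apply: Hx; rewrite inE.
Qed.

(* An invariant mean: averages over a minimal cover of G by right translates of
   a small neighbourhood W of 1 are, by minimality, nearly invariant. *)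
Theorem invariant_mean : exists M : (G -> R) -> R, right_mean M.
Proof.
(* An ultrafilter makes the averages of every continuous function converge along one and the same
   filter, since they stay in a compact segment. *)
have [F [UF F0F]] := ultraFilterLemma F0_proper.
have FF : ProperFilter F by exact: ultra_proper.
have nearF (P : set (set G)) : (forall W, nbhs (1%g : G) W -> P W) -> F P.
  by move=> H; apply: F0F; exists setT; [exact: filterT|move=> W W1 _; exact: H].
pose M f : R := lim ((fun W => avg (net W) f) @ F).
have MP f : continuous f -> (fun W => avg (net W) f) @ F --> M f.
  move=> cf; have [B fB] := cont_bound cf.
  have UI := ultra_fmap (fun W => avg (net W) f) UF.
  have cI : compact `[- B, B]%classic by exact: segment_compact.
  rewrite compact_ultra in cI; have [|p [_ Hp]] := cI _ UI.
    apply: nearF => W W1 /=; rewrite in_itv/= -ler_norml.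
    by apply: avg_bound => //; exact: net_gt0.
  by apply/cvg_ex; exists p.
have Mu f p : (fun W => avg (net W) f) @ F --> p -> M f = p.
  by move=> H; apply: cvg_lim H.
exists M; split.
- move=> f g cf cg; apply: Mu.
  rewrite (_ : (fun W => _) = (fun W => avg (net W) f + avg (net W) g)).
    exact: (cvgD (MP f cf) (MP g cg)).
  by apply/funext => W; rewrite /avg -mulrDl -big_split.
- move=> c f cf; apply: Mu.
  rewrite (_ : (fun W => _) = (fun W => c * avg (net W) f)).
    exact: (cvgM (cvg_cst c) (MP f cf)).
  by apply/funext => W; rewrite /avg mulrA -mulr_sumr.
- move=> c; apply: Mu.
  have H : (fun _ : set G => c) @ F --> c by exact: cvg_cst.
  apply: cvg_trans H; apply: near_eq_cvg; apply: nearF => W W1.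
  rewrite /avg /= big_const_seq iter_addr_0 count_predT -[c *+ _]mulr_natr mulfK//.
  by rewrite pnatr_eq0 -lt0n net_gt0.
- move=> f B cf fB.
  apply: (cvgr_to_le (cvg_norm (MP f cf))); apply: nearF => W W1.
  by apply: avg_bound => //; exact: net_gt0.
- move=> f h cf.
  have cfh : continuous (fun x => f (x * h)%g).
    move=> x; apply: (@cvg_comp _ _ _ (fun x => x * h)%g f); last exact: cf.
    by apply: cvg_mulg; [exact: cvg_id|exact: cvg_cst].
  (* For a given small [W] the average is invariant only up to [e]; invariance is exact in the limit
     because [e] is arbitrary. *)
  apply/eqP; rewrite -subr_eq0 -normr_le0; apply/ler_addgt0Pr => e e0; rewrite add0r.
  apply: (cvgr_to_le (cvg_norm (cvgB (MP _ cfh) (MP f cf)))).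
  have [V V1 oV] := uniform_cont cf e0.
  apply: F0F; exists V => // W W1 WV.
  by apply: avg_shift => //; exact: osc_leW oV.
Qed.

End Mean.

(** * Logarithmic derivatives and the adjoint representation *)

Lemma loc_const_segment (R : realType) (T : Type) (f : R -> T) :
  (forall t : R, 0 <= t <= 1 -> \forall t' \near t, f t' = f t) -> f 1 = f 0.
Proof.
move=> H; have cI : connected `[(0 : R), 1]%classic by exact: segment_connected.
have E := cI [set t | 0 <= t <= 1 /\ f t = f 0].
suff : [set t | 0 <= t <= 1 /\ f t = f 0] = `[(0 : R), 1]%classic.
  by move/seteqP => [_ /(_ 1)] /=; rewrite in_itv/= ler01 lexx => /(_ isT)[].
have U1 : open [set t : R | exists2 U, open_nbhs t U & forall s, U s -> f s = f 0].
  rewrite openE => t [U oU HU]; apply: filterS (open_nbhs_nbhs oU) => s Us.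
  by exists U => //; split=> //; exact: oU.1.
have U2 : open [set t : R | exists2 U, open_nbhs t U & forall s, U s -> f s <> f 0].
  rewrite openE => t [U oU HU]; apply: filterS (open_nbhs_nbhs oU) => s Us.
  by exists U => //; split=> //; exact: oU.1.
apply: E.
- by exists 0; rewrite /= lexx ler01.
- exists [set t : R | exists2 U, open_nbhs t U & forall s, U s -> f s = f 0] => //.
  apply/seteqP; split=> t /=; rewrite in_itv/=.
    move=> [t01 ft]; split=> //.
    by have /near_open[U oU HU] := H t t01; exists U => // s /HU ->.
  by move=> [t01 [U oU HU]]; split=> //; apply: HU; exact: oU.2.
- exists (~` [set t : R | exists2 U, open_nbhs t U & forall s, U s -> f s <> f 0]).
    exact: open_closedC.
  apply/seteqP; split=> t /=; rewrite in_itv/=.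
    by move=> [t01 ft]; split=> // -[U oU HU]; apply: (HU t) => //; exact: oU.2.
  move=> [t01 nU]; split=> //; apply: contrapT => nft; apply: nU.
  by have /near_open[U oU HU] := H t t01; exists U => // s /HU ->.
Qed.

Section Omega.
Context {R : realType} {G : lieGroupType R}.
Local Notation n := (mdim G).
Variables (kap : 'rV[R]_n -> G) (kapi : G -> 'rV[R]_n).

(* [omega phi u] is the pull-back at u of the left Maurer-Cartan form, [AD] the
   adjoint representation and [BL x] the derivative of left translation by x, all
   read in the parametrization kap and acting on row vectors from the right. *)
Definition omega m (phi : 'rV[R]_m -> G) (u : 'rV[R]_m) : 'M[R]_(m, n) :=
  jacobian (fun w => kapi ((phi u)^-1 * phi w)%g) u.
Definition AD (g : G) : 'M[R]_n := jacobian (fun v => kapi (kap v ^ g)%g) 0.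
Definition BL (x : G) : 'M[R]_n := jacobian (fun v => kapi (x * kap v)%g) 0.

Definition local_param := [/\ kap 0 = 1%g, kapi 1%g = 0, smooth_at kap 0, smooth_at kapi 1%g &
  (\forall u \near (0 : 'rV[R]_n), kapi (kap u) = u) /\ (\forall g \near (1%g : G), kap (kapi g) = g)].

Hypothesis LP : local_param.
Let k0 : kap 0 = 1%g. Proof. by case: LP. Qed.
Let ki1 : kapi 1%g = 0. Proof. by case: LP. Qed.
Let Sk : smooth_at kap 0. Proof. by case: LP. Qed.
Let Ski : smooth_at kapi 1%g. Proof. by case: LP. Qed.
Let kK : \forall u \near (0 : 'rV[R]_n), kapi (kap u) = u. Proof. by case: LP => _ _ _ _ []. Qed.
Let kiK : \forall g \near (1%g : G), kap (kapi g) = g. Proof. by case: LP => _ _ _ _ []. Qed.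
Let mG := @lie_mfd R G.
Let eu m := @euclidean_manifold R m.

Lemma smooth_at_mulgl m (phi : 'rV[R]_m -> G) (x : G) u :
  smooth_at phi u -> smooth_at (fun w => (x * phi w)%g) u.
Proof. by move=> S; exact: (smooth_at_mulg (eu m) (smooth_at_cst x u (eu m) mG) S). Qed.

Lemma smooth_at_conjg (M : chartedType R) (phi : M -> G) (x : G) u : smooth_manifold M ->
  smooth_at phi u -> smooth_at (fun w => (phi w ^ x)%g) u.
Proof.
move=> mM S; have Sx := smooth_at_cst x u mM mG.
exact: (smooth_at_mulg mM (smooth_at_cst (x^-1)%g u mM mG) (smooth_at_mulg mM S Sx)).
Qed.

Lemma sm_kapi m (phi : 'rV[R]_m -> G) u : smooth_at phi u -> smooth_at kapi (phi u) ->
  sm (fun w => kapi (phi w)) u.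
Proof.
move=> S1 S2; apply/smooth_at_rV.
exact: (smooth_at_comp (eu m) mG (eu n) S1 S2).
Qed.

Lemma sm_kapi1 m (phi : 'rV[R]_m -> G) u : smooth_at phi u -> phi u = 1%g ->
  sm (fun w => kapi (phi w)) u.
Proof. by move=> S1 E; apply: sm_kapi => //; rewrite E. Qed.

Lemma smooth_cvg1 m (phi : 'rV[R]_m -> G) u : smooth_at phi u -> phi u = 1%g ->
  phi @ u --> (1%g : G).
Proof. by move=> S <-; exact: S.1. Qed.

(** Near [u] the map [phi] equals [kap (kapi (phi w))], so the chain rule can be applied in the
    coordinates at 1. *)
Lemma jac_chain m k (phi : 'rV[R]_m -> G) u (f : G -> 'rV[R]_k) : phi u = 1%g ->
  smooth_at phi u -> smooth_at f 1%g ->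
  jacobian (fun w => f (phi w)) u = jacobian (fun w => kapi (phi w)) u *m jacobian (fun v => f (kap v)) 0.
Proof.
move=> E Sphi Sf.
have S1 : sm (fun w => kapi (phi w)) u by exact: sm_kapi1.
have S2 : sm (fun v => f (kap v)) 0.
  by apply/smooth_at_rV; apply: (smooth_at_comp (eu n) mG (eu k) Sk); rewrite k0.
have E0 : kapi (phi u) = 0 by rewrite E.
have H : \forall w \near u, kap (kapi (phi w)) = phi w.
  exact: (smooth_cvg1 Sphi E kiK).
rewrite -[X in _ *m jacobian _ X]E0.
rewrite -(jacobian_comp (g := fun v => f (kap v)) (sm_diff S1)); last by rewrite E0; exact: sm_diff.
apply/esym/near_eq_jacobian; first by apply: filterS H => w /= ->.
by apply: differentiable_comp; [exact: sm_diff|rewrite E0; exact: sm_diff].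
Qed.

Lemma jac_kap : jacobian (fun v => kapi (kap v)) 0 = 1%:M.
Proof.
rewrite -(jacobian_id (0 : 'rV[R]_n)); apply: near_eq_jacobian; first exact: kK.
by apply: sm_diff; exact: sm_kapi1.
Qed.

Lemma sm_mul2 : sm (fun w : 'rV[R]_(n + n) => kapi (kap (lsubmx w) * kap (rsubmx w))%g) 0.
Proof.
apply: sm_kapi1; last by rewrite !linear0 !k0 mulg1.
apply: (smooth_at_mulg (eu (n + n))).
  apply: (smooth_at_comp (eu (n + n)) (eu n) mG (f := @lsubmx R 1 n n)); last by rewrite linear0.
  by apply/smooth_at_rV; exact: sm_lsubmx.
apply: (smooth_at_comp (eu (n + n)) (eu n) mG (f := @rsubmx R 1 n n)); last by rewrite linear0.
by apply/smooth_at_rV; exact: sm_rsubmx.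
Qed.

Lemma jacobian_row_mx m p q (f : 'rV[R]_m -> 'rV[R]_p) (g : 'rV[R]_m -> 'rV[R]_q) u :
  sm f u -> sm g u -> jacobian (fun w => row_mx (f w) (g w)) u = row_mx (jacobian f u) (jacobian g u).
Proof.
move=> Sf Sg; have Sfg := sm_row_mx Sf Sg; apply: jacobianP => [|v]; first exact: sm_diff.
have dfg := sm_diff Sfg.
rewrite mul_mx_row -(deriveEjacobian _ (sm_diff Sf)) -(deriveEjacobian _ (sm_diff Sg)).
apply/rowP => j; rewrite -derive_coord; last exact: diff_derivable.
case: (split_ordP j) => l ->.
  have -> : (fun w => row_mx (f w) (g w) 0 (lshift q l)) = (fun w => f w 0 l).
    by apply/funext => w; rewrite row_mxEl.
  by rewrite row_mxEl derive_coord//; apply: diff_derivable; exact: sm_diff.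
have -> : (fun w => row_mx (f w) (g w) 0 (rshift p l)) = (fun w => g w 0 l).
  by apply/funext => w; rewrite row_mxEr.
by rewrite row_mxEr derive_coord//; apply: diff_derivable; exact: sm_diff.
Qed.

(** Multiplication has addition as its derivative at (1, 1): on each factor separately it is the
    identity because 1 is neutral, and this determines both blocks of the Jacobian of [Phi]. *)
Lemma jac_mul m (a b : 'rV[R]_m -> G) u : a u = 1%g -> b u = 1%g ->
  smooth_at a u -> smooth_at b u ->
  jacobian (fun w => kapi (a w * b w)%g) u =
  jacobian (fun w => kapi (a w)) u + jacobian (fun w => kapi (b w)) u.
Proof.
move=> a1 b1 Sa Sb.
pose Phi := fun w : 'rV[R]_(n + n) => kapi (kap (lsubmx w) * kap (rsubmx w))%g.
have SPhi : sm Phi 0 := sm_mul2.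
have S1 : sm (fun w => kapi (a w)) u by exact: sm_kapi1.
have S2 : sm (fun w => kapi (b w)) u by exact: sm_kapi1.
have S12 := sm_row_mx S1 S2.
have E0 : row_mx (kapi (a u)) (kapi (b u)) = 0 by rewrite a1 b1 ki1 row_mx0.
have H1 : \forall w \near u, kap (kapi (a w)) = a w by exact: (smooth_cvg1 Sa a1 kiK).
have H2 : \forall w \near u, kap (kapi (b w)) = b w by exact: (smooth_cvg1 Sb b1 kiK).
have -> : jacobian (fun w => kapi (a w * b w)%g) u =
    row_mx (jacobian (fun w => kapi (a w)) u) (jacobian (fun w => kapi (b w)) u) *m jacobian Phi 0.
  rewrite -(jacobian_row_mx S1 S2) -[X in _ *m jacobian _ X]E0.
  rewrite -(jacobian_comp (g := Phi) (sm_diff S12)); last by rewrite E0; exact: sm_diff.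
  apply: near_eq_jacobian; last by apply: sm_diff; apply: sm_kapi1; [exact: (smooth_at_mulg (eu m) Sa Sb)|rewrite a1 b1 mulg1].
  near=> w; rewrite /Phi /= row_mxKl row_mxKr; congr (kapi (_ * _)%g); apply/esym; by near: w.
have J1 : (row_mx 1%:M 0 : 'M[R]_(n, n + n)) *m jacobian Phi 0 = 1%:M.
  have Sc : sm (fun w : 'rV[R]_n => row_mx w (0 : 'rV[R]_n)) 0.
    by apply: sm_row_mx; [exact: sm_id|exact: sm_cst].
  have -> : (row_mx 1%:M 0 : 'M[R]_(n, n + n)) = jacobian (fun w : 'rV[R]_n => row_mx w (0 : 'rV[R]_n)) 0.
    by rewrite jacobian_row_mx ?jacobian_id ?jacobian_cst//; [exact: sm_id|exact: sm_cst].
  rewrite -[X in _ *m jacobian _ X](row_mx0 R 1 n n) -(jacobian_comp (g := Phi) (sm_diff Sc)); last by rewrite row_mx0; exact: sm_diff.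
  rewrite -jac_kap; congr jacobian; apply/funext => w.
  by rewrite /Phi /= row_mxKl row_mxKr k0 mulg1.
have J2 : (row_mx 0 1%:M : 'M[R]_(n, n + n)) *m jacobian Phi 0 = 1%:M.
  have Sc : sm (fun w : 'rV[R]_n => row_mx (0 : 'rV[R]_n) w) 0.
    by apply: sm_row_mx; [exact: sm_cst|exact: sm_id].
  have -> : (row_mx 0 1%:M : 'M[R]_(n, n + n)) = jacobian (fun w : 'rV[R]_n => row_mx (0 : 'rV[R]_n) w) 0.
    by rewrite jacobian_row_mx ?jacobian_id ?jacobian_cst//; [exact: sm_cst|exact: sm_id].
  rewrite -[X in _ *m jacobian _ X](row_mx0 R 1 n n) -(jacobian_comp (g := Phi) (sm_diff Sc)); last by rewrite row_mx0; exact: sm_diff.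
  rewrite -jac_kap; congr jacobian; apply/funext => w.
  by rewrite /Phi /= row_mxKl row_mxKr k0 mul1g.
move: (jacobian (fun w => kapi (a w)) u) (jacobian (fun w => kapi (b w)) u) => A B.
move: (jacobian Phi 0) J1 J2 => J J1 J2.
rewrite -[J]vsubmxK in J1 J2 *.
move: J1 J2; rewrite !mul_row_col !mul1mx !mul0mx addr0 add0r => -> ->.
by rewrite !mulmx1.
Unshelve. all: by end_near. Qed.

Lemma omega_left m (phi : 'rV[R]_m -> G) u x : omega (fun w => (x * phi w)%g) u = omega phi u.
Proof.
rewrite /omega; congr jacobian; apply/funext => w; congr kapi.
by apply: (mulgI (x * phi u)%g); rewrite mulVKg -mulgA mulVKg.
Qed.

Lemma omega_near_eq m (phi psi : 'rV[R]_m -> G) u : smooth_at phi u ->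
  (\near u, phi u = psi u) -> omega phi u = omega psi u.
Proof.
move=> S H; rewrite /omega -(nbhs_singleton H); apply: near_eq_jacobian.
  by apply: filterS H => w ->.
by apply: sm_diff; apply: sm_kapi1; [exact: smooth_at_mulgl|rewrite mulVg].
Qed.

Lemma omega_cst m (x : G) (u : 'rV[R]_m) : omega (fun=> x) u = 0.
Proof. exact: jacobian_cst. Qed.

Lemma omega_conj m (phi : 'rV[R]_m -> G) u g : smooth_at phi u ->
  omega (fun w => (phi w ^ g)%g) u = omega phi u *m AD g.
Proof.
move=> S; rewrite /omega /AD.
rewrite -(jac_chain (f := fun x => kapi (x ^ g)%g) (phi := fun w => ((phi u)^-1 * phi w)%g)).
- by congr jacobian; apply/funext => w; rewrite -conjVg -conjMg.
- by rewrite mulVg.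
- exact: smooth_at_mulgl.
- apply: (smooth_at_comp mG mG (eu n)); last by rewrite conj1g.
  exact: (smooth_at_conjg _ mG (smooth_at_id (1%g : G) mG)).
Qed.

(** The Leibniz rule: the increment of the product is the increment of [phi] conjugated by [psi u],
    times the increment of [psi], and both factors are 1 at [u]. *)
Lemma omega_mul m (phi psi : 'rV[R]_m -> G) u : smooth_at phi u -> smooth_at psi u ->
  omega (fun w => (phi w * psi w)%g) u = omega phi u *m AD (psi u) + omega psi u.
Proof.
move=> S1 S2; rewrite -omega_conj// /omega.
rewrite -(jac_mul (a := fun w => ((phi u ^ psi u)^-1 * phi w ^ psi u)%g) (b := fun w => ((psi u)^-1 * psi w)%g)).
- congr jacobian; apply/funext => w; congr kapi.
  apply: (mulgI (phi u * psi u)%g); rewrite mulVKg.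
  by rewrite -conjVg -conjMg conjgE !mulgA !mulgK mulgV mul1g.
- by rewrite mulVg.
- by rewrite mulVg.
- by exact: (smooth_at_mulgl _ (smooth_at_conjg _ (eu m) S1)).
- exact: smooth_at_mulgl.
Qed.

Lemma AD1 : AD 1%g = 1%:M.
Proof. by rewrite /AD -jac_kap; congr jacobian; apply/funext => w; rewrite conjg1. Qed.

Lemma ADM g h : AD (g * h)%g = AD g *m AD h.
Proof.
have Skg : smooth_at (fun v => kap v ^ g)%g 0 by exact: (smooth_at_conjg _ (eu n) Sk).
rewrite {1}/AD (_ : (fun v => kapi (kap v ^ (g * h))%g) = (fun v => kapi ((kap v ^ g) ^ h)%g)); last first.
  by apply/funext => v; rewrite conjgM.
apply: (jac_chain (f := fun x => kapi (x ^ h)%g) (phi := fun v => (kap v ^ g)%g)).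
- by rewrite k0 conj1g.
- exact: Skg.
- apply: (smooth_at_comp mG mG (eu n)); last by rewrite conj1g.
  exact: (smooth_at_conjg _ mG (smooth_at_id (1%g : G) mG)).
Qed.

Lemma omega_inv m (phi : 'rV[R]_m -> G) u : smooth_at phi u ->
  omega (fun w => ((phi w)^-1)%g) u = - (omega phi u *m AD ((phi u)^-1)%g).
Proof.
move=> S; have Si : smooth_at (fun w => ((phi w)^-1)%g) u by exact: (smooth_at_invg (eu m) S).
apply/eqP; rewrite -addr_eq0 addrC -(omega_mul S Si).
rewrite (_ : (fun w => _) = (fun=> 1%g)) ?omega_cst//.
by apply/funext => w; rewrite mulgV.
Qed.

Lemma omega_comp m p (phi : 'rV[R]_p -> G) (f : 'rV[R]_m -> 'rV[R]_p) u : sm f u ->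
  smooth_at phi (f u) -> omega (fun w => phi (f w)) u = jacobian f u *m omega phi (f u).
Proof.
move=> Sf S; rewrite /omega.
rewrite -(@jacobian_comp R m p n f (fun w => kapi ((phi (f u))^-1 * phi w)%g) u) //.
  exact: sm_diff.
by apply: sm_diff; apply: sm_kapi1; [exact: smooth_at_mulgl|rewrite mulVg].
Qed.

Lemma omega_lin m p (phi : 'rV[R]_p -> G) (N : 'M[R]_(m, p)) u : smooth_at phi (u *m N) ->
  omega (fun w => phi (w *m N)) u = N *m omega phi (u *m N).
Proof.
move=> S; have SN : sm (mulmxr N : 'rV[R]_m -> 'rV[R]_p) u.
  by apply: (@sm_mulmx _ _ _ _ _ id); [exact: sm_id|exact: sm_cst].
by have := omega_comp SN S; rewrite jacobian_lin.
Qed.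

Lemma omega1E m (phi : 'rV[R]_m -> G) u : phi u = 1%g -> omega phi u = jacobian (fun w => kapi (phi w)) u.
Proof. by move=> E; rewrite /omega E; congr jacobian; apply/funext => w; rewrite invg1 mul1g. Qed.

Lemma omega_kap : omega kap 0 = 1%:M.
Proof. by rewrite omega1E// jac_kap. Qed.

Lemma jac_kapi m (phi : 'rV[R]_m -> G) u : smooth_at phi u -> smooth_at kapi (phi u) ->
  jacobian (fun w => kapi (phi w)) u = omega phi u *m BL (phi u).
Proof.
move=> S S2; rewrite /omega /BL.
rewrite -(jac_chain (f := fun x => kapi (phi u * x)%g) (phi := fun w => ((phi u)^-1 * phi w)%g)).
- by congr jacobian; apply/funext => w; rewrite mulVKg.
- by rewrite mulVg.
- exact: smooth_at_mulgl.
- apply: (smooth_at_comp mG mG (eu n)); last by rewrite mulg1.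
  by exact: (smooth_at_mulg mG (smooth_at_cst (phi u) (1%g : G) mG mG) (smooth_at_id (1%g : G) mG)).
Qed.

Lemma BL1 : BL 1%g = 1%:M.
Proof. by rewrite /BL -jac_kap; congr jacobian; apply/funext => w; rewrite mul1g. Qed.

(** In coordinates the Jacobian is [omega] times [BL], hence 0 near [u0]; the mean value bound with
    constant 0 makes the coordinates constant. *)
Lemma omega0_const m (phi : 'rV[R]_m -> G) u0 : smooth_at phi u0 ->
  (\forall u \near u0, omega phi u = 0) -> \forall u \near u0, phi u = phi u0.
Proof.
move=> S H.
pose psi w := ((phi u0)^-1 * phi w)%g.
have Spsi : smooth_at psi u0 by exact: smooth_at_mulgl.
have psi0 : psi u0 = 1%g by rewrite /psi mulVg.
have cpsi : psi @ u0 --> (1%g : G) by rewrite -psi0; exact: Spsi.1.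
have HK := cpsi _ (smooth_at_near mG (eu n) Ski).
have HN := smooth_at_near (eu m) mG Spsi.
have HkiK := cpsi _ kiK.
have [r r0 Hr] : exists2 r, 0 < r & forall u, `|u0 - u| < r ->
    differentiable (fun w => kapi (psi w)) u /\ jacobian (fun w => kapi (psi w)) u = 0.
  apply: near_norm_lt; near=> u.
  have s1 : smooth_at psi u by near: u; exact: HN.
  have s2 : smooth_at kapi (psi u) by near: u; exact: HK.
  split; first by apply: sm_diff; exact: sm_kapi.
  rewrite jac_kapi// omega_left.
  have -> : omega phi u = 0 by near: u.
  by rewrite mul0mx.
near=> u.
have Bu : `|u0 - u| < r by near: u; exact: (@nbhs_ball_norm R _ u0 (PosNum r0)).
have E : kapi (psi u) = kapi (psi u0).
  apply/eqP; rewrite -subr_eq0 -normr_le0 -[X in _ <= X](mul0r `|u - u0|).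
  apply: (@lipschitz_of_diff _ _ _ (fun w => kapi (psi w)) u0 r 0) => //.
  - by move=> x; rewrite -ball_normE => /Hr[].
  - by move=> x v; rewrite -ball_normE => /Hr[_ ->]; rewrite mulmx0 normr0 mul0r.
  - exact: ballxx.
  - by rewrite -ball_normE.
have : psi u = 1%g.
  have <- : kap (kapi (psi u)) = psi u by near: u; exact: HkiK.
  by rewrite E psi0 ki1 k0.
by move/(congr1 (fun x => phi u0 * x)%g); rewrite /psi mulVKg mulg1.
Unshelve. all: by end_near. Qed.

End Omega.

Lemma cvg_near_eq (T : Type) (U : topologicalType) (F : set_system T) (FF : Filter F)
  (f g : T -> U) (l : U) : (\forall x \near F, f x = g x) -> g @ F --> l -> f @ F --> l.
Proof.
move=> E H A /H HA.
have {}HA : F (g @^-1` A) by exact: HA.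
have {}E : F [set x | f x = g x] by exact: E.
change (F (f @^-1` A)); apply: filterS (filterI E HA) => x [Ex gx].
by have {}Ex : f x = g x := Ex; rewrite /preimage /= Ex.
Qed.

Lemma cvg_congr (T : Type) (U : topologicalType) (F : set_system T) (f g : T -> U) (l l' : U) :
  (forall x, f x = g x) -> l = l' -> f @ F --> l -> g @ F --> l'.
Proof. by move=> /funext -> ->. Qed.

Section LinComb.
Variables (F : fieldType) (n : nat) (I : Type) (A : I -> 'M[F]_n).

Definition lincomb (s : seq (I * 'M[F]_n)) : 'M[F]_n := \sum_(p <- s) p.2 *m A p.1.

Lemma lincombM (B : 'M[F]_n) s : B *m lincomb s = lincomb [seq (p.1, B *m p.2) | p <- s].
Proof. by rewrite /lincomb mulmx_sumr big_map; apply: eq_bigr => p _; rewrite mulmxA. Qed.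

(** A left combination of maximal rank has every [A i] in its row space, since otherwise adding a
    multiple of [A i] would raise the rank. A column killed by this combination is then killed by
    all [A i], hence by [Q], and this puts the rows of [Q] in the same row space. *)
Lemma lincomb_span (Q : 'M[F]_n) :
  (forall l : 'cV[F]_n, (forall i, A i *m l = 0) -> Q *m l = 0) -> exists s, Q = lincomb s.
Proof.
move=> H.
pose P k := `[< exists s, \rank (lincomb s) = k >].
have eP : exists k, P k by exists (\rank (lincomb [::])); apply/asboolP; exists [::].
have bP k : P k -> (k <= n)%N by move=> /asboolP[s <-]; exact: rank_leq_col.
case: (ex_maxnP eP bP) => k /asboolP[s sk] kmax.
have sub i : (A i <= lincomb s)%MS.
  have /sub_addsmxP[[u v] /= E] : ((lincomb s + A i) <= (lincomb s + A i))%MS by [].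
  pose s' := (i, v) :: [seq (p.1, u *m p.2) | p <- s].
  have Es' : lincomb s' = (lincomb s + A i)%MS.
    by rewrite E /s' {1}/lincomb big_cons -/(lincomb _) -lincombM addrC.
  have : (\rank (lincomb s') <= k)%N by apply: kmax; apply/asboolP; exists s'.
  rewrite Es' -sk => rk.
  have /eqmxP e : (lincomb s == lincomb s + A i)%MS.
    by rewrite -(mxrank_leqif_eq (addsmxSl _ _)) eqn_leq rk mxrankS// addsmxSl.
  by rewrite e addsmxSr.
have : (Q <= lincomb s)%MS.
  rewrite submxE; apply/eqP/matrixP => a b.
  have : Q *m col b (cokermx (lincomb s)) = 0.
    apply: H => i; rewrite colE mulmxA.
    by have := sub i; rewrite submxE => /eqP->; rewrite mul0mx.
  have -> : Q *m col b (cokermx (lincomb s)) = col b (Q *m cokermx (lincomb s)).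
    by rewrite !colE mulmxA.
  by move/matrixP/(_ a 0); rewrite mxE [in RHS]mxE => ->; rewrite mxE.
move=> /submxP[D ->]; exists [seq (p.1, D *m p.2) | p <- s].
exact: lincombM.
Qed.

End LinComb.

(** * Continuity of the adjoint representation and derivatives of commutators *)

Section Adjoint.
Context {R : realType} {G : lieGroupType R}.
Local Notation n := (mdim G).

Lemma local_param_exists : exists kap kapi, @local_param R G kap kapi.
Proof.
have mG := @lie_mfd R G.
have [c Mc [c1 _]] := manifold_chart (1%g : G) mG; have [hc _] := Mc.
have en := @euclidean_manifold R n.
pose a := chart_to c 1%g.
have Ef : chart_from c (0 + a) = 1%g by rewrite add0r chart_toK.
have Si : smooth_at (fun u : 'rV[R]_n => u + a) 0.
  by apply/smooth_at_rV; apply: sm_D; [exact: sm_id|exact: sm_cst].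
have Si' : smooth_at (fun u : 'rV[R]_n => u - a) a.
  by apply/smooth_at_rV; apply: sm_D; [exact: sm_id|exact: sm_cst].
have ca : (fun u : 'rV[R]_n => u + a) @ (0 : 'rV[R]_n) --> a.
  by rewrite -[X in _ --> X]add0r; exact: Si.1.
exists (fun u => chart_from c (u + a)), (fun g => chart_to c g - a); split.
- exact: Ef.
- by rewrite /a subrr.
- apply: (smooth_at_comp en en mG (f := fun u : 'rV[R]_n => u + a)); first exact: Si.
  by rewrite add0r; apply: smooth_at_chart_from => //; exact: chart_img_to.
- apply: (smooth_at_comp mG en en (g := fun u : 'rV[R]_n => u - a)); last exact: Si'.
  exact: smooth_at_chart_to.
- split.
    have H : \forall u \near (0 : 'rV[R]_n), chart_img c (u + a).
      exact: ca _ (chart_img_nbhs hc c1).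
    by apply: filterS H => u /(chart_imgK hc)[_ ->]; rewrite addrK.
  by apply: filterS (chart_nbhs hc c1) => g cg; rewrite subrK chart_toK.
Qed.

Variables (kap : 'rV[R]_n -> G) (kapi : G -> 'rV[R]_n).
Hypothesis LP : local_param kap kapi.
Let k0 : kap 0 = 1%g. Proof. by case: LP. Qed.
Let ki1 : kapi 1%g = 0. Proof. by case: LP. Qed.
Let Sk : smooth_at kap 0. Proof. by case: LP. Qed.
Let Ski : smooth_at kapi 1%g. Proof. by case: LP. Qed.
Let kiK : \forall g \near (1%g : G), kap (kapi g) = g. Proof. by case: LP => _ _ _ _ []. Qed.
Let mG := @lie_mfd R G.
Let eu m := @euclidean_manifold R m.
Local Notation AD := (AD kap kapi).
Local Notation BL := (BL kap kapi).
Local Notation omega := (omega kapi).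

(** The partial Jacobian in [v] is a block of the full Jacobian, which depends continuously on the
    base point. This yields the continuity of [AD] and [BL] at 1. *)
Lemma partial_jacobian_cvg (Phi : 'rV[R]_(n + n) -> 'rV[R]_n) : sm Phi 0 ->
  (fun w : 'rV[R]_n => jacobian (fun v : 'rV[R]_n => Phi (row_mx w v)) 0) @ (0 : 'rV[R]_n)
    --> jacobian (fun v : 'rV[R]_n => Phi (row_mx (0 : 'rV[R]_n) v)) 0.
Proof.
move=> SPhi.
have Sr : sm (fun w : 'rV[R]_n => row_mx w (0 : 'rV[R]_n)) 0.
  by apply: sm_row_mx; [exact: sm_id|exact: sm_cst].
pose f (w : 'rV[R]_n) := (row_mx 0 1%:M : 'M[R]_(n, n + n)) *m jacobian Phi (row_mx w 0).
have Sf : sm f 0.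
  apply: sm_mulmx; first exact: sm_cst.
  apply: (@sm_comp _ _ _ _ _ (fun w : 'rV[R]_n => row_mx w (0 : 'rV[R]_n)) (jacobian Phi)) => //.
  by rewrite row_mx0; exact: sm_jacobian.
have cr : (fun w : 'rV[R]_n => row_mx w (0 : 'rV[R]_n)) @ (0 : 'rV[R]_n) --> (0 : 'rV[R]_(n + n)).
  by rewrite -[X in _ --> X](row_mx0 R 1 n n); exact: (sm_cont Sr).
have HS := cr _ (sm_near SPhi).
have E : \forall w \near (0 : 'rV[R]_n), jacobian (fun v : 'rV[R]_n => Phi (row_mx w v)) 0 = f w.
  near=> w.
  have Sw : sm Phi (row_mx w 0) by near: w; exact: HS.
  have Sv : sm (fun v : 'rV[R]_n => row_mx w v) 0 by apply: sm_row_mx; [exact: sm_cst|exact: sm_id].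
  rewrite /f -(jacobian_id (0 : 'rV[R]_n)) -(jacobian_cst w (0 : 'rV[R]_n)).
  rewrite -(jacobian_row_mx (sm_cst w _) (sm_id _)).
  by rewrite -(jacobian_comp (g := Phi) (sm_diff Sv) (sm_diff Sw)).
rewrite (nbhs_singleton E); exact: cvg_near_eq E (sm_cont Sf).
Unshelve. all: by end_near. Qed.

Let kapi_cvg : kapi @ (1%g : G) --> (0 : 'rV[R]_n).
Proof. by rewrite -ki1; exact: Ski.1. Qed.

Let Sl : smooth_at (fun w : 'rV[R]_(n + n) => kap (lsubmx w)) 0.
Proof.
apply: (smooth_at_comp (eu (n + n)) (eu n) mG (f := @lsubmx R 1 n n)); last by rewrite linear0.
by apply/smooth_at_rV; exact: sm_lsubmx.
Qed.

Let Sr : smooth_at (fun w : 'rV[R]_(n + n) => kap (rsubmx w)) 0.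
Proof.
apply: (smooth_at_comp (eu (n + n)) (eu n) mG (f := @rsubmx R 1 n n)); last by rewrite linear0.
by apply/smooth_at_rV; exact: sm_rsubmx.
Qed.

Lemma AD_cvg1 : AD @ (1%g : G) --> (1%:M : 'M[R]_n).
Proof.
pose Phi (w : 'rV[R]_(n + n)) := kapi (kap (rsubmx w) ^ kap (lsubmx w))%g.
have SPhi : sm Phi 0.
  apply: (sm_kapi1 LP); last by rewrite !linear0 !k0 conj1g.
  exact: (smooth_at_mulg (eu _) (smooth_at_invg (eu _) Sl) (smooth_at_mulg (eu _) Sr Sl)).
have c := partial_jacobian_cvg SPhi.
have E (w : 'rV[R]_n) : jacobian (fun v : 'rV[R]_n => Phi (row_mx w v)) 0 = AD (kap w).
  rewrite /AD (_ : (fun v => Phi (row_mx w v)) = (fun v => kapi (kap v ^ kap w)%g))//.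
  by apply/funext => v; rewrite /Phi row_mxKl row_mxKr.
have c' : (fun w : 'rV[R]_n => AD (kap w)) @ (0 : 'rV[R]_n) --> (1%:M : 'M[R]_n).
  by apply: (cvg_congr E _ c); rewrite E k0; exact: (AD1 LP).
have c2 := cvg_comp _ _ kapi_cvg c'.
by apply: cvg_near_eq c2; apply: filterS kiK => g /= ->.
Qed.

(** Multiplicativity transports continuity from 1 to every point. *)
Lemma AD_cont : continuous AD.
Proof.
move=> g.
have c1 : (fun x : G => (g^-1 * x)%g) @ g --> (1%g : G).
  by rewrite -[X in _ --> X](mulVg g); apply: cvg_mulg; [exact: cvg_cst|exact: cvg_id].
have c2 := cvg_comp _ _ c1 AD_cvg1.
have cm : (fun B : 'M[R]_n => AD g *m B) @ (1%:M : 'M[R]_n) --> AD g *m 1%:M.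
  by apply: (sm_cont (f := fun B : 'M[R]_n => AD g *m B)); apply: sm_mulmx; [exact: sm_cst|exact: sm_id].
have c3 := cvg_comp _ _ c2 cm.
rewrite /continuous_at -[X in _ --> X]mulmx1; apply: cvg_near_eq c3.
by near=> x; rewrite /= -(ADM LP) mulVKg.
Unshelve. all: by end_near. Qed.

Lemma BL_cvg1 : BL @ (1%g : G) --> (1%:M : 'M[R]_n).
Proof.
pose Phi (w : 'rV[R]_(n + n)) := kapi (kap (lsubmx w) * kap (rsubmx w))%g.
have SPhi : sm Phi 0 by exact: (sm_mul2 LP).
have c := partial_jacobian_cvg SPhi.
have E (w : 'rV[R]_n) : jacobian (fun v : 'rV[R]_n => Phi (row_mx w v)) 0 = BL (kap w).
  rewrite /BL (_ : (fun v => Phi (row_mx w v)) = (fun v => kapi (kap w * kap v)%g))//.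
  by apply/funext => v; rewrite /Phi row_mxKl row_mxKr.
have c' : (fun w : 'rV[R]_n => BL (kap w)) @ (0 : 'rV[R]_n) --> (1%:M : 'M[R]_n).
  by apply: (cvg_congr E _ c); rewrite E k0; exact: (BL1 LP).
have c2 := cvg_comp _ _ kapi_cvg c'.
by apply: cvg_near_eq c2; apply: filterS kiK => g /= ->.
Qed.

(** The commutator is [(phi w)^-1 * phi w ^ x]. The Leibniz rule gives two terms, and the adjoint
    factors of the first combine into that of the commutator itself. *)
Lemma omega_comm m (phi : 'rV[R]_m -> G) u x : smooth_at phi u ->
  omega (fun w => [~ phi w, x]%g) u = omega phi u *m (AD x - AD [~ phi u, x]%g).
Proof.
move=> S; have Si := smooth_at_invg (eu m) S; have Sx := smooth_at_conjg x (eu m) S.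
rewrite -[LHS]/(omega (fun w => ((phi w)^-1 * phi w ^ x)%g) u).
rewrite (omega_mul LP Si Sx) (omega_inv LP S) (omega_conj LP _ S).
by rewrite mulNmx -mulmxA -(ADM LP) addrC mulmxBr.
Qed.

Lemma smooth_at_comm m (phi : 'rV[R]_m -> G) u x : smooth_at phi u ->
  smooth_at (fun w => [~ phi w, x]%g) u.
Proof.
move=> S; exact: (smooth_at_mulg (eu m) (smooth_at_invg (eu m) S) (smooth_at_conjg x (eu m) S)).
Qed.

End Adjoint.

(** * The projection obtained by averaging the adjoint representation *)

Section MeanMatrix.
Context {R : realType} {G : lieGroupType R}.
Variables (M : (G -> R) -> R) (HM : right_mean M).

Lemma mean_sum (I : Type) (s : seq I) (f : I -> G -> R) : (forall i, continuous (f i)) ->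
  M (fun x => \sum_(i <- s) f i x) = \sum_(i <- s) M (f i) /\
  continuous (fun x => \sum_(i <- s) f i x).
Proof.
have [MD MZ MC _ _] := HM => cf; elim: s => [|i s [IH cs]].
  have -> : (fun x : G => \sum_(i <- [::]) f i x) = (fun=> 0) by apply/funext => x; rewrite big_nil.
  by rewrite MC big_nil; split=> // x; exact: cvg_cst.
have -> : (fun x : G => \sum_(j <- i :: s) f j x) = (fun x => f i x + \sum_(j <- s) f j x).
  by apply/funext => x; rewrite big_cons.
split; first by rewrite MD// big_cons IH.
by move=> x; apply: cvgD; [exact: cf|exact: cs].
Qed.

Definition mmean p q (F : G -> 'M[R]_(p, q)) : 'M[R]_(p, q) := \matrix_(i, j) M (fun x => F x i j).

Definition mcont p q (F : G -> 'M[R]_(p, q)) := forall i j, continuous (fun x => F x i j).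

Lemma mmean_mull m p q (A : 'M[R]_(m, p)) (F : G -> 'M[R]_(p, q)) : mcont F ->
  mmean (fun x => A *m F x) = A *m mmean F.
Proof.
have [MD MZ MC _ _] := HM => cF; apply/matrixP => i j; rewrite !mxE.
have c k : continuous (fun x => A i k * F x k j).
  by move=> x; apply: cvgM; [exact: cvg_cst|exact: cF].
rewrite (_ : (fun x => _) = (fun x => \sum_k A i k * F x k j)); last by apply/funext => x; rewrite mxE.
rewrite (mean_sum _ c).1; apply: eq_bigr => k _; rewrite MZ ?mxE//; exact: cF.
Qed.

Lemma mmean_mulr m p q (A : 'M[R]_(q, m)) (F : G -> 'M[R]_(p, q)) : mcont F ->
  mmean (fun x => F x *m A) = mmean F *m A.
Proof.
have [MD MZ MC _ _] := HM => cF; apply/matrixP => i j; rewrite !mxE.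
have c k : continuous (fun x => A k j * F x i k).
  by move=> x; apply: cvgM; [exact: cvg_cst|exact: cF].
rewrite (_ : (fun x => _) = (fun x => \sum_k A k j * F x i k)); last first.
  by apply/funext => x; rewrite mxE; apply: eq_bigr => k _; rewrite mulrC.
rewrite (mean_sum _ c).1; apply: eq_bigr => k _; rewrite MZ; last exact: cF.
by rewrite mxE mulrC.
Qed.

Lemma mmean_cst p q (A : 'M[R]_(p, q)) : mmean (fun=> A) = A.
Proof. by have [_ _ MC _ _] := HM; apply/matrixP => i j; rewrite mxE MC. Qed.

Lemma mmean_shift p q (F : G -> 'M[R]_(p, q)) h : mcont F ->
  mmean (fun x => F (x * h)%g) = mmean F.
Proof.
have [_ _ _ _ MS] := HM => cF; apply/matrixP => i j; rewrite !mxE.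
exact: (MS (fun x => F x i j)).
Qed.

Variables (kap : 'rV[R]_(mdim G) -> G) (kapi : G -> 'rV[R]_(mdim G)).
Hypothesis LP : local_param kap kapi.
Local Notation AD := (AD kap kapi).
Local Notation n := (mdim G).

(* Averaging Ad projects onto its fixed vectors, the Lie algebra of the center. *)
Definition fixproj : 'M[R]_n := mmean AD.
Local Notation P := fixproj.

Let cAD : mcont AD.
Proof. by move=> i j x; have /continuous_coordP := @AD_cont R G kap kapi LP x; apply. Qed.

Let cADV : mcont (fun x => AD (x^-1)%g).
Proof.
move=> i j x; apply: (@cvg_comp _ _ _ (fun x : G => x^-1)%g (fun x => AD x i j)); last exact: cAD.
by apply: cvg_invg; exact: cvg_id.
Qed.

Lemma fixproj_r h : P *m AD h = P.
Proof.
rewrite /P -(mmean_mulr (AD h) cAD) -[RHS](mmean_shift h cAD).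
by congr mmean; apply/funext => x; rewrite (ADM LP).
Qed.

(** The mean is invariant on the right only. The average [Q] of the inverses absorbs [AD h] on the
    left instead, and [P *m Q], computed in two ways, equals both [Q] and [P]. *)
Lemma fixproj_l h : AD h *m P = P.
Proof.
pose Q := mmean (fun x => AD (x^-1)%g).
have Ql g : AD g *m Q = Q.
  rewrite /Q -(mmean_mull (AD g) cADV) -[RHS](mmean_shift (g^-1)%g cADV).
  by congr mmean; apply/funext => x; rewrite -(ADM LP) invgF.
have PQ : P *m Q = Q.
  rewrite /P -(mmean_mulr Q cAD) -[RHS]mmean_cst.
  by congr mmean; apply/funext.
have QP : P *m Q = P.
  rewrite /Q -(mmean_mull P cADV).
  have -> : (fun x => P *m AD (x^-1)%g) = (fun=> P) by apply/funext => x; exact: fixproj_r.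
  exact: mmean_cst.
have <- : Q = P := etrans (esym PQ) QP.
exact: Ql.
Qed.

Lemma fixproj_id : P *m P = P.
Proof.
rewrite {2}/P -(mmean_mull P cAD).
have -> : (fun x => P *m AD x) = (fun=> P) by apply/funext => x; exact: fixproj_r.
exact: mmean_cst.
Qed.

Lemma fixproj_fixr q (l : 'M[R]_(n, q)) : (forall g, (AD g - 1%:M) *m l = 0) -> (1%:M - P) *m l = 0.
Proof.
move=> H; rewrite mulmxBl mul1mx /P -(mmean_mulr l cAD) -[X in X - _]mmean_cst.
apply/eqP; rewrite subr_eq0; apply/eqP; congr mmean; apply/funext => x.
by apply/esym/eqP; rewrite -subr_eq0 -{2}[l]mul1mx -mulmxBl H.
Qed.

Lemma fixproj_fixl q (l : 'M[R]_(q, n)) : (forall g, l *m (AD g - 1%:M) = 0) -> l *m (1%:M - P) = 0.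
Proof.
move=> H; rewrite mulmxBr mulmx1 /P -(mmean_mull l cAD) -[X in X - _]mmean_cst.
apply/eqP; rewrite subr_eq0; apply/eqP; congr mmean; apply/funext => x.
by apply/esym/eqP; rewrite -subr_eq0 -{2}[l]mulmx1 -mulmxBr H.
Qed.

(** A column fixed by every [AD g] is fixed by their average, so [1 - P] kills it and [lincomb_span]
    applies. This form produces products of commutators filling the complement of the center; the
    transposed form [span_cols] produces the equations of the center. *)
Lemma span_rows : exists s : seq (G * 'M[R]_n),
  \sum_(p <- s) p.2 *m (AD p.1 - 1%:M) = 1%:M - P.
Proof.
have [l Hl|s Es] := @lincomb_span R n G (fun g => AD g - 1%:M) (1%:M - P).
  exact: fixproj_fixr.
by exists s; rewrite Es.
Qed.

Lemma span_cols : exists s : seq (G * 'M[R]_n),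
  \sum_(p <- s) (AD p.1 - 1%:M) *m p.2 = 1%:M - P.
Proof.
have [l Hl|s Es] := @lincomb_span R n G (fun g => (AD g - 1%:M)^T) (1%:M - P)^T.
  rewrite -[l]trmxK -trmx_mul fixproj_fixl ?trmx0// => g.
  by rewrite -[AD g - _]trmxK -trmx_mul Hl trmx0.
exists [seq (p.1, p.2^T) | p <- s]; rewrite big_map /=.
rewrite -[RHS]trmxK Es /lincomb raddf_sum; apply: eq_bigr => p _.
by rewrite /= trmx_mul trmxK.
Qed.

End MeanMatrix.

(** * The center near the identity *)

(** An idempotent splits through its range: the rows of [B] are a basis of the range, and [C] gives
    the coordinates of the projection in that basis. *)
Lemma idem_factor (F : fieldType) n (P : 'M[F]_n) : P *m P = P ->
  exists (C : 'M[F]_(n, \rank P)) (B : 'M[F]_(\rank P, n)), C *m B = P /\ B *m C = 1%:M.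
Proof.
move=> PP; exists (P *m pinvmx (row_base P)), (row_base P).
have E : P *m pinvmx (row_base P) *m row_base P = P by rewrite mulmxKpV// eq_row_base.
split=> //; apply: (row_free_inj (row_base_free P)).
rewrite -mulmxA E mul1mx; have : (row_base P <= P)%MS by rewrite eq_row_base.
by move=> /submxP[D ->]; rewrite -mulmxA PP.
Qed.

Lemma comm_eq1 (G : groupType) (x y : G) : [~ x, y]%g = 1%g -> commute x y.
Proof.
move=> H; have E : (x ^ y)%g = x by rewrite -[RHS]mulg1 -H commgEl mulVKg.
by rewrite /commute -{2}E conjgE mulVKg.
Qed.

Lemma central_comm (G : groupType) (x y : G) : center_subgroup G x -> [~ x, y]%g = 1%g.
Proof. by move=> /(_ y) c; rewrite commgEl conjgE c mulKg mulVg. Qed.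

Lemma continuous_mulmx (R : realType) (T : topologicalType) m n p (f : T -> 'M[R]_(m, n))
  (g : T -> 'M[R]_(n, p)) x : {for x, continuous f} -> {for x, continuous g} ->
  {for x, continuous (fun y => f y *m g y)}.
Proof.
move=> /continuous_coordP cf /continuous_coordP cg; apply/continuous_coordP => i j.
have -> : (fun y => (f y *m g y) i j) = (fun y => \sum_k f y i k * g y k j).
  by apply/funext => y; rewrite mxE.
apply: cvg_big => [|k _]; first exact: add_continuous.
exact: (cvgM (cf i k) (cg k j)).
Qed.

Lemma near_norm (R : realType) n (x0 : 'rV[R]_n) (d : R) : 0 < d -> \forall x \near x0, `|x0 - x| < d.
Proof.
move=> d0; have : nbhs x0 (ball x0 d) by exact: nbhsx_ballx.
by rewrite -ball_normE.
Qed.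

Section CenterLocal.
Context {R : realType} {G : lieGroupType R}.
Local Notation n := (mdim G).
Variables (kap : 'rV[R]_n -> G) (kapi : G -> 'rV[R]_n).
Hypothesis LP : local_param kap kapi.
Let k0 : kap 0 = 1%g. Proof. by case: LP. Qed.
Let ki1 : kapi 1%g = 0. Proof. by case: LP. Qed.
Let Sk : smooth_at kap 0. Proof. by case: LP. Qed.
Let Ski : smooth_at kapi 1%g. Proof. by case: LP. Qed.
Let kiK : \forall g \near (1%g : G), kap (kapi g) = g. Proof. by case: LP => _ _ _ _ []. Qed.
Let mG := @lie_mfd R G.
Let eu m := @euclidean_manifold R m.
Local Notation AD := (AD kap kapi).
Local Notation BL := (BL kap kapi).
Local Notation omega := (omega kapi).

Variables (P : 'M[R]_n) (s : seq (G * 'M[R]_n)).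
Hypothesis PP : P *m P = P.
Hypothesis PAD : forall h, P *m AD h = P.
Let N (p : G * 'M[R]_n) := p.2 *m (1%:M - P).
Hypothesis sE : \sum_(p <- s) (AD p.1 - 1%:M) *m N p = 1%:M - P.

(* By the choice of s, the differential of center_coord at 1 is the identity;
   on the center it equals [kapi g *m P]. *)
Definition center_coord (g : G) : 'rV[R]_n := kapi g *m P + \sum_(p <- s) kapi [~ g, p.1]%g *m N p.
Local Notation Th := center_coord.

(** The share of the commutator terms in the derivative of [center_coord], once [omega phi u] is
    factored out on the left. *)
Let EE (g : G) : 'M[R]_n := \sum_(p <- s) (AD p.1 - AD [~ g, p.1]%g) *m BL [~ g, p.1]%g *m N p.

Definition comm_regular (g : G) := smooth_at kapi g /\ forall p, List.In p s -> smooth_at kapi [~ g, p.1]%g.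

Lemma cvg_comm1 (x : G) : (fun g : G => [~ g, x]%g) @ (1%g : G) --> (1%g : G).
Proof.
have c : (fun g : G => (g^-1 * (x^-1 * (g * x)))%g) @ (1%g : G) --> (1%g^-1 * (x^-1 * (1%g * x)))%g.
  apply: cvg_mulg; first by apply: cvg_invg; exact: cvg_id.
  by apply: cvg_mulg; [exact: cvg_cst|apply: cvg_mulg; [exact: cvg_id|exact: cvg_cst]].
apply: (cvg_congr _ _ c) => [g|]; first by rewrite commgEl conjgE.
by rewrite mul1g mulVg mulg1 invg1.
Qed.

Lemma near_comm_regular : \forall g \near (1%g : G), comm_regular g.
Proof.
have H := smooth_at_near mG (eu n) Ski.
suff : \forall g \near (1%g : G), forall p, List.In p s -> smooth_at kapi [~ g, p.1]%g.
  by move=> H2; near=> g; split; [near: g; exact: H|near: g; exact: H2].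
elim: s => [|p s' IH]; first by near=> g.
have Hp : \forall g \near (1%g : G), smooth_at kapi [~ g, p.1]%g by exact: (cvg_comm1 p.1 H).
near=> g => q [<-|qs]; first by near: g; exact: Hp.
have : forall p, List.In p s' -> smooth_at kapi [~ g, p.1]%g by near: g; exact: IH.
by apply.
Unshelve. all: by end_near. Qed.

Lemma sm_jac_center_coord m (phi : 'rV[R]_m -> G) u : smooth_at phi u -> comm_regular (phi u) ->
  sm (Th \o phi) u /\ jacobian (Th \o phi) u = omega phi u *m (BL (phi u) *m P + EE (phi u)).
Proof.
move=> S [S1 S2].
have H r : (forall p, List.In p r -> smooth_at kapi [~ phi u, p.1]%g) ->
  sm (fun w => \sum_(p <- r) kapi [~ phi w, p.1]%g *m N p) u /\
  jacobian (fun w => \sum_(p <- r) kapi [~ phi w, p.1]%g *m N p) u =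
  \sum_(p <- r) omega phi u *m ((AD p.1 - AD [~ phi u, p.1]%g) *m BL [~ phi u, p.1]%g *m N p).
  elim: r => [|p r IH] Hr.
    have -> : (fun w => \sum_(p <- [::]) kapi [~ phi w, p.1]%g *m N p) = (fun=> 0).
      by apply/funext => w; rewrite big_nil.
    by split; [exact: sm_cst|rewrite big_nil jacobian_cst].
  have [IH1 IH2] : _ /\ _ := IH (fun q qr => Hr q (or_intror qr)).
  have Sp : smooth_at kapi [~ phi u, p.1]%g by apply: Hr; left.
  have Sc := smooth_at_comm p.1 S.
  have Sf : sm (fun w => kapi [~ phi w, p.1]%g) u by exact: (sm_kapi (phi := fun w => [~ phi w, p.1]%g) Sc Sp).
  have SfN : sm (fun w => kapi [~ phi w, p.1]%g *m N p) u by apply: sm_mulmx => //; exact: sm_cst.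
  have -> : (fun w => \sum_(q <- p :: r) kapi [~ phi w, q.1]%g *m N q) =
      (fun w => kapi [~ phi w, p.1]%g *m N p + \sum_(q <- r) kapi [~ phi w, q.1]%g *m N q).
    by apply/funext => w; rewrite big_cons.
  split; first exact: sm_D.
  rewrite (jacobianD (sm_diff SfN) (sm_diff IH1)) IH2 big_cons; congr (_ + _).
  rewrite (jacobian_mulmxr _ (sm_diff Sf)).
  rewrite (jac_kapi LP (phi := fun w => [~ phi w, p.1]%g) Sc Sp) (omega_comm LP p.1 S).
  by rewrite !mulmxA.
have [H1 H2] := H s S2.
have Sf : sm (fun w => kapi (phi w)) u by exact: sm_kapi.
have SfP : sm (fun w => kapi (phi w) *m P) u by apply: sm_mulmx => //; exact: sm_cst.
split; first exact: (sm_D SfP H1).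
rewrite -[LHS]/(jacobian (fun w => kapi (phi w) *m P + \sum_(p <- s) kapi [~ phi w, p.1]%g *m N p) u).
rewrite (jacobianD (sm_diff SfP) (sm_diff H1)) H2 mulmxDr; congr (_ + _).
  by rewrite (jacobian_mulmxr _ (sm_diff Sf)) (jac_kapi LP S S1) mulmxA.
by rewrite mulmx_sumr.
Qed.

Lemma EE1 : EE 1%g = 1%:M - P.
Proof.
rewrite -sE /EE; apply: eq_bigr => p _.
by rewrite comm1g (AD1 LP) (BL1 LP) mulmx1.
Qed.

Lemma P_EE g : P *m EE g = 0.
Proof.
have E x y : P *m (AD x - AD y) = 0.
  by move: (AD x) (AD y) (PAD x) (PAD y) => A B EA EB; rewrite mulmxBr EA EB subrr.
rewrite /EE mulmx_sumr big1// => p _; move: (N p) => Np.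
by rewrite -mulmxA mulmxA E mul0mx.
Qed.

Lemma EE_cvg : EE @ (1%g : G) --> (1%:M - P).
Proof.
rewrite -EE1 /EE.
elim: s => [|p r IH].
  by apply: (cvg_congr _ _ (cvg_cst (0 : 'M[R]_n))) => [g|]; rewrite big_nil.
have E1 : [~ 1%g, p.1]%g = 1%g by exact: comm1g.
have c1 : {for 1%g, continuous (fun g : G => AD [~ g, p.1]%g)}.
  rewrite /prop_for /continuous_at E1.
  exact: (cvg_comp _ _ (cvg_comm1 p.1) (AD_cont LP (x := 1%g))).
have c2 : {for 1%g, continuous (fun g : G => BL [~ g, p.1]%g)}.
  rewrite /prop_for /continuous_at E1 (BL1 LP).
  exact: (cvg_comp _ _ (cvg_comm1 p.1) (BL_cvg1 LP)).
have c3 : {for 1%g, continuous (fun g : G => AD p.1 - AD [~ g, p.1]%g)}.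
  by apply: cvgB; [exact: cvg_cst|exact: c1].
have cN : {for 1%g, continuous (fun _ : G => N p)} by exact: cvg_cst.
have c4 := continuous_mulmx (continuous_mulmx c3 c2) cN.
apply: (cvg_congr _ _ (cvgD c4 IH)) => [g|]; first by rewrite big_cons.
by rewrite big_cons.
Qed.


Lemma near_unit : \forall g \near (1%g : G), EE g + P \in unitmx.
Proof.
have c : (fun g => \det (EE g + P)) @ (1%g : G) --> (1 : R).
  have c1 : (fun g => EE g + P) @ (1%g : G) --> (1%:M : 'M[R]_n).
    by rewrite -[X in _ --> X](subrK P); apply: cvgD; [exact: EE_cvg|exact: cvg_cst].
  have c2 : (fun A : 'M[R]_n => \det A) @ (1%:M : 'M[R]_n) --> (1 : R).
    rewrite -[X in _ --> X](det1 _ n).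
    have C : Ck_on 0 setT (fun A : 'M[R]_n => \det A).
      by apply: (@Ck_on_det R _ 0 n setT id openT) => A _; exact: cvg_id.
    exact: C.
  exact: (cvg_comp _ _ c1 c2).
have H : \forall g \near (1%g : G), \det (EE g + P) != 0 by exact: (cvgr_neq0 _ c (oner_neq0 _)).
by apply: filterS H => g; rewrite unitmxE unitfE.
Qed.

(* The velocity of a curve with center_coord in the range of P is killed by EE,
   and EE vanishes only on the range of P near 1, because [P *m EE = 0] and
   [EE 1 = 1 - P].  Such a curve is therefore central. *)
Lemma omega_central m (phi : 'rV[R]_m -> G) u (B : 'M[R]_(m, n)) :
  smooth_at phi u -> comm_regular (phi u) -> EE (phi u) + P \in unitmx ->
  B *m P = B -> (\forall w \near u, Th (phi w) = w *m B) ->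
  omega phi u *m P = omega phi u.
Proof.
move=> S Sr Eu BP H; have [S1 J1] := sm_jac_center_coord S Sr.
have J2 : jacobian (Th \o phi) u = B.
  rewrite -(jacobian_lin B u); apply: near_eq_jacobian; first exact: H.
  exact: sm_diff.
have : omega phi u *m EE (phi u) = 0.
  have : jacobian (Th \o phi) u *m (1%:M - P) = 0.
    by rewrite J2 mulmxBr mulmx1 BP subrr.
  rewrite J1 mulmxDr mulmxDl -!mulmxA.
  have -> : P *m (1%:M - P) = 0 by rewrite mulmxBr mulmx1 PP subrr.
  rewrite !mulmx0 add0r.
  suff -> : EE (phi u) *m (1%:M - P) = EE (phi u) by [].
  rewrite mulmx_suml; apply: eq_bigr => p _; rewrite -mulmxA; congr (_ *m _).
  by rewrite /N -mulmxA mulmxBr mulmx1 mulmxBl mul1mx PP subrr subr0.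
move: (omega phi u) (P_EE (phi u)) Eu; move: (EE (phi u)) => E w PE Eu wE.
have : (w - w *m P) *m (E + P) = 0.
  by rewrite mulmxBl !mulmxDr wE add0r -!mulmxA PE mulmx0 add0r PP subrr.
move=> /(congr1 (mulmxr (invmx (E + P)))) /=; rewrite mulmxK// mul0mx => /eqP.
by rewrite subr_eq0 => /eqP <-.
Qed.

Lemma center_coord1 : Th 1%g = 0.
Proof.
rewrite /center_coord ki1 mul0mx add0r big1// => p _.
by rewrite comm1g ki1 mul0mx.
Qed.

Lemma center_coord_central g : center_subgroup G g -> Th g = kapi g *m P.
Proof.
move=> c; rewrite /center_coord big1 ?addr0// => p _.
by rewrite central_comm// ki1 mul0mx.
Qed.

Lemma smooth_at_center_coord : smooth_at Th 1%g.
Proof.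
have Sg (x : G) : smooth_at (fun g : G => kapi [~ g, x]%g) 1%g.
  apply: (smooth_at_comp mG mG (eu n) (f := fun g : G => [~ g, x]%g)); last by rewrite comm1g.
  exact: (smooth_at_mulg mG (smooth_at_invg mG (smooth_at_id _ mG))
    (smooth_at_conjg x mG (smooth_at_id _ mG))).
have SD (f g : G -> 'rV[R]_n) : smooth_at f 1%g -> smooth_at g 1%g -> smooth_at (fun x => f x + g x) 1%g.
  move=> Sf Sg'; have Sp := smooth_at_pair (eu n) (eu n) mG Sf Sg'.
  split; first by apply: cvgD; [exact: Sf.1|exact: Sg'.1].
  have [c Mc [c1 Ac]] := manifold_chart (1%g : G) mG.
  exists c, (Chart setT id id); split=> //.
  apply: (sm_D (f := f \o chart_from c) (g := g \o chart_from c)).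
    exact: (smooth_at_to_rv mG Mc c1 Sf).
  exact: (smooth_at_to_rv mG Mc c1 Sg').
have SM (f : G -> 'rV[R]_n) (A : 'M[R]_n) : smooth_at f 1%g -> smooth_at (fun x => f x *m A) 1%g.
  move=> Sf; apply: (smooth_at_comp mG (eu n) (eu n) (g := fun v : 'rV[R]_n => v *m A) Sf).
  by apply/smooth_at_rV; apply: sm_mulmx; [exact: sm_id|exact: sm_cst].
apply: (SD); first exact: SM.
elim: s => [|p r IH].
  have -> : (fun g => \sum_(p <- [::]) kapi [~ g, p.1]%g *m N p) = (fun=> 0).
    by apply/funext => g; rewrite big_nil.
  exact: (smooth_at_cst _ _ mG (eu n)).
have -> : (fun g => \sum_(q <- p :: r) kapi [~ g, q.1]%g *m N q) =
    (fun g => kapi [~ g, p.1]%g *m N p + \sum_(q <- r) kapi [~ g, q.1]%g *m N q).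
  by apply/funext => g; rewrite big_cons.
exact: (SD _ _ (SM _ (N p) (Sg p.1)) IH).
Qed.

(** Near 1 [center_coord] is a chart, and [z] parametrizes the preimage of the range of [P]. Central
    elements lie there, their commutators being 1. Conversely [omega_central] and [PAD] make the
    derivative of [[~ z t, y]] vanish, so this commutator keeps along rays the value 1 that it has
    at 0. *)
Theorem center_local r (C : 'M[R]_(n, r)) (B : 'M[R]_(r, n)) : C *m B = P -> B *m C = 1%:M ->
  exists (z : 'rV[R]_r -> G) (theta : G -> 'rV[R]_r),
  [/\ smooth_at z 0, z 0 = 1%g, smooth_at theta 1%g, theta 1%g = 0 &
  [/\ \forall t \near (0 : 'rV[R]_r), theta (z t) = t,
      \forall t \near (0 : 'rV[R]_r), center_subgroup G (z t),
      \forall g \near (1%g : G), center_subgroup G g -> z (theta g) = g &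
      omega z 0 = B]].
Proof.
move=> CB BC.
have BP : B *m P = B by rewrite -CB mulmxA BC mul1mx.
have reg1 := nbhs_singleton near_comm_regular.
have regk : comm_regular (kap 0) by rewrite k0.
have [STk JTk] := sm_jac_center_coord Sk regk.
have JTk1 : jacobian (Th \o kap) 0 = 1%:M.
  by rewrite JTk k0 EE1 (BL1 LP) mul1mx addrC subrK mulmx1; exact: (omega_kap LP).
have [g0 [Sg0 g00 K1 K2]] : exists g : 'rV[R]_n -> 'rV[R]_n,
  [/\ sm g (Th (kap 0)), g (Th (kap 0)) = 0, \forall y \near Th (kap 0), Th (kap (g y)) = y &
      \forall x \near (0 : 'rV[R]_n), g (Th (kap x)) = x].
  by apply: (inverse_function STk); rewrite JTk1 unitmx1.
rewrite k0 center_coord1 in Sg0 g00 K1.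
have SB : sm (fun t : 'rV[R]_r => t *m B) 0 by apply: sm_mulmx; [exact: sm_id|exact: sm_cst].
have cB : (fun t : 'rV[R]_r => t *m B) @ (0 : 'rV[R]_r) --> (0 : 'rV[R]_n).
  by rewrite -[X in _ --> X](mul0mx _ B); exact: (sm_cont SB).
pose z (t : 'rV[R]_r) := kap (g0 (t *m B)); pose theta g := Th g *m C.
have z0 : z 0 = 1%g by rewrite /z mul0mx g00 k0.
have Sz : smooth_at z 0.
  apply: (smooth_at_comp (eu r) (eu n) mG (f := fun t : 'rV[R]_r => g0 (t *m B))); last by rewrite mul0mx g00.
  apply/smooth_at_rV.
  by apply: (@sm_comp _ _ _ _ _ (fun t : 'rV[R]_r => t *m B) g0) => //; rewrite mul0mx.
have HTz : \forall t \near (0 : 'rV[R]_r), Th (z t) = t *m B by exact: (cB _ K1).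
have cz : z @ (0 : 'rV[R]_r) --> (1%g : G) by rewrite -z0; exact: Sz.1.
have Wz : \forall t \near (0 : 'rV[R]_r), smooth_at z t /\ omega z t *m P = omega z t.
  have H1 := smooth_at_near (eu r) mG Sz.
  have H2 : \forall t \near (0 : 'rV[R]_r), comm_regular (z t) by exact: (cz _ near_comm_regular).
  have H3 : \forall t \near (0 : 'rV[R]_r), EE (z t) + P \in unitmx by exact: (cz _ near_unit).
  have H4 : \forall t \near (0 : 'rV[R]_r), \forall t' \near t, Th (z t') = t' *m B.
    by apply/near_join.
  near=> t.
  have S : smooth_at z t by near: t; exact: H1.
  split; first exact: S.
  apply: (@omega_central _ _ _ B); [exact: S| | |exact: BP|].
  - by near: t; exact: H2.
  - by near: t; exact: H3.
  - by near: t; exact: H4.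
exists z, theta; split.
- exact: Sz.
- exact: z0.
- apply: (smooth_at_comp mG (eu n) (eu r) (g := fun v : 'rV[R]_n => v *m C) smooth_at_center_coord).
  by apply/smooth_at_rV; apply: sm_mulmx; [exact: sm_id|exact: sm_cst].
- by rewrite /theta center_coord1 mul0mx.
- split.
  + by apply: filterS HTz => t E; rewrite /theta E -mulmxA BC mulmx1.
  + have [d d0 Hd] := near_norm_lt Wz.
    have Hb := near_norm (0 : 'rV[R]_r) d0.
    apply: filterS Hb => t td y.
    apply: comm_eq1.
    pose f (a : R) := [~ z (a *: t), y]%g.
    have -> : 1%g = f 0 by rewrite /f scale0r z0 comm1g.
    have -> : [~ z t, y]%g = f 1 by rewrite /f scale1r.
    apply: loc_const_segment => a /andP[a0 a1].
    pose phi (w : 'rV[R]_r) := [~ z w, y]%g.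
    have ad : `|0 - a *: t| < d.
      rewrite sub0r normrN normrZ ger0_norm//; move: td; rewrite sub0r normrN => td.
      by apply: le_lt_trans td; rewrite ler_piMl.
    have Sphi : smooth_at phi (a *: t) by apply: smooth_at_comm; exact: (Hd _ ad).1.
    have H0 : \forall w \near (a *: t : 'rV[R]_r), phi w = phi (a *: t).
      apply: (omega0_const LP Sphi).
      have e0 : 0 < d - `|0 - a *: t| by rewrite subr_gt0.
      have H1 : \forall w \near (a *: t : 'rV[R]_r), `|0 - w| < d.
        apply: filterS (near_norm (a *: t : 'rV[R]_r) e0) => w.
        rewrite ltrBrDl; apply: le_lt_trans.
        by rewrite -{1}[0 - w](subrKA (a *: t)) ler_normD.
      apply: filterS H1 => w /Hd[Sw Pw].
      rewrite (omega_comm LP y Sw) -Pw -mulmxA.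
      have -> : P *m (AD y - AD [~ z w, y]%g) = 0; last by rewrite mulmx0.
      move: (AD y) (AD [~ z w, y]%g) (PAD y) (PAD [~ z w, y]%g) => A1 A2 E1 E2.
      by rewrite mulmxBr E1 E2 subrr.
    have c : (fun a' : R => a' *: t) @ a --> a *: t by apply: cvgZr_tmp; exact: cvg_id.
    exact: (c _ H0).
  + have H1 : \forall g \near (1%g : G), g0 (Th (kap (kapi g))) = kapi g.
      have c : kapi @ (1%g : G) --> (0 : 'rV[R]_n) by rewrite -ki1; exact: Ski.1.
      exact: (c _ K2).
    near=> g => cg; rewrite /z /theta -mulmxA CB.
    have Eg : kap (kapi g) = g by near: g; exact: kiK.
    have -> : Th g *m P = Th g by rewrite (center_coord_central cg) -mulmxA PP.
    rewrite -{1}Eg; have -> : g0 (Th (kap (kapi g))) = kapi g by near: g; exact: H1.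
    exact: Eg.
  + have regz : comm_regular (z 0) by rewrite z0.
    have [S1 J1] := sm_jac_center_coord Sz regz.
    have J2 : jacobian (Th \o z) 0 = B.
      rewrite -(jacobian_lin B 0); apply: near_eq_jacobian; first exact: HTz.
      exact: sm_diff.
    by move: J1; rewrite J2 z0 EE1 (BL1 LP) mul1mx addrC subrK mulmx1 => <-.
Unshelve. all: by end_near. Qed.

End CenterLocal.

(** * Logarithm and exponential of the center *)

Section TaylorEstimates.
Context {R : realType}.

Lemma geometric_cvg (u : nat -> R) (K t : R) : 0 <= t < 1 ->
  (forall n, `|u n.+1 - u n| <= K * t ^+ n) -> cvgn u.
Proof.
move=> /andP[t0 t1] H.
have K0 : 0 <= K by have := le_trans (normr_ge0 _) (H 0%N); rewrite expr0 mulr1.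
have : cvgn (series (telescope u)).
  apply: (@normed_cvg R R^o); apply: (@series_le_cvg R _ (geometric K t)) => [n|n|n|].
  - exact: normr_ge0.
  - by rewrite /geometric /= mulr_ge0// exprn_ge0.
  - exact: H.
  - by apply: is_cvg_geometric_series; rewrite ger0_norm.
rewrite telescopeK => /cvg_ex[l Hl]; apply/cvg_ex; exists (l + u 0%N).
apply: (cvg_congr _ erefl (cvgD Hl (cvg_cst (u 0%N)))) => n.
by rewrite /= subrK.
Qed.

Lemma sm_lipschitz0 m n (h : 'rV[R]_m -> 'rV[R]_n) : sm h 0 ->
  exists2 K : R, 0 <= K & \forall x \near (0 : 'rV[R]_m), `|h x - h 0| <= K * `|x|.
Proof.
move=> Sh; have [_ /(_ (conj (sm_diff Sh) erefl)) H] := diff_epsP h (jacobian h 0) 0.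
exists (1 + m%:R * `|jacobian h 0|); first by rewrite addr_ge0// mulr_ge0.
apply: filterS (H 1 ltr01) => x; rewrite addr0 mul1r => Hx.
rewrite -[h x - h 0](subrK (x *m jacobian h 0)); apply: (le_trans (ler_normD _ _)).
by rewrite mulrDl mul1r; apply: lerD => //; exact: mulmx_norm_le.
Qed.

Lemma sm_mxvec (V : normedModType R) m n (F : V -> 'M[R]_(m, n)) x : sm F x -> sm (fun y => mxvec (F y)) x.
Proof.
move=> /sm_mxP SF; apply/sm_mxP => i j; rewrite ord1; case/mxvec_indexP: j => a b.
apply: (@sm_eq _ _ _ (fun y => F y a b)); last exact: SF.
by near=> y; rewrite mxvecE.
Unshelve. all: by end_near. Qed.

(** The Jacobian of [f y - y *m J] is O(|y|), as the Jacobian of [f] is itself smooth. The mean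
    value bound on a ball of radius 2|x|, which contains [x] strictly, supplies the second factor
    |x|. *)
Lemma taylor2 m n (f : 'rV[R]_m -> 'rV[R]_n) : sm f 0 ->
  exists2 C : R, 0 <= C & \forall x \near (0 : 'rV[R]_m),
    `|f x - f 0 - x *m jacobian f 0| <= C * `|x| ^+ 2.
Proof.
move=> Sf; have [K K0 HK] := sm_lipschitz0 (sm_mxvec (sm_jacobian Sf)).
pose J := jacobian f 0; rewrite -/J in HK *.
have [d d0 Hd] : exists2 d : R, 0 < d & forall y : 'rV[R]_m, `|0 - y| < d ->
    sm f y /\ `|jacobian f y - J| <= K * `|y|.
  have HS := sm_near Sf.
  apply: near_norm_lt; near=> y; split; first by near: y; exact: HS.
  have HKy : `|mxvec (jacobian f y) - mxvec J| <= K * `|y| by near: y; exact: HK.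
  apply: rv_norm_le => [|i j]; first by rewrite mulr_ge0.
  apply: le_trans HKy; move: (jacobian f y) (J) => A B.
  by rewrite -mxvecE linearB; exact: rv_coord_le.
exists (m%:R * (K * 2)); first by rewrite !mulr_ge0.
have d2 : 0 < d / 2 by rewrite divr_gt0.
apply: filterS (near_norm (0 : 'rV[R]_m) d2) => x; rewrite sub0r normrN => Hx.
have [->|xn0] := eqVneq x 0; first by rewrite subrr mul0mx subr0 normr0 mulr_ge0// ?exprn_ge0// !mulr_ge0.
have x0 : 0 < `|x| by rewrite normr_gt0.
pose g (y : 'rV[R]_m) := f y - y *m J.
have inb y : ball (0 : 'rV[R]_m) (2 * `|x|) y -> `|y| <= 2 * `|x| /\ `|0 - y| < d.
  rewrite -ball_normE /= sub0r normrN => Hy; split; first exact: ltW.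
  by apply: lt_trans Hy _; move: Hx; lra.
have dg y : ball (0 : 'rV[R]_m) (2 * `|x|) y -> differentiable g y /\ jacobian g y = jacobian f y - J.
  move=> /inb[_ /Hd[Sy _]].
  have Sl : sm (fun y : 'rV[R]_m => (- y) *m J) y.
    apply: sm_mulmx; last exact: sm_cst.
    apply: (@sm_eq _ _ _ (fun y : 'rV[R]_m => y *m (- 1%:M))); last by apply: sm_mulmx; [exact: sm_id|exact: sm_cst].
    by near=> w; rewrite mulmxN mulmx1.
  have Eg : g = (fun y => f y + (- y) *m J) by apply/funext => w; rewrite /g mulNmx.
  rewrite Eg; split; first exact: sm_diff (sm_D Sy Sl).
  rewrite (jacobianD (sm_diff Sy) (sm_diff Sl)); congr (_ + _).
  rewrite -[RHS](jacobian_lin (- J) y); congr jacobian.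
  by apply/funext => w; rewrite /= mulmxN mulNmx.
have := @lipschitz_of_diff R m n g 0 (2 * `|x|) (m%:R * (K * (2 * `|x|))) _ _ _ 0 x.
have -> : g 0 = f 0 by rewrite /g mul0mx subr0.
rewrite subr0 (_ : g x - f 0 = f x - f 0 - x *m J); last by rewrite /g addrAC.
have -> : m%:R * (K * 2) * `|x| ^+ 2 = m%:R * (K * (2 * `|x|)) * `|x| by ring.
apply.
- by rewrite !mulr_ge0.
- by move=> y /dg[].
- move=> y v By; have [_ ->] := dg y By; have [yx /Hd[_ Hy]] := inb y By.
  apply: (le_trans (mulmx_norm_le _ _)); apply: ler_wpM2r => //.
  apply: ler_wpM2l => //; apply: (le_trans Hy); exact: ler_wpM2l.
- by apply: ballxx; rewrite mulr_gt0.
- by rewrite -ball_normE /= sub0r normrN; lra.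
Unshelve. all: by end_near. Qed.

Lemma sm_of_jacobian m n (f : 'rV[R]_m -> 'rV[R]_n) (J : 'rV[R]_m -> 'M[R]_(m, n)) x : sm J x ->
  (\forall y \near x, differentiable f y /\ jacobian f y = J y) -> sm f x.
Proof.
move=> [U oU SJ] /near_open[W oW HW]; exists (U `&` W); first exact: open_nbhsI'.
have oUW : open (U `&` W) by apply: openI; [exact: oU.1|exact: oW.1].
have df y : (U `&` W) y -> differentiable f y by move=> [_ /HW[]].
case=> [|k]; first by move=> y /df/differentiable_continuous.
apply: (@Ck_onS _ _ _ _ _ _ (fun v y => v *m J y)) => //.
  move=> v y Uy; rewrite (deriveEjacobian _ (df y Uy)); congr (_ *m _).
  by case: Uy => _ /HW[].
move=> v; apply: Ck_on_mulmx => //; first exact: Ck_on_cst.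
by apply: (@Ck_on_sub _ _ _ _ _ U) => [y []//|]; exact: SJ.
Qed.

End TaylorEstimates.

(** * The logarithm of a commutative local group *)

Section LocalLog.
Context {R : realType} {r : nat}.

Lemma row_mx_norm_le p q (a : 'rV[R]_p) (b : 'rV[R]_q) (c : R) : `|a| <= c -> `|b| <= c -> `|row_mx a b| <= c.
Proof.
move=> ac bc; apply: rv_norm_le => [|i j]; first exact: le_trans (normr_ge0 a) ac.
rewrite ord1; case: (split_ordP j) => l ->.
  by rewrite row_mxEl; apply: le_trans ac; exact: rv_coord_le.
by rewrite row_mxEr; apply: le_trans bc; exact: rv_coord_le.
Qed.

Lemma near_row_mx p q (Q : 'rV[R]_(p + q) -> Prop) : (\forall w \near (0 : 'rV[R]_(p + q)), Q w) ->
  exists2 d : R, 0 < d & forall (a : 'rV[R]_p) (b : 'rV[R]_q), `|a| < d -> `|b| < d -> Q (row_mx a b).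
Proof.
move=> /near_norm_lt[d d0 Hd]; exists (d / 2); first by rewrite divr_gt0.
move=> a b Ha Hb; apply: Hd; rewrite sub0r normrN.
apply: (@le_lt_trans _ _ (d / 2)); last by lra.
by apply: row_mx_norm_le; exact: ltW.
Qed.

Lemma near_ball0 p (Q : 'rV[R]_p -> Prop) : (\forall w \near (0 : 'rV[R]_p), Q w) ->
  exists2 d : R, 0 < d & forall a : 'rV[R]_p, `|a| < d -> Q a.
Proof.
by move=> /near_norm_lt[d d0 Hd]; exists d => // a Ha; apply: Hd; rewrite sub0r normrN.
Qed.

(** Product and left division of a local group in coordinates. The interchange law [mu_inter] is the
    form of associativity and commutativity that makes square roots multiplicative. *)
Variables mu nu : 'rV[R]_r -> 'rV[R]_r -> 'rV[R]_r.
Let Mu (w : 'rV[R]_(r + r)) := mu (lsubmx w) (rsubmx w).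
Let Nu (w : 'rV[R]_(r + r)) := nu (lsubmx w) (rsubmx w).
Hypothesis SMu : sm Mu 0.
Hypothesis SNu : sm Nu 0.
Hypothesis mu0r : \forall a \near (0 : 'rV[R]_r), mu a 0 = a.
Hypothesis mu0l : \forall a \near (0 : 'rV[R]_r), mu 0 a = a.
Hypothesis mu_nu : \forall w \near (0 : 'rV[R]_(r + r)), mu (lsubmx w) (nu (lsubmx w) (rsubmx w)) = rsubmx w.
Hypothesis nu_diag : \forall a \near (0 : 'rV[R]_r), nu a a = 0.
Hypothesis mu_inter : exists2 d : R, 0 < d & forall a b c e, `|a| < d -> `|b| < d -> `|c| < d -> `|e| < d ->
  mu (mu a b) (mu c e) = mu (mu a c) (mu b e).

Let mu00 : mu 0 0 = 0. Proof. exact: nbhs_singleton mu0r. Qed.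

Let Mu_row a b : Mu (row_mx a b) = mu a b.
Proof. by rewrite /Mu row_mxKl row_mxKr. Qed.

Let jac_Mu : jacobian Mu 0 = col_mx 1%:M 1%:M.
Proof.
have E0 : row_mx 0 0 = 0 :> 'rV[R]_(r + r) by exact: row_mx0.
have J1 : (row_mx 1%:M 0 : 'M[R]_(r, r + r)) *m jacobian Mu 0 = 1%:M.
  have Sc : sm (fun w : 'rV[R]_r => row_mx w (0 : 'rV[R]_r)) 0 by apply: sm_row_mx; [exact: sm_id|exact: sm_cst].
  have -> : (row_mx 1%:M 0 : 'M[R]_(r, r + r)) = jacobian (fun w : 'rV[R]_r => row_mx w (0 : 'rV[R]_r)) 0.
    by rewrite (jacobian_row_mx (sm_id _) (sm_cst _ _)) jacobian_id jacobian_cst.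
  rewrite -[X in _ *m jacobian _ X]E0 -(jacobian_comp (g := Mu) (sm_diff Sc)); last by rewrite E0; exact: sm_diff.
  rewrite -(jacobian_id (0 : 'rV[R]_r)); apply/esym/near_eq_jacobian; last exact: sm_diff (sm_id _).
  by apply: filterS mu0r => a /= E; rewrite Mu_row E.
have J2 : (row_mx 0 1%:M : 'M[R]_(r, r + r)) *m jacobian Mu 0 = 1%:M.
  have Sc : sm (fun w : 'rV[R]_r => row_mx (0 : 'rV[R]_r) w) 0 by apply: sm_row_mx; [exact: sm_cst|exact: sm_id].
  have -> : (row_mx 0 1%:M : 'M[R]_(r, r + r)) = jacobian (fun w : 'rV[R]_r => row_mx (0 : 'rV[R]_r) w) 0.
    by rewrite (jacobian_row_mx (sm_cst _ _) (sm_id _)) jacobian_id jacobian_cst.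
  rewrite -[X in _ *m jacobian _ X]E0 -(jacobian_comp (g := Mu) (sm_diff Sc)); last by rewrite E0; exact: sm_diff.
  rewrite -(jacobian_id (0 : 'rV[R]_r)); apply/esym/near_eq_jacobian; last exact: sm_diff (sm_id _).
  by apply: filterS mu0l => a /= E; rewrite Mu_row E.
move: (jacobian Mu 0) J1 J2 => J; rewrite -[J]vsubmxK !mul_row_col !mul1mx !mul0mx addr0 add0r.
by move=> -> ->.
Qed.

Let mu_taylor : exists2 C : R, 0 <= C & exists2 d : R, 0 < d &
  forall (rho : R) a b, rho < d -> `|a| <= rho -> `|b| <= rho -> `|mu a b - a - b| <= C * rho ^+ 2.
Proof.
have [C C0 HC] := taylor2 SMu; exists C => //.
have [d d0 Hd] := near_row_mx HC; exists d => // rho a b rd Ha Hb.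
have := Hd a b (le_lt_trans Ha rd) (le_lt_trans Hb rd).
have EM0 : Mu 0 = 0 by rewrite /Mu !linear0 mu00.
rewrite Mu_row EM0 subr0 jac_Mu mul_row_col !mulmx1 opprD addrA => H; apply: (le_trans H).
apply: ler_wpM2l => //.
rewrite ler_sqr ?nnegrE ?normr_ge0//; first exact: row_mx_norm_le.
exact: le_trans (normr_ge0 a) Ha.
Qed.

(** Squaring has derivative 2 at 0, so the inverse function theorem gives a smooth root with
    derivative 1/2, and [taylor2] the quadratic error. *)
Lemma sqrt_exists : exists q : 'rV[R]_r -> 'rV[R]_r, exists2 C : R, 0 <= C &
  exists2 d : R, 0 < d & forall a, `|a| < d ->
  [/\ `|q a - 2^-1 *: a| <= C * `|a| ^+ 2, mu (q a) (q a) = a & q (mu a a) = a].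
Proof.
pose dbl a := mu a a.
have Srow : sm (fun w : 'rV[R]_r => row_mx w w) 0 by apply: sm_row_mx; exact: sm_id.
have E0 : row_mx 0 0 = 0 :> 'rV[R]_(r + r) by exact: row_mx0.
have Ed : dbl = Mu \o (fun w : 'rV[R]_r => row_mx w w) by apply/funext => a /=; rewrite Mu_row.
have Sd : sm dbl 0 by rewrite Ed; apply: sm_comp => //; rewrite E0.
have Jd : jacobian dbl 0 = 2%:M.
  rewrite Ed (jacobian_comp (sm_diff Srow)); last by rewrite E0; exact: sm_diff.
  rewrite E0 jac_Mu (jacobian_row_mx (sm_id _) (sm_id _)) jacobian_id mul_row_col !mulmx1.
  by apply/matrixP => i j; rewrite !mxE -mulrnDl.
have [q [Sq q0 K1 K2]] : exists q : 'rV[R]_r -> 'rV[R]_r,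
    [/\ sm q (dbl 0), q (dbl 0) = 0, \forall y \near dbl 0, dbl (q y) = y & \forall x \near (0 : 'rV[R]_r), q (dbl x) = x].
  apply: (inverse_function Sd); rewrite Jd unitmxE det_scalar unitfE expf_neq0//.
have d00 : dbl 0 = 0 := mu00; rewrite d00 in Sq q0 K1.
have Jq : jacobian q 0 = (2^-1)%:M.
  have : jacobian dbl 0 *m jacobian q (dbl 0) = 1%:M.
    rewrite -(jacobian_comp (sm_diff Sd)); last by rewrite d00; exact: sm_diff.
    rewrite -(jacobian_id (0 : 'rV[R]_r)); apply/esym/near_eq_jacobian; last exact: sm_diff (sm_id _).
    by apply: filterS K2 => a /= ->.
  rewrite Jd d00 mul_scalar_mx => /(congr1 (fun A => 2^-1 *: A)).
  by rewrite scalerA mulVf// scale1r scalemx1.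
exists q; have [C C0 HC] := taylor2 Sq; exists C => //.
apply: near_ball0; near=> a; split.
- have : `|q a - q 0 - a *m jacobian q 0| <= C * `|a| ^+ 2 by near: a; exact: HC.
  by rewrite q0 subr0 Jq mul_mx_scalar.
- by near: a; exact: K1.
- by near: a; exact: K2.
Unshelve. all: by end_near. Qed.

(* With q the local square root, the logarithm is the limit of 2^n q^n, which is
   additive because mu is addition up to second order. *)
Theorem local_log : exists L : 'rV[R]_r -> 'rV[R]_r,
  [/\ sm L 0, L 0 = 0, jacobian L 0 = 1%:M &
  exists2 d : R, 0 < d & forall a b, `|a| < d -> `|b| < d -> L (mu a b) = L a + L b].
Proof.
have [q [C C0 [d1 d10 Hq]]] := sqrt_exists.
have [C2 C20 [d2 d20 Hmu]] := mu_taylor.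
have [d3 d30 Hint] := mu_inter.
have q0 : q 0 = 0 by have [|_ _] := Hq 0; [rewrite normr0|rewrite mu00].
(* The bound 1/6 gives [q] the ratio 1/2 + 1/6 = 2/3. Errors are quadratic and get multiplied by 2
   at each step, so the rate of convergence is 2 (2/3)^2 = 8/9 < 1. *)
have [d [d0 dd1 dd2 dd3 dC]] : exists d : R, [/\ 0 < d, d <= d1, d <= d2, d <= d3 & C * d <= 6^-1].
  have c6 : 0 < (6 * (C + 1))^-1 by rewrite invr_gt0 mulr_gt0// ltr_wpDl.
  exists (Num.min (Num.min d1 d2) (Num.min d3 (6 * (C + 1))^-1)).
  split; rewrite ?lt_min ?d10 ?d20 ?d30 ?c6// ?ge_min ?lexx ?orbT//.
  apply: (@le_trans _ _ (C * (6 * (C + 1))^-1)).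
    by apply: ler_wpM2l => //; rewrite !ge_min lexx !orbT.
  rewrite invfM mulrCA -[leRHS]mulr1 ler_pM2l//.
  by rewrite ler_pdivrMr ?mul1r ?lerDl// ltr_wpDl.
have qs a : `|a| < d -> `|q a| <= 2 / 3 * `|a|.
  move=> ad; have [H _ _] := Hq a (lt_le_trans ad dd1).
  rewrite -[q a](subrK (2^-1 *: a)); apply: (le_trans (ler_normD _ _)).
  rewrite normrZ ger0_norm//.
  have : C * `|a| ^+ 2 <= 6^-1 * `|a|.
    rewrite expr2 mulrA ler_wpM2r//; apply: le_trans dC.
    by apply: ler_wpM2l => //; exact: ltW.
  by move: H; lra.
have t01 : (0 : R) <= 2 / 3 /\ (2 / 3 : R) <= 1 by lra.
have iq a n : `|a| < d -> `|iter n q a| <= (2 / 3) ^+ n * `|a| /\ `|iter n q a| < d.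
  move=> ad; elim: n => [|n [IH1 IH2]]; first by rewrite expr0 mul1r.
  have H := qs _ IH2; split; rewrite iterS.
    by apply: (le_trans H); rewrite exprS -[leRHS]mulrA; apply: ler_wpM2l => //; lra.
  apply: le_lt_trans H _; apply: le_lt_trans IH2; rewrite ler_piMl//; lra.
pose b n a := 2 ^+ n *: iter n q a.
have p89 n : 2 ^+ n * ((2 / 3) ^+ n) ^+ 2 = (8 / 9) ^+ n :> R.
  by rewrite -!exprM mulnC exprM -exprMn; congr (_ ^+ _); field.
have bS a n : `|a| < d -> `|b n.+1 a - b n a| <= 2 * C * (8 / 9) ^+ n * `|a| ^+ 2.
  move=> ad; have [H1 H2] := iq a n ad.
  have -> : b n.+1 a - b n a = 2 ^+ n.+1 *: (q (iter n q a) - 2^-1 *: iter n q a).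
    by rewrite /b iterS scalerBr scalerA exprSr mulfK.
  have [H _ _] := Hq _ (lt_le_trans H2 dd1).
  rewrite normrZ ger0_norm ?exprn_ge0//.
  apply: (@le_trans _ _ (2 ^+ n.+1 * (C * ((2 / 3) ^+ n * `|a|) ^+ 2))).
    apply: ler_wpM2l; first exact: exprn_ge0.
    apply: (le_trans H); apply: ler_wpM2l => //.
    rewrite ler_sqr ?nnegrE// mulr_ge0// exprn_ge0//; lra.
  by rewrite exprMn (exprS 2 n) -p89 le_eqVlt; apply/orP; left; apply/eqP; ring.
(* 18 is 2 times 9, the sum of the geometric series of ratio 8/9; the factor [1 - (8/9)^n] records
   the partial sum so that the induction closes. *)
have bB a n : `|a| < d -> `|b n a - a| <= 18 * C * `|a| ^+ 2 * (1 - (8 / 9) ^+ n).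
  move=> ad; elim: n => [|n IH].
    by rewrite /b /= expr0 scale1r !subrr normr0 mulr0.
  rewrite -[b n.+1 a](subrK (b n a)) -addrA; apply: (le_trans (ler_normD _ _)).
  apply: (le_trans (lerD (bS a n ad) IH)).
  rewrite (exprS (8 / 9) n); move: ((8 / 9) ^+ n) => t.
  by rewrite le_eqVlt; apply/orP; left; apply/eqP; field.
pose L a : 'rV[R]_r := \row_j lim ((fun n => b n a 0 j) @ \oo).
have Lc a j : `|a| < d -> (fun n => b n a 0 j) @ \oo --> L a 0 j.
  move=> ad; rewrite /L mxE; apply: (@geometric_cvg R _ (2 * C * `|a| ^+ 2) (8 / 9)); first by lra.
  move=> n; rewrite mulrAC; apply: le_trans (bS a n ad).
  apply: le_trans (rv_coord_le _ 0 j); by rewrite !mxE.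
have LB a : `|a| < d -> `|L a - a| <= 18 * C * `|a| ^+ 2.
  move=> ad; have c0 : 0 <= 18 * C * `|a| ^+ 2 by rewrite mulr_ge0 ?mulr_ge0// exprn_ge0.
  apply: rv_norm_le => // i j; rewrite ord1 [X in `|X|]mxE [X in `|_ + X|]mxE.
  apply: (cvgr_to_le (cvg_norm (cvgB (Lc a j ad) (cvg_cst (a 0 j))))).
  near=> n; apply: (@le_trans _ _ `|b n a - a|).
    have E : (b n a - a) 0 j = b n a 0 j - a 0 j by rewrite [LHS]mxE [X in _ + X]mxE.
    by have := rv_coord_le (b n a - a) 0 j; rewrite E.
  apply: (le_trans (bB a n ad)); rewrite -[leRHS]mulr1.
  apply: ler_wpM2l; first exact: c0.
  by rewrite lerBlDr lerDl; apply: exprn_ge0; lra.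
have L0 : L 0 = 0.
  by apply/eqP; rewrite -normr_le0; have := LB 0; rewrite normr0 subr0 expr0n mulr0; apply.
have iq' a n : `|a| < d -> `|iter n q a| <= `|a|.
  move=> ad; have [H _] := iq a n ad; apply: (le_trans H); rewrite ler_piMl// exprn_ile1//; lra.
have [dm dm0 Hdm] : exists2 dm : R, 0 < dm & forall a a' : 'rV[R]_r, `|a| < dm -> `|a'| < dm -> `|mu a a'| < d.
  have c : Mu @ (0 : 'rV[R]_(r + r)) --> (0 : 'rV[R]_r).
    by rewrite -mu00; have := sm_cont SMu; rewrite /prop_for /continuous_at {2}/Mu !linear0.
  have H : \forall w \near (0 : 'rV[R]_(r + r)), `|0 - Mu w| < d by exact: (c _ (near_norm (0 : 'rV[R]_r) d0)).
  have [dm dm0 Hdm] := near_row_mx H; exists dm => // a a' Ha Ha'.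
  by have := Hdm a a' Ha Ha'; rewrite Mu_row sub0r normrN.
pose d4 := Num.min d dm.
have d40 : 0 < d4 by rewrite lt_min d0.
have d4P (x : R) : x < d4 -> x < d /\ x < dm by rewrite lt_min => /andP[].
(* By interchange [mu (q u) (q v)] squares to [mu u v], and [q] undoes squaring near 0. *)
have q_mu u v : `|u| < d4 -> `|v| < d4 -> q (mu u v) = mu (q u) (q v).
  move=> /[dup] /d4P[ud udm] u4 /[dup] /d4P[vd vdm] v4.
  have quu := iq' u 1%N ud; have qvv := iq' v 1%N vd.
  have [_ Eu _] := Hq u (lt_le_trans ud dd1); have [_ Ev _] := Hq v (lt_le_trans vd dd1).
  have xd : `|mu (q u) (q v)| < d.
    by apply: Hdm; [apply: le_lt_trans quu udm|apply: le_lt_trans qvv vdm].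
  have [_ _] := Hq _ (lt_le_trans xd dd1).
  have lt3 w w' : `|w| <= `|w'| -> `|w'| < d -> `|w| < d3.
    by move=> H1 H2; apply: le_lt_trans H1 _; apply: lt_le_trans H2 dd3.
  by rewrite Hint ?Eu ?Ev//; [exact: lt3 quu ud|exact: lt3 qvv vd|exact: lt3 quu ud|exact: lt3 qvv vd].
have iq_mu n u v : `|u| < d4 -> `|v| < d4 -> iter n q (mu u v) = mu (iter n q u) (iter n q v).
  move=> /[dup] /d4P[ud udm] u4 /[dup] /d4P[vd vdm] v4.
  elim: n => [//|n IH]; rewrite !iterS IH q_mu//.
    by apply: le_lt_trans u4; exact: iq'.
  by apply: le_lt_trans v4; exact: iq'.
(* [mu] is addition up to a quadratic error. At stage [n] the arguments are of size (2/3)^n, so the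
   error, even multiplied by 2^n, tends to 0. *)
have L_mu u v : `|u| < d4 -> `|v| < d4 -> L (mu u v) = L u + L v.
  move=> /[dup] /d4P[ud udm] u4 /[dup] /d4P[vd vdm] v4.
  have xd := Hdm u v udm vdm.
  apply/eqP; rewrite -subr_eq0; apply/eqP/rowP => j; rewrite [RHS]mxE.
  have -> : (L (mu u v) - (L u + L v)) 0 j = L (mu u v) 0 j - (L u 0 j + L v 0 j).
    by rewrite [LHS]mxE [X in _ + X]mxE [X in - X]mxE.
  apply/eqP; rewrite -normr_le0.
  have cl := cvg_norm (cvgB (Lc _ j xd) (cvgD (Lc u j ud) (Lc v j vd))).
  pose rho := Num.max `|u| `|v|.
  have rd : rho < d by rewrite gt_max ud.
  have rho0 : 0 <= rho by rewrite le_max normr_ge0.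
  have cr : geometric (C2 * rho ^+ 2) (8 / 9) @ \oo --> (0 : R).
    by apply: cvg_geometric; rewrite ger0_norm ?divr_ge0 ?ler0n// ltr_pdivrMr ?ltr0n// mul1r ltr_nat.
  suff HN : \forall n \near \oo, `|b n (mu u v) 0 j - (b n u 0 j + b n v 0 j)| <= geometric (C2 * rho ^+ 2) (8 / 9) n.
    exact: ler_cvg_to (cl _ _ _) cr HN.
  near=> n.
  have -> : b n (mu u v) 0 j - (b n u 0 j + b n v 0 j) =
      (2 ^+ n *: (mu (iter n q u) (iter n q v) - iter n q u - iter n q v)) 0 j.
    by rewrite /b iq_mu// !mxE; ring.
  apply: (le_trans (rv_coord_le _ 0 j)); rewrite normrZ ger0_norm ?exprn_ge0//.
  have t0 : 0 <= (2 / 3 : R) ^+ n by apply: exprn_ge0; lra.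
  have Hb w : `|w| < d -> `|w| <= rho -> `|iter n q w| <= (2 / 3) ^+ n * rho.
    by move=> wd wr; have [H _] := iq w n wd; apply: (le_trans H); exact: ler_wpM2l.
  have rn : (2 / 3) ^+ n * rho < d2.
    apply: le_lt_trans (lt_le_trans rd dd2); rewrite ler_piMl// exprn_ile1//; lra.
  have Bu := Hb u ud (_ : `|u| <= rho); have Bv := Hb v vd (_ : `|v| <= rho).
  rewrite !le_max !lexx !orbT in Bu Bv.
  have H := Hmu _ _ _ rn (Bu isT) (Bv isT).
  apply: (@le_trans _ _ (2 ^+ n * (C2 * ((2 / 3) ^+ n * rho) ^+ 2))).
    by apply: ler_wpM2l => //; exact: exprn_ge0.
  by rewrite /geometric /= -p89 exprMn le_eqVlt; apply/orP; left; apply/eqP; ring.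
have [dL0 JL0] : differentiable L 0 /\ jacobian L 0 = 1%:M.
  apply/diff_epsP => e e0.
  have c0 : 0 < 18 * C + 1 by rewrite ltr_wpDl// mulr_ge0.
  have m0 : 0 < Num.min d (e / (18 * C + 1)) by rewrite lt_min d0 divr_gt0.
  apply: filterS (near_norm (0 : 'rV[R]_r) m0) => k; rewrite sub0r normrN lt_min => /andP[kd ke].
  rewrite addr0 L0 subr0 mulmx1; apply: (le_trans (LB k kd)); rewrite expr2 mulrA ler_wpM2r//.
  have : `|k| * (18 * C + 1) <= e by rewrite -ler_pdivlMr// ltW.
  by apply: le_trans; rewrite mulrC ler_wpM2l// lerDl.
exists L; split=> //; last by exists d4.
(* So far [L] is known to be differentiable at 0 only. Near [a] one has [L x = L a + L (nu a x)]
   with [nu a a = 0], which carries the derivative 1 at 0 over to [a]: the Jacobian there is that of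
   [nu a] at [a], a smooth function of [a]. *)
have [d5 d50 Hd5] := near_row_mx (sm_near SNu).
have [d6 d60 Hd6] := near_ball0 nu_diag.
have [d7 d70 Hd7] := near_row_mx mu_nu.
pose J (a : 'rV[R]_r) : 'M[R]_r := (row_mx 0 1%:M : 'M[R]_(r, r + r)) *m jacobian Nu (row_mx a a).
apply: (@sm_of_jacobian _ _ _ L J).
  apply: sm_mulmx; first exact: sm_cst.
  apply: (@sm_comp _ _ _ _ _ (fun a : 'rV[R]_r => row_mx a a) (jacobian Nu)).
    by apply: sm_row_mx; exact: sm_id.
  by rewrite row_mx0; exact: sm_jacobian.
have dd : 0 < Num.min (Num.min d5 d6) (Num.min d7 d4) by rewrite (lt_min _ _ (Num.min d7 d4)) (lt_min _ d5) (lt_min _ d7) d50 d60 d70 d40.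
apply: filterS (near_norm (0 : 'rV[R]_r) dd) => a.
rewrite sub0r normrN (lt_min _ _ (Num.min d7 d4)) (lt_min _ d5) (lt_min _ d7) => /andP[/andP[a5 a6] /andP[a7 a4]].
have Sg : sm (fun x => nu a x) a.
  have Srow : sm (fun x : 'rV[R]_r => row_mx a x) a by apply: sm_row_mx; [exact: sm_cst|exact: sm_id].
  apply: (@sm_eq _ _ _ (Nu \o (fun x : 'rV[R]_r => row_mx a x))).
    by near=> x; rewrite /= /Nu row_mxKl row_mxKr.
  by apply: (sm_comp Srow); exact: Hd5.
have ga : nu a a = 0 by exact: Hd6.
have Jg : jacobian (fun x => nu a x) a = J a.
  have Srow : sm (fun x : 'rV[R]_r => row_mx a x) a by apply: sm_row_mx; [exact: sm_cst|exact: sm_id].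
  rewrite /J -(jacobian_id a) -(jacobian_cst a a) -(jacobian_row_mx (sm_cst a a) (sm_id a)).
  rewrite -(jacobian_comp (g := Nu) (sm_diff Srow)); last exact/sm_diff/Hd5.
  by congr jacobian; apply/funext => x; rewrite /= /Nu row_mxKl row_mxKr.
have EL : \forall x \near a, L x = L a + L (nu a x).
  have c : (fun x => nu a x) @ a --> (0 : 'rV[R]_r) by rewrite -ga; exact: (sm_cont Sg).
  have H1 : \forall x \near a, `|0 - nu a x| < d4 by exact: (c _ (near_norm (0 : 'rV[R]_r) d40)).
  have e0 : 0 < d7 - `|a| by rewrite subr_gt0.
  have H2 := near_norm a e0.
  near=> x.
  rewrite -L_mu//.
    have -> : mu a (nu a x) = x; last by [].
    have x7 : `|x| < d7.
      have : `|a - x| < d7 - `|a| by near: x; exact: H2.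
      rewrite ltrBrDl => Hx; apply: le_lt_trans Hx.
      by rewrite -[x in `|x|](subKr a); apply: (le_trans (ler_normB _ _)).
    by have := Hd7 a x a7 x7; rewrite row_mxKl row_mxKr.
  by rewrite -normrN -sub0r; near: x; exact: H1.
have dLg : differentiable (L \o (fun x => nu a x)) a.
  by apply: differentiable_comp; [exact: sm_diff|rewrite ga].
have dS : differentiable (fun x => L a + L (nu a x)) a.
  by apply: differentiableD => //; exact: differentiable_cst.
have EL' : \forall x \near a, L a + L (nu a x) = L x by apply: filterS EL => x ->.
split; first exact: near_eq_differentiable EL' dS.
rewrite -(near_eq_jacobian EL' dS) (jacobianD (differentiable_cst (L a) a) dLg) jacobian_cst add0r.
rewrite (jacobian_comp (f := fun x => nu a x) (g := L) (sm_diff Sg)); last by rewrite ga.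
by rewrite ga JL0 mulmx1.
Unshelve. all: by end_near. Qed.

End LocalLog.

(** * The exponential homomorphism onto the center near 1 *)

Section CentralExp.
Context {R : realType} {G : lieGroupType R}.
Local Notation n := (mdim G).
Variables (kap : 'rV[R]_n -> G) (kapi : G -> 'rV[R]_n).
Hypothesis LP : local_param kap kapi.
Variables (r : nat) (B : 'M[R]_(r, n)) (z : 'rV[R]_r -> G) (theta : G -> 'rV[R]_r).
Hypotheses (Sz : smooth_at z 0) (z0 : z 0 = 1%g) (St : smooth_at theta 1%g) (t1 : theta 1%g = 0).
Hypothesis tK : \forall t \near (0 : 'rV[R]_r), theta (z t) = t.
Hypothesis zC : \forall t \near (0 : 'rV[R]_r), center_subgroup G (z t).
Hypothesis zK : \forall g \near (1%g : G), center_subgroup G g -> z (theta g) = g.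
Hypothesis oz : omega kapi z 0 = B.
Let mG := @lie_mfd R G.
Let eu m := @euclidean_manifold R m.

Lemma center_subgroupM (x y : G) : center_subgroup G x -> center_subgroup G y -> center_subgroup G (x * y)%g.
Proof. by move=> cx cy w; rewrite /commute -mulgA (cy w) mulgA (cx w) mulgA. Qed.

Lemma center_subgroupV (x : G) : center_subgroup G x -> center_subgroup G (x^-1)%g.
Proof.
by move=> cx w; apply: (mulgI x); rewrite mulVKg mulgA (cx w) mulgK.
Qed.

Lemma center_subgroupX (x : G) k : center_subgroup G x -> center_subgroup G (x ^+ k)%g.
Proof.
move=> cx; elim: k => [|k IH]; first by move=> w; rewrite expg0 /commute mul1g mulg1.
by rewrite expgS; exact: center_subgroupM.
Qed.

Let mu a b := theta (z a * z b)%g.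
Let nu a x := theta ((z a)^-1 * z x)%g.

Let Szl : smooth_at (fun w : 'rV[R]_(r + r) => z (lsubmx w)) 0.
Proof.
apply: (smooth_at_comp (eu (r + r)) (eu r) mG (f := @lsubmx R 1 r r)); last by rewrite linear0.
by apply/smooth_at_rV; exact: sm_lsubmx.
Qed.

Let Szr : smooth_at (fun w : 'rV[R]_(r + r) => z (rsubmx w)) 0.
Proof.
apply: (smooth_at_comp (eu (r + r)) (eu r) mG (f := @rsubmx R 1 r r)); last by rewrite linear0.
by apply/smooth_at_rV; exact: sm_rsubmx.
Qed.

Let Smul : smooth_at (fun w : 'rV[R]_(r + r) => z (lsubmx w) * z (rsubmx w))%g 0.
Proof. exact: (smooth_at_mulg (eu _) Szl Szr). Qed.

Let Sdiv : smooth_at (fun w : 'rV[R]_(r + r) => (z (lsubmx w))^-1 * z (rsubmx w))%g 0.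
Proof. exact: (smooth_at_mulg (eu _) (smooth_at_invg (eu _) Szl) Szr). Qed.

Let cmul : (fun w : 'rV[R]_(r + r) => z (lsubmx w) * z (rsubmx w))%g @ (0 : 'rV[R]_(r + r)) --> (1%g : G).
Proof. by have := Smul.1; rewrite /prop_for /continuous_at !linear0 z0 mulg1. Qed.

Let cdiv : (fun w : 'rV[R]_(r + r) => (z (lsubmx w))^-1 * z (rsubmx w))%g @ (0 : 'rV[R]_(r + r)) --> (1%g : G).
Proof. by have := Sdiv.1; rewrite /prop_for /continuous_at !linear0 z0 mulVg. Qed.

Let SMu : sm (fun w : 'rV[R]_(r + r) => mu (lsubmx w) (rsubmx w)) 0.
Proof.
apply/smooth_at_rV; apply: (smooth_at_comp (eu _) mG (eu r) Smul).
by rewrite !linear0 z0 mulg1.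
Qed.

Let SNu : sm (fun w : 'rV[R]_(r + r) => nu (lsubmx w) (rsubmx w)) 0.
Proof.
apply/smooth_at_rV; apply: (smooth_at_comp (eu _) mG (eu r) Sdiv).
by rewrite !linear0 z0 mulVg.
Qed.

Let small : exists2 d : R, 0 < d & forall a b : 'rV[R]_r, `|a| < d -> `|b| < d ->
  [/\ theta (z a) = a, center_subgroup G (z a), z (mu a b) = (z a * z b)%g & z (nu a b) = ((z a)^-1 * z b)%g].
Proof.
have [d1 d10 H1] := near_ball0 tK; have [d2 d20 H2] := near_ball0 zC.
pose Q3 (w : 'rV[R]_(r + r)) := center_subgroup G (z (lsubmx w) * z (rsubmx w))%g ->
    z (mu (lsubmx w) (rsubmx w)) = (z (lsubmx w) * z (rsubmx w))%g.
pose Q4 (w : 'rV[R]_(r + r)) := center_subgroup G ((z (lsubmx w))^-1 * z (rsubmx w))%g ->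
    z (nu (lsubmx w) (rsubmx w)) = ((z (lsubmx w))^-1 * z (rsubmx w))%g.
have H3' : \forall w \near (0 : 'rV[R]_(r + r)), Q3 w by exact: (@cmul _ zK).
have H4' : \forall w \near (0 : 'rV[R]_(r + r)), Q4 w by exact: (@cdiv _ zK).
have [d3 d30 H3] := near_row_mx H3'; have [d4 d40 H4] := near_row_mx H4'.
rewrite /Q3 /Q4 in H3 H4.
exists (Num.min (Num.min d1 d2) (Num.min d3 d4)); first by rewrite !lt_min d10 d20 d30.
move=> a b; rewrite !lt_min => /andP[/andP[a1 a2] /andP[a3 a4]] /andP[/andP[b1 b2] /andP[b3 b4]].
have ca := H2 a a2; have cb := H2 b b2.
split; [exact: H1|exact: ca| |].
- by have := H3 a b a3 b3; rewrite row_mxKl row_mxKr; apply; exact: center_subgroupM.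
- have := H4 a b a4 b4; rewrite row_mxKl row_mxKr; apply.
  by apply: center_subgroupM => //; exact: center_subgroupV.
Qed.

Lemma central_log : exists L : 'rV[R]_r -> 'rV[R]_r,
  [/\ sm L 0, L 0 = 0, jacobian L 0 = 1%:M &
  exists2 d : R, 0 < d & forall a b, `|a| < d -> `|b| < d -> L (mu a b) = L a + L b].
Proof.
have [d d0 Hd] := small.
have tK0 (a : 'rV[R]_r) : `|a| < d -> theta (z a) = a by move=> ad; have [] := Hd a a ad ad.
apply: (@local_log R r mu nu SMu SNu).
- by apply: filterS tK => a E; rewrite /mu z0 mulg1.
- by apply: filterS tK => a E; rewrite /mu z0 mul1g.
- have H (a b : 'rV[R]_r) : `|a| < d -> `|b| < d -> mu a (nu a b) = b.
    by move=> ad bd; have [_ _ _ E] := Hd a b ad bd; rewrite /mu E mulVKg tK0.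
  apply: filterS (near_norm (0 : 'rV[R]_(r + r)) d0) => w; rewrite sub0r normrN => wd.
  by apply: H; apply: le_lt_trans wd; apply: rv_norm_le => // i j; rewrite !mxE; exact: rv_coord_le.
- by near=> a; rewrite /nu mulVg t1.
have [dm dm0 Hdm] : exists2 dm : R, 0 < dm & forall a a' : 'rV[R]_r, `|a| < dm -> `|a'| < dm -> `|mu a a'| < d.
  have c := sm_cont SMu.
  have {}c : (fun w : 'rV[R]_(r + r) => mu (lsubmx w) (rsubmx w)) @ (0 : 'rV[R]_(r + r)) --> (0 : 'rV[R]_r).
    by move: c; rewrite /prop_for /continuous_at {2}/mu !linear0 z0 mulg1 t1.
  have H : \forall w \near (0 : 'rV[R]_(r + r)), `|0 - mu (lsubmx w) (rsubmx w)| < d.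
    exact: (c _ (near_norm (0 : 'rV[R]_r) d0)).
  have [dm dm0 Hdm] := near_row_mx H; exists dm => // a a' Ha Ha'.
  by have := Hdm a a' Ha Ha'; rewrite row_mxKl row_mxKr sub0r normrN.
(* It remains to prove the interchange law, and this is where centrality of [z b] enters: it lets
   [z b] and [z c] trade places. *)
exists (Num.min d dm); first by rewrite lt_min d0.
move=> a b c e; rewrite !lt_min => /andP[ad am] /andP[bd bm] /andP[cd cm] /andP[ed em].
have [_ Ca Eab _] := Hd a b ad bd; have [_ Cc Ece _] := Hd c e cd ed.
have [_ _ Eac _] := Hd a c ad cd; have [_ Cb Ebe _] := Hd b e bd ed.
rewrite /mu -/(mu a b) -/(mu c e) -/(mu a c) -/(mu b e) Eab Ece Eac Ebe.
by congr theta; rewrite -!mulgA; congr (_ * _)%g; rewrite !mulgA (Cb (z c)).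
Unshelve. all: by end_near. Qed.

Theorem central_exp : exists (E : 'rV[R]_r -> G) (lam : G -> 'rV[R]_r),
  [/\ forall u v, E (u + v) = (E u * E v)%g, forall u, smooth_at E u,
      forall u, center_subgroup G (E u), omega kapi E 0 = B &
  [/\ smooth_at lam 1%g, lam 1%g = 0, \forall t \near (0 : 'rV[R]_r), lam (E t) = t &
      \forall g \near (1%g : G), center_subgroup G g -> E (lam g) = g]].
Proof.
have [L [SL L0 JL [d1 d10 Lmu]]] := central_log.
have [d2 d20 Hd2] := small.
have [g [Sg g0 K1 K2]] : exists g : 'rV[R]_r -> 'rV[R]_r,
    [/\ sm g (L 0), g (L 0) = 0, \forall y \near L 0, L (g y) = y & \forall x \near (0 : 'rV[R]_r), g (L x) = x].
  by apply: (inverse_function SL); rewrite JL unitmx1.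
rewrite L0 in Sg g0 K1.
have cg : g @ (0 : 'rV[R]_r) --> (0 : 'rV[R]_r) by rewrite -[X in _ --> X]g0; exact: (sm_cont Sg).
pose E0 t := z (g t).
have SE0 : smooth_at E0 0.
  by apply: (smooth_at_comp (eu r) (eu r) mG (f := g)); [exact/smooth_at_rV|rewrite g0].
have E00 : E0 0 = 1%g by rewrite /E0 g0.
have HN : \forall t \near (0 : 'rV[R]_r), smooth_at E0 t /\ center_subgroup G (E0 t).
  have H1 := smooth_at_near (eu r) mG SE0.
  have H2 : \forall t \near (0 : 'rV[R]_r), center_subgroup G (E0 t) by exact: (cg _ zC).
  by near=> t; split; [near: t; exact: H1|near: t; exact: H2].
have [d3 d30 Hd3] := near_ball0 HN.
have [d4 d40 Hd4] := near_ball0 K2.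
have [d5 d50 Hd5] : exists2 d5 : R, 0 < d5 & forall a b : 'rV[R]_r, `|a| < d5 -> `|b| < d5 -> `|mu a b| < d4.
  have c := sm_cont SMu.
  have {}c : (fun w : 'rV[R]_(r + r) => mu (lsubmx w) (rsubmx w)) @ (0 : 'rV[R]_(r + r)) --> (0 : 'rV[R]_r).
    by move: c; rewrite /prop_for /continuous_at {2}/mu !linear0 z0 mulg1 t1.
  have H : \forall w \near (0 : 'rV[R]_(r + r)), `|0 - mu (lsubmx w) (rsubmx w)| < d4.
    exact: (c _ (near_norm (0 : 'rV[R]_r) d40)).
  have [dm dm0 Hdm] := near_row_mx H; exists dm => // a a' Ha Ha'.
  by have := Hdm a a' Ha Ha'; rewrite row_mxKl row_mxKr sub0r normrN.
pose e := Num.min d1 (Num.min d2 d5).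
have e0 : 0 < e by rewrite (lt_min 0 d1) (lt_min 0 d2) d10 d20 d50.
have HG : \forall t \near (0 : 'rV[R]_r), `|g t| < e /\ L (g t) = t.
  have H1 : \forall t \near (0 : 'rV[R]_r), `|0 - g t| < e by exact: (cg _ (near_norm (0 : 'rV[R]_r) e0)).
  near=> t; split; last by near: t; exact: K1.
  by rewrite -normrN -sub0r; near: t; exact: H1.
have [d6 d60 Hd6] := near_ball0 HG.
have E0D s t : `|s| < d6 -> `|t| < d6 -> E0 (s + t) = (E0 s * E0 t)%g.
  move=> /Hd6[gs Ls] /Hd6[gt Lt].
  move: gs gt; rewrite !(lt_min _ d1) !(lt_min _ d2) => /and3P[s1 s2 s5] /and3P[t1' t2 t5].
  have [_ _ Emu _] := Hd2 _ _ s2 t2.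
  rewrite /E0 -Emu; congr z; rewrite -{1}Ls -{1}Lt -(Lmu _ _ s1 t1').
  by rewrite Hd4//; exact: Hd5.
pose d := Num.min d3 d6.
have d0 : 0 < d by rewrite (lt_min 0 d3) d30.
have dP (x : 'rV[R]_r) : `|x| < d -> `|x| < d3 /\ `|x| < d6 by rewrite (lt_min _ d3) => /andP[].
(* For [k >= N v] one has 2^k > k > |v| / d, so [v] divided by 2^k falls in the ball where [E0] is
   defined well and additive. *)
pose N (v : 'rV[R]_r) := Num.bound (`|v| / d).
pose h k (v : 'rV[R]_r) := 2 ^- k *: v.
have hS k v : h k v = h k.+1 v + h k.+1 v.
  rewrite /h -scalerDl (exprS 2 k) invfM; congr (_ *: _); lra.
have hn k v : `|h k v| = 2 ^- k * `|v| by rewrite /h normrZ ger0_norm// invr_ge0 exprn_ge0.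
have hle k v : `|h k.+1 v| <= `|h k v|.
  rewrite !hn ler_wpM2r// lef_pV2 ?posrE ?exprn_gt0// exprS ler_peMl ?exprn_ge0//; lra.
have hN v k : (N v <= k)%N -> `|h k v| < d.
  move=> Nk; rewrite hn mulrC ltr_pdivrMr ?exprn_gt0// mulrC -ltr_pdivrMr//.
  have /archi_boundP H : 0 <= `|v| / d by rewrite divr_ge0// ltW.
  apply: lt_le_trans H _; rewrite -natrX ler_nat; apply: leq_trans Nk _.
  by apply: ltnW; exact: ltn_expl.
have EX v k : `|h k v| < d -> forall m, (k <= m)%N -> (E0 (h m v) ^+ (2 ^ m) = E0 (h k v) ^+ (2 ^ k))%g.
  move=> hd m /subnK <-; elim: (m - k)%N => [//|j IH].
  have hj i : `|h (i + k)%N v| < d.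
    by elim: i => [//|i IHi]; rewrite addSn; apply: le_lt_trans (hle _ _) IHi.
  rewrite -IH addSn (hS (j + k)%N v).
  have Hj := hj j.+1; rewrite addSn in Hj; have [_ H6] := dP _ Hj.
  by rewrite E0D// expnS expgnA expg2.
(* Every exponent beyond [N v] gives the same value by [EX]. Several arguments can thus be halved
   equally often, and powers of the commuting elements multiplied together. *)
pose E v := (E0 (h (N v) v) ^+ (2 ^ N v))%g.
have EE v m : (N v <= m)%N -> E v = (E0 (h m v) ^+ (2 ^ m))%g.
  by move=> Nm; rewrite (EX v (N v))// hN.
have Esmall v : `|v| < d -> E v = E0 v.
  move=> vd; have h0 : h 0%N v = v by rewrite /h expr0 invr1 scale1r.
  by have := EX v 0%N; rewrite h0 => /(_ vd (N v) (leq0n _)); rewrite expg1.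
have C0 v : `|v| < d -> center_subgroup G (E0 v) by move=> /dP[/Hd3[]].
have ED u v : E (u + v) = (E u * E v)%g.
  pose w := u + v; rewrite -/w; pose m := maxn (N w) (maxn (N u) (N v)).
  have [m1 m2 m3] : [/\ (N w <= m)%N, (N u <= m)%N & (N v <= m)%N].
    by rewrite /m !leq_max !leqnn !orbT.
  rewrite (EE _ m m1) (EE _ m m2) (EE _ m m3) -expgMn; last by apply: C0; exact: hN.
  have [_ Hu] := dP _ (hN _ _ m2); have [_ Hv] := dP _ (hN _ _ m3).
  by rewrite -E0D//; congr (E0 _ ^+ _)%g; rewrite /h /w scalerDr.
have EC v : center_subgroup G (E v) by apply: center_subgroupX; apply: C0; exact: hN.
have E1 : E 0 = 1%g by rewrite Esmall ?normr0.
have nearE : \forall t \near (0 : 'rV[R]_r), E0 t = E t.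
  by apply: filterS (near_norm (0 : 'rV[R]_r) d0) => t; rewrite sub0r normrN => /Esmall.
have SE00 : smooth_at E 0 by exact: (smooth_at_eq (eu r) mG nearE SE0).
have SE u : smooth_at E u.
  have Ssh : smooth_at (fun w : 'rV[R]_r => E (w - u)) u.
    apply: (smooth_at_comp (eu r) (eu r) mG (f := fun w : 'rV[R]_r => w - u)); last by rewrite subrr.
    by apply/smooth_at_rV; apply: sm_D; [exact: sm_id|exact: sm_cst].
  have -> : E = (fun w : 'rV[R]_r => E u * E (w - u))%g by apply/funext => w; rewrite -ED addrC subrK.
  exact: (smooth_at_mulg (eu r) (smooth_at_cst _ _ (eu r) mG) Ssh).
exists E, (fun x => L (theta x)); split.
- exact: ED.
- exact: SE.
- exact: EC.
- rewrite -(omega_near_eq LP SE0 nearE) (omega_comp LP Sg); last by rewrite g0.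
  rewrite g0 oz.
  have : jacobian L 0 *m jacobian g (L 0) = 1%:M.
    rewrite -(jacobian_comp (sm_diff SL)); last by rewrite L0; exact: sm_diff.
    rewrite -(jacobian_id (0 : 'rV[R]_r)); apply/esym/near_eq_jacobian; last exact: sm_diff (sm_id _).
    by apply: filterS K2 => a /= ->.
  by rewrite JL mul1mx L0 => ->; rewrite mul1mx.
have ct : theta @ (1%g : G) --> (0 : 'rV[R]_r) by rewrite -[X in _ --> X]t1; exact: St.1.
split.
- by apply: (smooth_at_comp mG (eu r) (eu r) St); rewrite t1; exact/smooth_at_rV.
- by rewrite t1.
- have H1 : \forall t \near (0 : 'rV[R]_r), theta (z (g t)) = g t by exact: (cg _ tK).
  near=> t.
  have <- : E0 t = E t by near: t; exact: nearE.
  have -> : theta (E0 t) = g t by near: t; exact: H1.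
  by near: t; exact: K1.
- have cL : (fun x => L (theta x)) @ (1%g : G) --> (0 : 'rV[R]_r).
    have cL0 : L @ (0 : 'rV[R]_r) --> (0 : 'rV[R]_r) by rewrite -[X in _ --> X]L0; exact: (sm_cont SL).
    exact: (cvg_comp _ _ ct cL0).
  have H1 : \forall x \near (1%g : G), E0 (L (theta x)) = E (L (theta x)) by exact: (cL _ nearE).
  have H2 : \forall x \near (1%g : G), g (L (theta x)) = theta x by exact: (ct _ K2).
  near=> x => cx.
  have <- : E0 (L (theta x)) = E (L (theta x)) by near: x; exact: H1.
  rewrite /E0; have -> : g (L (theta x)) = theta x by near: x; exact: H2.
  by move: cx; near: x; exact: zK.
Unshelve. all: by end_near. Qed.

End CentralExp.

Section LocalCharts.
Context {R : realType} {G : lieGroupType R}.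
Local Notation n := (mdim G).
Let mG := @lie_mfd R G.
Let eu m := @euclidean_manifold R m.

Lemma near_translate (x : G) (Q : G -> Prop) : (\forall y \near (1%g : G), Q y) -> \forall y \near x, Q (x^-1 * y)%g.
Proof.
move=> H; have c : (fun y => x^-1 * y)%g @ x --> (1%g : G).
  by rewrite -[X in _ --> X](mulVg x); apply: cvg_mulg; [exact: cvg_cst|exact: cvg_id].
exact: (c _ H).
Qed.

(** Gaussian elimination factors [B] as an invertible matrix, [pid_mx k] and an invertible matrix;
    the inverse of the last one straightens the row space. *)
Lemma row_free_pid k (B : 'M[R]_(k, n)) : row_free B -> (k <= n)%N /\ exists2 A : 'M[R]_n, A \in unitmx &
  forall w : 'rV[R]_n, (w <= B)%MS <-> exists v : 'rV[R]_k, w *m A = v *m pid_mx k.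
Proof.
move=> fB; have rB : \rank B = k by apply/eqP.
split; first by rewrite -rB rank_leq_col.
have E := mulmx_ebase B; rewrite rB in E.
move: (row_ebase B) (col_ebase B) E (row_ebase_unit B) (col_ebase_unit B) => M1 L <- uM uL.
exists (invmx M1); first by rewrite unitmx_inv.
move=> w; split=> [/submxP[D ->]|[v Hv]].
  by exists (D *m L); rewrite !mulmxA mulmxK.
apply/submxP; exists (v *m invmx L).
by rewrite !mulmxA mulmxKV// -Hv mulmxKV.
Qed.

(** One chart at 1 suffices: left translations carry it to every point of [S], and the matrix [A]
    sends the row space of [B] onto the first [k] coordinates. *)
Lemma translate_embedded (S : set G) k (B : 'M[R]_(k, n)) (phi : 'rV[R]_n -> G) (psi : G -> 'rV[R]_n) :
  row_free B -> phi 0 = 1%g -> smooth_at phi 0 -> smooth_at psi 1%g -> psi 1%g = 0 ->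
  (\forall y \near (1%g : G), phi (psi y) = y) -> (\forall u \near (0 : 'rV[R]_n), psi (phi u) = u) ->
  (forall x, S x -> \forall y \near (1%g : G), S (x * y)%g <-> (psi y <= B)%MS) ->
  embedded_submanifold S k.
Proof.
move=> fB phi0 Sphi Spsi psi1 K1 K2 HS; have [kn [A uA HA]] := row_free_pid fB.
apply: (embedded_local mG kn) => x Sx.
have c0 : (fun u : 'rV[R]_n => u *m invmx A) @ (0 : 'rV[R]_n) --> (0 : 'rV[R]_n).
  rewrite -[X in _ --> X](mul0mx _ (invmx A)); apply: (sm_cont (f := fun u : 'rV[R]_n => u *m invmx A)).
  by apply: sm_mulmx; [exact: sm_id|exact: sm_cst].
have Sl (D : 'M[R]_n) (u : 'rV[R]_n) : smooth_at (fun u : 'rV[R]_n => u *m D) u.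
  by apply/smooth_at_rV; apply: sm_mulmx; [exact: sm_id|exact: sm_cst].
exists (fun u => x * phi (u *m invmx A))%g, (fun y => psi (x^-1 * y)%g *m A), 0.
have Sx1 : smooth_at (fun y => x^-1 * y)%g x.
  exact: (smooth_at_mulg mG (smooth_at_cst _ _ mG mG) (smooth_at_id _ mG)).
split.
- by rewrite mul0mx phi0 mulg1.
- apply: (smooth_at_mulg (eu n) (smooth_at_cst _ _ (eu n) mG)).
  apply: (smooth_at_comp (eu n) (eu n) mG (f := fun u : 'rV[R]_n => u *m invmx A)); first exact: Sl.
  by rewrite mul0mx.
- apply: (smooth_at_comp mG (eu n) (eu n) (f := fun y => psi (x^-1 * y)%g) (g := fun u : 'rV[R]_n => u *m A)); last exact: Sl.
  by apply: (smooth_at_comp mG mG (eu n) Sx1); rewrite mulVg.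
- by rewrite mulVg psi1 mul0mx.
split.
- by apply: filterS (near_translate x K1) => y E; rewrite mulmxK// E mulVKg.
- have H : \forall u \near (0 : 'rV[R]_n), psi (phi (u *m invmx A)) = u *m invmx A by exact: (c0 _ K2).
  by apply: filterS H => u E; rewrite mulKg E mulmxKV.
- apply: filterS (near_translate x (HS x Sx)) => y; rewrite mulVKg => H.
  by apply: (iff_trans H); exact: HA.
Qed.

Variables (kap : 'rV[R]_n -> G) (kapi : G -> 'rV[R]_n).
Hypothesis LP : local_param kap kapi.

Lemma local_inverse1 (phi : 'rV[R]_n -> G) : phi 0 = 1%g -> smooth_at phi 0 ->
  omega kapi phi 0 \in unitmx -> exists psi : G -> 'rV[R]_n,
  [/\ smooth_at psi 1%g, psi 1%g = 0, \forall y \near (1%g : G), phi (psi y) = y &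
      \forall u \near (0 : 'rV[R]_n), psi (phi u) = u].
Proof.
have [k0 ki1 Sk Ski [kK kiK]] := LP.
move=> phi0 Sphi; rewrite (omega1E _ phi0) => U.
have Sf : sm (fun w => kapi (phi w)) 0 by exact: (sm_kapi1 LP).
have [g [Sg g0 K1 K2]] := inverse_function Sf U.
rewrite phi0 ki1 in Sg g0 K1.
exists (fun y => g (kapi y)).
have cki : kapi @ (1%g : G) --> (0 : 'rV[R]_n) by rewrite -ki1; exact: Ski.1.
have cgk : (fun y => phi (g (kapi y))) @ (1%g : G) --> (1%g : G).
  have cg : g @ (0 : 'rV[R]_n) --> (0 : 'rV[R]_n) by rewrite -[X in _ --> X]g0; exact: (sm_cont Sg).
  have cp : phi @ (0 : 'rV[R]_n) --> (1%g : G) by rewrite -phi0; exact: Sphi.1.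
  exact: (cvg_comp _ _ (cvg_comp _ _ cki cg) cp).
split.
- by apply: (smooth_at_comp mG (eu n) (eu n) Ski); rewrite ki1; exact/smooth_at_rV.
- by rewrite ki1.
- have H1 : \forall y \near (1%g : G), kapi (phi (g (kapi y))) = kapi y by exact: (cki _ K1).
  have H2 : \forall y \near (1%g : G), kap (kapi (phi (g (kapi y)))) = phi (g (kapi y)) by exact: (cgk _ kiK).
  near=> y.
  have <- : kap (kapi (phi (g (kapi y)))) = phi (g (kapi y)) by near: y; exact: H2.
  have -> : kapi (phi (g (kapi y))) = kapi y by near: y; exact: H1.
  by near: y; exact: kiK.
- exact: K2.
Unshelve. all: by end_near. Qed.

Lemma smooth_at_lin m p (phi : 'rV[R]_p -> G) (N : 'M[R]_(m, p)) u :
  smooth_at phi (u *m N) -> smooth_at (fun w => phi (w *m N)) u.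
Proof.
move=> S; have Sl : smooth_at (fun w : 'rV[R]_m => w *m N) u.
  by apply/smooth_at_rV; apply: sm_mulmx; [exact: sm_id|exact: sm_cst].
exact: (smooth_at_comp (eu m) (eu p) mG Sl S).
Qed.

End LocalCharts.

(** * The identity component of the center is embedded *)

Section CenterComponent.
Context {R : realType} {G : lieGroupType R}.
Local Notation n := (mdim G).
Variables (kap : 'rV[R]_n -> G) (kapi : G -> 'rV[R]_n).
Hypothesis LP : local_param kap kapi.
Variables (P : 'M[R]_n) (r : nat) (C : 'M[R]_(n, r)) (B : 'M[R]_(r, n)).
Hypotheses (CB : C *m B = P) (BC : B *m C = 1%:M).
Variables (E : 'rV[R]_r -> G) (lam : G -> 'rV[R]_r).
Hypotheses (ED : forall u v, E (u + v) = (E u * E v)%g) (SE : forall u, smooth_at E u)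
  (EC : forall u, center_subgroup G (E u)) (oE : omega kapi E 0 = B)
  (lam1 : lam 1%g = 0) (clam : smooth_at lam 1%g)
  (Elam : \forall g \near (1%g : G), center_subgroup G g -> E (lam g) = g).
Let mG := @lie_mfd R G.
Let eu m := @euclidean_manifold R m.

Lemma hom0 : E 0 = 1%g.
Proof. by apply: (mulgI (E 0)); rewrite -ED addr0 mulg1. Qed.

Lemma homN u : E (- u) = (E u)^-1%g.
Proof. by apply: (mulgI (E u)); rewrite -ED subrr hom0 mulgV. Qed.

Lemma row_factor_proj : B *m P = B. Proof. by rewrite -CB mulmxA BC mul1mx. Qed.
Lemma proj_col_factor : P *m C = C. Proof. by rewrite -CB -mulmxA BC mulmx1. Qed.

Lemma row_free_B : row_free B.
Proof.
apply/row_freeP; exists C; exact: BC.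
Qed.

(** The two summands of [w'] can be prescribed independently: [1 - P] and [C] each kill the summand
    that the other one reads. *)
Lemma split_coord (w : 'rV[R]_n) (t : 'rV[R]_r) :
  let w' := w *m (1%:M - P) + t *m B in w' *m (1%:M - P) = w *m (1%:M - P) /\ w' *m C = t.
Proof.
have PP : P *m P = P by rewrite -{2}CB mulmxA proj_col_factor CB.
have QQ : (1%:M - P) *m (1%:M - P) = 1%:M - P :> 'M[R]_n.
  by rewrite mulmxBr mulmx1 mulmxBl mul1mx PP subrr subr0.
have BQ : B *m (1%:M - P) = 0 by rewrite mulmxBr mulmx1 row_factor_proj subrr.
have QC : (1%:M - P) *m C = 0 by rewrite mulmxBl mul1mx proj_col_factor subrr.
move=> /=; split; first by rewrite mulmxDl -!mulmxA QQ BQ mulmx0 addr0.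
by rewrite mulmxDl -!mulmxA QC BC mulmx0 add0r mulmx1.
Qed.

(** The translate of E(R^r) by [x] is connected, central and contains [x], so it can be adjoined to
    the connected central set joining 1 to [x]. *)
Lemma central_connected (x : G) : center_component G x -> forall t, center_component G (x * E t)%g.
Proof.
move=> Zx t; have := Zx => -[A [A1 sAC cA] Ax].
have cE : connected (range (fun t => x * E t)%g).
  apply: connected_continuous_connected.
    have -> : [set: 'rV[R]_r] = \bigcup_(v in [set: 'rV[R]_r]) ((fun a : R => a *: v) @` `[0, 1]%classic).
      apply/seteqP; split=> // v _; exists v => //; exists 1; last by rewrite scale1r.
      by rewrite /= in_itv/= ler01 lexx.
    apply: bigcup_connected.
      by exists 0 => v _; exists 0; rewrite ?scale0r//= in_itv/= lexx ler01.
    move=> v _; apply: connected_continuous_connected; first exact: segment_connected.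
    apply: continuous_subspaceT => a.
    exact: cvgZr_tmp cvg_id.
  apply: continuous_subspaceT => u.
  exact: (smooth_at_mulg (eu r) (smooth_at_cst x u (eu r) mG) (SE u)).1.
exists (A `|` range (fun t => x * E t)%g).
  split; first by left.
  - move=> y [/sAC//|[u _ <-]]; apply: center_subgroupM => //; exact: sAC.
  - apply: connectedU => //; exists x; split=> //.
    by exists 0 => //; rewrite hom0 mulg1.
by right; exists t.
Qed.

(** [Phi] has derivative 1 at 0, hence is a chart. A point of the component near [x] is [x] times a
    central element near 1, that is [x] times some [E t], which in this chart means that the
    coordinate along [1 - P] vanishes. *)
Theorem center_component_embedded : embedded_submanifold (center_component G) r.
Proof.
have [k0 ki1 Sk Ski [kK kiK]] := LP.
pose Phi (w : 'rV[R]_n) := (kap (w *m (1%:M - P)) * E (w *m C))%g.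
have S1 : smooth_at (fun w : 'rV[R]_n => kap (w *m (1%:M - P))) 0.
  by apply: smooth_at_lin; rewrite mul0mx.
have S2 : smooth_at (fun w : 'rV[R]_n => E (w *m C)) 0 by apply: smooth_at_lin; exact: SE.
have SPhi : smooth_at Phi 0 by exact: (smooth_at_mulg (eu n) S1 S2).
have Phi0 : Phi 0 = 1%g by rewrite /Phi !mul0mx k0 hom0 mulg1.
have oPhi : omega kapi Phi 0 = 1%:M.
  rewrite (omega_mul LP S1 S2) (omega_lin LP (phi := kap)); last by rewrite mul0mx.
  rewrite (omega_lin LP (phi := E)); last exact: SE.
  by rewrite !mul0mx hom0 (AD1 LP) (omega_kap LP) oE !mulmx1 CB subrK.
have [psi [Spsi psi1 K1 K2]] : exists psi : G -> 'rV[R]_n,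
  [/\ smooth_at psi 1%g, psi 1%g = 0, \forall y \near (1%g : G), Phi (psi y) = y &
      \forall u \near (0 : 'rV[R]_n), psi (Phi u) = u].
  by apply: (local_inverse1 LP Phi0 SPhi); rewrite oPhi unitmx1.
apply: (translate_embedded row_free_B Phi0 SPhi Spsi psi1 K1 K2) => x Zx.
have Cx : center_subgroup G x by have [A [_ sAC _] Ax] := Zx; exact: sAC.
have cl : (fun g => lam g *m B) @ (1%g : G) --> (0 : 'rV[R]_n).
  have c1 : lam @ (1%g : G) --> (0 : 'rV[R]_r) by rewrite -lam1; exact: clam.1.
  have c2 : (fun t : 'rV[R]_r => t *m B) @ (0 : 'rV[R]_r) --> (0 : 'rV[R]_n).
    rewrite -[X in _ --> X](mul0mx _ B); apply: (sm_cont (f := fun t : 'rV[R]_r => t *m B)).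
    by apply: sm_mulmx; [exact: sm_id|exact: sm_cst].
  exact: (cvg_comp _ _ c1 c2).
have H1 : \forall g \near (1%g : G), psi (Phi (lam g *m B)) = lam g *m B by exact: (cl _ K2).
have PhiB t : Phi (t *m B) = E t.
  by have [E1 E2] := split_coord 0 t; rewrite mul0mx add0r in E1 E2; rewrite /Phi E1 E2 k0 mul1g.
near=> y; split=> [Zy|/submxP[t Ht]].
- have Cy : center_subgroup G y.
    have [A [_ sAC _] Ay] := Zy; rewrite -(mulKg x y).
    by apply: center_subgroupM; [exact: center_subgroupV|exact: sAC].
  have Ey : E (lam y) = y by move: Cy; near: y; exact: Elam.
  have : psi (Phi (lam y *m B)) = lam y *m B by near: y; exact: H1.
  by rewrite PhiB Ey => ->; exact: submxMl.
- have <- : Phi (psi y) = y by near: y; exact: K1.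
  by rewrite Ht PhiB; exact: central_connected.
Unshelve. all: by end_near. Qed.

End CenterComponent.

(** * A local homomorphism killing the commutators *)

Section CommutatorSubgroup.
Variable G : groupType.

Lemma subgroupM (H : set G) x y : subgroup H -> H x -> H y -> H (x * y)%g.
Proof.
move=> [H1 HD] Hx Hy; have HV := HD _ _ H1 Hy.
by have := HD _ _ Hx HV; rewrite div1g invgK.
Qed.

Lemma subgroupV (H : set G) x : subgroup H -> H x -> H (x^-1)%g.
Proof. by move=> [H1 HD] Hx; have := HD _ _ H1 Hx; rewrite div1g. Qed.

Lemma commutator_subgroupP : subgroup (commutator_subgroup G).
Proof.
split=> [A [[A1 _] _] //|x y Hx Hy A [sA cA]].
by apply: sA.2; [apply: Hx|apply: Hy].
Qed.

Lemma comm_in_commutator x y : commutator_subgroup G [~ x, y]%g.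
Proof. by move=> A [_]; apply; exists x, y. Qed.

Lemma commutator_subgroup_min (H : set G) : subgroup H -> (forall x y, H [~ x, y]%g) ->
  commutator_subgroup G `<=` H.
Proof. by move=> sH cH z; apply; split=> // _ [x [y ->]]. Qed.

End CommutatorSubgroup.

Lemma cvg_mulmx0 (R : realType) p q (A : 'M[R]_(p, q)) (T : Type) (F : set_system T) (f : T -> 'rV[R]_p) :
  f @ F --> (0 : 'rV[R]_p) -> (fun y => f y *m A) @ F --> (0 : 'rV[R]_q).
Proof.
move=> cf; have c2 : (fun t : 'rV[R]_p => t *m A) @ (0 : 'rV[R]_p) --> (0 : 'rV[R]_q).
  rewrite -[X in _ --> X](mul0mx _ A); apply: (sm_cont (f := fun t : 'rV[R]_p => t *m A)).
  by apply: sm_mulmx; [exact: sm_id|exact: sm_cst].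
exact: (cvg_comp _ _ cf c2).
Qed.

Section Tau.
Local Opaque omega AD BL.
Context {R : realType} {G : lieGroupType R}.
Local Notation n := (mdim G).
Variables (kap : 'rV[R]_n -> G) (kapi : G -> 'rV[R]_n).
Hypothesis LP : local_param kap kapi.
Local Notation AD := (AD kap kapi).
Variables (P : 'M[R]_n) (r : nat) (C : 'M[R]_(n, r)) (B : 'M[R]_(r, n)).
Hypotheses (CB : C *m B = P) (BC : B *m C = 1%:M).
Hypothesis ADP : forall h, AD h *m P = P.
Variable s : seq (G * 'M[R]_n).
Hypothesis sE : \sum_(p <- s) p.2 *m (AD p.1 - 1%:M) = 1%:M - P.
Variable E : 'rV[R]_r -> G.
Hypotheses (ED : forall u v, E (u + v) = (E u * E v)%g) (SE : forall u, smooth_at E u)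
  (EC : forall u, center_subgroup G (E u)) (oE : omega kapi E 0 = B).
Let mG := @lie_mfd R G.
Let eu m := @euclidean_manifold R m.
Local Notation omega := (omega kapi).
Local Notation Q := (1%:M - P : 'M[R]_n).

Let k0 : kap 0 = 1%g. Proof. by case: LP. Qed.
Let E0 : E 0 = 1%g. Proof. exact: hom0. Qed.
Let BPs : B *m P = B. Proof. exact: row_factor_proj CB BC. Qed.

(** The derivative at 0 is the sum of the [p.2 *m (AD p.1 - 1%:M)]. For the list of [span_rows] it
    is [1 - P], so these elements of G' fill the complement of the central directions. *)
Fixpoint comm_prod (t : seq (G * 'M[R]_n)) (u : 'rV[R]_n) : G :=
  if t is p :: t' then ([~ kap (u *m p.2), p.1] * comm_prod t' u)%g else 1%g.

Lemma comm_prod0 t : comm_prod t 0 = 1%g.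
Proof. by elim: t => [//|p t IH] /=; rewrite IH mul0mx k0 comm1g mulg1. Qed.

Lemma comm_prod_in t u : commutator_subgroup G (comm_prod t u).
Proof.
have sG := commutator_subgroupP G.
elim: t => [|p t IH] /=; first by have [] := sG.
exact: (subgroupM sG (comm_in_commutator _ _) IH).
Qed.

(** Multiplication by [P] trivializes the adjoint action, so the two terms of the derivative of a
    commutator cancel. *)
Lemma omega_commP m (phi : 'rV[R]_m -> G) u x : smooth_at phi u ->
  omega (fun w => [~ phi w, x]%g) u *m P = 0.
Proof.
move=> S; rewrite (omega_comm LP x S) -mulmxA.
have -> : (AD x - AD [~ phi u, x]%g) *m P = 0; last by rewrite mulmx0.
move: (AD x) (AD [~ phi u, x]%g) (ADP x) (ADP [~ phi u, x]%g) => A1 A2 E1 E2.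
by rewrite mulmxBl E1 E2 subrr.
Qed.

Lemma omega_mulP m (phi psi : 'rV[R]_m -> G) u : smooth_at phi u -> smooth_at psi u ->
  omega (fun w => (phi w * psi w)%g) u *m P = omega phi u *m P + omega psi u *m P.
Proof. by move=> S1 S2; rewrite (omega_mul LP S1 S2) mulmxDl -mulmxA ADP. Qed.

Lemma near_comm_prod t : \forall u \near (0 : 'rV[R]_n), smooth_at (comm_prod t) u /\ omega (comm_prod t) u *m P = 0.
Proof.
have Sk : smooth_at kap 0 by case: LP.
elim: t => [|p t IH].
  near=> u; split; first exact: (smooth_at_cst (1%g : G) u (eu n) mG).
  by rewrite -[comm_prod [::]]/(fun=> 1%g) omega_cst mul0mx.
have H1 : \forall u \near (0 : 'rV[R]_n), smooth_at kap (u *m p.2).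
  have c : (fun u : 'rV[R]_n => u *m p.2) @ (0 : 'rV[R]_n) --> (0 : 'rV[R]_n).
    rewrite -[X in _ --> X](mul0mx _ p.2); apply: (sm_cont (f := fun u : 'rV[R]_n => u *m p.2)).
    by apply: sm_mulmx; [exact: sm_id|exact: sm_cst].
  exact: (c _ (smooth_at_near (eu n) mG Sk)).
near=> u.
have Sku : smooth_at kap (u *m p.2) by near: u; exact: H1.
have Sp := smooth_at_lin Sku; have Sc := smooth_at_comm p.1 Sp.
have [St Ot] : smooth_at (comm_prod t) u /\ omega (comm_prod t) u *m P = 0 by near: u; exact: IH.
split; first exact: (smooth_at_mulg (eu n) Sc St).
have O1 := omega_commP p.1 Sp.
exact: (etrans (omega_mulP Sc St) (etrans (f_equal2 +%R O1 Ot) (addr0 0))).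
Unshelve. all: by end_near. Qed.

Lemma omega_comm_prod0 t : omega (comm_prod t) 0 = \sum_(p <- t) p.2 *m (AD p.1 - 1%:M).
Proof.
have Sk : smooth_at kap 0 by case: LP.
elim: t => [|p t IH]; first by rewrite big_nil -[comm_prod [::]]/(fun=> 1%g) omega_cst.
have Sku : smooth_at kap (0 *m p.2) by rewrite mul0mx.
have Sp := smooth_at_lin Sku; have Sc := smooth_at_comm p.1 Sp.
have [St _] := nbhs_singleton (near_comm_prod t).
rewrite -[comm_prod (p :: t)]/(fun u => ([~ kap (u *m p.2), p.1] * comm_prod t u)%g).
rewrite (omega_mul LP Sc St) IH big_cons comm_prod0 (AD1 LP) mulmx1; congr (_ + _).
rewrite (omega_comm LP p.1 Sp) (omega_lin LP Sku) mul0mx k0 comm1g (AD1 LP).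
by rewrite (omega_kap LP) mulmx1.
Qed.

Local Notation F := (comm_prod s).

(** Near [t] the homomorphism is the left translate by [E t] of what it is near 0, and [omega] is
    invariant under left translation. *)
Lemma omega_hom t : omega E t = B.
Proof.
have Ssh : smooth_at (fun w : 'rV[R]_r => E (w - t)) t.
  apply: (smooth_at_comp (eu r) (eu r) mG (f := fun w : 'rV[R]_r => w - t)); last by rewrite subrr.
  by apply/smooth_at_rV; apply: sm_D; [exact: sm_id|exact: sm_cst].
have -> : E = (fun w : 'rV[R]_r => E t * E (w - t))%g by apply/funext => w; rewrite -ED addrC subrK.
have St : sm (fun w : 'rV[R]_r => w - t) t by apply: sm_D; [exact: sm_id|exact: sm_cst].
rewrite omega_left (omega_comp LP St); last by rewrite subrr.
rewrite subrr oE (jacobianD (sm_diff (sm_id t)) (sm_diff (sm_cst _ _))) jacobian_id jacobian_cst.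
by rewrite addr0 mul1mx.
Qed.

(* omega composed with P is additive on products and vanishes on commutators, so the
   central factor of F a * F b has zero derivative. *)
Lemma comm_prod_mul (psi : G -> 'rV[R]_n) : smooth_at psi 1%g -> psi 1%g = 0 ->
  (\forall y \near (1%g : G), (F (psi y *m Q) * E (psi y *m C))%g = y) ->
  exists2 d : R, 0 < d & forall a b : 'rV[R]_n, `|a| < d -> `|b| < d ->
    (F a * F b)%g = F (psi (F a * F b)%g *m Q).
Proof.
move=> Spsi psi1 K1.
have [Nl ENl] : exists N : 'M[R]_(n + n, n), forall a b : 'rV[R]_n, row_mx a b *m N = a.
  by exists (col_mx 1%:M 0) => a b; rewrite mul_row_col mulmx1 mulmx0 addr0.
have [Nr ENr] : exists N : 'M[R]_(n + n, n), forall a b : 'rV[R]_n, row_mx a b *m N = b.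
  by exists (col_mx 0 1%:M) => a b; rewrite mul_row_col mulmx1 mulmx0 add0r.
pose q (x : 'rV[R]_(n + n)) := (F (x *m Nl) * F (x *m Nr))%g.
have cN (N : 'M[R]_(n + n, n)) : (fun u : 'rV[R]_(n + n) => u *m N) @ (0 : 'rV[R]_(n + n)) --> (0 : 'rV[R]_n).
  rewrite -[X in _ --> X](mul0mx _ N); apply: (sm_cont (f := fun u : 'rV[R]_(n + n) => u *m N)).
  by apply: sm_mulmx; [exact: sm_id|exact: sm_cst].
have HFl := cN Nl _ (near_comm_prod s); have HFr := cN Nr _ (near_comm_prod s).
have {}HFl : \forall x \near (0 : 'rV[R]_(n + n)), smooth_at F (x *m Nl) /\ omega F (x *m Nl) *m P = 0 by exact: HFl.
have {}HFr : \forall x \near (0 : 'rV[R]_(n + n)), smooth_at F (x *m Nr) /\ omega F (x *m Nr) *m P = 0 by exact: HFr.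
have Hq : \forall x \near (0 : 'rV[R]_(n + n)), smooth_at q x /\ omega q x *m P = 0.
  apply: filterS2 HFl HFr => x [S1 O1] [S2 O2].
  have Sl := smooth_at_lin S1; have Sr := smooth_at_lin S2.
  split; first exact: (smooth_at_mulg (eu _) Sl Sr).
  have OL : omega (fun w => F (w *m Nl)) x *m P = 0.
    exact: (etrans (congr1 (mulmx^~ P) (omega_lin LP S1)) (etrans (esym (mulmxA _ _ _)) (etrans (congr1 (mulmx Nl) O1) (mulmx0 _ _)))).
  have OR : omega (fun w => F (w *m Nr)) x *m P = 0.
    exact: (etrans (congr1 (mulmx^~ P) (omega_lin LP S2)) (etrans (esym (mulmxA _ _ _)) (etrans (congr1 (mulmx Nr) O2) (mulmx0 _ _)))).
  exact: (etrans (omega_mulP Sl Sr) (etrans (f_equal2 +%R OL OR) (addr0 0))).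
have [Sq0 _] := nbhs_singleton Hq.
have q0 : q 0 = 1%g by rewrite /q !mul0mx !comm_prod0 mulg1.
have cq : q @ (0 : 'rV[R]_(n + n)) --> (1%g : G) by rewrite -q0; exact: Sq0.1.
pose w x := psi (q x).
have cw : w @ (0 : 'rV[R]_(n + n)) --> (0 : 'rV[R]_n).
  have cp : psi @ (1%g : G) --> (0 : 'rV[R]_n) by rewrite -psi1; exact: Spsi.1.
  exact: (cvg_comp _ _ cq cp).
have Hw : \forall x \near (0 : 'rV[R]_(n + n)), sm w x.
  have H1 : \forall x \near (0 : 'rV[R]_(n + n)), smooth_at psi (q x).
    exact: (cq _ (smooth_at_near mG (eu n) Spsi)).
  near=> x.
  have [Sx _] : smooth_at q x /\ omega q x *m P = 0 by near: x; exact: Hq.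
  have Spx : smooth_at psi (q x) by near: x; exact: H1.
  by apply/smooth_at_rV; exact: (smooth_at_comp (eu _) mG (eu n) Sx Spx).
pose T x := E (w x *m C).
have HK : \forall x \near (0 : 'rV[R]_(n + n)), (F (w x *m Q) * T x)%g = q x by exact: (cq _ K1).
have cwQ : (fun x => w x *m Q) @ (0 : 'rV[R]_(n + n)) --> (0 : 'rV[R]_n).
  have c2 : (fun t : 'rV[R]_n => t *m Q) @ (0 : 'rV[R]_n) --> (0 : 'rV[R]_n).
    rewrite -[X in _ --> X](mul0mx _ Q); apply: (sm_cont (f := fun t : 'rV[R]_n => t *m Q)).
    by apply: sm_mulmx; [exact: sm_id|exact: sm_cst].
  exact: (cvg_comp _ _ cw c2).
have HFw : \forall x \near (0 : 'rV[R]_(n + n)), smooth_at F (w x *m Q) /\ omega F (w x *m Q) *m P = 0.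
  exact: (cwQ _ (near_comm_prod s)).
have HKK : \forall x \near (0 : 'rV[R]_(n + n)), \forall y \near x, (F (w y *m Q) * T y)%g = q y.
  by apply/near_join.
have HT : \forall x \near (0 : 'rV[R]_(n + n)), smooth_at T x /\ omega T x = 0.
  near=> x.
  have Sw : sm w x by near: x; exact: Hw.
  have [SF OF] : smooth_at F (w x *m Q) /\ omega F (w x *m Q) *m P = 0 by near: x; exact: HFw.
  have [Sx Ox] : smooth_at q x /\ omega q x *m P = 0 by near: x; exact: Hq.
  have SwC : sm (fun x => w x *m C) x by apply: sm_mulmx => //; exact: sm_cst.
  have SwQ : sm (fun x => w x *m Q) x by apply: sm_mulmx => //; exact: sm_cst.
  have ST : smooth_at T x.
    by apply: (smooth_at_comp (eu _) (eu r) mG (f := fun x => w x *m C)); [exact/smooth_at_rV|exact: SE].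
  have SFw : smooth_at (fun x => F (w x *m Q)) x.
    by apply: (smooth_at_comp (eu _) (eu n) mG (f := fun x => w x *m Q)); [exact/smooth_at_rV|exact: SF].
  split; first exact: ST.
  have OT : omega T x *m P = omega T x.
    by rewrite (omega_comp LP SwC (SE _)) omega_hom -mulmxA BPs.
  have OFw : omega (fun x => F (w x *m Q)) x *m P = 0.
    by rewrite (omega_comp LP SwQ SF) -mulmxA OF mulmx0.
  have Sm : smooth_at (fun x => F (w x *m Q) * T x)%g x := smooth_at_mulg (eu _) SFw ST.
  have Exq : \forall y \near x, (F (w y *m Q) * T y)%g = q y by near: x; exact: HKK.
  have Om := omega_near_eq LP Sm Exq.
  have O0 := etrans (esym (omega_mulP SFw ST)) (etrans (congr1 (mulmx^~ P) Om) Ox).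
  exact: (etrans (esym OT) (etrans (esym (add0r _)) (etrans (f_equal2 +%R (esym OFw) erefl) O0))).
have [ST0 _] := nbhs_singleton HT.
have HT2 : \forall x \near (0 : 'rV[R]_(n + n)), omega T x = 0 by apply: filterS HT => x [].
have T0 : T 0 = 1%g by rewrite /T /w q0 psi1 mul0mx E0.
have HTc := omega0_const LP ST0 HT2.
have HH : \forall x \near (0 : 'rV[R]_(n + n)), q x = F (w x *m Q).
  near=> x.
  have <- : (F (w x *m Q) * T x)%g = q x by near: x; exact: HK.
  have -> : T x = T 0 by near: x; exact: HTc.
  by rewrite T0 mulg1.
have [d d0 Hd] := near_row_mx HH; exists d => // a b Ha Hb.
by have := Hd a b Ha Hb; rewrite /w /q ENl ENr.
Unshelve. all: by end_near. Qed.

(** Near 1 an element is [F a * E t], and [t] is its value of tau. As [E] is central, the product of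
    two such elements is [F a * F b] times [E] of the sum, and [comm_prod_mul] rewrites [F a * F b]
    without any factor from [E]. Hence tau is additive. *)
Theorem tau_chart : exists (Psi : 'rV[R]_n -> G) (psi : G -> 'rV[R]_n),
  [/\ Psi 0 = 1%g, smooth_at Psi 0, smooth_at psi 1%g & psi 1%g = 0] /\
  [/\ \forall y \near (1%g : G), Psi (psi y) = y,
      \forall u \near (0 : 'rV[R]_n), psi (Psi u) = u,
      \forall t \near (0 : 'rV[R]_r), psi (E t) *m C = t,
      exists2 W, nbhs (1%g : G) W & forall x y, W x -> W y -> psi (x * y)%g *m C = psi x *m C + psi y *m C &
      \forall x \near (1%g : G), commutator_subgroup G (x * E (- (psi x *m C)))%g].
Proof.
pose Psi (w : 'rV[R]_n) := (F (w *m Q) * E (w *m C))%g.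
have [SF0 _] := nbhs_singleton (near_comm_prod s).
have SF0Q : smooth_at F (0 *m Q) by rewrite mul0mx.
have S1 : smooth_at (fun w : 'rV[R]_n => F (w *m Q)) 0 := smooth_at_lin SF0Q.
have S2 : smooth_at (fun w : 'rV[R]_n => E (w *m C)) 0 by apply: smooth_at_lin; exact: SE.
have SPsi : smooth_at Psi 0 by exact: (smooth_at_mulg (eu n) S1 S2).
have Psi0 : Psi 0 = 1%g by rewrite /Psi !mul0mx comm_prod0 E0 mulg1.
have QQ : Q *m Q = Q.
  have PP : P *m P = P by rewrite -{2}CB mulmxA (proj_col_factor CB BC) CB.
  by rewrite mulmxBr mulmx1 mulmxBl mul1mx PP subrr subr0.
have oPsi : omega Psi 0 = 1%:M.
  rewrite (omega_mul LP S1 S2) (omega_lin LP SF0Q) (omega_lin LP (phi := E)); last exact: SE.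
  by rewrite !mul0mx E0 (AD1 LP) omega_comm_prod0 sE oE !mulmx1 CB QQ subrK.
have [psi [Spsi psi1 K1 K2]] : exists psi : G -> 'rV[R]_n,
  [/\ smooth_at psi 1%g, psi 1%g = 0, \forall y \near (1%g : G), Psi (psi y) = y &
      \forall u \near (0 : 'rV[R]_n), psi (Psi u) = u].
  by apply: (local_inverse1 LP Psi0 SPsi); rewrite oPsi unitmx1.
exists Psi, psi; split; first by split.
have split_c := split_coord CB BC.
split; [exact: K1|exact: K2| | |].
- have cB : (fun t : 'rV[R]_r => t *m B) @ (0 : 'rV[R]_r) --> (0 : 'rV[R]_n).
    rewrite -[X in _ --> X](mul0mx _ B); apply: (sm_cont (f := fun t : 'rV[R]_r => t *m B)).
    by apply: sm_mulmx; [exact: sm_id|exact: sm_cst].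
  have H : \forall t \near (0 : 'rV[R]_r), psi (Psi (t *m B)) = t *m B by exact: (cB _ K2).
  apply: filterS H => t.
  have [E1 E2] := split_c 0 t; rewrite mul0mx add0r in E1 E2.
  by rewrite /Psi E1 comm_prod0 mul1g E2 => ->; rewrite E2.
- have [d d0 Hd] := comm_prod_mul Spsi psi1 K1.
  have [d2 d20 Hd2] := near_ball0 K2.
  (* The coordinate that the product [x * y] is expected to have. It must be shown to be small,
     because [psi (Psi u) = u] is known near 0 only. *)
  pose S (x y : G) := psi (F (psi x *m Q) * F (psi y *m Q))%g *m Q + (psi x *m C + psi y *m C) *m B.
  have cp : psi @ (1%g : G) --> (0 : 'rV[R]_n) by rewrite -psi1; exact: Spsi.1.
  have SFp : smooth_at (fun x : G => F (psi x *m Q)) 1%g.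
    apply: (smooth_at_comp mG (eu n) mG (g := fun u : 'rV[R]_n => F (u *m Q)) Spsi).
    by rewrite psi1.
  have SCp : smooth_at (fun x : G => E (psi x *m C)) 1%g.
    apply: (smooth_at_comp mG (eu n) mG (g := fun u : 'rV[R]_n => E (u *m C)) Spsi).
    by rewrite psi1.
  have c1 : (fun p : G * G => psi (F (psi p.1 *m Q) * F (psi p.2 *m Q))%g) @ (1%g : G, 1%g : G) --> (0 : 'rV[R]_n).
    have cF : (fun x : G => F (psi x *m Q)) @ (1%g : G) --> (1%g : G).
      by have := SFp.1; rewrite /prop_for /continuous_at psi1 mul0mx comm_prod0.
    have cF1 : (fun p : G * G => F (psi p.1 *m Q)) @ (1%g : G, 1%g : G) --> (1%g : G).
      by apply: (@cvg_comp _ _ _ fst (fun x : G => F (psi x *m Q))); [exact: cvg_fst|exact: cF].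
    have cF2 : (fun p : G * G => F (psi p.2 *m Q)) @ (1%g : G, 1%g : G) --> (1%g : G).
      by apply: (@cvg_comp _ _ _ snd (fun x : G => F (psi x *m Q))); [exact: cvg_snd|exact: cF].
    have cFF : (fun p : G * G => F (psi p.1 *m Q) * F (psi p.2 *m Q))%g @ (1%g : G, 1%g : G) --> (1%g : G).
      by rewrite -[X in _ --> X]mulg1; apply: cvg_mulg; [exact: cF1|exact: cF2].
    exact: (cvg_comp _ _ cFF cp).
  have cS : (fun p : G * G => S p.1 p.2) @ (1%g : G, 1%g : G) --> (0 : 'rV[R]_n).
    have cp1 : (fun p : G * G => psi p.1) @ (1%g : G, 1%g : G) --> (0 : 'rV[R]_n).
      by apply: (@cvg_comp _ _ _ fst psi); [exact: cvg_fst|exact: cp].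
    have cp2 : (fun p : G * G => psi p.2) @ (1%g : G, 1%g : G) --> (0 : 'rV[R]_n).
      by apply: (@cvg_comp _ _ _ snd psi); [exact: cvg_snd|exact: cp].
    have cD : (fun p : G * G => psi p.1 *m C + psi p.2 *m C) @ (1%g : G, 1%g : G) --> (0 : 'rV[R]_r).
      by rewrite -[X in _ --> X]addr0; apply: cvgD; apply: cvg_mulmx0; [exact: cp1|exact: cp2].
    by rewrite -[X in _ --> X]addr0; apply: cvgD; apply: cvg_mulmx0; [exact: c1|exact: cD].
  have HS : \forall p \near (1%g : G, 1%g : G), `|0 - S p.1 p.2| < d2 by exact: (cS _ (near_norm (0 : 'rV[R]_n) d20)).
  have cQ : (fun x => psi x *m Q) @ (1%g : G) --> (0 : 'rV[R]_n) by exact: cvg_mulmx0.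
  have HQ : \forall x \near (1%g : G), `|0 - psi x *m Q| < d by exact: (cQ _ (near_norm (0 : 'rV[R]_n) d0)).
  have [[W1 W2] /= [W11 W21] HW] := HS.
  pose W3 := [set x : G | `|0 - psi x *m Q| < d /\ Psi (psi x) = x].
  have W31 : nbhs (1%g : G) W3 by exact: filterI HQ K1.
  exists (W1 `&` W2 `&` W3); first by apply: filterI => //; exact: filterI.
  move=> x y [[Wx _] [xd Ex]] [[_ Wy] [yd Ey]].
  have := HW (x, y) (conj Wx Wy); rewrite /= sub0r normrN => HSd.
  rewrite sub0r normrN in xd; rewrite sub0r normrN in yd.
  have FF := Hd _ _ xd yd.
  have [E1 E2] := split_c (psi (F (psi x *m Q) * F (psi y *m Q))%g) (psi x *m C + psi y *m C).
  have -> : (x * y)%g = Psi (S x y).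
    rewrite -{1}Ex -{1}Ey /Psi /S E1 E2 -FF ED !mulgA; congr (_ * _)%g.
    by rewrite -!mulgA; congr (_ * _)%g; exact: (EC (psi x *m C) _).
  by rewrite Hd2 // /S E2.
- apply: filterS K1 => x Ex.
  rewrite -{1}Ex /Psi -mulgA -ED subrr E0 mulg1; exact: comm_prod_in.
Qed.

End Tau.

(** * Integrality of the exponential on the commutator subgroup *)

Section RealLemmas.
Context {R : realType}.

Lemma int_small0 (x : R) : x \is a Num.int -> `|x| < 1 -> x = 0.
Proof.
move=> xi x1; apply/eqP; apply: contraTT x1 => x0.
by rewrite -leNgt norm_intr_ge1.
Qed.

(** Pigeonhole on the fractional parts of the first (Q+1)^|I| + 1 multiples, with boxes of side
    1/(Q+1) < e; [N] is the difference of two indices that fall in the same box. *)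
Lemma dirichlet (I : finType) (c : I -> R) (e : R) : 0 < e -> exists N : nat, (0 < N)%N /\
  exists z : I -> R, forall i, z i \is a Num.int /\ `|N%:R * c i - z i| <= e.
Proof.
move=> e0; pose Q := Num.trunc e^-1.
have HQ : e^-1 < Q.+1%:R by exact: truncnS_gt.
have Q0 : (0 : R) < Q.+1%:R by rewrite ltr0n.
pose fr (x : R) := x - (Num.floor x)%:~R.
have fr01 x : 0 <= fr x < 1.
  by have /andP[h1 h2] := floor_itv x; rewrite subr_ge0 h1 /= ltrBlDl -[1]/(1%:~R) -intrD.
pose box (k : 'I_(Q.+1 ^ #|I|).+1) : {ffun I -> 'I_Q.+1} :=
  [ffun i => inord (Num.trunc (Q.+1%:R * fr (k%:R * c i)))].
have : ~~ injectiveb box.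
  apply/negP => /injectiveP/leq_card; rewrite card_ffun !card_ord.
  by rewrite ltnn.
move=> /injectivePn[k1 [k2 k12 E]].
wlog lt12 : k1 k2 k12 E / (k1 < k2)%N.
  move=> H; have [lt|gt|eq] := ltngtP k1 k2; first exact: (H k1 k2).
    by apply: (H k2 k1) => //; rewrite eq_sym.
  by move: k12; rewrite (val_inj eq) eqxx.
exists (k2 - k1)%N; split; first by rewrite subn_gt0.
exists (fun i => (Num.floor (k2%:R * c i))%:~R - (Num.floor (k1%:R * c i))%:~R) => i.
split; first by rewrite rpredB// intr_int.
have -> : (k2 - k1)%:R * c i - ((Num.floor (k2%:R * c i))%:~R - (Num.floor (k1%:R * c i))%:~R) =
    fr (k2%:R * c i) - fr (k1%:R * c i) by rewrite /fr natrB ?(ltnW lt12)//; ring.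
have /(congr1 (@nat_of_ord _)) := congr1 (fun f : {ffun I -> 'I_Q.+1} => f i) E.
have bd x : (Num.trunc (Q.+1%:R * fr x) < Q.+1)%N /\
    (Num.trunc (Q.+1%:R * fr x))%:R <= Q.+1%:R * fr x < (Num.trunc (Q.+1%:R * fr x)).+1%:R.
  have /andP[f0 f1] := fr01 x.
  have p0 : 0 <= Q.+1%:R * fr x by rewrite mulr_ge0.
  split; last exact: truncn_itv.
  by rewrite truncn_lt_nat// -[ltRHS]mulr1 ltr_pM2l.
rewrite !ffunE !inordK; [|exact: (bd _).1|exact: (bd _).1].
have [_] := bd (k1%:R * c i); have [_] := bd (k2%:R * c i).
move: (fr (k1%:R * c i)) (fr (k2%:R * c i)) => x y + + Exy; rewrite Exy.
move: (Num.trunc _) => m /andP[a1 a2] /andP[b1 b2]; rewrite -natr1 in a2 b2.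
have eQ : 1 < e * Q.+1%:R by move: HQ; rewrite -[ltLHS]mul1r ltr_pdivrMr// mulrC.
have H : `|Q.+1%:R * (y - x)| < e * Q.+1%:R.
  by apply: lt_trans eQ; rewrite ltr_norml mulrBr; apply/andP; split; lra.
by move: H; rewrite normrM gtr0_norm// mulrC ltr_pM2r// distrC => /ltW.
Qed.

(** If [v] is killed by [A] then [v *m (A - c%:M)] is [- c *: v], too long for the bound on
    [A - c%:M] unless [v] is 0. *)
Lemma near_scalar_unit n (A : 'M[R]_n) (c : R) : n%:R * `|A - c%:M| < c -> A \in unitmx.
Proof.
move=> H; have c0 : 0 < c by apply: le_lt_trans H; rewrite mulr_ge0.
rewrite -row_free_unit -kermx_eq0; apply/rowV0P => v /sub_kermxP vA.
apply/eqP; rewrite -normr_le0; apply: contraTT H; rewrite -!ltNge -leNgt => v0.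
rewrite -(ler_pM2r v0); apply: le_trans (mulmx_norm_le _ _).
by rewrite mulmxBr vA sub0r normrN mul_mx_scalar normrZ gtr0_norm.
Qed.

Lemma ball_scale r (v : 'rV[R]_r) (a d : R) : 0 <= a <= 1 -> `|v| < d -> `|a *: v| < d.
Proof.
move=> /andP[a0 a1]; apply: le_lt_trans; rewrite normrZ ger0_norm//.
by rewrite ler_piMl.
Qed.

(** Boundedness upgrades additivity to homogeneity. The conclusion is on the half ball because [t]
    is expanded along the vectors [(d / 2) *: delta_mx 0 j], with coefficients of modulus at most
    1. *)
Lemma local_additive_linear r (h : 'rV[R]_r -> R) (d K : R) : 0 < d ->
  (forall s t, `|s| < d -> `|t| < d -> `|s + t| < d -> h (s + t) = h s + h t) ->
  (forall t, `|t| < d -> `|h t| <= K) ->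
  exists l : 'cV[R]_r, forall t, `|t| < d / 2 -> h t = (t *m l) 0 0.
Proof.
move=> d0 hD hK.
have n0 : `|0 : 'rV[R]_r| < d by rewrite normr0.
have h0 : h 0 = 0 by have := hD 0 0 n0 n0; rewrite addr0 => /(_ n0) H; lra.
have hN t : `|t| < d -> h (- t) = - h t.
  move=> td; have := hD t (- t) td; rewrite normrN subrr h0 => /(_ td n0); lra.
have hMn k t : `|k%:R *: t| < d -> h (k%:R *: t) = k%:R * h t.
  elim: k => [|k IH] Hk; first by rewrite scale0r mul0r h0.
  have le1 j : (j <= k.+1)%N -> `|j%:R *: t| < d.
    move=> jk; apply: le_lt_trans Hk; rewrite !normrZ ler_wpM2r// !ger0_norm// ler_nat//.
  have Hj := le1 k (leqnSn k); have H1 := le1 1%N (ltn0Sn k); rewrite scale1r in H1.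
  by rewrite -natr1 scalerDl scale1r hD// ?IH// ?mulrDl ?mul1r// -[X in _ + X]scale1r -scalerDl natr1.
(* Approximate [a] by [k / m] with remainder [rho < 1/m]. Since [m] times [h (rho *: t)] is
   [h ((m * rho) *: t)], which is bounded by [K], the total error is at most 2K/m, and [m] is chosen
   to make this at most [e]. *)
have hZ a t : 0 <= a <= 1 -> `|t| < d -> h (a *: t) = a * h t.
  move=> /andP[a0 a1] td; apply/eqP; rewrite -subr_eq0 -normr_le0.
  apply/ler_addgt0Pr => e e0; rewrite add0r.
  have K0 : 0 <= K by apply: le_trans (hK 0 n0).
  pose m := (Num.trunc (2 * K / e)).+1.
  have m0 : (0 : R) < m%:R by rewrite ltr0n.
  have mn : m%:R != 0 :> R by rewrite gt_eqF.
  pose k := Num.trunc (m%:R * a); pose rho := a - k%:R / m%:R.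
  have ma0 : 0 <= m%:R * a by rewrite mulr_ge0// ltW.
  have /andP[k1 k2] : k%:R <= m%:R * a < k.+1%:R by exact: truncn_itv.
  have mrho : m%:R * rho = m%:R * a - k%:R by rewrite mulrBr mulrCA mulfV// mulr1.
  have mr0 : 0 <= m%:R * rho by rewrite mrho subr_ge0.
  have mr1 : m%:R * rho < 1 by rewrite mrho ltrBlDl natr1.
  have rho0 : 0 <= rho by rewrite -(pmulr_rge0 _ m0).
  have m1 : (1 : R) <= m%:R by rewrite ler1n.
  have rho1 : rho <= 1 by nra.
  have im : 0 <= (m%:R : R)^-1 <= 1.
    by apply/andP; split; [rewrite invr_ge0; exact: ltW|rewrite invf_le1].
  have Es : h t = m%:R * h (m%:R^-1 *: t).
    by rewrite -hMn scalerA mulfV// scale1r.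
  have Ek : k%:R *: (m%:R^-1 *: t) = (k%:R / m%:R) *: t by rewrite scalerA.
  have km1 : 0 <= (k%:R / m%:R : R) <= 1.
    apply/andP; split; first by apply: divr_ge0 => //; exact: ltW.
    rewrite ler_pdivrMr// mul1r; apply: le_trans k1 _.
    by rewrite ger_pMr.
  have E1 : h ((k%:R / m%:R) *: t) = k%:R / m%:R * h t.
    by rewrite -Ek hMn ?Ek ?ball_scale// [in RHS]Es mulrA mulfVK.
  have E2 : m%:R * h (rho *: t) = h ((m%:R * rho) *: t).
    by rewrite -scalerA hMn// scalerA ball_scale// mr0 ltW.
  have Ea : a *: t = (k%:R / m%:R) *: t + rho *: t by rewrite -scalerDl /rho addrC subrK.
  have -> : h (a *: t) - a * h t = h (rho *: t) - rho * h t.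
    have T1 := ball_scale km1 td.
    have T2 : `|rho *: t| < d by apply: ball_scale => //; rewrite rho0.
    have T3 : `|(k%:R / m%:R) *: t + rho *: t| < d by rewrite -Ea; apply: ball_scale => //; rewrite a0.
    by rewrite Ea (hD _ _ T1 T2 T3) E1 /rho; ring.
  have B1 : m%:R * `|h (rho *: t)| <= K.
    rewrite -{1}[m%:R]gtr0_norm// -normrM E2; apply: hK.
    by rewrite ball_scale// mr0 ltW.
  have B2 : m%:R * `|rho * h t| <= K.
    rewrite normrM ger0_norm// mulrA; apply: le_trans (hK t td).
    by rewrite ler_piMl// ltW.
  have mK : 2 * K <= e * m%:R.
    have : 2 * K / e < m%:R by exact: truncnS_gt.
    by rewrite ltr_pdivrMr// [in ltRHS]mulrC => /ltW.
  have B3 : `|h (rho *: t) - rho * h t| <= `|h (rho *: t)| + `|rho * h t| by exact: ler_normB.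
  rewrite -(ler_pM2l m0); apply: (@le_trans _ _ (2 * K)); last by rewrite [leRHS]mulrC.
  apply: (@le_trans _ _ (m%:R * (`|h (rho *: t)| + `|rho * h t|))).
    by apply: ler_wpM2l => //; exact: ltW.
  by rewrite mulrDr; lra.
pose e j : 'rV[R]_r := (d / 2) *: delta_mx 0 j.
have d2 : 0 < d / 2 by rewrite divr_gt0.
have ne j : `|e j| <= d / 2.
  apply: rv_norm_le => [|i k]; first exact: ltW.
  rewrite mxE normrM gtr0_norm// ler_piMr ?(ltW d2)// mxE.
  by case: (_ && _); rewrite /= ?normr1 ?normr0.
have ned j : `|e j| < d by apply: le_lt_trans (ne j) _; lra.
exists (\col_j ((d / 2)^-1 * h (e j))) => t td2.
have td : `|t| < d by apply: lt_trans td2 _; lra.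
have hj j : h (t 0 j *: delta_mx 0 j) = t 0 j * ((d / 2)^-1 * h (e j)).
  have Et : t 0 j *: delta_mx 0 j = (t 0 j / (d / 2)) *: e j :> 'rV[R]_r.
    by rewrite /e scalerA divfK// gt_eqF.
  have tj : `|t 0 j| < d / 2 by apply: le_lt_trans (rv_coord_le t 0 j) td2.
  have rat x : 0 <= x -> x < d / 2 -> 0 <= x / (d / 2) <= 1.
    move=> x0 xd; apply/andP; split; first by apply: divr_ge0 => //; exact: ltW.
    by rewrite ler_pdivrMr// mul1r ltW.
  have [t0|t0] := leP 0 (t 0 j).
    rewrite ger0_norm// in tj.
    by rewrite Et (hZ _ _ (rat _ t0 tj) (ned j)) mulrA.
  have tN : 0 <= - t 0 j by rewrite oppr_ge0 ltW.
  rewrite ltr0_norm// in tj.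
  rewrite Et -[t 0 j]opprK mulNr scaleNr hN; last exact: ball_scale (rat _ tN tj) (ned j).
  by rewrite (hZ _ _ (rat _ tN tj) (ned j)); ring.
have hsum (s : seq 'I_r) : uniq s -> h (\sum_(j <- s) t 0 j *: delta_mx 0 j) =
    \sum_(j <- s) h (t 0 j *: delta_mx 0 j) /\ `|\sum_(j <- s) t 0 j *: delta_mx 0 j : 'rV[R]_r| < d.
  have nb (s' : seq 'I_r) : uniq s' -> `|\sum_(j <- s') t 0 j *: delta_mx 0 j : 'rV[R]_r| < d.
    move=> us; apply: le_lt_trans td; apply: rv_norm_le => // i k; rewrite ord1 summxE.
    under eq_bigr do rewrite !mxE eqxx /=.
    have [ks|ks] := boolP (k \in s').
      rewrite (bigD1_seq k)//= eqxx mulr1 big1 ?addr0; first exact: rv_coord_le.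
      by move=> j jk; rewrite eq_sym (negbTE jk) mulr0.
    rewrite big_seq big1 ?normr0// => j js; have [kj|] := eqVneq k j; last by rewrite mulr0.
    by move: ks; rewrite kj js.
  elim: s => [|j s IH] us; first by rewrite !big_nil h0; split.
  have [IH1 IH2] := IH (subseq_uniq (subseq_cons s j) us).
  split; last exact: nb.
  have Hb := nb _ us; rewrite !big_cons in Hb *.
  rewrite hD ?IH1//.
  by have := nb [:: j] isT; rewrite big_seq1.
have [+ _] := hsum (index_enum 'I_r) (index_enum_uniq _).
rewrite -row_sum_delta => ->; rewrite mxE; apply: eq_bigr => j _.
by rewrite hj [in RHS]mxE.
Qed.

End RealLemmas.

Section GroupTopology.
Context {R : realType} {G : lieGroupType R}.
Hypothesis G_connected : connected [set: G].

Lemma clopen_full (A : set G) x0 : A x0 -> (forall x, A x -> \forall y \near x, A y) ->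
  (forall x, ~ A x -> \forall y \near x, ~ A y) -> forall x, A x.
Proof.
move=> Ax0 H1 H2.
have o1 : open A by rewrite openE => x Ax; exact: H1.
have o2 : open (~` A) by rewrite openE => x Ax; exact: H2.
have E : A = [set: G].
  apply: G_connected; first by exists x0.
  - by exists A => //; rewrite setTI.
  - by exists A; [rewrite -[A]setCK; exact: open_closedC|rewrite setTI].
by move=> x; rewrite E.
Qed.

(** Each coset of [H] is open, so [H] and its complement are both open in the connected group
    [G]. *)
Lemma subgroup_nbhs_full (H : set G) : subgroup H -> nbhs (1%g : G) H -> forall x, H x.
Proof.
move=> sH H1; apply: (@clopen_full H 1%g) => [|x Hx|x nHx]; first by case: sH.
- apply: filterS (near_translate x H1) => y Hy.
  by rewrite -(mulVKg x y); exact: subgroupM.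
- apply: filterS (near_translate x H1) => y Hy Hy'; apply: nHx.
  have -> : x = (y * (x^-1 * y)^-1)%g by rewrite invgM invgK mulVKg.
  by apply: subgroupM => //; exact: subgroupV.
Qed.

Lemma int_valued_const (f : G -> R) : continuous f -> (forall x, f x \is a Num.int) -> forall x, f x = f 1%g.
Proof.
move=> cf fi.
have loc x : \forall y \near x, f y = f x.
  have /cvgrPdist_lt/(_ 1 ltr01) H := cf x.
  apply: filterS H => y Hy; apply/eqP; rewrite eq_sym -subr_eq0; apply/eqP.
  by apply: int_small0 => //; rewrite rpredB.
apply: (@clopen_full (fun x => f x = f 1%g) 1%g) => [//|x Ex|x nEx].
  by apply: filterS (loc x) => y ->.
by apply: filterS (loc x) => y ->.
Qed.

Lemma sym_half (W : set G) : nbhs (1%g : G) W -> exists U : set G,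
  [/\ nbhs (1%g : G) U, U 1%g, forall x, U x -> U (x^-1)%g & forall x y, U x -> U y -> W (x * y)%g].
Proof.
move=> W1.
have c : (fun p : G * G => p.1 * p.2)%g @ (1%g : G, 1%g : G) --> (1%g : G).
  by rewrite -[X in _ --> X]mulg1; apply: cvg_mulg; [exact: cvg_fst|exact: cvg_snd].
have [[A B] /= [A1 B1] AB] := c _ W1.
pose V := A `&` B; have V1 : nbhs (1%g : G) V by exact: filterI.
have ci : (fun x : G => x^-1)%g @ (1%g : G) --> (1%g : G).
  by rewrite -[X in _ --> X]invg1; apply: cvg_invg; exact: cvg_id.
have Vi1 : nbhs (1%g : G) [set x | V (x^-1)%g] by exact: (ci _ V1).
exists (V `&` [set x | V (x^-1)%g]); split.
- exact: filterI.
- by split; rewrite /= ?invg1; exact: nbhs_singleton V1.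
- by move=> x [Vx Vix]; split; rewrite //= invgK.
- by move=> x y [[Ax _] _] [[_ By] _]; exact: (AB (x, y)).
Qed.

Hypothesis G_compact : compact [set: G].

(** A Urysohn function equal to 1 at the identity and 0 off the interior of [U] exists because
    compact Hausdorff spaces are normal; its translates over a finite cover are divided by their
    positive sum. *)
Lemma partition_of_unity (U : set G) : nbhs (1%g : G) U -> exists m (x : 'I_m -> G) (phi : 'I_m -> G -> R),
  [/\ forall j, continuous (phi j), forall j y, 0 <= phi j y, forall y, \sum_j phi j y = 1 &
      forall j y, phi j y != 0 -> U ((x j)^-1 * y)%g].
Proof.
move=> U1; have hG : hausdorff_space G by have [] := @lie_mfd R G.
have cU : closed (~` U°) by apply: open_closedC; exact: open_interior.
have c1 : closed [set (1%g : G)] by exact: (@accessible_closed_set1 G (@hausdorff_accessible G hG) 1%g).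
have d1 : ~` U° `&` [set (1%g : G)] = set0.
  by rewrite -subset0 => y [/= nU y1]; apply: nU; rewrite y1; exact: U1.
have sep := (@normal_separatorP R G).1 (compact_normal hG G_compact) _ _ cU c1 d1.
pose b : G -> R := Urysohn (~` U°) [set (1%g : G)].
have cb : continuous b by exact: Urysohn_continuous.
have b0 y : 0 <= b y.
  by have := @Urysohn_range G R (~` U°) [set 1%g] (b y) (ex_intro2 _ _ y I erefl); rewrite /= in_itv/= => /andP[].
have bU y : b y != 0 -> U y.
  move=> by0; apply: contrapT => nU; move/negP: by0; apply; apply/eqP.
  apply: (@Urysohn_sub0 G R _ _ sep); exists y => //= yU; apply: nU; exact: interior_subset yU.
have b1 : b 1%g = 1 by apply: (@Urysohn_sub1 G R _ _ sep); exists 1%g.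
have W1 : nbhs (1%g : G) [set g | 0 < b (g^-1)%g].
  have c : (fun g : G => b (g^-1)%g) @ (1%g : G) --> (1 : R).
    have ci : (fun x : G => x^-1)%g @ (1%g : G) --> (1%g : G).
      by rewrite -[X in _ --> X]invg1; apply: cvg_invg; exact: cvg_id.
    rewrite -b1; exact: (cvg_comp _ _ ci (cb 1%g)).
  exact: (cvgr_gt _ c _ ltr01).
have [s cs] := covers_exists G_compact W1.
pose x (j : 'I_(size s)) := ((nth 1%g s j)^-1)%g.
pose bj (j : 'I_(size s)) y := b (nth 1%g s j * y)%g.
have cbj j : continuous (bj j).
  move=> y; apply: (@cvg_comp _ _ _ (fun y => nth 1%g s j * y)%g b); last exact: cb.
  by apply: cvg_mulg; [exact: cvg_cst|exact: cvg_id].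
pose S y := \sum_j bj j y.
have S0 y : 0 < S y.
  have [w ws /=] := cs (y^-1)%g.
  rewrite invgM !invgK => bw.
  have iw : (index w s < size s)%N by rewrite index_mem.
  rewrite /S (bigD1 (Ordinal iw))//= ltr_pwDl//; last by apply: sumr_ge0 => j _; exact: b0.
  by rewrite /bj /= nth_index.
have cS : continuous S.
  move=> y; have -> : S = (fun y => \sum_j bj j y) by [].
  by apply: cvg_big => [|j _]; [exact: add_continuous|exact: cbj].
exists (size s), x, (fun j y => bj j y / S y); split.
- by move=> j y; apply: cvgM; [exact: cbj|apply: cvgV; [rewrite gt_eqF|exact: cS]].
- by move=> j y; apply: divr_ge0; [exact: b0|exact: ltW].
- by move=> y /=; rewrite -mulr_suml -/(S y) mulfV// gt_eqF.
- move=> j y; rewrite /x invgK => H; apply: bU; apply: contraNneq H => H.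
  by rewrite /bj H mul0r.
Qed.

End GroupTopology.

(** * Correcting a local homomorphism into a map to R/Z *)

Section Cocycle.
Context {R : realType} {G : lieGroupType R}.
Hypothesis G_connected : connected [set: G].
Variables (M : (G -> R) -> R) (HM : right_mean M).
Variables (W U : set G) (t : G -> R).
Hypotheses (tD : forall x y, W x -> W y -> t (x * y)%g = t x + t y)
  (U1 : U 1%g) (UV : forall x, U x -> U (x^-1)%g) (UU : forall x y, U x -> U y -> W (x * y)%g).
Variables (m : nat) (x : 'I_m -> G) (phi : 'I_m -> G -> R).
Hypotheses (cphi : forall j, continuous (phi j)) (phi0 : forall j y, 0 <= phi j y)
  (phi1 : forall y, \sum_j phi j y = 1) (phiU : forall j y, phi j y != 0 -> U ((x j)^-1 * y)%g).
Variables (N eps : R) (z : 'I_m -> 'I_m -> R).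
Hypotheses (zint : forall j k, z j k \is a Num.int) (eps4 : 4 * eps < 1)
  (zeps : forall j k, `|N * t ((x j)^-1 * x k)%g - z j k| <= eps).
Let e j k := N * t ((x j)^-1 * x k)%g - z j k.

Let UW y : U y -> W y. Proof. by move=> Uy; rewrite -[y]mulg1; exact: UU. Qed.
Let t1 : t 1%g = 0. Proof. by have := tD (UW U1) (UW U1); rewrite mulg1; lra. Qed.
Let tV y : U y -> t (y^-1)%g = - t y.
Proof. by move=> Uy; have := tD (UW Uy) (UW (UV Uy)); rewrite mulgV t1; lra. Qed.

Let t_trans j k p q : phi j p != 0 -> phi k q != 0 -> U (p^-1 * q)%g ->
  t ((x j)^-1 * x k)%g = t ((x j)^-1 * p)%g + t (p^-1 * q)%g - t ((x k)^-1 * q)%g.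
Proof.
move=> /phiU jp /phiU kq pq.
have -> : ((x j)^-1 * x k = ((x j)^-1 * p) * (p^-1 * q) * ((x k)^-1 * q)^-1)%g.
  by rewrite invgM invgK -!mulgA !mulVKg.
rewrite tD; last exact/UW/UV; last exact: UU.
by rewrite tD ?tV//; exact: UW.
Qed.

(** The contributions of [t] cancel by additivity, so the difference of the two sides is an integer
    combination of values of [z]. It consists of four terms of size at most [eps], and [4 * eps < 1]
    makes it 0. This exactness is what the Dirichlet approximation is for. *)
Let cocycle j l' l k p q : phi j p != 0 -> phi l' p != 0 -> phi l q != 0 -> phi k q != 0 ->
  U (p^-1 * q)%g -> e j k = e j l' + e l' l + e l k.
Proof.
move=> jp lp lq kq pq; apply/eqP; rewrite -subr_eq0; apply/eqP; apply: int_small0.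
  have -> : e j k - (e j l' + e l' l + e l k) = z j l' + z l' l + z l k - z j k.
    have pp : U (p^-1 * p)%g by rewrite mulVg.
    have qq : U (q^-1 * q)%g by rewrite mulVg.
    rewrite /e (t_trans jp kq pq) (t_trans jp lp pp) (t_trans lp lq pq) (t_trans lq kq qq).
    by rewrite !mulVg t1; ring.
  by rewrite rpredB// !rpredD.
apply: le_lt_trans eps4; apply: (le_trans (ler_normB _ _)).
have := zeps j k; have := zeps j l'; have := zeps l' l; have := zeps l k; rewrite -!/(e _ _).
have := ler_normD (e j l' + e l' l) (e l k); have := ler_normD (e j l') (e l' l); lra.
Qed.

Let antisym l k y : phi l y != 0 -> phi k y != 0 -> e l k = - e k l.
Proof.
move=> ly ky; have yy : U (y^-1 * y)%g by rewrite mulVg.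
by have := cocycle ly ky ly ly yy; lra.
Qed.

(* [defect g y] is the small lift of f(y g) - f(y), where f : G -> R/Z equals
   N t(x_l^-1 y) + sum_j phi_j(y) e_jl near x_l; the correction by e makes these
   local formulas agree modulo Z. *)
Definition osc_sum (g y : G) : R := \sum_j \sum_k phi j (y * g)%g * phi k y * e j k.
Definition defect (g y : G) : R := N * t g + osc_sum g y.

Let active : exists l : G -> 'I_m, forall y, phi (l y) y != 0.
Proof.
suff H y : exists j, phi j y != 0.
  by exists (fun y => projT1 (cid (H y))) => y; exact: projT2 (cid (H y)).
apply: contrapT => H; have : \sum_j phi j y = 0.
  by apply: big1 => j _; apply/eqP; apply: contrapT => /negP Hj; apply: H; exists j.
by rewrite phi1; apply/eqP; exact: oner_neq0.
Qed.

Let osc_split g y l l' : phi l y != 0 -> phi l' (y * g)%g != 0 -> U g ->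
  osc_sum g y = \sum_j phi j (y * g)%g * e j l' + e l' l - \sum_k phi k y * e k l.
Proof.
move=> ly l'y Ug.
have pq : U ((y * g)^-1 * y)%g by rewrite invgM -mulgA mulVg mulg1; exact: UV.
have -> : osc_sum g y = \sum_j \sum_k (phi k y * (phi j (y * g)%g * e j l') +
    phi j (y * g)%g * (phi k y * (e l' l)) + phi j (y * g)%g * (- (phi k y * e k l))).
  apply: eq_bigr => j _; apply: eq_bigr => k _.
  have [->|jn] := eqVneq (phi j (y * g)%g) 0; first by rewrite !mul0r mulr0 !addr0.
  have [->|kn] := eqVneq (phi k y) 0; first by rewrite !(mul0r, mulr0, oppr0, addr0).
  by rewrite (cocycle jn l'y ly kn pq) (antisym ly kn); ring.
under eq_bigr do rewrite !big_split /= -mulr_suml phi1 mul1r -!mulr_sumr -mulr_suml phi1 mul1r sumrN.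
by rewrite !big_split /= -!mulr_suml !phi1 !mul1r.
Qed.

(** [A] is a discontinuous real lift of the map f, computed at each point with an arbitrarily chosen
    index [l y]; passing from one index to another costs only an integer value of [z]. *)
Lemma defect_int : exists A : G -> R, forall g y, U g ->
  defect g y - (A (y * g)%g - A y) \is a Num.int.
Proof.
have [l Hl] := active.
exists (fun y => N * t ((x (l y))^-1 * y)%g + \sum_j phi j y * e j (l y)) => g y Ug.
have pq : U ((y * g)^-1 * y)%g by rewrite invgM -mulgA mulVg mulg1; exact: UV.
have Eg : ((y * g)^-1 * y = g^-1)%g by rewrite invgM -mulgA mulVg mulg1.
rewrite /defect (osc_split (Hl y) (Hl (y * g)%g) Ug) {2}/e (t_trans (Hl (y * g)%g) (Hl y) pq) Eg (tV Ug).
set a := \sum_j _; set b := \sum_j _.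
rewrite (_ : _ - _ = - z (l (y * g)%g) (l y)); last by ring.
by rewrite rpredN.
Qed.

Lemma osc_bound g y : `|osc_sum g y| <= eps.
Proof.
apply: (le_trans (ler_norm_sum _ _ _)).
apply: (@le_trans _ _ (\sum_j phi j (y * g)%g * eps)); last by rewrite -mulr_suml phi1 mul1r.
apply: ler_sum => j _; apply: (le_trans (ler_norm_sum _ _ _)).
apply: (@le_trans _ _ (\sum_k phi j (y * g)%g * eps * phi k y)); last by rewrite -mulr_sumr phi1 mulr1.
apply: ler_sum => k _; rewrite !normrM ger0_norm// ger0_norm// mulrAC.
by apply: ler_wpM2r; [exact: phi0|apply: ler_wpM2l; [exact: phi0|exact: zeps]].
Qed.

Lemma osc_cont g : continuous (osc_sum g).
Proof.
move=> y; rewrite /osc_sum.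
apply: cvg_big => [|j _]; first exact: add_continuous.
apply: cvg_big => [|k _]; first exact: add_continuous.
have c1 : (fun y => phi j (y * g)%g) @ y --> phi j (y * g)%g.
  apply: (@cvg_comp _ _ _ (fun y => y * g)%g (phi j)); last exact: cphi.
  by apply: cvg_mulg; [exact: cvg_id|exact: cvg_cst].
apply: cvgM; last exact: cvg_cst.
by apply: cvgM; [exact: c1|exact: cphi].
Qed.

Lemma defect_cont g : continuous (defect g).
Proof. by move=> y; apply: cvgD; [exact: cvg_cst|exact: osc_cont]. Qed.

Definition mean_defect (g : G) : R := M (defect g).

Lemma mean_defect_near g : `|mean_defect g - N * t g| <= eps.
Proof.
have [MD _ MC MB _] := HM; rewrite /mean_defect /defect (MD (fun=> N * t g)).
- by rewrite MC addrC addKr; apply: MB; [exact: osc_cont|exact: osc_bound].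
- by move=> y; exact: cvg_cst.
- exact: osc_cont.
Qed.

Let mean_shift g h : M (fun y => defect h (y * g)%g) = mean_defect h.
Proof. by have [_ _ _ _ MR] := HM; apply: (MR (defect h)); exact: defect_cont. Qed.

Let defect_shift_cont g h : continuous (fun y => defect h (y * g)%g).
Proof.
move=> y; apply: (@cvg_comp _ _ _ (fun y => y * g)%g (defect h)); last exact: defect_cont.
by apply: cvg_mulg; [exact: cvg_id|exact: cvg_cst].
Qed.

(** Before averaging, the defect of [g * h] at [y] and the sum of the defects of [g] at [y] and of
    [h] at [y * g] differ by an integer, and by at most [3 * eps < 1], so they are equal. Right
    invariance of the mean then removes the shift by [g]. *)
Lemma mean_defectD g h : U g -> U h -> U (g * h)%g -> mean_defect (g * h)%g = mean_defect g + mean_defect h.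
Proof.
move=> Ug Uh Ugh; have [MD _ _ _ _] := HM; have [A HA] := defect_int.
rewrite -(mean_shift g h) -MD; [|exact: defect_cont|exact: defect_shift_cont].
congr M; apply/funext => y; apply/eqP; rewrite -subr_eq0; apply/eqP; apply: int_small0.
  have H1 := HA _ y Ugh; have H2 := HA _ y Ug; have H3 := HA _ (y * g)%g Uh.
  have := rpredB H1 (rpredD H2 H3); rewrite mulgA.
  by congr (_ \is a Num.int); ring.
have -> : defect (g * h)%g y - (defect g y + defect h (y * g)%g) =
    osc_sum (g * h)%g y - (osc_sum g y + osc_sum h (y * g)%g).
  by rewrite /defect (tD (UW Ug) (UW Uh)); ring.
have := osc_bound (g * h)%g y; have := osc_bound g y; have := osc_bound h (y * g)%g.
move=> B1 B2 B3; apply: le_lt_trans (ler_normB _ _) _.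
by have := ler_normD (osc_sum g y) (osc_sum h (y * g)%g); move: eps4; lra.
Qed.

Definition word_prod (s : seq G) : G := foldr (fun g w => g * w)%g 1%g s.

Fixpoint word_defect (s : seq G) (y : G) : R :=
  if s is g :: s' then defect g y + word_defect s' (y * g)%g else 0.

(** Along a word with product 1 the lifts telescope, so the total defect is an integer at every [y].
    Being continuous on a connected group it is constant, and its mean is that integer. *)
Lemma mean_defect_word s : (forall g, g \in s -> U g) -> word_prod s = 1%g ->
  \sum_(g <- s) mean_defect g \is a Num.int.
Proof.
move=> sU s1; have [MD _ MC _ _] := HM; have [A HA] := defect_int.
pose S := word_defect.
have cS s' : continuous (S s').
  elim: s' => [|g s' IH] y /=; first exact: cvg_cst.
  apply: cvgD; first exact: defect_cont.
  apply: (@cvg_comp _ _ _ (fun y => y * g)%g (S s')); last exact: IH.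
  by apply: cvg_mulg; [exact: cvg_id|exact: cvg_cst].
have cSg s' g : continuous (fun y => S s' (y * g)%g).
  move=> y; apply: (@cvg_comp _ _ _ (fun y => y * g)%g (S s')); last exact: cS.
  by apply: cvg_mulg; [exact: cvg_id|exact: cvg_cst].
have MS s' : M (S s') = \sum_(g <- s') mean_defect g.
  elim: s' => [|g s' IH]; first by rewrite big_nil /= MC.
  rewrite big_cons -IH -[S (g :: s')]/(fun y => defect g y + S s' (y * g)%g).
  rewrite MD; [|exact: defect_cont|exact: cSg]; congr (_ + _).
  by have [_ _ _ _ MR] := HM; apply: (MR (S s')).
have Si s' y : (forall g, g \in s' -> U g) -> S s' y - (A (y * word_prod s')%g - A y) \is a Num.int.
  elim: s' y => [|g s' IH] y sU'; first by rewrite /= mulg1 subrr subr0 rpred0.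
  have H1 := HA g y (sU' g (mem_head _ _)).
  have H2 := IH (y * g)%g (fun h hs => sU' h (mem_behead (s := g :: s') hs)).
  have := rpredD H1 H2; rewrite /= mulgA.
  by congr (_ \is a Num.int); ring.
have Sint y : S s y \is a Num.int by have := Si s y sU; rewrite s1 mulg1 subrr subr0.
rewrite -MS; have -> : S s = (fun=> S s 1%g).
  by apply/funext => y; exact: (int_valued_const G_connected (cS s) Sint).
by rewrite MC.
Qed.

Lemma cocycle_mean : exists p : G -> R,
  [/\ forall g, `|p g - N * t g| <= eps,
      forall g h, U g -> U h -> U (g * h)%g -> p (g * h)%g = p g + p h &
      forall s, (forall g, g \in s -> U g) -> word_prod s = 1%g -> \sum_(g <- s) p g \is a Num.int].
Proof.
exists mean_defect; split; [exact: mean_defect_near|exact: mean_defectD|exact: mean_defect_word].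
Qed.

End Cocycle.

Section WordRelation.
Context {R : realType} {G : lieGroupType R}.
Hypothesis G_connected : connected [set: G].
Variables (U : set G) (p : G -> R).
Hypotheses (Un : nbhs (1%g : G) U) (U1 : U 1%g) (UV : forall x, U x -> U (x^-1)%g)
  (pD : forall g h, U g -> U h -> U (g * h)%g -> p (g * h)%g = p g + p h)
  (pint : forall s, (forall g, g \in s -> U g) -> word_prod s = 1%g -> \sum_(g <- s) p g \is a Num.int).

(* The values of p on the words representing y are well defined modulo Z, and 0 is
   one of them when y is a product of commutators. *)
Definition word_value (y : G) (c : R) := exists s : seq G,
  [/\ forall g, g \in s -> U g, word_prod s = y & \sum_(g <- s) p g = c].

Lemma word_prod_cat (s s' : seq G) : word_prod (s ++ s') = (word_prod s * word_prod s')%g.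
Proof. by elim: s => [|g s IH] /=; rewrite ?mul1g// IH mulgA. Qed.

Lemma word_prod_inv (s : seq G) : word_prod [seq (g^-1)%g | g <- rev s] = (word_prod s)^-1%g.
Proof.
elim: s => [|g s IH]; first by rewrite /= invg1.
by rewrite rev_cons -cats1 map_cat word_prod_cat IH /= mulg1 invgM.
Qed.

Lemma letter_one : p 1%g = 0.
Proof. by have := pD U1 U1; rewrite mulg1 => /(_ U1); lra. Qed.

Lemma letter_inv g : U g -> p (g^-1)%g = - p g.
Proof. by move=> Ug; have := pD Ug (UV Ug); rewrite mulgV letter_one => /(_ U1); lra. Qed.

Lemma word_valueM y y' c c' : word_value y c -> word_value y' c' -> word_value (y * y')%g (c + c').
Proof.
move=> [s [sU <- <-]] [s' [sU' <- <-]]; exists (s ++ s'); split.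
- by move=> g; rewrite mem_cat => /orP[/sU|/sU'].
- exact: word_prod_cat.
- by rewrite big_cat.
Qed.

Lemma word_valueV y c : word_value y c -> word_value (y^-1)%g (- c).
Proof.
move=> [s [sU <- <-]]; exists [seq (g^-1)%g | g <- rev s]; split.
- by move=> g /mapP[h]; rewrite mem_rev => /sU Uh ->; exact: UV.
- exact: word_prod_inv.
- rewrite big_map (perm_big s) ?perm_rev//= -sumrN big_seq [RHS]big_seq.
  by apply: eq_bigr => g /sU; exact: letter_inv.
Qed.

Lemma word_value1 g : U g -> word_value g (p g).
Proof.
move=> Ug; exists [:: g]; split; last by rewrite big_seq1.
  by move=> h; rewrite inE => /eqP->.
by rewrite /= mulg1.
Qed.

Lemma word_value_all y : exists c, word_value y c.
Proof.
apply: (subgroup_nbhs_full G_connected (H := fun y => exists c, word_value y c)).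
  split; first by exists (p 1%g); exact: word_value1.
  by move=> a b [c Hc] [d Hd]; exists (c - d); apply: word_valueM => //; exact: word_valueV.
by apply: filterS Un => g Ug; exists (p g); exact: word_value1.
Qed.

(** Every element is represented by some word. If [a] and [b] have values [c] and [d], the
    commutator has the value [- c - d + c + d]. *)
Lemma word_value_comm y : commutator_subgroup G y -> word_value y 0.
Proof.
have sH : subgroup (fun y => word_value y 0).
  split; first by have := word_value1 U1; rewrite letter_one.
  by move=> a b Ha Hb; rewrite -(subr0 0); apply: word_valueM => //; exact: word_valueV.
suff cH a b : word_value [~ a, b]%g 0 by exact: (@commutator_subgroup_min G _ sH cH y).
have [c Hc] := word_value_all a; have [d Hd] := word_value_all b.
have -> : [~ a, b]%g = (a^-1 * (b^-1 * (a * b)))%g by rewrite commgEl conjgE.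
rewrite (_ : 0 = - c + (- d + (c + d))); last by ring.
by do 2!(apply: word_valueM; first exact: word_valueV); exact: word_valueM.
Qed.

Lemma word_value_int c : word_value 1%g c -> c \is a Num.int.
Proof. by move=> [s [sU s1 <-]]; exact: pint. Qed.

End WordRelation.

Section LatticeMap.
Context {R : realType} {G : lieGroupType R}.
Hypotheses (G_compact : compact [set: G]) (G_connected : connected [set: G]).
Variables (r : nat) (E : 'rV[R]_r -> G) (tau : G -> 'rV[R]_r).
Hypotheses (ED : forall u v, E (u + v) = (E u * E v)%g) (SE : forall u, smooth_at E u)
  (tauD : exists2 W, nbhs (1%g : G) W & forall x y, W x -> W y -> tau (x * y)%g = tau x + tau y)
  (tauE : \forall t \near (0 : 'rV[R]_r), tau (E t) = t).

(** For each coordinate the corrected local homomorphism [p] is linear on E(R^r) near 1, which gives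
    a column of [L]. When E(v) is in G', it has the word value 0, but also the value of the word
    repeating [k] times the short letter E(v/k), which is that coordinate of [v *m L]; the two
    differ by an integer. *)
Theorem lattice_map : exists2 L : 'M[R]_r, L \in unitmx &
  forall v, commutator_subgroup G (E v) -> forall i, (v *m L) 0 i \is a Num.int.
Proof.
have [M HM] := invariant_mean G_compact.
have [W W1 tauW] := tauD; have [U [Un U1 UV UU]] := sym_half W1.
have [m [x [phi [cphi phi0 phi1 phiU]]]] := partition_of_unity G_compact Un.
have E0 : E 0 = 1%g by exact: hom0.
have HE : \forall t \near (0 : 'rV[R]_r), tau (E t) = t /\ U (E t).
  have cE : E @ (0 : 'rV[R]_r) --> (1%g : G) by rewrite -E0; exact: (SE 0).1.
  have H2 : \forall t \near (0 : 'rV[R]_r), U (E t) by exact: (cE _ Un).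
  by apply: filterS2 tauE H2 => t.
have [d d0 Hd] := near_ball0 HE.
have r1 : (0 : R) < r%:R + 1 by rewrite ltr_wpDl.
(* 1/5 ensures [4 * eps < 1]. The second bound serves invertibility: testing on
   [(d / 4) *: delta_mx 0 j] bounds the entries of [L - N] by (4/d) eps, and [r] times this is at
   most r / (2 (r + 1)) < 1 <= N. *)
have e0 : 0 < Num.min 5^-1 (d / (8 * (r%:R + 1))) by rewrite lt_min invr_gt0 ltr0n divr_gt0// mulr_gt0.
have [N [N0 [z Hz]]] := dirichlet (fun q : 'I_r * 'I_m * 'I_m => tau ((x q.1.2)^-1 * x q.2)%g 0 q.1.1) e0.
set eps := Num.min _ _ in e0 Hz.
have [e5 er] : eps <= 5^-1 /\ eps <= d / (8 * (r%:R + 1)) by rewrite /eps !ge_min !lexx orbT.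
have N1 : (1 : R) <= N%:R by rewrite ler1n.
have Hp i : exists p : G -> R,
  [/\ forall g, `|p g - N%:R * tau g 0 i| <= eps,
      forall g h, U g -> U h -> U (g * h)%g -> p (g * h)%g = p g + p h &
      forall s, (forall g, g \in s -> U g) -> word_prod s = 1%g -> \sum_(g <- s) p g \is a Num.int].
  apply: (cocycle_mean G_connected HM (t := fun g => tau g 0 i) (W := W) _ U1 UV UU cphi phi0 phi1 phiU
    (z := fun j k => z (i, j, k))).
  - by move=> g h Wg Wh; rewrite tauW// mxE.
  - by move=> j k; have [] := Hz (i, j, k).
  - by move: e5; lra.
  - by move=> j k; have [] := Hz (i, j, k).
have d2 : 0 < d / 2 by rewrite divr_gt0.
have Hl i : exists l : 'cV[R]_r, (forall t : 'rV[R]_r, `|t| < d / 2 -> `|(t *m l) 0 0 - N%:R * t 0 i| <= eps) /\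
    forall v, commutator_subgroup G (E v) -> (v *m l) 0 0 \is a Num.int.
  have [p [pN pD pint]] := Hp i.
  have [|t td|l Hl] := @local_additive_linear R r (fun t => p (E t)) d (N%:R * d + eps) d0.
  - move=> s t sd td std; rewrite ED; apply: pD; [exact: (Hd s sd).2|exact: (Hd t td).2|].
    by rewrite -ED; exact: (Hd _ std).2.
  - have := pN (E t); rewrite (Hd t td).1 => H.
    rewrite -[p (E t)](subrK (N%:R * t 0 i)) addrC; apply: (le_trans (ler_normD _ _)); apply: lerD => //.
    rewrite normrM ger0_norm// ler_wpM2l//.
    by apply: (le_trans (rv_coord_le t 0 i)); exact: ltW.
  have dd (t : 'rV[R]_r) : `|t| < d / 2 -> `|t| < d by move=> H; apply: lt_trans H _; lra.
  exists l; split=> [t td|v Gv].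
    by rewrite -Hl//; have := pN (E t); rewrite (Hd t (dd _ td)).1.
  pose k := (Num.trunc (`|v| / (d / 2))).+1.
  have k0 : (0 : R) < k%:R by rewrite ltr0n.
  pose w := k%:R^-1 *: v.
  have wd : `|w| < d / 2.
    rewrite normrZ ger0_norm ?invr_ge0 ?ltW// mulrC ltr_pdivrMr// mulrC -ltr_pdivrMr//.
    exact: truncnS_gt.
  have kw : k%:R *: w = v by rewrite scalerA mulfV ?scale1r// gt_eqF.
  have Uw : U (E w) by exact: (Hd w (dd _ wd)).2.
  have Hk j : word_value U p (E (j%:R *: w)) (j%:R * p (E w)).
    elim: j => [|j IH]; first by rewrite scale0r E0 mul0r -(letter_one U1 pD); exact: word_value1.
    by rewrite -natr1 scalerDl scale1r ED mulrDl mul1r; apply: word_valueM => //; exact: word_value1.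
  have := Hk k; rewrite kw Hl// => Hv.
  have H0 := word_value_comm G_connected Un U1 UV pD Gv.
  have := word_valueM Hv (word_valueV U1 UV pD H0); rewrite mulgV => /(word_value_int pint).
  rewrite oppr0 addr0 (_ : k%:R * _ = (v *m l) 0 0)//.
  have -> : v *m l = k%:R *: (w *m l) by rewrite scalemxAl kw.
  by rewrite [RHS]mxE.
pose l i := projT1 (cid (Hl i)); pose L : 'M[R]_r := \matrix_(j, i) l i j 0.
have vL v i : (v *m L) 0 i = (v *m l i) 0 0.
  by rewrite !mxE; apply: eq_bigr => j _; rewrite mxE.
have HL i := projT2 (cid (Hl i)).
exists L; last by move=> v Gv i; rewrite vL; exact: (HL i).2.
apply: (@near_scalar_unit R r L N%:R).
have LN : `|L - N%:R%:M| <= 4 / d * eps.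
  apply: rv_norm_le => [|j i]; first by rewrite mulr_ge0 ?divr_ge0 ?ltW.
  pose t : 'rV[R]_r := (d / 4) *: delta_mx 0 j.
  have td : `|t| < d / 2.
    apply: (@le_lt_trans _ _ (d / 4)); last by lra.
    apply: rv_norm_le => [|a b]; first by rewrite divr_ge0 ?ltW.
    rewrite mxE normrM ger0_norm ?divr_ge0 ?(ltW d0)// ler_piMr ?divr_ge0 ?(ltW d0)// mxE.
    by case: (_ && _); rewrite /= ?normr1 ?normr0.
  have := (HL i).1 t td; rewrite -vL.
  have -> : (t *m L) 0 i - N%:R * t 0 i = d / 4 * (L - N%:R%:M) j i.
    rewrite /t -scalemxAl [X in X - _]mxE -rowE [X in _ * X - _]mxE [X in _ - _ * X]mxE [X in _ - _ * (_ * X)]mxE /=.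
    rewrite [(L - _) j i]mxE [X in _ * (_ + X)]mxE [X in _ * (_ - X)]mxE eq_sym.
    by case: (j == i); rewrite /= ?mulr1n ?mulr0n; ring.
  rewrite normrM ger0_norm ?divr_ge0 ?(ltW d0)// => H.
  have -> : `|(L - N%:R%:M) j i| = 4 / d * (d / 4 * `|(L - N%:R%:M) j i|).
    have E4 : 4 / d * (d / 4) = 1 by field; rewrite gt_eqF.
    by rewrite mulrA E4 mul1r.
  by apply: ler_wpM2l => //; rewrite divr_ge0 ?ltW.
apply: lt_le_trans N1.
apply: (@le_lt_trans _ _ (r%:R * (4 / d * (d / (8 * (r%:R + 1)))))).
  apply: ler_wpM2l => //; apply: (le_trans LN); apply: ler_wpM2l => //.
  by rewrite divr_ge0 ?ltW.
have -> : r%:R * (4 / d * (d / (8 * (r%:R + 1)))) = r%:R / (2 * (r%:R + 1)) :> R.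
  by field; rewrite !gt_eqF.
rewrite ltr_pdivrMr ?mulr_gt0//; lra.
Qed.

End LatticeMap.

(** * The lattice of the torus factor *)

Section LatticeBasis.
Context {R : realType} {r : nat}.
Variables (Lam : set 'rV[R]_r) (L : 'M[R]_r) (K : R).
Hypotheses (Lam0 : Lam 0) (LamB : forall u v, Lam u -> Lam v -> Lam (u - v)).
Hypotheses (uL : L \in unitmx) (LamL : forall v, Lam v -> forall i, (v *m L) 0 i \is a Num.int).
Hypothesis LamK : forall v, exists2 w, Lam w & `|v - w| <= K.

Let LamN v : Lam v -> Lam (- v). Proof. by move=> Lv; rewrite -sub0r; exact: LamB. Qed.
Let LamD u v : Lam u -> Lam v -> Lam (u + v).
Proof. by move=> Lu Lv; rewrite -[v]opprK; apply: LamB => //; exact: LamN. Qed.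

Let LamZ (a : R) v : a \is a Num.int -> Lam v -> Lam (a *: v).
Proof.
move=> /intrP[z ->] Lv; have H (k : nat) : Lam (k%:R *: v).
  by elim: k => [|k IH]; rewrite ?scale0r// -natr1 scalerDl scale1r; exact: LamD.
case: z => k; first exact: H.
by rewrite NegzE mulrNz scaleNr; apply: LamN; exact: H.
Qed.

Let Lam_sum (I : Type) (s : seq I) (F : I -> 'rV[R]_r) : (forall i, Lam (F i)) -> Lam (\sum_(i <- s) F i).
Proof. by move=> H; elim: s => [|i s IH]; rewrite ?big_nil// big_cons; exact: LamD. Qed.

(** Lattice vectors within [K] of the multiples [c *: delta_mx 0 i] form a matrix close to [c%:M];
    [c = r K + 1] is just large enough for [near_scalar_unit]. *)
Lemma lattice_full_rank : exists2 V : 'M[R]_r, V \in unitmx & forall i, Lam (row i V).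
Proof.
pose c := r%:R * K + 1.
pose w i := projT1 (cid2 (LamK (c *: delta_mx 0 i))).
have [wL wK] : (forall i, Lam (w i)) /\ (forall i, `|c *: delta_mx 0 i - w i| <= K).
  by split=> i; rewrite /w; case: (cid2 _).
exists (\matrix_i w i); last by move=> i; rewrite rowK.
apply: (@near_scalar_unit R r _ c).
have K0 : 0 <= K by have [w0 _ H] := LamK 0; exact: le_trans H.
apply: (@le_lt_trans _ _ (r%:R * K)); last by rewrite ltrDl.
apply: ler_wpM2l => //; apply: rv_norm_le => // i j.
apply: le_trans (wK i); apply: le_trans (rv_coord_le _ 0 j).
by rewrite !mxE -normrN opprB eqxx /= mulr_natr eq_sym.
Qed.

Lemma det_row_subst (v : 'rV[R]_r) i :
  \det (\matrix_(a, b) (if a == i then v 0 b else (a == b)%:R)) = v 0 i.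
Proof.
rewrite (expand_det_col _ i) (bigD1 i)//= big1 ?addr0.
  rewrite mxE eqxx /cofactor -signr_odd addnn odd_double expr0 mul1r.
  rewrite (_ : row' i _ = 1%:M) ?det1 ?mulr1//.
  apply/matrixP => a b; rewrite !mxE eq_sym (negbTE (neq_lift i a)).
  by rewrite (inj_eq (@lift_inj _ i)).
by move=> a ai; rewrite mxE (negbTE ai) mul0r.
Qed.

(* A family in Lam of minimal nonzero |det| is a basis: subtracting integral parts
   from the coordinates of a lattice vector would otherwise lower it. *)
Theorem lattice_basis : exists2 V : 'M[R]_r, V \in unitmx &
  forall v : 'rV[R]_r, Lam (v *m V) <-> forall i, v 0 i \is a Num.int.
Proof.
have dL : \det L != 0 by move: uL; rewrite unitmxE unitfE.
pose Q k := `[< exists V : 'M[R]_r, [/\ V \in unitmx, forall i, Lam (row i V) & `|\det V * \det L| = k%:R] >].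
(* [V *m L] has integral entries, so the determinants take discrete values and a smallest nonzero
   one exists. *)
have detN (V : 'M[R]_r) : (forall i, Lam (row i V)) -> exists k : nat, `|\det V * \det L| = k%:R.
  move=> HV; have Hij i j : (V *m L) i j \is a Num.int.
    by have := LamL (HV i) j; rewrite -row_mul mxE.
  apply/natrP; rewrite -det_mulmx natr_norm_int//.
  rewrite /determinant; apply: rpred_sum => s _; apply: rpredM; first by rewrite rpredX// rpredN rpred1.
  by apply: rpred_prod => i _; exact: Hij.
have eQ : exists k, Q k.
  have [V uV HV] := lattice_full_rank; have [k Hk] := detN V HV.
  by exists k; apply/asboolP; exists V.
case: (ex_minnP eQ) => k /asboolP[V [uV HV Vk]] kmin.
have dV : \det V != 0 by move: uV; rewrite unitmxE unitfE.
have int_in (v : 'rV[R]_r) : (forall i, v 0 i \is a Num.int) -> Lam (v *m V).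
  by move=> vi; rewrite mulmx_sum_row; apply: Lam_sum => i; exact: LamZ.
exists V => // v; split; last exact: int_in.
move=> Lv i; pose fl : 'rV[R]_r := \row_j (Num.floor (v 0 j))%:~R.
have Lw : Lam ((v - fl) *m V).
  rewrite mulmxBl; apply: LamB => //; apply: int_in => j; by rewrite mxE intr_int.
have [w0 w1] : 0 <= (v - fl) 0 i /\ (v - fl) 0 i < 1.
  have /andP[h1 h2] := floor_itv (v 0 i); rewrite [(v - fl) 0 i]mxE [X in _ + X]mxE [fl 0 i]mxE.
  by rewrite subr_ge0; split=> //; rewrite ltrBlDl -[1]/(1%:~R) -intrD.
have [E|ne] := eqVneq ((v - fl) 0 i) 0.
  move/eqP: E; rewrite [(v - fl) 0 i]mxE [X in _ + X]mxE [fl 0 i]mxE subr_eq0 => /eqP->.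
  exact: intr_int.
exfalso; pose T : 'M[R]_r := \matrix_(a, b) (if a == i then (v - fl) 0 b else (a == b)%:R).
have dT : \det T = (v - fl) 0 i by exact: det_row_subst.
have HTV j : Lam (row j (T *m V)).
  rewrite row_mul; have [->|ji] := eqVneq j i.
    by rewrite (_ : row i T = v - fl)//; apply/rowP => b; rewrite mxE mxE eqxx.
  rewrite (_ : row j T = delta_mx 0 j); last by apply/rowP => b; rewrite mxE mxE (negbTE ji) mxE eqxx eq_sym.
  by rewrite -rowE.
have [k' Hk'] := detN _ HTV.
have kk' : (k <= k')%N.
  apply: kmin; apply/asboolP; exists (T *m V); split=> //.
  by rewrite unitmxE unitfE det_mulmx dT mulf_neq0.
have : (k'%:R : R) < k%:R.
  rewrite -Hk' -Vk det_mulmx dT -mulrA normrM ger0_norm// -[ltRHS]mul1r ltr_pM2r// normr_gt0 mulf_neq0//.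
by rewrite ltr_nat ltnNge kk'.
Qed.

End LatticeBasis.

Section Cocompact.
Context {R : realType} {G : lieGroupType R}.
Hypotheses (G_compact : compact [set: G]) (G_connected : connected [set: G]).
Variables (r : nat) (E : 'rV[R]_r -> G) (tau : G -> 'rV[R]_r).
Hypotheses (ED : forall u v, E (u + v) = (E u * E v)%g) (EC : forall u, center_subgroup G (E u)).
Hypotheses (ctau : tau @ (1%g : G) --> (0 : 'rV[R]_r))
  (tauG : \forall x \near (1%g : G), commutator_subgroup G (x * E (- tau x))%g).
Local Notation G' := (commutator_subgroup G).

Lemma coset_mul x y u v : G' (x * E (- u))%g -> G' (y * E (- v))%g -> G' (x * y * E (- (u + v)))%g.
Proof.
move=> Hx Hy; have -> : (x * y * E (- (u + v)) = (x * E (- u)) * (y * E (- v)))%g.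
  by rewrite opprD ED !mulgA; congr (_ * _)%g; rewrite -!mulgA; congr (_ * _)%g; rewrite (EC (- u) y).
exact: (subgroupM (commutator_subgroupP G)).
Qed.

Lemma coset_inv x u : G' (x * E (- u))%g -> G' (x^-1 * E (- (- u)))%g.
Proof.
move=> Hx; have -> : (x^-1 * E (- (- u)) = (x * E (- u))^-1)%g.
  by rewrite (homN ED (- u)) invgM; exact/esym/(center_subgroupV (EC (- u))).
exact: (subgroupV (commutator_subgroupP G)).
Qed.

(** The elements that are products of an element of G' and one of E(R^r) form a subgroup, which
    contains a neighbourhood of 1. *)
Lemma coset_exists x : exists v, G' (x * E (- v))%g.
Proof.
apply: (subgroup_nbhs_full G_connected (H := fun x => exists v, G' (x * E (- v))%g)).
  split; first by exists 0; rewrite oppr0 (hom0 ED) mulg1; case: (commutator_subgroupP G).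
  by move=> a b [u Hu] [v Hv]; exists (u - v); exact: coset_mul Hu (coset_inv Hv).
by apply: filterS tauG => y Hy; exists (tau y).
Qed.

(** Near [x] the vector chosen for [x] can be corrected by a value of [tau] of norm less than 1;
    compactness turns these local bounds into a single one. *)
Lemma cocompact : exists K : R, forall x, exists2 v, G' (x * E (- v))%g & `|v| <= K.
Proof.
have near1 : \forall g \near (1%g : G), `|0 - tau g| < 1 by exact: (@ctau _ (near_norm (0 : 'rV[R]_r) ltr01)).
have H := (compact_near_coveringP [set: G]).1 G_compact nat \oo
  (fun (k : nat) x => exists2 v, G' (x * E (- v))%g & `|v| <= k%:R) _.
have [|k _ Hk] := H _.
  move=> x _; have [v Hv] := coset_exists x.
  pose k0 := (Num.trunc (`|v| + 1)).+1.
  have Hn : \forall y \near x, exists2 w, G' (y * E (- w))%g & `|w| <= `|v| + 1.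
    apply: filterS (near_translate x (filterI near1 tauG)) => y [y1 yG].
    exists (v + tau (x^-1 * y)%g); first by rewrite -{1}(mulVKg x y); exact: coset_mul.
    apply: (le_trans (ler_normD _ _)); rewrite lerD2l; apply: ltW.
    by move: y1; rewrite /= sub0r normrN.
  exists ([set y | exists2 w, G' (y * E (- w))%g & `|w| <= `|v| + 1], [set k | (k0 <= k)%N]).
    by split => //=; exists k0.
  move=> [y k] [/= [w Hw wv] kk]; exists w => //; apply: (le_trans wv).
  apply: (@le_trans _ _ k0%:R); last by rewrite ler_nat.
  by apply: ltW; exact: truncnS_gt.
by exists k%:R => x; exact: (Hk k (leqnn k) x I).
Qed.

End Cocompact.

(** * Splitting off the torus *)

Section SmoothPaths.
Context {R : realType} {G : lieGroupType R}.
Hypothesis G_connected : connected [set: G].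
Let mG := @lie_mfd R G.
Let eu m := @euclidean_manifold R m.

Lemma smooth_step_bound (s : R) : 0 <= smooth_step s <= 1.
Proof.
have a0 := flat_ge0 0 s; have b0 := flat_ge0 0 (1 - s).
apply/andP; split; first by rewrite mulr_ge0// invr_ge0 addr_ge0.
have [E|ne] := eqVneq (flat 0 s + flat 0 (1 - s)) 0; first by rewrite /smooth_step E invr0 mulr0.
by rewrite ler_pdivrMr ?mul1r ?lerDl// lt_def ne addr_ge0.
Qed.

(** Smoothness is meant in [G], so the notion makes sense for G' before it is known to be
    embedded. *)
Definition smooth_path_in (H : set G) (g : G) := exists c : 'rV[R]_1 -> G,
  [/\ forall t, smooth_at c t, forall t, H (c t), c (const_mx 0) = 1%g & c (const_mx 1) = g].

Lemma smooth_path_subgroup (H : set G) : subgroup H -> subgroup (smooth_path_in H).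
Proof.
move=> sH; split.
  exists (fun=> 1%g); split=> // t; last by case: sH.
  exact: (smooth_at_cst _ _ (eu 1) mG).
move=> x y [c [Sc Hc c0 c1]] [d [Sd Hd d0 d1]]; exists (fun t => c t / d t)%g; split.
- by move=> t; exact: (smooth_at_mulg (eu 1) (Sc t) (smooth_at_invg (eu 1) (Sd t))).
- by move=> t; apply: sH.2.
- by rewrite c0 d0 divg1.
- by rewrite c1 d1.
Qed.

(** The endpoints of such paths form a subgroup. It contains a neighbourhood of 1: run through a
    coordinate ray with [smooth_step] as time, which never leaves the ball where [kap] is smooth. *)
Lemma smooth_path_exists g : smooth_path_in [set: G] g.
Proof.
have sT : subgroup [set: G] by split.
apply: (subgroup_nbhs_full G_connected (smooth_path_subgroup sT)).
have [kap [kapi LP]] := @local_param_exists R G.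
have [k0 ki1 Sk Ski [kK kiK]] := LP.
have [d d0 Hd] := near_ball0 (smooth_at_near (eu _) mG Sk).
have cki : kapi @ (1%g : G) --> (0 : 'rV[R]_(mdim G)) by rewrite -ki1; exact: Ski.1.
have H1 : \forall x \near (1%g : G), `|0 - kapi x| < d by exact: (cki _ (near_norm (0 : 'rV[R]_(mdim G)) d0)).
apply: filterS2 kiK H1 => x Ex; rewrite sub0r normrN => xd.
pose s (t : 'rV[R]_1) := smooth_step (t 0 0) *: kapi x.
have Ss t : sm s t.
  apply/sm_mxP => i j.
  apply: (@sm_eq _ _ _ (fun t : 'rV[R]_1 => smooth_step (t 0 0) * kapi x i j)).
    by near=> u; rewrite /s [in RHS]mxE.
  apply: sm_M; last exact: sm_cst.
  apply: (@sm_compR _ _ (fun t : 'rV[R]_1 => t 0 0) smooth_step); first exact: sm_coord.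
  exact: sm_smooth_step.
exists (fun t => kap (s t)); split=> //.
- move=> t; apply: (smooth_at_comp (eu 1) (eu _) mG (f := s)); first exact/smooth_at_rV.
  by apply: Hd; apply: ball_scale => //; exact: smooth_step_bound.
- by rewrite /s mxE smooth_step_le0// scale0r.
- by rewrite /s mxE smooth_step_ge1// scale1r.
Unshelve. all: by end_near. Qed.

(** While [c] joins 1 to [x] in [G], the commutator [[~ c t, y]] joins 1 to [[~ x, y]] inside G'. *)
Lemma commutator_smooth_path g : commutator_subgroup G g -> smooth_path_in (commutator_subgroup G) g.
Proof.
have sP := smooth_path_subgroup (commutator_subgroupP G).
suff H x y : smooth_path_in (commutator_subgroup G) [~ x, y]%g.
  exact: (@commutator_subgroup_min G _ sP H g).
have [c [Sc _ c0 c1]] := smooth_path_exists x.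
exists (fun t => [~ c t, y]%g); split.
- by move=> t; exact: smooth_at_comm.
- by move=> t; exact: comm_in_commutator.
- by rewrite c0 comm1g.
- by rewrite c1.
Qed.

End SmoothPaths.

Section Splitting.
Context {R : realType} {G : lieGroupType R}.
Hypothesis G_connected : connected [set: G].
Local Notation G' := (commutator_subgroup G).
Variables (r : nat) (E : 'rV[R]_r -> G) (tau : G -> 'rV[R]_r).
Hypotheses (ED : forall u v, E (u + v) = (E u * E v)%g) (SE : forall u, smooth_at E u)
  (EC : forall u, center_subgroup G (E u)) (Stau : smooth_at tau 1%g)
  (tauG : \forall x \near (1%g : G), G' (x * E (- tau x))%g)
  (EL : forall v, G' (E v) <-> forall i, v 0 i \is a Num.int)
  (eG : embedded_submanifold G' (submanifold_dim G')).
Let mG := @lie_mfd R G.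
Let eu m := @euclidean_manifold R m.
Let sG := commutator_subgroupP G.
Let E0 : E 0 = 1%g. Proof. exact: hom0. Qed.
Let EN u : E (- u) = (E u)^-1%g. Proof. exact: homN. Qed.

Lemma floor_addz (t : R) (m : int) : Num.floor (t + m%:~R) = Num.floor t + m.
Proof.
have /andP[h1 h2] := floor_itv t; apply: floor_def; move: h2; rewrite !intrD => h2.
by apply/andP; split; [rewrite lerD2r|rewrite addrAC ltrD2r].
Qed.

Let ev (i : 'I_r) : 'rV[R]_r := delta_mx 0 i.

(* gam runs along a path c in G' from 1 to E(-e_i), translated by E(-k e_i) on
   [k, k+1]; as the path is constant outside [0, 1], gam(t) = E(-(k-1) e_i) c(t-k+1) c(t-k) near
   k, whence smoothness. *)
Lemma loop_lift i : exists gam : R -> G,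
  [/\ forall t, G' (gam t), forall t (m : int), gam (t + m%:~R) = (E (- (m%:~R *: ev i)) * gam t)%g &
      forall v : 'rV[R]_r, smooth_at (fun v : 'rV[R]_r => gam (v 0 i)) v].
Proof.
have Gz (m : int) : G' (E (m%:~R *: ev i)).
  apply/EL => j; rewrite !mxE; apply: rpredM; first exact: intr_int.
  by case: (_ && _); rewrite ?rpred1 ?rpred0.
have Ge : G' (E (- ev i)) by rewrite -scaleN1r; exact: (Gz (-1)).
have [c [Sc Gc c0 c1]] := commutator_smooth_path G_connected Ge.
pose cs (s : R) := c (const_mx (smooth_step s)).
pose gam t := (E (- ((Num.floor t)%:~R *: ev i)) * cs (t - (Num.floor t)%:~R))%g.
exists gam; split.
- move=> t; apply: (subgroupM sG _ (Gc _)).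
  by rewrite -scaleNr -mulrNz; exact: Gz.
- move=> t m; rewrite /gam floor_addz intrD scalerDl opprD ED [RHS]mulgA.
  by rewrite (EC (- ((Num.floor t)%:~R *: ev i))) opprD addrACA subrr addr0.
move=> v.
have Scs (a : R) w : smooth_at (fun v : 'rV[R]_r => cs (v 0 i + a)) w.
  apply: (smooth_at_comp (eu r) (eu 1) mG (f := fun v : 'rV[R]_r => const_mx (smooth_step (v 0 i + a)))); last exact: Sc.
  apply/smooth_at_rV; apply/sm_mxP => p q.
  apply: (@sm_eq _ _ _ (fun v : 'rV[R]_r => smooth_step (v 0 i + a))).
    by near=> u; rewrite mxE.
  apply: (@sm_compR _ _ (fun v : 'rV[R]_r => v 0 i + a) smooth_step); last exact: sm_smooth_step.
  by apply: sm_D; [exact: sm_coord|exact: sm_cst].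
pose k := Num.floor (v 0 i).
pose psi (w : 'rV[R]_r) := (E (- ((k - 1)%:~R *: ev i)) * (cs (w 0 i + (1 - k%:~R)) * cs (w 0 i + - k%:~R)))%g.
have Spsi : smooth_at psi v.
  apply: (smooth_at_mulg (eu r) (smooth_at_cst _ _ (eu r) mG)).
  exact: (smooth_at_mulg (eu r) (Scs (1 - k%:~R) v) (Scs (- k%:~R) v)).
apply: (smooth_at_eq (eu r) mG _ Spsi).
have /andP[k1 k2] : k%:~R <= v 0 i < (k + 1)%:~R by exact: floor_itv.
rewrite intrD in k2.
have d0 : 0 < Num.min 1 (k%:~R + 1 - v 0 i) by rewrite lt_min ltr01 subr_gt0.
apply: filterS (near_norm v d0) => w wv.
have {}wv : `|v 0 i - w 0 i| < Num.min 1 (k%:~R + 1 - v 0 i).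
  by apply: le_lt_trans wv; have := rv_coord_le (v - w) 0 i; rewrite [X in `|X|]mxE [X in `|_ + X|]mxE.
rewrite lt_min !ltr_norml in wv; case/andP: wv => /andP[w1 w2] /andP[w3 w4].
have [wk|wk] := leP k%:~R (w 0 i).
  have fl : Num.floor (w 0 i) = k.
    by apply: floor_def; rewrite wk intrD; lra.
  rewrite /psi /gam fl mulgA; congr (_ * _)%g.
  rewrite /cs (smooth_step_ge1 (t := w 0 i + (1 - k%:~R))); last by lra.
  by rewrite c1 -ED -opprD intrB scalerBl scale1r subrK.
have fl : Num.floor (w 0 i) = k - 1.
  by apply: floor_def; rewrite subrK wk andbT intrB; move: w2 k1; rewrite -[1%:~R]/(1 : R); lra.
rewrite /psi /gam fl; congr (_ * _)%g.
rewrite {2}/cs (smooth_step_le0 (t := w 0 i + - k%:~R)); last by lra.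
by rewrite c0 mulg1 intrB opprB.
Unshelve. all: by end_near. Qed.

Let gam i := projT1 (cid (loop_lift i)).
Let gamP i := projT2 (cid (loop_lift i)).

Fixpoint gam_prod (s : seq 'I_r) (v : 'rV[R]_r) : G :=
  if s is i :: s' then (gam i (v 0%R i) * gam_prod s' v)%g else 1%g.

Lemma gam_prod_in s v : G' (gam_prod s v).
Proof.
elim: s => [|i s IH] /=; first by case: sG.
by apply: (subgroupM sG) => //; have [H _ _] := gamP i; exact: H.
Qed.

Lemma smooth_at_gam_prod s v : smooth_at (gam_prod s) v.
Proof.
elim: s => [|i s IH]; first exact: (smooth_at_cst (1%g : G) v (eu r) mG).
by have [_ _ H] := gamP i; exact: (smooth_at_mulg (eu r) (H v) IH).
Qed.

Lemma gam_prod_shift s (v k : 'rV[R]_r) : (forall i, k 0 i \is a Num.int) ->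
  gam_prod s (v + k) = (E (- (\sum_(i <- s) k 0 i *: ev i)) * gam_prod s v)%g.
Proof.
move=> kz; elim: s => [|i s IH]; first by rewrite big_nil oppr0 E0 /= mulg1.
have [m km] := intrP (kz i).
have Hg : gam i (v 0 i + m%:~R) = (E (- (m%:~R *: ev i)) * gam i (v 0 i))%g.
  by have [_ H _] := gamP i; exact: H.
rewrite /= big_cons opprD ED IH mxE km Hg -!mulgA; congr (_ * _)%g.
by rewrite !mulgA; congr (_ * _)%g; rewrite (EC _ (gam i (v 0 i))).
Qed.

(* A Z^r-periodic section of G -> G/G': it trivializes the bundle. *)
Definition periodic_lift (v : 'rV[R]_r) : G := (E v * gam_prod (index_enum 'I_r) v)%g.
Local Notation S := periodic_lift.

Lemma smooth_at_periodic_lift v : smooth_at S v.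
Proof. exact: (smooth_at_mulg (eu r) (SE v) (smooth_at_gam_prod _ v)). Qed.

(** Adding an integral vector [k] multiplies the factor [E v] by E(k) and the other factor by
    E(-k). *)
Lemma periodic_lift_eq u v : G' (E (u - v)) -> S u = S v.
Proof.
move=> /EL kz; rewrite /S -[u](subrK v) addrC; set k := u - v in kz *.
rewrite (gam_prod_shift _ _ kz) -[\sum_(i <- _) _](row_sum_delta k) ED !mulgA; congr (_ * _)%g.
by rewrite -mulgA -ED subrr E0 mulg1.
Qed.

Lemma torus_map_int u v : torus_map u = torus_map v <-> G' (E (u - v)).
Proof.
rewrite torus_map_eq EL; split=> H i.
  by have [z Hz] := H i; rewrite !mxE Hz intr_int.
by have := H i; rewrite !mxE => /intrP.
Qed.

Lemma coset_diff g u v : G' (g * E (- u))%g -> G' (g * E (- v))%g -> G' (E (u - v)).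
Proof.
move=> Hu Hv; have -> : E (u - v) = ((g * E (- u))^-1 * (g * E (- v)))%g.
  by rewrite invgM -mulgA mulKg -EN opprK -ED.
by apply: (subgroupM sG) => //; exact: (subgroupV sG).
Qed.

Let coset := coset_exists G_connected ED EC tauG.
(** An arbitrary, possibly discontinuous choice. It enters only through the periodic lift and
    [torus_map], whose values depend on the coset of [g] alone. *)
Let vv g := projT1 (cid (coset g)).
Let vvP g : G' (g * E (- vv g))%g. Proof. exact: (projT2 (cid (coset g))). Qed.

Lemma lift_in g v : G' (g * E (- v))%g -> G' (g * (S v)^-1)%g.
Proof.
move=> H; have -> : (g * (S v)^-1 = (g * E (- v)) * (gam_prod (index_enum 'I_r) v)^-1)%g.
  by rewrite /S invgM EN -!mulgA; congr (_ * _)%g; rewrite -EN (EC (- v)).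
by apply: (subgroupM sG) => //; apply: (subgroupV sG); exact: gam_prod_in.
Qed.

Let f1 g : set_type G' := SigSub (mem_set (lift_in (vvP g))).
Let f2 g : torus R r := torus_map (vv g).
Let uu (y : torus R r) := projT1 (cid (torus_map_surj y)).
Let uuP y : y = torus_map (uu y). Proof. exact: (projT2 (cid (torus_map_surj y))). Qed.
Let h (p : set_type G' * torus R r) : G := (set_val p.1 * S (uu p.2))%g.

Let vvS g v : G' (g * E (- v))%g -> S (vv g) = S v /\ torus_map (vv g) = torus_map v.
Proof.
move=> Hv; have H := coset_diff (vvP g) Hv.
by split; [exact: periodic_lift_eq|apply/torus_map_int].
Qed.

Let uuS y v : y = torus_map v -> S (uu y) = S v.
Proof. by move=> Ey; apply: periodic_lift_eq; apply/torus_map_int; rewrite -uuP. Qed.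

Let fK : cancel (fun g => (f1 g, f2 g)) h.
Proof. by move=> g; rewrite /h /= (uuS (v := vv g))// mulgVK. Qed.

Let hK : cancel h (fun g => (f1 g, f2 g)).
Proof.
move=> [k y]; have Gk : G' (set_val k) by exact: set_valP.
have Hg : G' (h (k, y) * E (- uu y))%g.
  have -> : (h (k, y) * E (- uu y) = set_val k * gam_prod (index_enum 'I_r) (uu y))%g.
    rewrite /h /S /= -!mulgA; congr (_ * _)%g.
    by rewrite -(EC (- uu y)) mulgA -ED subrr E0 mul1g.
  exact: (subgroupM sG Gk (gam_prod_in _ _)).
have [E1 E2] := vvS Hg; congr pair; last by rewrite /f2 E2 -uuP.
by apply: val_inj; rewrite /= E1 /h /= mulgK.
Qed.

Let mG' := sub_manifold mG eG.
Let mT := torus_manifold (R := R) r.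

(** Near [g0] the choice [vv] may be replaced by the smooth lift [w] built from [tau], as both
    components are unchanged by integral vectors. *)
Let Sf g0 : smooth_at (fun g => (f1 g, f2 g)) g0.
Proof.
pose w (g : G) := vv g0 + tau (g0^-1 * g)%g.
have Hw : \forall g \near g0, G' (g * E (- w g))%g.
  apply: filterS (near_translate g0 tauG) => g Hg.
  by rewrite -{1}(mulVKg g0 g); exact: (coset_mul ED EC (vvP g0) Hg).
have Sw : smooth_at w g0.
  have S1 : smooth_at (fun g => tau (g0^-1 * g)%g) g0.
    apply: (smooth_at_comp mG mG (eu r) (f := fun g => g0^-1 * g)%g); last by rewrite mulVg.
    exact: (smooth_at_mulg mG (smooth_at_cst _ _ mG mG) (smooth_at_id _ mG)).
  apply: (smooth_at_comp mG (eu r) (eu r) (g := fun u : 'rV[R]_r => vv g0 + u) S1).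
  by apply/smooth_at_rV; apply: sm_D; [exact: sm_cst|exact: sm_id].
apply: (smooth_at_pair mG' mT mG).
  apply: (smooth_at_sub mG eG mG).
  have SS : smooth_at (fun g => g * (S (w g))^-1)%g g0.
    apply: (smooth_at_mulg mG (smooth_at_id _ mG)); apply: (smooth_at_invg mG).
    exact: (smooth_at_comp mG (eu r) mG Sw (smooth_at_periodic_lift _)).
  apply: (smooth_at_eq mG mG _ SS); apply: filterS Hw => g Hg.
  exact: (congr1 (fun s => g * s^-1)%g (esym (vvS Hg).1)).
have ST := smooth_at_comp mG (eu r) mT Sw (smooth_at_torus_map _).
apply: (smooth_at_eq mG mT _ ST); apply: filterS Hw => g Hg.
by rewrite /f2 (vvS Hg).2.
Qed.

(** Near [p] the choice [uu] may be replaced by a smooth local section of [torus_map], for the same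
    reason of periodicity. *)
Let Sh p : smooth_at h p.
Proof.
have mP := prod_manifold mG' mT.
have [sig [Ssig sig0 sigK]] := torus_section (uu p.2).
rewrite -uuP in Ssig sig0 sigK.
pose h' (q : set_type G' * torus R r) : G := (set_val q.1 * S (sig q.2))%g.
have S1 : smooth_at (fun q : set_type G' * torus R r => set_val q.1 : G) p.
  exact: (smooth_at_comp mP mG' mG (smooth_at_fst mG' mT p) (smooth_at_set_val mG eG p.1)).
have S2 : smooth_at (fun q : set_type G' * torus R r => sig q.2) p.
  exact: (smooth_at_comp mP mT (eu r) (smooth_at_snd mG' mT p) Ssig).
have S3 : smooth_at (fun q : set_type G' * torus R r => S (sig q.2)) p.
  exact: (smooth_at_comp mP (eu r) mG S2 (smooth_at_periodic_lift _)).
have Sh' : smooth_at h' p by exact: (smooth_at_mulg mP S1 S3).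
apply: (smooth_at_eq mP mG _ Sh').
have c : (@snd (set_type G') (torus R r)) @ p --> p.2 by exact: cvg_snd.
have H : \forall q \near p, torus_map (sig q.2) = q.2 by exact: (c _ sigK).
by apply: filterS H => q Hq; rewrite /h /h' (uuS (v := sig q.2)).
Qed.

Theorem split_diffeomorphic : diffeomorphic G (set_type G' * torus R r)%type.
Proof.
have mP := prod_manifold mG' mT.
split; [exact: mG|exact: mP|].
exists (fun g => (f1 g, f2 g)), h; split.
- exact: fK.
- exact: hK.
- by apply/(smoothP _ mG mP); exact: Sf.
- by apply/(smoothP _ mP mG); exact: Sh.
Qed.

End Splitting.

Theorem theorem1p2 (R : realType) (G : lieGroupType R)
    (G_compact : compact [set: G]) (G_connected : connected [set: G]) :
  let r := submanifold_dim (center_component G) in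
  diffeomorphic G (set_type (commutator_subgroup G) * torus R r)%type.
Proof.
have mG := @lie_mfd R G.
have eu m := @euclidean_manifold R m.
have [M HM] := invariant_mean G_compact.
have [kap [kapi LP]] := @local_param_exists R G.
pose P := fixproj M kap kapi.
have PP : P *m P = P := fixproj_id HM LP.
have PAD h : P *m AD kap kapi h = P := fixproj_r HM LP h.
have ADP h : AD kap kapi h *m P = P := fixproj_l HM LP h.
have QQ : (1%:M - P) *m (1%:M - P) = 1%:M - P.
  by rewrite mulmxBr mulmx1 mulmxBl mul1mx PP subrr subr0.
have [s1 Es1] := span_cols HM LP.
have [s2 Es2] := span_rows HM LP.
rewrite -/P in Es1 Es2.
(* [center_local] takes its coefficients multiplied by [1 - P] on the right; idempotence of [1 - P]
   keeps the sum unchanged. *)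
have Es1' : \sum_(p <- s1) (AD kap kapi p.1 - 1%:M) *m (p.2 *m (1%:M - P)) = 1%:M - P.
  rewrite -[RHS]QQ -{2}Es1 mulmx_suml; apply: eq_bigr => p _; exact: mulmxA.
clearbody P.
have [C [B [CB BC]]] := idem_factor PP.
set r := \rank P in C B CB BC.
have [z [theta [Sz z0 St t1 [tK zC zK oz]]]] := center_local LP PP PAD Es1' CB BC.
have [E [lam [ED SE EC oE [Slam lam1 lamE Elam]]]] := central_exp LP Sz z0 St t1 tK zC zK oz.
have E0 : E 0 = 1%g by exact: hom0.
have eZ := center_component_embedded LP CB BC ED SE EC oE lam1 Slam Elam.
have Z1 : center_component G 1%g.
  exists [set 1%g]; last by [].
  split=> //; last exact: connected1.
  by move=> _ -> x; rewrite /commute mul1g mulg1.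
(* The component of the center contains 1, so its dimension as a submanifold is unambiguous, and the
   exponent in the statement becomes [\rank P]. *)
rewrite (submanifold_dimE mG (ex_intro _ _ Z1) eZ) => {Z1 eZ}.
have [Psi [psi [[Psi0 SPsi Spsi psi1] [K1 K2 psiE psiD psiG]]]] :=
  tau_chart LP CB BC ADP Es2 ED SE EC oE.
pose tau x := psi x *m C.
have [L uL HL] := lattice_map G_compact G_connected ED SE (tau := tau) psiD psiE.
have Stau : smooth_at tau 1%g.
  apply: (smooth_at_comp mG (eu _) (eu r) (g := fun u : 'rV[R]_(mdim G) => u *m C) Spsi).
  by apply/smooth_at_rV; apply: sm_mulmx; [exact: sm_id|exact: sm_cst].
have tau1 : tau 1%g = 0 by rewrite /tau psi1 mul0mx.
have ctau : tau @ (1%g : G) --> (0 : 'rV[R]_r) by rewrite -tau1; exact: Stau.1.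
have [K HK] := cocompact G_compact G_connected ED EC ctau psiG.
have sG := commutator_subgroupP G.
(* The vectors [v] with E(v) in G' form a lattice: [L] makes them discrete, and [K] makes them
   cocompact because every E(v) agrees modulo G' with some E(w) of bounded [w]. A basis [V] turns
   this lattice into Z^r. *)
have [V uV HV] : exists2 V : 'M[R]_r, V \in unitmx &
    forall v : 'rV[R]_r, commutator_subgroup G (E (v *m V)) <-> forall i, v 0 i \is a Num.int.
  apply: (@lattice_basis R r (fun v => commutator_subgroup G (E v)) L K _ _ uL HL).
  - by rewrite E0; case: sG.
  - move=> u v Hu Hv; rewrite ED (homN ED); exact: (subgroupM sG Hu (subgroupV sG Hv)).
  - move=> v; have [w Hw wK] := HK (E v).
    by exists (v - w); [rewrite ED|rewrite opprB addrC subrK].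
pose E' v := E (v *m V); pose tau' x := tau x *m invmx V.
have ED' u v : E' (u + v) = (E' u * E' v)%g by rewrite /E' mulmxDl ED.
have SE' u : smooth_at E' u by apply: smooth_at_lin; exact: SE.
have Stau' : smooth_at tau' 1%g.
  apply: (smooth_at_comp mG (eu r) (eu r) (g := fun u : 'rV[R]_r => u *m invmx V) Stau).
  by apply/smooth_at_rV; apply: sm_mulmx; [exact: sm_id|exact: sm_cst].
have tau'1 : tau' 1%g = 0 by rewrite /tau' tau1 mul0mx.
have E'N x : E' (- tau' x) = E (- tau x) by rewrite /E' /tau' mulNmx mulmxKV.
have tauG : \forall x \near (1%g : G), commutator_subgroup G (x * E' (- tau' x))%g.
  by apply: filterS psiG => x; rewrite E'N.
(* Near 1 an element [y] lies in G' exactly when [tau' y] is 0: if [y] is in G' then so is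
   [E' (- tau' y)], so [tau' y] is integral, and its entries are smaller than 1. *)
have eG : embedded_submanifold (commutator_subgroup G) (\rank (1%:M - P)).
  apply: (translate_embedded (row_base_free (1%:M - P)) Psi0 SPsi Spsi psi1 K1 K2) => x Gx.
  have ct : tau' @ (1%g : G) --> (0 : 'rV[R]_r) by rewrite -tau'1; exact: Stau'.1.
  have Ht : \forall y \near (1%g : G), `|0 - tau' y| < 1 by exact: (ct _ (near_norm (0 : 'rV[R]_r) ltr01)).
  apply: filterS2 tauG Ht => y Hy ty.
  have Q0 : (psi y <= row_base (1%:M - P))%MS <-> tau' y = 0.
    rewrite eq_row_base; split=> [/submxP[D HD]|t0].
      by rewrite /tau' /tau HD -(mulmxA D) mulmxBl mul1mx (proj_col_factor CB BC) subrr mulmx0 mul0mx.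
    have psiP : psi y *m P = 0.
      rewrite -CB mulmxA; have : tau y = 0; last by rewrite /tau => ->; rewrite mul0mx.
      by rewrite -[tau y](mulmxKV uV) -/(tau' y) t0 mul0mx.
    by apply/submxP; exists (psi y); rewrite mulmxBr mulmx1 psiP subr0.
  split=> [Gxy|/Q0 t0]; last first.
    apply: (subgroupM sG Gx); move: Hy.
    by rewrite t0 oppr0 /E' mul0mx E0 mulg1.
  apply/Q0; have Gy : commutator_subgroup G y.
    by rewrite -(mulKg x y); exact: (subgroupM sG (subgroupV sG Gx) Gxy).
  have : commutator_subgroup G (E' (- tau' y)).
    by rewrite -(mulKg y (E' _)); exact: (subgroupM sG (subgroupV sG Gy) Hy).
  move=> /HV ti; apply/rowP => i; rewrite [RHS]mxE; apply: int_small0.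
    by have := ti i; rewrite mxE rpredN.
  by apply: le_lt_trans ty; rewrite sub0r normrN; exact: rv_coord_le.
have G0 : commutator_subgroup G !=set0 by exists 1%g; case: sG.
have eG' : embedded_submanifold (commutator_subgroup G) (submanifold_dim (commutator_subgroup G)).
  by rewrite (submanifold_dimE mG G0 eG).
exact: (split_diffeomorphic G_connected ED' SE' (fun u => EC _) Stau' tauG HV eG').
Qed.
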